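(* If $\mathrm{Tr}(A)>2$ (i.e. $2-\Delta>2$), then the set of escaping orbits $\mathcal E=\{(t_0,v_0): v_n\to\infty\text{ as }n\to\infty\}$ has Hausdorff dimension $\mathrm{HD}(\mathcal E)=2$.
   Context: Setting (piecewise smooth Fermi-Ulam model). Let $\ell:\mathbb R\to(0,\infty)$ be strictly positive, Lipschitz continuous and $1$-periodic, with $\dot\ell$ piecewise smooth having a jump discontinuity only at $t=0$ (mod $1$); thus $\ell$ is smooth on $[0,1]$ with one-sided derivatives at the endpoints. A unit point mass moves freely on a line between a fixed (right) wall and an infinitely heavy moving (left) wall, at distance $\ell(t)$ from each other at time $t$; all collisions are elastic. Let $\mathbb T=\mathbb R/\mathbb Z$. The collision space is $\{(t,v)\in\mathbb T\times\mathbb R: v>-\dot\ell(t)\}$, where $t$ is a time (mod 1) of collision with the moving wall and $v$ is the velocity immediately after it (positive towards the fixed wall). The collision map $f$ sends $(t,v)$ to the data of the next collision with the moving wall; for large $v$, $f(t,v)=(t+\delta t,\ v-2\dot\ell(t+\delta t))$, where $\delta t$ solves $\delta t=\frac{\ell(t)+\ell(t+\delta t)}{v}$. Write $(t_n,v_n)=f^n(t_0,v_0)$. Constants: $\ell_0=\ell(0)$, $\dot\ell^\pm=\dot\ell(0^\pm)$, $\alpha=\int_0^1\ell(s)^{-2}\,ds$, $\Delta=\alpha\,\ell_0(\dot\ell^+-\dot\ell^-)$. $A$ is the constant differential of the map $(\tau,I)\mapsto(\bar\tau,\bar I)$, $\bar\tau=\tau-I\bmod1$, $\bar I=I+\Delta(\bar\tau-\frac12)$;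 $\mathrm{Tr}(A)=2-\Delta$. *)

(* Defs.v *)
From mathcomp Require Import all_boot all_order all_algebra.
From mathcomp Require Import all_classical all_reals all_analysis.
From mathcomp Require Import ring lra.

Set Implicit Arguments.
Unset Strict Implicit.
Unset Printing Implicit Defensive.

Import Order.TTheory GRing.Theory Num.Theory.
Import numFieldNormedType.Exports.

Local Open Scope classical_set_scope.
Local Open Scope ring_scope.

(** * Hausdorff measure and dimension for a (pseudo-)distance [d] *)

Section Hausdorff.
Local Open Scope ereal_scope.
Context {R : realType} {T : Type} (d : T -> T -> R).
Implicit Types (A U : set T) (s delta : R).

Definition diam U : \bar R := ereal_sup [set (d p.1 p.2)%:E | p in U `*` U].

(* The empty set contributes 0 for every [s], including [s = 0]. *)
Definition diam_pow s U : \bar R :=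
  if `[< U = set0 >] then 0 else diam U `^ s.

Definition hausdorff_content s delta A : \bar R :=
  ereal_inf [set \sum_(0 <= i <oo) diam_pow s (U i) |
    U in [set U : (set T)^nat | A `<=` \bigcup_i U i /\
                                forall i, diam (U i) <= delta%:E]].

Definition hausdorff_measure s A : \bar R :=
  ereal_sup [set hausdorff_content s delta A |
    delta in [set delta | (0 < delta)%R]].

Definition hausdorff_dim A : \bar R :=
  ereal_inf [set s%:E | s in [set s | (0 <= s)%R /\ hausdorff_measure s A = 0]].

End Hausdorff.

(** * The circle and the cylinder *)

Section Cylinder.
Context {R : realType}.

(* A class of R/Z is represented by its element in [0, 1). *)
Definition frac (x : R) : R := x - (Num.floor x)%:~R.

(* The distance from [x - y] to the nearest integer, that is, the quotient
   distance on R/Z between the classes of [x] and [y]. *)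
Definition circle_dist (x y : R) : R :=
  Num.min (frac (x - y)) (1 - frac (x - y)).

Definition cylinder_dist (p q : R * R) : R :=
  Num.sqrt (circle_dist p.1 q.1 ^+ 2 + (p.2 - q.2) ^+ 2).

End Cylinder.

(** * The Fermi-Ulam model *)

Section FermiUlam.
Context {R : realType}.
Implicit Types (l : R -> R) (z : R * R).

(* C^oo on the closed interval [0, 1]: C^oo inside, with every derivative having
   finite one-sided limits at the two endpoints. *)
Definition smooth_on_unit_interval l : Prop :=
  (forall n t, 0 < t < 1 -> derivable (derive1n n l) t 1) /\
  (forall n, cvg (derive1n n l x @[x --> 0^'+]) /\
             cvg (derive1n n l x @[x --> 1^'-])).

Definition dl_right l : R := lim (derive1 l x @[x --> 0^'+]).
Definition dl_left l : R := lim (derive1 l x @[x --> 0^'-]).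

Record fermi_ulam_wall l : Prop := FermiUlamWall {
  wall_gt0 : forall t, 0 < l t ;
  wall_lipschitz : exists k : R, k.-lipschitz l ;
  wall_periodic : periodic l 1 ;
  wall_smooth : smooth_on_unit_interval l ;
  wall_jump : dl_left l != dl_right l }.

(* The time 0 (mod 1) is left out since the velocity of the wall, hence the
   condition on [v], is undefined there. *)
Definition collision_space l : set (R * R) :=
  [set z | 0 < z.1 < 1 /\ - derive1 l z.1 < z.2].

(* Let [x] be the distance to the fixed wall. After a collision at [t] the
   particle is at [x = `|l t - v * u|] at time [t + u], until it meets the moving
   wall [x = l (t + u)] again; the absolute value accounts for the bounce on the
   fixed wall. The next collision is the first meeting. If the fixed wall has not
   been reached by then (possible only for slow particles), the particle arrives
   with velocity [v], otherwise with velocity [- v]; an elastic collision with a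
   wall of velocity [- l'] turns an incoming velocity [w] into [- w - 2 l'].
   Whether [z'] lies in [collision_space l] is not asserted here. *)
Definition next_collision l z z' : Prop :=
  let: (t, v) := z in
  exists s : R, [/\ 0 < s,
    forall u, 0 < u < s -> `|l t - v * u| < l (t + u),
    `|l t - v * s| = l (t + s),
    z'.1 = frac (t + s)
  & z'.2 = (if 0 < l t - v * s then - v else v) - 2 * derive1 l z'.1].

(* [collision_map l z z'] is the graph of the partial map f on the collision
   space. f is undefined at [z] if the next meeting with the moving wall happens
   at time 0 (mod 1) or is tangential; these points form curves. *)
Definition collision_map l z z' : Prop :=
  [/\ collision_space l z, collision_space l z' & next_collision l z z'].

Definition escaping l : set (R * R) :=
  [set z0 | exists z : nat -> R * R,
     [/\ z 0%N = z0, forall n, collision_map l (z n) (z n.+1)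
       & (z n).2 @[n --> \oo] --> +oo]].

Lemma next_collision_fun l z z1 z2 :
  next_collision l z z1 -> next_collision l z z2 -> z1 = z2.
Proof.
case: z => t v [s [s0 sb se z11 z12]] [r [r0 rb re z21 z22]].
have E : s = r.
  case: (ltgtP s r) => // h.
    by have := rb s; rewrite s0 h se ltxx => /(_ isT).
  by have := sb r; rewrite r0 h re ltxx => /(_ isT).
rewrite -{}E in z21 z22.
by rewrite [z1]surjective_pairing [z2]surjective_pairing z12 z22 z11 z21.
Qed.

Lemma next_collision_fast l (k : R) (t v : R) z' :
  (forall u, 0 < l u) -> k.-lipschitz l -> k < v -> 0 < v ->
  next_collision l (t, v) z' <->
  exists s, s = (l t + l (t + s)) / v /\
            z' = (frac (t + s), v - 2 * derive1 l (frac (t + s))).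
Proof.
move=> lp lk kv v0.
have lipE a b : 0 < b -> `|l (a + b) - l a| < v * b.
  move=> b0; have /= := lk (a + b, a) (conj I I).
  rewrite [a + b - a]addrC addKr (gtr0_norm b0) => /le_lt_trans; apply.
  by rewrite ltr_pM2r.
have lip a b : 0 < b -> l (a + b) - l a < v * b.
  by move=> b0; rewrite (le_lt_trans (ler_norm _))// lipE.
have lip' a b : 0 < b -> l a - l (a + b) < v * b.
  by move=> b0; rewrite (le_lt_trans (ler_norm _))// distrC lipE.
split.
  case=> s [s0 _ se z1 z2]; exists s.
  have h : l t - v * s < 0.
    rewrite ltNge; apply/negP => /ger0_norm h; rewrite h in se.
    by have := lip' t s s0; lra.
  rewrite ltr0_norm// in se.
  split; first by rewrite -se; field; rewrite gt_eqF.
  by rewrite [z']surjective_pairing z2 z1 (lt_gtF h).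
move=> [s [sE ->]].
have vs : v * s = l t + l (t + s).
  by rewrite {1}sE mulrCA mulfV ?mulr1// gt_eqF.
have s0 : 0 < s by rewrite sE divr_gt0// addr_gt0.
have h : l t - v * s = - l (t + s) by rewrite vs; ring.
exists s; split=> //=.
- move=> u /andP[u0 us]; rewrite ltr_norml; apply/andP; split.
    have := lip (t + u) (s - u); rewrite subr_gt0 => /(_ us).
    rewrite -addrA [u + _]addrC subrK; lra.
  by have := lip' t u u0; lra.
- by rewrite h normrN gtr0_norm.
- by rewrite h oppr_gt0 (lt_gtF (lp _)).
Qed.

(** * The constants and the limit map *)

Definition alpha l : R :=
  (\int[lebesgue_measure]_(s in `[0%R, 1%R]) (l s ^- 2))%R.

Definition Delta l : R := alpha l * l 0 * (dl_right l - dl_left l).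

(* The column vector (tau, I) is mapped to (taubar, Ibar). *)
Definition limit_map (D : R) (p : 'cV[R]_2) : 'cV[R]_2 :=
  let taubar := frac (p 0 0 - p 1 0) in
  \col_i (if i == 0 then taubar else p 1 0 + D * (taubar - 1 / 2)).

Definition limit_matrix (D : R) : 'M[R]_2 :=
  \matrix_(i, j)
    (if i == 0 then (if j == 0 then 1 else - 1)
     else (if j == 0 then D else 1 - D)).

(* [limit_matrix D] is the differential of [limit_map D]: the map is affine with
   this linear part on each domain where the integer part of [tau - I] is
   constant. *)
Lemma limit_map_differential D (p q : 'cV[R]_2) :
  Num.floor (p 0 0 - p 1 0) = Num.floor (q 0 0 - q 1 0) ->
  limit_map D q - limit_map D p = limit_matrix D *m (q - p).
Proof.
move=> h; apply/colP => i; rewrite !mxE /frac -h !big_ord_recl big_ord0 !mxE /=.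
have -> : lift ord0 ord0 = 1 :> 'I_2 by apply/val_inj.
by case: (i == 0); ring.
Qed.

Lemma limit_matrix_tr D : \tr (limit_matrix D) = 2 - D.
Proof. by rewrite /mxtrace !big_ord_recl big_ord0 !mxE /=; ring. Qed.

End FermiUlam.

(* Main.v *)
(* In the momentum [p = l (v + l')] and the phase [Z = p * int_0^t l^-2] a collision
   inside a period changes [p] by O(p^-2) and [Z] by 2 + O(p^-2), with remainders
   which are also Lipschitz small. Recording the phases [x], [y] of two consecutive
   passages of the discontinuity, the passage map is therefore a small Lipschitz
   perturbation, at high energy [y - x], of
     [F (x, y) = (y, 2 y - x + D (frac y - 1/2))], where [D = - Delta > 0].
   [F] is hyperbolic, piecewise affine, and commutes with integer translations.
   It is ergodic modulo 2Z^2: the set of points which visit a given set infinitely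
   often is invariant under translations in the unstable and stable directions,
   because a discontinuity met along one direction can be bypassed along the other.
   Recurrence yields about [lam ^ n] words of length [n] leading back to a small box,
   [lam > 1] being the expansion of [F]; the symmetry [z -> - z] reverses the drift of
   the energy, so that the words can be assembled into loops with positive drift.
   An orbit segment of the perturbed map which crosses the box in the unstable
   direction contains subsegments following each of the loops, so the escaping points
   on it contain a Cantor set of dimension at least [s], for each [s < 1], with bounds
   which do not depend on the stable coordinate; integrating over that coordinate
   shows that the dimension is at least 2, and grids give the converse. *)

(* The modulus 2 is a parity device. Shifting a point by an integer vector [g] shifts the energy by
   [latJ g], which [F] preserves. Returns modulo 2Z^2 have even shifts, so an orbit from a box to
   its translate by (0, 1) modulo 2Z^2 has an odd, hence nonzero, drift, and the symmetry chooses
   its sign. The drift of a returning word is not controlled: the words of one sign are kept, and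
   one fixed loop of drift at least 1 is appended to each.

   The passage map is close to [F] only at high energy and away from the walls x in Z and y in Z.
   Loops therefore keep a quantified distance from the walls ([good]), and cone fields are replaced
   by the intermediate value theorem on Lipschitz curves crossing a box. Finitely many loops have
   one energy threshold, which persists because each block raises the level by at least 1.

   With blocks of length m, the number of branches is at least kap^m and lengths shrink at most by
   La^m, where kap = La^s < lam < La; this yields the exponent s. Slices are straight lines in the
   coordinates [uu] and [ss] rather than invariant leaves, so no holonomy has to be estimated. *)
From HB Require Import structures.
Require Import Defs.
From mathcomp Require Import all_boot all_order all_algebra.
From mathcomp Require Import all_classical all_reals all_analysis.
From mathcomp Require Import measurable_realfun ring lra zify.
Import Order.TTheory GRing.Theory Num.Theory.
Import numFieldNormedType.Exports.
Set Implicit Arguments.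
Unset Strict Implicit.
Unset Printing Implicit Defensive.
Local Open Scope classical_set_scope.
Local Open Scope ring_scope.

(* Universally quantified hypotheses slow [lra] down. *)
Ltac flra :=
  first [solve [repeat match goal with H : forall _, _ |- _ => clear H end; lra] | lra].

(** * Area on the torus R^2/2Z^2 *)

Section PeriodicLebesgue.
Context {R : realType}.
Local Notation leb := (@lebesgue_measure R).
Implicit Types (A B : set R).

Lemma lebesgue_shift (c : R) A : measurable A ->
  leb [set x | A (x + c)] = leb A.
Proof.
move=> mA.
have mf : measurable_fun setT ((fun x : R => x + c) : R -> measurableTypeR R).
  exact: measurable_realfun.measurable_funD.
suff H : forall A, measurable A -> leb A =
    pushforward leb (fun x : R => (x + c : measurableTypeR R)) A.
  by rewrite [RHS]H.
apply: lebesgue_measure_unique => //= _ [[a b]] _ <-.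
rewrite /pushforward.
have -> : (fun x : R => (x + c : measurableTypeR R)) @^-1` `]a, b] =
  `]a - c, b - c]%classic.
  by apply/seteqP; split => x /=; rewrite !in_itv/= ltrBlDr lerBrDr.
rewrite !lebesgue_measure_itv/= !lte_fin ltrD2r.
by case: ifP => // _; rewrite -!EFinD; congr EFin; ring.
Qed.

Lemma lebesgue_refl (c : R) A : measurable A ->
  leb [set x | A (c - x)] = leb A.
Proof.
move=> mA.
have mA' : measurable [set x | A (x + c)].
  have mf : measurable_fun setT (fun x : R => x + c).
    exact: measurable_realfun.measurable_funD.
  by have := mf measurableT _ mA; rewrite setTI.
rewrite -(lebesgue_shift c mA) -(lebesgue_measureN mA').
by congr (leb _); apply/seteqP; split => x /=; rewrite addrC.
Qed.

Let lebU A B : measurable A -> measurable B -> A `&` B = set0 ->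
  leb (A `|` B) = (leb A + leb B)%E.
Proof. by move=> mA mB AB; rewrite (measureU leb mA mB AB). Qed.

Definition per2 B := forall x, B (x + 2) <-> B x.

Lemma per2z B (m : int) x : per2 B -> B (x + 2 * m%:~R) <-> B x.
Proof.
move=> pB.
have H n y : B (y + 2 * n%:R) <-> B y.
  elim: n y => [|n IH] y; first by rewrite mulr0 addr0.
  have -> : y + 2 * n.+1%:R = y + 2 * n%:R + 2 by rewrite -natr1; ring.
  by rewrite pB IH.
case: m => n; first exact: H.
rewrite NegzE mulrNz mulrN; have := H n.+1 (x - 2 * n.+1%:R).
by rewrite subrK => <-.
Qed.

(** The window is cut at the first multiple of 2 beyond [a]; its two pieces, translated by multiples
    of 2, fill [[0, 2[] in the opposite order. *)
Lemma lebesgue_per2 B (a : R) : measurable B -> per2 B ->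
  leb (B `&` `[a, a + 2[) = leb (B `&` `[0, 2[).
Proof.
move=> mB pB.
pose n := Num.floor (a / 2).
have n1 : 2 * n%:~R <= a.
  by have := floor_le_tmp (a / 2); rewrite -/n; flra.
have n2 : a < 2 * n%:~R + 2.
  by have := floorD1_gt (a / 2); rewrite -/n intrD; flra.
pose c : R := 2 * n%:~R.
have mI (i : interval R) : measurable (B `&` [set` i]) by exact: measurableI.
have -> : B `&` `[a, a + 2[ = (B `&` `[a, c + 2[) `|` (B `&` `[c + 2, a + 2[).
  rewrite -setIUr; congr (_ `&` _); apply/seteqP; split => x /=; rewrite !in_itv/=.
    by rewrite /c; case: (ltP x (2 * n%:~R + 2)) => h /andP[-> ->]; [left|right].
  by rewrite /c => -[|] /andP[? ?]; apply/andP; split; flra.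
have -> : B `&` `[0, 2[ = (B `&` `[0, a - c[) `|` (B `&` `[a - c, 2[).
  rewrite -setIUr; congr (_ `&` _); apply/seteqP; split => x /=; rewrite !in_itv/=.
    by rewrite /c; case: (ltP x (a - 2 * n%:~R)) => h /andP[-> ->]; [left|right].
  by rewrite /c => -[|] /andP[? ?]; apply/andP; split; flra.
rewrite lebU; [|exact: mI|exact: mI|]; last first.
  by apply/seteqP; split => x //= -[[_]]; rewrite !in_itv/= => ? [_ ?]; flra.
rewrite lebU; [|exact: mI|exact: mI|]; last first.
  by apply/seteqP; split => x //= -[[_]]; rewrite !in_itv/= => ? [_ ?]; flra.
rewrite [RHS]addeC; congr (_ + _)%E.
  rewrite -(lebesgue_shift (- c) (mI `[a - c, 2[)); congr (leb _).
  apply/seteqP; split => x /=; rewrite !in_itv/= => -[Bx ?]; split => //.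
  - by rewrite -(per2z n _ pB) -/c subrK.
  - by flra.
  - by rewrite -(per2z n _ pB) -/c subrK in Bx.
  - by flra.
rewrite -(lebesgue_shift (- (c + 2)) (mI `[0, a - c[)); congr (leb _).
have E x : x - (c + 2) + 2 * (n + 1)%:~R = x by rewrite /c intrD; ring.
apply/seteqP; split => x /=; rewrite !in_itv/= => -[Bx ?]; split => //.
- by rewrite -(per2z (n + 1) _ pB) E.
- by flra.
- by rewrite -(per2z (n + 1) _ pB) E in Bx.
- by flra.
Qed.

(** The Haar measure of R/2Z without a quotient space: points of the circle stay real numbers, and
    sets on the circle become sets of period 2. Invariance under shifts and reflections is claimed
    for such sets. *)
Definition mu1 : set (measurableTypeR R) -> \bar R := mrestr leb (measurable_itv `[0, 2[).
HB.instance Definition _ := Measure.on mu1.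

Lemma mu1T : mu1 setT = 2%:E.
Proof. by rewrite /mu1 /mrestr setTI lebesgue_measure_itv/= lte_fin ltr0n/= oppr0 adde0. Qed.

Let mu1_fin : fin_num_fun mu1.
Proof.
move=> A mA; rewrite ge0_fin_numE//; apply: (@le_lt_trans _ _ (mu1 setT)).
  by apply: le_measure => //; rewrite inE.
by rewrite mu1T ltry.
Qed.
HB.instance Definition _ := Measure_isFinite.Build _ _ _ mu1 mu1_fin.

Lemma mu1_shift (c : R) B : measurable B -> per2 B ->
  mu1 [set x | B (x + c)] = mu1 B.
Proof.
move=> mB pB; rewrite /mu1 /mrestr -(lebesgue_per2 c mB pB).
rewrite -(@lebesgue_shift c (B `&` `[c, c + 2[)); last exact: measurableI.
congr (leb _); apply/seteqP; split => x /=; rewrite !in_itv/= => -[Bx ?];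
  split => //; flra.
Qed.

Lemma mu1_refl (c : R) B : measurable B -> per2 B ->
  mu1 [set x | B (c - x)] = mu1 B.
Proof.
move=> mB pB; rewrite /mu1 /mrestr.
have mI (i : interval R) : measurable (B `&` [set` i]) by exact: measurableI.
(* Reflection turns [[0, 2[] into []c - 2, c]], a window open at the other end; the endpoints are
   null. *)
have E1 : leb (B `&` `]c - 2, c]) = leb (B `&` `[c - 2, c - 2 + 2[).
  have null (x : R) : leb (B `&` [set x]) = 0%E.
    apply/eqP; rewrite eq_le measure_ge0 andbT -(lebesgue_measure_set1 x).
    by apply: le_measure; rewrite ?inE//; exact: measurableI.
  rewrite subrK.
  have -> : `]c - 2, c]%classic = `]c - 2, c[ `|` [set c].
    apply/seteqP; split => x /=; rewrite !in_itv/=.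
      move=> /andP[h1]; rewrite le_eqVlt => /orP[/eqP ->|h2]; first by right.
      by left; rewrite h1 h2.
    by case=> [/andP[? ?]|->]; apply/andP; split; flra.
  have -> : `[c - 2, c[%classic = `]c - 2, c[ `|` [set c - 2].
    apply/seteqP; split => x /=; rewrite !in_itv/=.
      move=> /andP[]; rewrite le_eqVlt => /orP[/eqP <-|h1] h2; first by right.
      by left; rewrite h1 h2.
    by case=> [/andP[? ?]|->]; apply/andP; split; flra.
  have mB1 x : measurable (B `&` [set x]) by exact: measurableI.
  rewrite !setIUr !lebU; try exact: mI; try exact: mB1.
  - by rewrite !null.
  - by apply/seteqP; split => x //= -[[_]]; rewrite in_itv/= => ? [_ ?]; flra.
  - by apply/seteqP; split => x //= -[[_]]; rewrite in_itv/= => ? [_ ?]; flra.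
rewrite -(lebesgue_per2 (c - 2) mB pB) -E1 -(lebesgue_refl c (mI `]c - 2, c])).
congr (leb _); apply/seteqP; split => x /=; rewrite !in_itv/= => -[Bx ?];
  split => //; flra.
Qed.

End PeriodicLebesgue.

Section TorusArea.
Context {R : realType}.
Local Notation T1 := (measurableTypeR R).
Local Notation T2 := (T1 * T1)%type.
Implicit Types (A B : set T2).

Definition area : set T2 -> \bar R := (@mu1 R \x @mu1 R)%E.
HB.instance Definition _ := Measure.on area.

Lemma areaE A : area A = (\int[@mu1 R]_x mu1 (xsection A x))%E.
Proof. by []. Qed.

Lemma areaE2 A : measurable A -> area A = (\int[@mu1 R]_y mu1 (ysection A y))%E.
Proof.
move=> mA; rewrite [RHS](_ : _ = (@mu1 R \x^ @mu1 R)%E A)//.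
apply: (@product_measure_unique _ _ _ _ R mu1 mu1 (product_measure2 mu1 mu1)) => //.
by move=> C E mC mE; exact: product_measure2E.
Qed.

Lemma areaT : area setT = 4%:E.
Proof.
transitivity (@mu1 R setT * @mu1 R setT)%E.
  by rewrite -setXTT; exact: product_measure1E.
rewrite !mu1T -EFinM; congr EFin; ring.
Qed.

Lemma area_fin A : measurable A -> area A \is a fin_num.
Proof.
move=> mA; rewrite ge0_fin_numE//; apply: (@le_lt_trans _ _ (area setT)).
  by apply: le_measure => //; rewrite inE.
by rewrite areaT ltry.
Qed.

(* Sealed, since conversion tests between areas of different sets are costly. *)
Fact ar_seal : {f : set T2 -> R | f = fun A => fine (area A)}.
Proof. by exists (fun A => fine (area A)). Qed.

Definition ar A : R := sval ar_seal A.

Lemma arE A : ar A = fine (area A). Proof. by rewrite /ar (svalP ar_seal). Qed.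

Lemma arK A : measurable A -> (ar A)%:E = area A.
Proof. by move=> mA; rewrite arE fineK// area_fin. Qed.

Lemma ar_ge0 A : 0 <= ar A.
Proof. by rewrite arE fine_ge0. Qed.

Lemma arT : ar setT = 4.
Proof. by rewrite arE areaT. Qed.

Lemma ar0 : ar set0 = 0.
Proof. by rewrite arE measure0. Qed.

Lemma ar_le A B : measurable A -> measurable B -> A `<=` B -> ar A <= ar B.
Proof.
by move=> mA mB AB; rewrite -lee_fin !arK//; apply: le_measure; rewrite ?inE.
Qed.

Lemma arU A B : measurable A -> measurable B -> A `&` B = set0 ->
  ar (A `|` B) = ar A + ar B.
Proof.
move=> mA mB AB; apply: EFin_inj; rewrite EFinD !arK//; last exact: measurableU.
exact: (measureU area).
Qed.

Lemma arU_le A B : measurable A -> measurable B -> ar (A `|` B) <= ar A + ar B.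
Proof.
move=> mA mB; rewrite -lee_fin EFinD !arK//; last exact: measurableU.
exact: (measureU2 area).
Qed.

Lemma arD A B : measurable A -> measurable B -> ar A <= ar (A `\` B) + ar (A `&` B).
Proof.
move=> mA mB; have mI : measurable (A `&` B) by exact: measurableI.
have mD : measurable (A `\` B) by exact: measurableD.
rewrite -arU//; first by rewrite setUC setUIDK.
by apply/seteqP; split => // z -[[_ ?] [_ ?]].
Qed.

Lemma arUD A B : measurable A -> measurable B ->
  ar (A `|` B) = ar A + ar (B `\` A).
Proof.
move=> mA mB; rewrite -arU//; last by apply/seteqP; split => // z [? []].
  congr (ar _); apply/seteqP; split => z; last by case=> [|[]]; [left|right].
  by case=> [|Bz]; [left|case: (pselect (A z)) => Az; [left|right]].
exact: measurableD.
Qed.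

Lemma arC A : measurable A -> ar (~` A) = 4 - ar A.
Proof.
move=> mA; rewrite -arT -(setvU A) [in RHS]arU//; try exact: measurableC.
  by rewrite addrK.
exact: setICl.
Qed.

Lemma ar_bigcup (F : (set T2)^nat) (a : nat -> R) (S : R) :
  (forall n, measurable (F n)) -> (forall n, ar (F n) <= a n) ->
  (forall n, \sum_(0 <= i < n) a i <= S) -> ar (\bigcup_n F n) <= S.
Proof.
move=> mF Fa aS; have mU : measurable (\bigcup_n F n) by exact: bigcup_measurable.
rewrite -lee_fin arK//.
apply: (le_trans (measure_sigma_subadditive area mF mU (fun x h => h))).
apply: lime_le; first exact: is_cvg_nneseries.
near=> n; rewrite /= (@le_trans _ _ (\sum_(0 <= i < n) (a i)%:E)%E)//.
  by apply: lee_sum => i _; rewrite -arK// lee_fin.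
by rewrite sumEFin lee_fin.
Unshelve. all: by end_near. Qed.

Lemma ar_bigsetU I (r : seq I) (F : I -> set T2) (a : I -> R) :
  (forall i, measurable (F i)) -> (forall i, ar (F i) <= a i) ->
  ar (\big[setU/set0]_(i <- r) F i) <= \sum_(i <- r) a i.
Proof.
move=> mF Fa; elim: r => [|i r IH]; first by rewrite !big_nil ar0.
rewrite !big_cons; apply: (le_trans (arU_le (mF i) _)).
  exact: bigsetU_measurable.
by rewrite lerD.
Qed.

Definition Om : set T2 := `[0, 2[%classic `*` `[0, 2[%classic.

(** [area] charges only the fundamental domain, so covers have to be produced only over [Om], where
    finitely many affine branches of an iterate occur. *)
Lemma ar_dom A : measurable A -> ar A <= ar (A `&` Om).
Proof.
move=> mA; have mO : measurable Om by apply: measurableX; exact: measurable_itv.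
have E : ar Om = 4.
  pose I : set T1 := `[0, 2[%classic.
  rewrite arE (_ : area Om = (@mu1 R I * @mu1 R I)%E); last first.
    by apply: product_measure1E; exact: measurable_itv.
  have -> : @mu1 R I = @mu1 R setT by rewrite /mu1 /mrestr setIid setTI.
  by rewrite mu1T -EFinM /=; ring.
apply: (le_trans (arD mA mO)); rewrite gerDr.
apply: (@le_trans _ _ (ar (~` Om))); last by rewrite arC// E subrr.
by apply: ar_le; [exact: measurableD|exact: measurableC|move=> z []].
Qed.

End TorusArea.

(** * The limit map *)

Section SawtoothMap.
Context {R : realType}.
Local Notation T1 := (measurableTypeR R).
Local Notation T2 := (T1 * T1)%type.
Implicit Types (A B : set T2) (z h : R * R).

Definition fl (x : R) : R := (Num.floor x)%:~R.

Lemma fl_itv x : fl x <= x < fl x + 1.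
Proof. by rewrite /fl -[X in _ < _ + X]/(1%:~R) -intrD floor_itv. Qed.

Lemma flDz x (m : int) : fl (x + m%:~R) = fl x + m%:~R.
Proof. by rewrite /fl floorDrz ?intrKfloor ?intrD// ?intr_int. Qed.

Lemma fl_eq x (m : int) : m%:~R <= x < m%:~R + 1 -> fl x = m%:~R.
Proof.
by rewrite -[X in _ + X]/(1%:~R) -intrD => h; rewrite /fl (floor_def h).
Qed.

Lemma measurable_fl : measurable_fun setT (fl : T1 -> T1).
Proof.
apply: nondecreasing_measurable => // x y xy.
by rewrite ler_int; exact: le_floor.
Qed.

Definition tr h z : R * R := (z.1 + h.1, z.2 + h.2).

Lemma measurable_tr h : measurable_fun setT (tr h : T2 -> T2).
Proof.
by apply/measurable_fun_pairP; split; apply: measurable_funD.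
Qed.

Lemma measurable_pre (f : T2 -> T2) A : measurable_fun setT f ->
  measurable A -> measurable (f @^-1` A).
Proof. by move=> mf mA; rewrite -[_ @^-1` _]setTI; exact: mf. Qed.

Definition per A := forall z, (A (z.1 + 2, z.2) <-> A z) /\ (A (z.1, z.2 + 2) <-> A z).

Lemma perz A (i j : int) z : per A ->
  A (z.1 + 2 * i%:~R, z.2 + 2 * j%:~R) <-> A z.
Proof.
move=> pA.
have p1 y : per2 (fun x => A (x, y)) by move=> x; have [] := pA (x, y).
have p2 x : per2 (fun y => A (x, y)) by move=> y; have [] := pA (x, y).
by rewrite (per2z i _ (p1 _)) (per2z j _ (p2 _)) -surjective_pairing.
Qed.

Lemma per_preim (f : R * R -> R * R) A :
  (forall z, exists i j : int, f (z.1 + 2, z.2) = ((f z).1 + 2 * i%:~R, (f z).2 + 2 * j%:~R)) ->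
  (forall z, exists i j : int, f (z.1, z.2 + 2) = ((f z).1 + 2 * i%:~R, (f z).2 + 2 * j%:~R)) ->
  per A -> per (f @^-1` A).
Proof.
move=> f1 f2 pA z; split => /=.
  by have [i [j ->]] := f1 z; exact: perz.
by have [i [j ->]] := f2 z; exact: perz.
Qed.

Lemma per_tr h A : per A -> per (tr h @^-1` A).
Proof.
apply: per_preim => z.
  by exists 1, 0; rewrite /tr /=; congr pair; ring.
by exists 0, 1; rewrite /tr /=; congr pair; ring.
Qed.

Lemma perC A : per A -> per (~` A).
Proof. by move=> pA z; have [p1 p2] := pA z; split => /=; rewrite ?p1 ?p2. Qed.

Lemma perI A B : per A -> per B -> per (A `&` B).
Proof.
move=> pA pB z; have [p1 p2] := pA z; have [q1 q2] := pB z.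
by split => /=; rewrite ?p1 ?p2 ?q1 ?q2.
Qed.

Lemma per_bigcup (F : nat -> set T2) (P : set nat) :
  (forall n, per (F n)) -> per (\bigcup_(n in P) F n).
Proof.
move=> pF z; split; split => -[n Pn Fn]; exists n => //;
  by have [p1 p2] := pF n z; rewrite ?(propext p1) ?(propext p2) in Fn *.
Qed.

Lemma per_bigcap (F : nat -> set T2) (P : set nat) :
  (forall n, per (F n)) -> per (\bigcap_(n in P) F n).
Proof.
move=> pF z; split; split => Fn n Pn; have := Fn n Pn;
  by have [p1 p2] := pF n z; rewrite ?(propext p1) ?(propext p2).
Qed.

(** On a line where [z.2] is fixed the map reflects the other coordinate. Fubini in one order on the
    left and in the other order on the right reduces the claim to [mu1_refl]. *)
Lemma ar_flip (g : R -> R) A : measurable A -> per A ->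
  measurable_fun setT ((fun z => (z.2, g z.2 - z.1)) : T2 -> T2) ->
  ar ((fun z => (z.2, g z.2 - z.1)) @^-1` A) = ar A.
Proof.
move=> mA pA mf; rewrite !arE; congr fine.
rewrite areaE2; last exact: measurable_pre.
rewrite areaE; apply: eq_integral => y _.
have pS : per2 (xsection A y).
  move=> x; rewrite /xsection /= !inE; have [_] := pA (y, x); exact.
rewrite -(mu1_refl (g y) (measurable_xsection _ mA) pS).
by congr (mu1 _); apply/seteqP; split => x; rewrite /ysection /xsection /= !inE.
Qed.

Lemma ar_tr h A : measurable A -> per A -> ar (tr h @^-1` A) = ar A.
Proof.
move=> mA pA.
have H1 a B : measurable B -> per B -> ar (tr (0, a) @^-1` B) = ar B.
  move=> mB pB; rewrite !arE; congr fine.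
  have mf := measurable_tr (0, a); rewrite !areaE.
  apply: eq_integral => y _.
  have pS : per2 (xsection B y).
    by move=> x; rewrite /xsection /= !inE; have [_] := pB (y, x).
  rewrite -(mu1_shift a (measurable_xsection _ mB) pS).
  by congr (mu1 _); apply/seteqP; split => x; rewrite /xsection /= !inE /tr/= addr0.
have H2 a B : measurable B -> per B -> ar (tr (a, 0) @^-1` B) = ar B.
  move=> mB pB; rewrite !arE; congr fine.
  have mf := measurable_tr (a, 0).
  rewrite !areaE2//; last exact: measurable_pre.
  apply: eq_integral => y _.
  have pS : per2 (ysection B y).
    by move=> x; rewrite /ysection /= !inE; have [] := pB (x, y).
  rewrite -(mu1_shift a (measurable_ysection _ mB) pS).
  by congr (mu1 _); apply/seteqP; split => x; rewrite /ysection /= !inE /tr/= addr0.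
have mf := measurable_tr (0, h.2).
have mA2 := measurable_pre mf mA.
rewrite -[RHS](H1 h.2 A)// -[RHS](H2 h.1 _ mA2); last exact: per_tr.
by congr (ar _); apply/seteqP; split => z; rewrite /= /tr/= !addr0.
Qed.

(* [F] is the second order recurrence [x_(n+1) - 2 x_n + x_(n-1) =
   D ({x_n} - 1/2)] satisfied by the phases of the limit map, with
   [D = lam + 1/lam - 2 = - Delta]. *)
Context (lam : R).

Definition Fm z : R * R := (z.2, ((lam + lam^-1) * z.2 - (lam + lam^-1 - 2) * (fl z.2 + 2^-1)) - z.1).
Definition Fi z : R * R := (((lam + lam^-1) * z.1 - (lam + lam^-1 - 2) * (fl z.1 + 2^-1)) - z.2, z.1).

Lemma FmK : cancel Fm Fi.
Proof. by move=> [x y]; rewrite /Fm /Fi /=; congr pair; ring. Qed.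

Lemma FiK : cancel Fi Fm.
Proof. by move=> [x y]; rewrite /Fm /Fi /=; congr pair; ring. Qed.

Let mg : measurable_fun setT ((fun y => (lam + lam^-1) * y -
  (lam + lam^-1 - 2) * (fl y + 2^-1)) : T1 -> T1).
Proof.
apply: measurable_funB; apply: measurable_funM => //.
by apply: measurable_funD => //; exact: measurable_fl.
Qed.

Lemma measurable_Fm : measurable_fun setT (Fm : T2 -> T2).
Proof.
apply/measurable_fun_pairP; split; first exact: measurable_snd.
apply: measurable_funB; last exact: measurable_fst.
exact: (measurableT_comp mg measurable_snd).
Qed.

Lemma measurable_Fi : measurable_fun setT (Fi : T2 -> T2).
Proof.
apply/measurable_fun_pairP; split; last exact: measurable_fst.
apply: measurable_funB; last exact: measurable_snd.
exact: (measurableT_comp mg measurable_fst).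
Qed.

Lemma Fm_lattice z (i j : int) : Fm (z.1 + i%:~R, z.2 + j%:~R) =
  ((Fm z).1 + j%:~R, (Fm z).2 + (2 * j - i)%:~R).
Proof. by rewrite /Fm/= flDz intrD intrM rmorphN; congr pair; ring. Qed.

Lemma Fi_lattice z (i j : int) : Fi (z.1 + i%:~R, z.2 + j%:~R) =
  ((Fi z).1 + (2 * i - j)%:~R, (Fi z).2 + i%:~R).
Proof. by rewrite /Fi/= flDz intrD intrM rmorphN; congr pair; ring. Qed.

Lemma per_Fm A : per A -> per (Fm @^-1` A).
Proof.
apply: per_preim => z.
  have := Fm_lattice z 2 0; rewrite addr0 => ->; exists 0, (-1).
  by congr pair; rewrite /=; ring.
have := Fm_lattice z 0 2; rewrite addr0 => ->; exists 1, 2.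
by congr pair; rewrite /=; ring.
Qed.

Lemma per_Fi A : per A -> per (Fi @^-1` A).
Proof.
apply: per_preim => z.
  have := Fi_lattice z 2 0; rewrite addr0 => ->; exists 2, 1.
  by congr pair; rewrite /=; ring.
have := Fi_lattice z 0 2; rewrite addr0 => ->; exists (-1), 0.
by congr pair; rewrite /=; ring.
Qed.

Lemma ar_Fm A : measurable A -> per A -> ar (Fm @^-1` A) = ar A.
Proof.
move=> mA pA; apply: (@ar_flip (fun y => (lam + lam^-1) * y -
  (lam + lam^-1 - 2) * (fl y + 2^-1))) => //; exact: measurable_Fm.
Qed.

Lemma ar_Fi A : measurable A -> per A -> ar (Fi @^-1` A) = ar A.
Proof.
move=> mA pA; have mf := measurable_Fi; have mA' := measurable_pre mf mA.
rewrite -(ar_Fm mA' (per_Fi pA)); congr (ar _).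
by apply/seteqP; split => z /=; rewrite FmK.
Qed.

End SawtoothMap.

(** * Continuity of translations in measure *)

Section TranslationContinuity.
Context {R : realType}.
Local Notation T1 := (measurableTypeR R).
Local Notation T2 := (T1 * T1)%type.
Implicit Types (A B : set T2) (z h : R * R).

Lemma measurable_fst_set (C : set T1) : measurable C -> measurable [set z : T2 | C z.1].
Proof.
move=> mC; rewrite (_ : [set z : T2 | C z.1] = C `*` setT).
  exact: measurableX.
by apply/seteqP; split => z //= -[].
Qed.

Lemma measurable_snd_set (C : set T1) : measurable C -> measurable [set z : T2 | C z.2].
Proof.
move=> mC; rewrite (_ : [set z : T2 | C z.2] = setT `*` C).
  exact: measurableX.
by apply/seteqP; split => z //= -[].
Qed.

Lemma ar_fst (C : set T1) : measurable C -> ar [set z : T2 | C z.1] = 2 * fine (mu1 C).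
Proof.
move=> mC; have -> : [set z : T2 | C z.1] = C `*` setT.
  by apply/seteqP; split => z //= -[].
rewrite arE; have -> : area (C `*` setT) = (@mu1 R C * @mu1 R setT)%E.
  exact: product_measure1E.
by rewrite mu1T fineM ?fin_num_measure// mulrC.
Qed.

Lemma ar_snd (C : set T1) : measurable C -> ar [set z : T2 | C z.2] = 2 * fine (mu1 C).
Proof.
move=> mC; have -> : [set z : T2 | C z.2] = setT `*` C.
  by apply/seteqP; split => z //= -[].
rewrite arE; have -> : area (setT `*` C) = (@mu1 R setT * @mu1 R C)%E.
  exact: product_measure1E.
by rewrite mu1T fineM ?fin_num_measure.
Qed.

(** The symmetric difference of [A] and its translate; its area measures how far [A] is from being
    invariant under the shift [h]. *)
Definition dif A h : set T2 := (A `\` (tr h @^-1` A)) `|` ((tr h @^-1` A) `\` A).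

Lemma difP A h z : (A z <-> A (tr h z)) <-> ~ dif A h z.
Proof.
rewrite /dif /=; split; first by move=> H [[a b]|[a b]]; [apply: b|apply: b]; apply/H.
move=> H; split => a; apply: contrapT => b; apply: H; [left|right] => //.
Qed.

Lemma measurable_dif A h : measurable A -> measurable (dif A h).
Proof.
move=> mA; have mT := measurable_pre (measurable_tr h) mA.
by apply: measurableU; exact: measurableD.
Qed.

Lemma per_dif A h : per A -> per (dif A h).
Proof.
move=> pA; have pT := per_tr h pA.
move=> z; have [p1 p2] := pA z; have [q1 q2] := pT z.
by rewrite /dif /=; rewrite /= in q1 q2;
  rewrite (propext p1) (propext p2) (propext q1) (propext q2).
Qed.

Definition tcont A := forall e : R, 0 < e -> exists2 d : R, 0 < d &
  forall h, `|h.1| <= d -> `|h.2| <= d -> ar (dif A h) <= e.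

Lemma tcontC A : tcont A -> tcont (~` A).
Proof.
move=> tA e e0; have [d d0 H] := tA e e0; exists d => // h h1 h2.
rewrite (_ : dif _ _ = dif A h); first exact: H.
apply/seteqP; split => z; rewrite /dif/= => -[[a b]|[a b]];
  by [right; split => //; apply: contrapT|left; split => //; apply: contrapT].
Qed.

Lemma tcontU A B : measurable A -> measurable B -> tcont A -> tcont B ->
  tcont (A `|` B).
Proof.
move=> mA mB tA tB e e0; have e20 : 0 < e / 2 by rewrite divr_gt0.
have [d1 d10 H1] := tA _ e20; have [d2 d20 H2] := tB _ e20.
exists (Num.min d1 d2); first by rewrite lt_min d10.
move=> h; rewrite !le_min => /andP[a1 a2] /andP[b1 b2].
have m1 := measurable_dif h mA; have m2 := measurable_dif h mB.
have m3 := measurable_dif h (measurableU _ _ mA mB).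
apply: (@le_trans _ _ (ar (dif A h `|` dif B h))).
  apply: ar_le => //; first exact: measurableU.
  by move=> z; rewrite /dif /=; tauto.
by apply: (le_trans (arU_le m1 m2)); have := H1 h a1 b1; have := H2 h a2 b2; flra.
Qed.

Lemma tcont0 : tcont set0.
Proof.
move=> e e0; exists 1 => // h _ _.
rewrite (_ : dif _ _ = set0) ?ar0 ?ltW//.
by apply/seteqP; split => z // -[[]|[]].
Qed.

Lemma ar_bigcap0 (B : nat -> set T2) (e : R) : (forall n, measurable (B n)) ->
  (forall n, B n.+1 `<=` B n) -> \bigcap_n B n = set0 -> 0 < e ->
  exists n, ar (B n) <= e.
Proof.
move=> mB dB B0 e0.
have : (area \o B) x @[x --> \oo] --> area (\bigcap_n B n).
  apply: nonincreasing_cvg_mu => //.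
  - by rewrite -ge0_fin_numE// area_fin.
  - by rewrite B0.
  - by apply/nonincreasing_seqP => n; apply/subsetPset; exact: dB.
rewrite B0 measure0 => /fine_cvgP[_ /cvgrPdist_le /(_ _ e0) [N _ H]].
by exists N; have := H N (leqnn N); rewrite /= arE sub0r normrN ger0_norm// fine_ge0.
Qed.

(** Finite unions exhaust the union up to a set of area e/3. That set counts twice, once for itself
    and once translated, and periodicity makes the two areas equal. *)
Lemma tcont_bigcup (F : nat -> set T2) : (forall n, measurable (F n)) ->
  (forall n, per (F n)) -> (forall n, tcont (F n)) -> tcont (\bigcup_n F n).
Proof.
move=> mF pF tF e e0.
pose G n := \bigcup_(i < n) F i; pose A := \bigcup_n F n.
have GS n : G n.+1 = G n `|` F n by rewrite /G !bigcup_mkord big_ord_recr.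
have G0 : G 0%N = set0 by rewrite /G bigcup_mkord big_ord0.
have mG n : measurable (G n).
  by elim: n => [|n IH]; rewrite ?G0// GS; exact: measurableU.
have pG n : per (G n) by exact: per_bigcup.
have tG n : tcont (G n).
  by elim: n => [|n IH]; rewrite ?G0 ?GS; [exact: tcont0|exact: tcontU].
have mA : measurable A by exact: bigcup_measurable.
have e30 : 0 < e / 3 by rewrite divr_gt0.
have mAG n : measurable (A `\` G n) by exact: measurableD.
have [||N HN] := ar_bigcap0 mAG _ _ e30.
- by move=> n z [Az nG]; split => // Gn; apply: nG; rewrite GS; left.
- apply/seteqP; split => // z Hz; have [[i _ Fi] _] := Hz 0%N I.
  by have [_] := Hz i.+1 I; apply; exists i => //=.
have [d d0 H] := tG N _ e30; exists d => // h h1 h2.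
have pAG : per (A `\` G N) by apply: perI; [exact: per_bigcup|exact: perC].
have m1 := measurable_dif h (mG N).
have m2 := mAG N.
have m3 := measurable_pre (measurable_tr h) m2.
have m12 : measurable (dif (G N) h `|` (A `\` G N)) by exact: measurableU.
have mAh := measurable_dif h mA.
apply: (@le_trans _ _ (ar ((dif (G N) h `|` (A `\` G N)) `|` (tr h @^-1` (A `\` G N))))).
  apply: ar_le => //; first exact: measurableU.
  have GA z : G N z -> A z by move=> [i _ Fi]; exists i.
  move=> z; rewrite /dif /= -/A; have := GA z; have := GA (tr h z).
  case: (pselect (G N z)); case: (pselect (G N (tr h z))); tauto.
apply: (le_trans (arU_le m12 m3)); rewrite ar_tr//.
apply: (@le_trans _ _ (ar (dif (G N) h) + ar (A `\` G N) + ar (A `\` G N))).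
  by rewrite lerD2r; exact: arU_le.
by have := H h h1 h2; flra.
Qed.

Definition mod2 (x : R) : R := x - 2 * fl (x / 2).

Lemma mod2_itv x : 0 <= mod2 x < 2.
Proof. by rewrite /mod2; have := fl_itv (x / 2); flra. Qed.

Lemma mod2_id x : 0 <= x < 2 -> mod2 x = x.
Proof.
move=> h; rewrite /mod2 (_ : fl _ = 0%:~R) ?mulr0 ?subr0//.
by apply: fl_eq; rewrite /=; flra.
Qed.

Lemma mod2D x y : 0 <= mod2 x + y < 2 -> mod2 (x + y) = mod2 x + y.
Proof.
rewrite /mod2 => h; rewrite (_ : fl ((x + y) / 2) = fl (x / 2)); first by ring.
by rewrite {1}/fl; apply: fl_eq; rewrite -/(fl _); flra.
Qed.

Lemma mod2_per x : mod2 (x + 2) = mod2 x.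
Proof. rewrite /mod2 (_ : (x + 2) / 2 = x / 2 + 1%:~R); last by rewrite /=; field.
by rewrite flDz; ring. Qed.

Lemma measurable_mod2 : measurable_fun setT (mod2 : T1 -> T1).
Proof.
apply: measurable_funB => //; apply: measurable_funM => //.
by apply: (measurableT_comp measurable_fl); exact: measurable_funM.
Qed.

(** Pulling back by the folding makes every set periodic. Continuity of translations can thus be
    tested on rays, which are not periodic themselves. *)
Definition fold2 z : R * R := (mod2 z.1, mod2 z.2).

Lemma measurable_fold2 : measurable_fun setT (fold2 : T2 -> T2).
Proof.
apply/measurable_fun_pairP; split; apply: (measurableT_comp measurable_mod2).
  exact: measurable_fst.
exact: measurable_snd.
Qed.

Lemma per_fold2 B : per (fold2 @^-1` B).
Proof. by move=> z; rewrite /fold2 /= !mod2_per. Qed.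

Lemma fold2_per A : per A -> fold2 @^-1` A = A.
Proof.
move=> pA; apply/seteqP.
suff H z : A (fold2 z) <-> A z by split => z /=; rewrite H.
rewrite -(perz (- Num.floor (z.1 / 2)) (- Num.floor (z.2 / 2)) z pA).
by rewrite /fold2/mod2/fl !rmorphN !mulrN.
Qed.

Lemma mu1_itv_le (a b : R) : a <= b -> fine (@mu1 R `[a, b]) <= b - a.
Proof.
move=> ab; rewrite -lee_fin fineK ?fin_num_measure//.
apply: (@le_trans _ _ (lebesgue_measure `[a, b])).
  rewrite /mu1 /mrestr; apply: le_measure; rewrite ?inE//.
  by apply: measurableI; exact: measurable_itv.
rewrite lebesgue_measure_itv/= lte_fin; case: ifPn => [_|]; first by rewrite -EFinB.
by rewrite lee_fin subr_ge0.
Qed.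

(** Outside this set a shift of size at most [d] changes neither the period in which a point lies
    nor its side with respect to [x]. *)
Let near_bd (x d : R) : set T1 := (`[0, d] `|` `[2 - d, 2]) `|` `[x - d, x + d].

Let mnear x d : measurable (near_bd x d).
Proof. by apply: measurableU => //; exact: measurableU. Qed.

Let near_le x d : 0 < d -> fine (@mu1 R (near_bd x d)) <= 4 * d.
Proof.
move=> d0.
have H (A B : set T1) : measurable A -> measurable B ->
    fine (@mu1 R (A `|` B)) <= fine (@mu1 R A) + fine (@mu1 R B).
  move=> mA mB; have mAB := measurableU _ _ mA mB.
  by rewrite -lee_fin EFinD !fineK ?fin_num_measure//; exact: measureU2.
apply: (le_trans (H _ _ _ _)) => //; first exact: measurableU.
apply: (@le_trans _ _ (fine (@mu1 R `[0, d]) + fine (@mu1 R `[2 - d, 2]) + fine (@mu1 R `[x - d, x + d]))).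
  by rewrite lerD2r; exact: H.
have h1 := @mu1_itv_le 0 d (ltW d0).
have h2 := @mu1_itv_le (2 - d) 2; have h3 := @mu1_itv_le (x - d) (x + d).
by flra.
Qed.

Let ray_dif (x d y t : R) : 0 < d < 1 -> `|t| <= d ->
  ~ near_bd x d (mod2 y) -> (x < mod2 y) = (x < mod2 (y + t)).
Proof.
move=> d01; rewrite ler_norml /near_bd /= !in_itv/= => td h.
have m := mod2_itv y.
have h1 : d < mod2 y < 2 - d.
  by apply/andP; split; rewrite ltNge; apply/negP => k; apply: h; left;
    [left|right]; flra.
have h2 : (mod2 y < x - d) || (x + d < mod2 y).
  rewrite !ltNge -negb_and; apply/negP => k; apply: h; right; flra.
rewrite mod2D; last by flra.
case: ltP => k1; case: ltP => k2 //; case/orP: h2; flra.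
Qed.

(** The sets whose folded preimage has continuous translations form a sigma-algebra, which contains
    the preimages of rays under both coordinates and hence every measurable set. *)
Lemma tcont_measurable A : measurable A -> per A -> tcont A.
Proof.
move=> + pA; rewrite -{2}(fold2_per pA) => mA.
pose S : set (set T2) := [set B | measurable B /\ tcont (fold2 @^-1` B)].
have S0 : S set0 by split => //; rewrite preimage_set0; exact: tcont0.
have SC B : S B -> S (~` B).
  move=> [mB tB]; split; first exact: measurableC.
  by rewrite preimage_setC; exact: tcontC.
have SU (F : nat -> set T2) : (forall n, S (F n)) -> S (\bigcup_n F n).
  move=> SF; split; first by apply: bigcup_measurable => n _; have [] := SF n.
  rewrite preimage_bigcup; apply: tcont_bigcup => n; have [mFn tFn] := SF n => //.
    exact: (measurable_pre measurable_fold2).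
  exact: per_fold2.
suff : S A by move=> [].
have sS : sigma_algebra setT S.
  by split => // B SB; rewrite setTD; exact: SC.
(* For one coordinate at a time: rays generate the Borel sets of the line. *)
have gen (f : T2 -> T1) : measurable_fun setT f ->
    (forall x : R, tcont (fold2 @^-1` (f @^-1` `]x, +oo[))) ->
    forall C, measurable C -> S (f @^-1` C).
  move=> mf tf C; rewrite RGenOInfty.measurableE => mC.
  have sub := smallest_sub _ _ mC.
  apply: (sub [set C | S (f @^-1` C)]).
    split => /=.
    - by rewrite preimage_set0.
    - by move=> B SB; rewrite setTD preimage_setC; exact: SC.
    - by move=> F SF; rewrite preimage_bigcup; exact: SU.
  move=> _ [x ->]; split; last exact: tf.
  by rewrite -[_ @^-1` _]setTI; apply: mf => //; exact: measurable_itv.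
have tray (i : bool) (x : R) :
    tcont (fold2 @^-1` ((fun z => if i then z.1 else z.2) @^-1` `]x, +oo[)).
  set B := fold2 @^-1` _.
  have mf : measurable_fun setT ((fun z => if i then z.1 else z.2) : T2 -> T1).
    by case: i {B}; [exact: measurable_fst|exact: measurable_snd].
  have mB : measurable B.
    apply: measurable_pre; first exact: measurable_fold2.
    by rewrite -[_ @^-1` _]setTI; apply: mf => //; exact: measurable_itv.
  move=> e e0; pose d := Num.min (1/2) (e / 8).
  have d0 : 0 < d by rewrite lt_min !divr_gt0.
  have d1 : 0 < d < 1 by rewrite d0 /= gt_min; apply/orP; left; flra.
  exists d => // h h1 h2; have mD := measurable_dif h mB.
  have mN : measurable (mod2 @^-1` (near_bd x d) : set T1).
    by rewrite -[_ @^-1` _]setTI; apply: measurable_mod2.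
  have eN : fine (@mu1 R (mod2 @^-1` near_bd x d)) <= 4 * d.
    apply: le_trans (near_le x d0); rewrite le_eqVlt; apply/orP; left; apply/eqP.
    congr fine; rewrite /mu1 /mrestr; congr lebesgue_measure.
    by apply/seteqP; split => y /= []; rewrite in_itv/= => + /[dup] yI h3;
      rewrite mod2_id.
  have de : d <= e / 8 by rewrite ge_min lexx orbT.
  apply: (@le_trans _ _ (2 * fine (@mu1 R (mod2 @^-1` near_bd x d)))); last by flra.
  case: i @B mB mD {mf} => /= mB mD.
    rewrite -ar_fst//; apply: ar_le => //.
      exact: measurable_fst_set.
    move=> z; apply: contraPP => nz; apply/difP.
    by rewrite /= !in_itv /= !andbT /fold2 /= -(ray_dif d1 h1 nz).
  rewrite -ar_snd//; apply: ar_le => //.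
    exact: measurable_snd_set.
  move=> z; apply: contraPP => nz; apply/difP.
  by rewrite /= !in_itv /= !andbT /fold2 /= -(ray_dif d1 h2 nz).
apply: (smallest_sub sS _ mA) => B [] /= [C mC <-]; rewrite setTI.
  exact: (gen fst (measurable_fst) (tray true)).
exact: (gen snd (measurable_snd) (tray false)).
Qed.

End TranslationContinuity.

(** * Ergodicity of the limit map *)

Section Strips.
Context {R : realType}.
Local Notation T1 := (measurableTypeR R).
Local Notation T2 := (T1 * T1)%type.
Implicit Types (A B : set T2) (z h : R * R).

Lemma mu1U_le (A B : set T1) : measurable A -> measurable B ->
  fine (@mu1 R (A `|` B)) <= fine (@mu1 R A) + fine (@mu1 R B).
Proof.
move=> mA mB; have mAB := measurableU _ _ mA mB.
by rewrite -lee_fin EFinD !fineK ?fin_num_measure//; exact: measureU2.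
Qed.

Definition nearZ (c x : R) : Prop := x - fl x <= c \/ fl x + 1 - x <= c.

Lemma cut_nearZ (t x : R) : 0 <= t -> fl (x + t) <> fl x -> nearZ t x.
Proof.
move=> t0 H; right; rewrite leNgt; apply/negP => h; apply: H.
by rewrite {1}/fl; apply: fl_eq; rewrite -/(fl x); have := fl_itv x; flra.
Qed.

Lemma measurable_nearZ c : measurable (nearZ c : set T1).
Proof.
have -> : (nearZ c : set T1) = ((fun x => x - fl x) @^-1` `]-oo, c]) `|`
    ((fun x => fl x + 1 - x) @^-1` `]-oo, c]).
  by apply/seteqP; split => x /=; rewrite !in_itv.
have m1 : measurable_fun setT ((fun x => x - fl x) : T1 -> T1).
  by apply: measurable_funB => //; exact: measurable_fl.
have m2 : measurable_fun setT ((fun x => fl x + 1 - x) : T1 -> T1).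
  apply: measurable_funB => //; apply: measurable_funD => //; exact: measurable_fl.
by apply: measurableU; rewrite -[_ @^-1` _]setTI; [apply: m1|apply: m2].
Qed.

Lemma mu1_nearZ c : 0 <= c -> fine (@mu1 R (nearZ c)) <= 4 * c.
Proof.
move=> c0; have mN := measurable_nearZ c.
pose I1 : set T1 := `[0, c]%classic; pose I2 : set T1 := `[1, 1 + c]%classic.
pose I3 : set T1 := `[1 - c, 1]%classic; pose I4 : set T1 := `[2 - c, 2]%classic.
have m1 : measurable I1 by exact: measurable_itv.
have m2 : measurable I2 by exact: measurable_itv.
have m3 : measurable I3 by exact: measurable_itv.
have m4 : measurable I4 by exact: measurable_itv.
have h1 : fine (@mu1 R I1) <= c by apply: le_trans (mu1_itv_le _) _; flra.
have h2 : fine (@mu1 R I2) <= c by apply: le_trans (mu1_itv_le _) _; flra.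
have h3 : fine (@mu1 R I3) <= c by apply: le_trans (mu1_itv_le _) _; flra.
have h4 : fine (@mu1 R I4) <= c by apply: le_trans (mu1_itv_le _) _; flra.
have m12 := measurableU _ _ m1 m2; have m34 := measurableU _ _ m3 m4.
apply: (@le_trans _ _ (fine (@mu1 R ((I1 `|` I2) `|` (I3 `|` I4))))); last first.
  have := mu1U_le m12 m34; have := mu1U_le m1 m2; have := mu1U_le m3 m4; flra.
rewrite -lee_fin !fineK ?fin_num_measure//; last exact: measurableU.
have mm : measurable ((I1 `|` I2) `|` (I3 `|` I4)) by exact: measurableU.
rewrite /mu1 /mrestr; apply: le_measure; rewrite ?inE; try exact: measurableI.
move=> x /= [Nx]; rewrite in_itv/= => xI; split => //.
have [x1|x1] := ltP x 1.
  have flx : fl x = 0%:~R by apply: fl_eq; rewrite /=; flra.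
  by case: Nx; rewrite flx /= => h; [left; left|right; left]; rewrite /I1 /I2 /I3 /I4 /= in_itv/=; flra.
have flx : fl x = 1%:~R by apply: fl_eq; rewrite /=; flra.
by case: Nx; rewrite flx /= => h; [left; right|right; right]; rewrite /I1 /I2 /I3 /I4 /= in_itv/=; flra.
Qed.

(** By Fubini: every vertical section lies in an interval of length [2 * b / c], which is at most
    [2 * b]. *)
Lemma ar_strip (C : set T1) (c b : R) (g : T1 -> T1) :
  measurable C -> measurable_fun setT g -> 1 <= c -> 0 <= b ->
  let S := [set z : T2 | C z.1 /\ `|c * z.2 - g z.1| <= b] in
  measurable S /\ ar S <= fine (@mu1 R C) * (2 * b).
Proof.
move=> mC mg c1 b0 S.
have mh : measurable_fun setT ((fun z => c * z.2 - g z.1) : T2 -> T1).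
  apply: measurable_funB; last exact: (measurableT_comp mg measurable_fst).
  by apply: measurable_funM => //; exact: measurable_snd.
have mS : measurable S.
  have -> : S = [set z | C z.1] `&` ((fun z => c * z.2 - g z.1) @^-1` `[- b, b]).
    by apply/seteqP; split => z; rewrite /S /= in_itv /= ler_norml.
  apply: measurableI; first exact: measurable_fst_set.
  by rewrite -[_ @^-1` _]setTI; apply: mh => //; exact: measurable_itv.
split => //.
rewrite -lee_fin arK// areaE EFinM fineK ?fin_num_measure//.
have -> : (@mu1 R C * (2 * b)%:E = \int[@mu1 R]_x ((2 * b)%:E * (\1_C x)%:E))%E.
  rewrite ge0_integralZl//; last by rewrite lee_fin; flra.
  - by rewrite integral_indic// setIT muleC.
  - by apply/measurable_EFinP; exact: measurable_indic.
apply: ge0_le_integral => //.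
- exact: measurable_fun_xsection.
- by apply: measurable_funeM; apply/measurable_EFinP; exact: measurable_indic.
move=> x _; rewrite indicE; have [xC|xC] := boolP (x \in C); last first.
  rewrite mule0 (_ : xsection _ _ = set0) ?measure0//.
  apply/seteqP; split => // y; rewrite /xsection /= inE /S /= => -[Cx _].
  by have := mem_set Cx; rewrite (negbTE xC).
rewrite mule1; pose e := (g x - b) / c; pose f := (g x + b) / c.
apply: (@le_trans _ _ (mu1 (`[e, f]%classic : set T1))).
  apply: le_measure; rewrite ?inE//; first exact: measurable_xsection.
  move=> y; rewrite /xsection /= inE /S /= => -[_]; rewrite ler_norml in_itv /e /f/=.
  by rewrite ler_pdivrMr ?ler_pdivlMr; flra.
have ef : e <= f by rewrite /e /f ler_pM2r ?invr_gt0; flra.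
rewrite -[leLHS]fineK ?fin_num_measure// lee_fin; apply: (le_trans (mu1_itv_le ef)).
by rewrite /e /f -mulrBl ler_pdivrMr; nra.
Qed.

End Strips.

(** * Eigendirections, and transversality of the walls to their preimages *)

Section Ergodicity.
Context {R : realType}.
Local Notation T1 := (measurableTypeR R).
Local Notation T2 := (T1 * T1)%type.
Implicit Types (A B : set T2) (z h : R * R).
Context (lam : R) (lam1 : 1 < lam).
Local Notation mu := (lam^-1).
Local Notation D := (lam + mu - 2).
Local Notation F := (Fm lam).
Local Notation G := (Fi lam).

Lemma mu_gt0 : 0 < mu. Proof. by rewrite invr_gt0 (lt_trans ltr01). Qed.
Lemma mu_lt1 : mu < 1. Proof. by rewrite invf_lt1 ?(lt_trans ltr01). Qed.
Lemma lam_neq0 : lam != 0. Proof. by rewrite gt_eqF// (lt_trans ltr01). Qed.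
Lemma lammu : lam * mu = 1. Proof. by rewrite mulfV// gt_eqF ?(lt_trans ltr01). Qed.

(** Eigenvectors of the linear part of [F] for [lam] ([eu]) and [mu] ([es]), normalized by their
    first coordinate. *)
Definition eu (t : R) : R * R := (t, t * lam).
Definition es (t : R) : R * R := (t, t * mu).

Lemma Fi_eu t z : fl (z.1 + t) = fl z.1 -> G (tr (eu t) z) = tr (eu (mu * t)) (G z).
Proof.
by move=> h; rewrite /Fi /tr /eu /= h; congr pair; field; exact: lam_neq0.
Qed.

Lemma Fm_es t z : fl (z.2 + mu * t) = fl z.2 ->
  F (tr (es t) z) = tr (es (mu * t)) (F z).
Proof.
move=> h; rewrite /Fm /tr /es /= [t * mu]mulrC h; congr pair.
by field; exact: lam_neq0.
Qed.

Lemma measurable_iter (f : T2 -> T2) n : measurable_fun setT f ->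
  measurable_fun setT (iter n f).
Proof.
move=> mf; elim: n => [|n IH]; first exact: measurable_id.
exact: (measurableT_comp mf IH).
Qed.

Lemma iter_FmK n : cancel (iter n F) (iter n G).
Proof. by elim: n => // n IH z; rewrite iterSr /= FmK IH. Qed.

Lemma iter_FiK n : cancel (iter n G) (iter n F).
Proof. by elim: n => // n IH z; rewrite iterSr /= FiK IH. Qed.

Lemma per_iterF n A : per A -> per (iter n F @^-1` A).
Proof.
elim: n A => // n IH A pA.
rewrite (_ : _ @^-1` _ = iter n F @^-1` (F @^-1` A)); first by apply/IH/per_Fm.
by apply/seteqP; split.
Qed.

Lemma ar_iterF n A : measurable A -> per A -> ar (iter n F @^-1` A) = ar A.
Proof.
elim: n A => // n IH A mA pA.
rewrite (_ : _ @^-1` _ = iter n F @^-1` (F @^-1` A)); last by apply/seteqP; split.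
by rewrite IH ?ar_Fm//; [apply: measurable_pre => //; exact: measurable_Fm|exact: per_Fm].
Qed.

Lemma ar_iterG n A : measurable A -> per A -> ar (iter n G @^-1` A) = ar A.
Proof.
elim: n A => // n IH A mA pA.
rewrite (_ : _ @^-1` _ = iter n G @^-1` (G @^-1` A)); last by apply/seteqP; split.
by rewrite IH ?ar_Fi//; [apply: measurable_pre => //; exact: measurable_Fi|exact: per_Fi].
Qed.

(** The Chebyshev-type sequence s_0 = 0, s_1 = 1, s_(n+1) = (lam + mu) s_n - s_(n-1), stored as the
    pair (s_n, s_(n+1)). Up to sign these are the entries of the powers of the linear part of
    [F]. *)
Fixpoint slope (n : nat) : R * R :=
  if n is n.+1 then ((slope n).2, (lam + mu) * (slope n).2 - (slope n).1) else (0, 1).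

Lemma slope_ge n : [/\ 0 <= (slope n).1, (slope n).1 <= (slope n).2 & 1 <= (slope n).2].
Proof.
have h2 : 2 <= lam + mu.
  have l0 := mu_gt0; have l := lammu; have : 0 <= (lam - 1) * (1 - mu).
    by rewrite mulr_ge0// subr_ge0 ltW// mu_lt1.
  nra.
elim: n => [|n [h0 h3 h4]]; first by rewrite /=; split; flra.
have h5 : 0 <= (lam + mu - 2) * (slope n).2 by apply: mulr_ge0; flra.
by rewrite /=; split; flra.
Qed.

Definition intseq (B : R) : seq int :=
  [seq Posz i | i <- iota 0 (Num.trunc B).+1] ++
  [seq - Posz i | i <- iota 0 (Num.trunc B).+1].

Lemma mem_intseq (B : R) (m : int) : `|m%:~R| <= B -> m \in intseq B.
Proof.
move=> mB.
have kK : (`|m| <= Num.trunc B)%N.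
  by rewrite truncn_ge_nat ?natr_absz ?intr_norm// (le_trans _ mB).
rewrite mem_cat; case: (leP 0 m) => s.
  apply/orP; left; apply/mapP; exists `|m|%N; rewrite ?mem_iota ?add0n ?ltnS//.
  by rewrite gez0_abs.
apply/orP; right; apply/mapP; exists `|m|%N; rewrite ?mem_iota ?add0n ?ltnS//.
by rewrite ltz0_abs// opprK.
Qed.

(** All branches of an iterate share one linear part. Over a fundamental domain only finitely many
    translation parts occur, since the floors met on the way are bounded. The value [-1] used at
    [n = 0] is s_(-1). *)
Lemma theta_affine n : exists L : seq R, forall z, 0 <= z.1 < 2 -> 0 <= z.2 < 2 ->
  exists2 q : R * R, q.1 \in L /\ q.2 \in L &
  (iter n F z).1 = (slope n).1 * z.2 - (if n is m.+1 then (slope m).1 else -1) * z.1 - q.1 /\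
  (iter n F z).2 = (slope n).2 * z.2 - (slope n).1 * z.1 - q.2.
Proof.
elim: n => [|n [L HL]].
  exists [:: 0] => z _ _; exists (0, 0); rewrite ?inE//=.
  by split; ring.
(* A bound for the second coordinate of the iterate over the fundamental domain, with 1 added for
   its floor. *)
pose B : R := 2 * (slope n).2 + 2 * (slope n).1 + \sum_(q <- L) `|q| + 1.
pose L' := [seq (lam + mu) * w.1 - w.2 + D * (k%:~R + 2^-1) |
  k <- intseq B,
  w <- [seq (q2, q1) | q2 <- L, q1 <- L]].
exists (L ++ L') => z z1 z2; have [[q1 q2] /= [q1L q2L] [e1 e2]] := HL z z1 z2.
exists (q2, (lam + mu) * q2 - q1 + D * (fl (iter n F z).2 + 2^-1)); last first.
  by rewrite /= e1 e2; split => //; case: n {HL B L' q1L q2L} e1 e2 => [|n] /= e1 e2; ring.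
split; first by rewrite mem_cat q2L.
rewrite mem_cat; apply/orP; right; apply/allpairsP; exists (Num.floor (iter n F z).2, (q2, q1)); split => //; last first.
  by apply/allpairsP; exists (q2, q1).
have [h0 h3 h4] := slope_ge n.
have qB : `|q2| <= \sum_(q <- L) `|q|.
  by rewrite (big_rem _ q2L) /= lerDl sumr_ge0.
have aB : `|(iter n F z).2| <= B - 1.
  rewrite e2 /B; move: qB; set S := \sum_(_ <- _) _; rewrite ler_norml => qB.
  by rewrite ler_norml; apply/andP; split; nra.
have fB : `|(Num.floor (iter n F z).2)%:~R| <= B.
  have := fl_itv (iter n F z).2; rewrite /fl; move: aB; rewrite !ler_norml.
  set u := _%:~R; flra.
exact: mem_intseq.
Qed.

(** Transversality: pulled back by the iterate, the walls y in Z become finitely many lines in whose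
    equations the coefficient of [z.2] is at least 1. Their neighbourhoods meet those of the
    vertical walls x in Z in pieces of area of order [a * b]. *)
Lemma ar_near_pair n : exists2 C : R, 0 < C & forall a b : R, 0 <= a -> 0 <= b -> b <= 1 ->
  let S := [set z : T2 | nearZ a z.1 /\ nearZ b (iter n F z).2] in
  measurable S /\ ar S <= C * (a * b).
Proof.
have [L HL] := theta_affine n.
have [h0 h3 h4] := slope_ge n.
pose B : R := 2 * (slope n).2 + 2 * (slope n).1 + \sum_(q <- L) `|q| + 1.
pose L' := [seq q + k%:~R | k <- intseq B, q <- L].
exists (8 * (size L')%:R + 1); first by rewrite ltr_wpDl// mulr_ge0.
move=> a b a0 b0 b1 S.
have mS : measurable S.
  apply: measurableI; first exact: (measurable_fst_set (measurable_nearZ a)).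
  exact: (measurable_pre (measurable_iter n (measurable_Fm lam))
    (measurable_snd_set (measurable_nearZ b))).
split => //.
pose W q := [set z : T2 | nearZ a z.1 /\
  `|(slope n).2 * z.2 - ((slope n).1 * z.1 + q)| <= b].
have HW q : measurable (W q) /\ ar (W q) <= 8 * (a * b).
  have mg : measurable_fun setT ((fun x => (slope n).1 * x + q) : T1 -> T1).
    by apply: measurable_funD => //; exact: measurable_funM.
  have [mW aW] := ar_strip (measurable_nearZ a) mg h4 b0.
  by split => //; apply: (le_trans aW); have := mu1_nearZ a0; nra.
have mW q : measurable (W q) by have [] := HW q.
have : ar (\big[setU/set0]_(q <- L') W q) <= \sum_(q <- L') 8 * (a * b).
  by apply: ar_bigsetU => // q; have [] := HW q.
rewrite big_const_seq count_predT iter_addr addr0 => aU.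
have mU : measurable (\big[setU/set0]_(q <- L') W q) by exact: bigsetU_measurable.
have mO : measurable (@Om R) by apply: measurableX; exact: measurable_itv.
apply: (le_trans (ar_dom mS)); apply: (@le_trans _ _ (ar (\big[setU/set0]_(q <- L') W q))).
  apply: ar_le => //; first exact: measurableI.
  move=> z [[Na Nb]] [] /=; rewrite !in_itv/= => z1 z2.
  have [[q1 q2] /= [_ q2L] [_ e2]] := HL z z1 z2.
  have qB : `|q2| <= \sum_(q <- L) `|q|.
    by rewrite (big_rem _ q2L) /= lerDl sumr_ge0.
  have aB : `|(iter n F z).2| <= B - 1.
    rewrite e2 /B; move: qB; set s := \sum_(_ <- _) _; rewrite ler_norml => qB.
    by rewrite ler_norml; apply/andP; split; nra.
  have fI := fl_itv (iter n F z).2.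
  have [m mB mN] : exists2 m : int, `|m%:~R| <= B & `|(iter n F z).2 - m%:~R| <= b.
    move: aB; rewrite ler_norml => aB; case: Nb => h.
      exists (Num.floor (iter n F z).2); rewrite ler_norml -/(fl _); flra.
    exists (Num.floor (iter n F z).2 + 1); rewrite ler_norml intrD -/(fl _) /=; flra.
  rewrite -bigcup_seq; exists (q2 + m%:~R) => /=.
    by apply/allpairsP; exists (m, q2); split => //=; exact: mem_intseq.
  split => //; rewrite (_ : _ - _ = (iter n F z).2 - m%:~R) //.
  by rewrite e2; ring.
apply: (le_trans aU); rewrite -mulr_natr.
have := mulr_ge0 a0 b0; flra.
Qed.

End Ergodicity.

(** * Invariant sets do not vary along the unstable direction *)

Section DirectionalInvariance.
Context {R : realType}.
Local Notation T1 := (measurableTypeR R).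
Local Notation T2 := (T1 * T1)%type.
Implicit Types (A B : set T2) (z h : R * R).
Context (lam : R) (lam1 : 1 < lam).
Local Notation mu := (lam^-1).
Local Notation F := (Fm lam).
Local Notation G := (Fi lam).
Local Notation eu := (eu lam).
Local Notation es := (es lam).

Lemma fl_eqS (x y : R) : fl y + 1 <= x < fl y + 2 -> fl x = fl y + 1.
Proof.
move=> h; have := @fl_eq R x (Num.floor y + 1).
by rewrite intrD -/(fl y) /=; apply; flra.
Qed.

Let mu0 : 0 < mu. Proof. exact: mu_gt0. Qed.
Let mu1' : mu < 1. Proof. exact: mu_lt1. Qed.

Lemma mu_pow_small (e : R) : 0 < e -> exists k, mu ^+ k <= e.
Proof.
move=> e0; have : mu ^+ k @[k --> \oo] --> (0 : R).
  by apply: cvg_expr; rewrite gtr0_norm.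
move=> /cvgrPdist_le /(_ e e0) [N _ H]; exists N.
by have := H N (leqnn N); rewrite /= sub0r normrN ger0_norm// exprn_ge0// ltW.
Qed.

Lemma geo_tail_le (K k : nat) :
  \sum_(0 <= i < k) (if (i < K)%N then 0 else mu ^+ i) <= mu ^+ K / (1 - mu).
Proof.
pose v i := mu ^+ (maxn i K) / (1 - mu).
have m1 : 0 < 1 - mu by rewrite subr_gt0.
apply: (@le_trans _ _ (\sum_(0 <= i < k) (v i - v i.+1))).
  apply: ler_sum => i _; rewrite /v; case: ltnP => h.
    by rewrite (maxn_idPr h) subrr.
  rewrite (maxn_idPl (leqW h)) -mulrBl exprS.
  by rewrite -{2}[mu ^+ i]mul1r -mulrBl mulrAC mulfV ?mul1r// gt_eqF.
have -> : \sum_(0 <= i < k) (v i - v i.+1) = v 0%N - v k.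
  elim: k => [|k IH]; first by rewrite big_geq// subrr.
  by rewrite big_nat_recr//= IH addrA subrK.
rewrite /v max0n gerBl divr_ge0//; last exact: ltW.
by rewrite exprn_ge0// ltW.
Qed.

Lemma sum_head_le (C : nat -> R) (K k : nat) : (forall i, 0 <= C i) ->
  \sum_(0 <= i < k) (if (i < K)%N then C i else 0) <= \sum_(0 <= i < K) C i.
Proof.
move=> C0.
have -> : \sum_(0 <= i < k) (if (i < K)%N then C i else 0) =
    \sum_(0 <= i < minn k K) C i.
  elim: k => [|k IH]; first by rewrite min0n !big_geq.
  rewrite big_nat_recr//= IH; case: ltnP => h.
    by rewrite (minn_idPl h) big_nat_recr.
  by rewrite addr0 (minn_idPr (leqW h)).
by rewrite [leRHS](big_cat_nat (n := minn k K)) ?geq_minr//= lerDl sumr_ge0.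
Qed.

Lemma ar_cover A (E : nat -> set T2) (W : set T2) (k : nat) (a : nat -> R) :
  measurable A -> (forall i, measurable (E i)) -> measurable W ->
  (forall z, A z -> (exists2 i, (i < k)%N & E i z) \/ W z) ->
  (forall i, ar (E i) <= a i) -> ar A <= \sum_(0 <= i < k) a i + ar W.
Proof.
move=> mA mE mW H Ea.
have mU : measurable (\big[setU/set0]_(0 <= i < k) E i) by exact: bigsetU_measurable.
apply: (@le_trans _ _ (ar (\big[setU/set0]_(0 <= i < k) E i `|` W))).
  apply: ar_le => //; first exact: measurableU.
  move=> z /H [[i ik Ei]|]; [left|by right].
  by rewrite -bigcup_seq; exists i => //=; rewrite mem_index_iota.
apply: (le_trans (arU_le mU mW)); rewrite lerD2r; exact: ar_bigsetU.
Qed.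

(** Produces an area o(t) from a cover with two bounds: the first [K] pieces are of order t^2 with
    uncontrolled constants [C i], the others are summed geometrically. [K] is fixed before [t], so
    the constants of the first pieces are absorbed by taking [t] small. *)
Lemma tail_bound (C : nat -> R) (c e : R) : 0 < e -> 0 <= c -> (forall i, 0 <= C i) ->
  exists2 d : R, 0 < d & forall (t : R) A (E W : nat -> set T2),
    0 < t <= d -> measurable A -> (forall i, measurable (E i)) ->
    (forall k, measurable (W k)) ->
    (forall k z, A z -> (exists2 i, (i < k)%N & E i z) \/ W k z) ->
    (forall i, ar (E i) <= C i * t ^+ 2) ->
    (forall i, ar (E i) <= c * (mu ^+ i * t)) ->
    (forall eta, 0 < eta -> exists k, ar (W k) <= eta) ->
    ar A <= e * t.
Proof.
move=> e0 c0 C0; have m1 : 0 < 1 - mu by rewrite subr_gt0.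
have [K HK] : exists K, mu ^+ K <= e * (1 - mu) / (3 * (c + 1)).
  by apply: mu_pow_small; rewrite divr_gt0// mulr_gt0//; flra.
pose S := \sum_(0 <= i < K) C i; have S0 : 0 <= S by exact: sumr_ge0.
exists (e / (3 * (S + 1))); first by rewrite divr_gt0//; flra.
move=> t A E W /andP[t0 td] mA mE mW H E1 E2 HW.
have [k Wk] : exists k, ar (W k) <= e * t / 3 by apply: HW; rewrite divr_gt0// mulr_gt0.
pose a i := if (i < K)%N then C i * t ^+ 2 else c * (mu ^+ i * t).
have Ea i : ar (E i) <= a i by rewrite /a; case: ifP.
apply: (le_trans (ar_cover mA mE (mW k) (H k) Ea)).
have -> : \sum_(0 <= i < k) a i = t ^+ 2 * \sum_(0 <= i < k) (if (i < K)%N then C i else 0)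
    + c * t * \sum_(0 <= i < k) (if (i < K)%N then 0 else mu ^+ i).
  rewrite !mulr_sumr -big_split/=; apply: eq_bigr => i _.
  by rewrite /a; case: ifP => _; ring.
have h1 := sum_head_le K k C0; rewrite -/S in h1.
have h2 := geo_tail_le K k.
set s1 := \sum_(0 <= i < k) (if (i < K)%N then C i else 0) in h1 *.
set s2 := \sum_(0 <= i < k) (if (i < K)%N then 0 else mu ^+ i) in h2 *.
have h3 : t ^+ 2 * s1 <= e * t / 3.
  apply: (@le_trans _ _ (t ^+ 2 * S)); first by rewrite ler_wpM2l// sqr_ge0.
  have : t * (3 * (S + 1)) <= e by rewrite -ler_pdivlMr//; flra.
  by nra.
have h4 : c * t * s2 <= e * t / 3.
  have h5 : s2 <= e / (3 * (c + 1)).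
    apply: (le_trans h2); rewrite ler_pdivrMr//; apply: (le_trans HK).
    by rewrite [leLHS]mulrAC.
  apply: (@le_trans _ _ (c * t * (e / (3 * (c + 1))))).
    by rewrite ler_wpM2l// mulr_ge0// ltW.
  have : c / (c + 1) <= 1 by rewrite ler_pdivrMr; flra.
  have : 0 <= e * t / 3 by rewrite !mulr_ge0// ltW.
  move=> u0 u1; have -> : c * t * (e / (3 * (c + 1))) = (c / (c + 1)) * (e * t / 3).
    by field; flra.
  by rewrite ler_piMl.
flra.
Qed.

(** The segment contracted [i] times, backward along [eu] or forward along [es], crosses a wall. The
    exponent [i.+1] in [cutS] comes from the second coordinate of [es], which carries one more
    factor [mu]. *)
Definition cutU (i : nat) (t : R) : set T2 :=
  [set z | fl ((iter i G z).1 + mu ^+ i * t) <> fl (iter i G z).1].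
Definition cutS (i : nat) (t : R) : set T2 :=
  [set z | fl ((iter i F z).2 + mu ^+ i.+1 * t) <> fl (iter i F z).2].

Lemma measurable_cut (c : R) : measurable ([set x | fl (x + c) <> fl x] : set T1).
Proof.
have -> : [set x | fl (x + c) <> fl x] = (fun x => fl (x + c) - fl x) @^-1` (~` [set 0]).
  apply/seteqP; split => x /= H E; apply: H; first by apply/eqP; rewrite -subr_eq0 E.
  by rewrite E subrr.
rewrite -[_ @^-1` _]setTI.
have mf : measurable_fun setT ((fun x => fl (x + c) - fl x) : T1 -> T1).
  apply: measurable_funB; last exact: measurable_fl.
  by apply: (measurableT_comp measurable_fl); exact: measurable_funD.
by apply: mf => //; apply: measurableC; exact: measurable_set1.
Qed.

Lemma measurable_cutU i t : measurable (cutU i t).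
Proof.
exact: (measurable_pre (measurable_iter i (measurable_Fi lam))
  (measurable_fst_set (measurable_cut (mu ^+ i * t)))).
Qed.

Lemma measurable_cutS i t : measurable (cutS i t).
Proof.
exact: (measurable_pre (measurable_iter i (measurable_Fm lam))
  (measurable_snd_set (measurable_cut (mu ^+ i.+1 * t)))).
Qed.

Lemma iter_eu k t z : (forall i, (i < k)%N -> ~ cutU i t z) ->
  iter k G (tr (eu t) z) = tr (eu (mu ^+ k * t)) (iter k G z).
Proof.
elim: k => [|k IH] H; first by rewrite /= expr0 mul1r.
rewrite iterS IH ?Fi_eu ?exprS ?mulrA//; first by apply: contrapT; exact: H.
by move=> i ik; apply: H; rewrite ltnW.
Qed.

Lemma iter_es k t z : (forall i, (i < k)%N -> ~ cutS i t z) ->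
  iter k F (tr (es t) z) = tr (es (mu ^+ k * t)) (iter k F z).
Proof.
elim: k => [|k IH] H; first by rewrite /= expr0 mul1r.
rewrite iterS IH ?Fm_es ?exprS ?mulrA//.
  by rewrite -exprS; apply: contrapT; exact: H.
by move=> i ik; apply: H; rewrite ltnW.
Qed.

Lemma per_near1 c : per [set z : T2 | nearZ c z.1].
Proof. by move=> z; split => //=; rewrite /nearZ (flDz _ 2) /=; split; case; [left|right|left|right]; flra. Qed.

Lemma per_near2 c : per [set z : T2 | nearZ c z.2].
Proof. by move=> z; split => //=; rewrite /nearZ (flDz _ 2) /=; split; case; [left|right|left|right]; flra. Qed.

Lemma ar_near1 c : 0 <= c -> ar [set z : T2 | nearZ c z.1] <= 8 * c.
Proof.
move=> c0; rewrite ar_fst; last exact: measurable_nearZ.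
by have := mu1_nearZ c0; flra.
Qed.

Lemma ar_near2 c : 0 <= c -> ar [set z : T2 | nearZ c z.2] <= 8 * c.
Proof.
move=> c0; rewrite ar_snd; last exact: measurable_nearZ.
by have := mu1_nearZ c0; flra.
Qed.

Lemma cutS_near i t z : 0 <= t -> cutS i t z -> nearZ (mu ^+ i.+1 * t) (iter i F z).2.
Proof. by move=> t0; apply: cut_nearZ; rewrite mulr_ge0// exprn_ge0// ltW. Qed.

Lemma cutU_near i t z : 0 <= t -> cutU i t z -> nearZ (mu ^+ i * t) (iter i G z).1.
Proof. by move=> t0; apply: cut_nearZ; rewrite mulr_ge0// exprn_ge0// ltW. Qed.

Lemma ar_cutS i t : 0 <= t -> ar (cutS i t) <= 8 * (mu ^+ i * t).
Proof.
move=> t0; have c0 : 0 <= mu ^+ i.+1 * t by rewrite mulr_ge0// exprn_ge0// ltW.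
have mN := measurable_snd_set (measurable_nearZ (mu ^+ i.+1 * t)).
have mP := measurable_pre (measurable_iter i (measurable_Fm lam)) mN.
apply: (le_trans (ar_le (measurable_cutS i t) mP (fun z => @cutS_near i t z t0))).
rewrite ar_iterF//; last exact: per_near2.
apply: (le_trans (ar_near2 c0)); rewrite ler_pM2l// exprS -mulrA ler_piMl//.
  by rewrite mulr_ge0// exprn_ge0// ltW.
exact: ltW.
Qed.

Lemma ar_cutU i t : 0 <= t -> ar (cutU i t) <= 8 * (mu ^+ i * t).
Proof.
move=> t0; have c0 : 0 <= mu ^+ i * t by rewrite mulr_ge0// exprn_ge0// ltW.
have mN := measurable_fst_set (measurable_nearZ (mu ^+ i * t)).
have mP := measurable_pre (measurable_iter i (measurable_Fi lam)) mN.
apply: (le_trans (ar_le (measurable_cutU i t) mP (fun z => @cutU_near i t z t0))).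
rewrite ar_iterG//; last exact: per_near1.
exact: ar_near1.
Qed.

Context (U : set T2) (mU : measurable U) (pU : per U)
  (invU : forall z, U (F z) <-> U z).

Lemma inv_iterF k z : U (iter k F z) <-> U z.
Proof. by elim: k => // k IH; rewrite iterS invU. Qed.

Lemma inv_iterG k z : U (iter k G z) <-> U z.
Proof. by rewrite -(inv_iterF k) iter_FiK. Qed.

(** Hopf's argument: as long as no wall cuts the segment on the way, an invariant set separates its
    ends only if it separates those of its contracted image. *)
Lemma dif_iterG k t z : (forall i, (i < k)%N -> ~ cutU i t z) ->
  dif U (eu t) z -> dif U (eu (mu ^+ k * t)) (iter k G z).
Proof.
move=> H; apply: contraPP => /difP.
by rewrite -iter_eu// !inv_iterG => /difP.
Qed.

Lemma dif_iterF k t z : (forall i, (i < k)%N -> ~ cutS i t z) ->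
  dif U (es t) z -> dif U (es (mu ^+ k * t)) (iter k F z).
Proof.
move=> H; apply: contraPP => /difP.
by rewrite -iter_es// !inv_iterF => /difP.
Qed.

Lemma dif_small (t e : R) : 0 < t -> 0 < e -> exists k,
  ar (dif U (eu (mu ^+ k * t))) <= e /\ ar (dif U (es (mu ^+ k * t))) <= e.
Proof.
move=> t0 e0; have [d d0 H] := tcont_measurable mU pU e0.
have l0 : 0 < lam by rewrite (lt_trans ltr01).
have [k Hk] : exists k, mu ^+ k <= d / (t * lam).
  by apply: mu_pow_small; rewrite divr_gt0// mulr_gt0.
have p0 : 0 < mu ^+ k by rewrite exprn_gt0.
have h : mu ^+ k * t * lam <= d by rewrite -mulrA -ler_pdivlMr// mulr_gt0.
have q0 : 0 < mu ^+ k * t by rewrite mulr_gt0.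
exists k; split; apply: H; rewrite /= gtr0_norm ?mulr_gt0//.
- by apply: le_trans h; rewrite ler_peMr// ltW.
- by apply: le_trans h; rewrite ler_peMr// ltW.
- by apply: le_trans h; rewrite ler_wpM2l ?ltW//; exact: lt_trans lam1.
Qed.

Let mdif h : measurable (dif U h). Proof. exact: measurable_dif. Qed.
Let pdif h : per (dif U h). Proof. exact: per_dif. Qed.
Let mN t : measurable [set z : T2 | nearZ t z.1].
Proof. exact: measurable_fst_set (measurable_nearZ t). Qed.

(** The strip along the walls has area of order [t], so a further small factor has to be gained. Up
    to a negligible set a disagreement forces a cut at some time [i]: being close to a wall both now
    and then costs order t^2 by transversality, and order mu^i t by preservation of area. *)
Lemma near_es (e : R) : 0 < e -> exists2 d, 0 < d & forall t, 0 < t <= d ->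
  ar (dif U (es t) `&` [set z : T2 | nearZ t z.1]) <= e * t.
Proof.
move=> e0.
have /choice [C HC] : forall i, exists C : R, 0 < C /\
    forall a b : R, 0 <= a -> 0 <= b -> b <= 1 ->
    let S := [set z : T2 | nearZ a z.1 /\ nearZ b (iter i F z).2] in
    measurable S /\ ar S <= C * (a * b).
  by move=> i; have [C ? ?] := ar_near_pair lam1 i; exists C.
have C0 i : 0 <= C i by have [/ltW] := HC i.
have [d d0 H] := tail_bound e0 (ler0n R 8) C0.
exists (Num.min d 1); first by rewrite lt_min d0 /=.
move=> t /andP[t0]; rewrite le_min => /andP[td t1].
pose E i := cutS i t `&` [set z : T2 | nearZ t z.1].
pose W k := iter k F @^-1` (dif U (es (mu ^+ k * t))).
have mE i : measurable (E i) by apply: measurableI => //; exact: measurable_cutS.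
have mW k : measurable (W k).
  exact: (measurable_pre (measurable_iter k (measurable_Fm lam))).
apply: (H t _ E W) => //.
- by rewrite t0.
- exact: measurableI.
- move=> k z [Dz Nz].
  case: (pselect (exists2 i, (i < k)%N & cutS i t z)) => [[i ik c]|nc].
    by left; exists i.
  right; apply: dif_iterF => // i ik c; apply: nc; by exists i.
- move=> i; have [_ /(_ t (mu ^+ i.+1 * t))] := HC i.
  have c0 : 0 <= mu ^+ i.+1 * t by rewrite mulr_ge0 ?exprn_ge0// ltW.
  have c1 : mu ^+ i.+1 * t <= t by rewrite ler_piMl ?(ltW t0)// exprn_ile1 ?ltW.
  case=> //; [exact: ltW|exact: le_trans t1|move=> mS aS].
  apply: (@le_trans _ _ _ _ _ _ (le_trans aS _)).
    apply: ar_le => // z [cz Nz]; split => //; apply: cutS_near => //; exact: ltW.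
  by rewrite ler_wpM2l// expr2 ler_pM2l.
- move=> i; apply: le_trans (ar_cutS i (ltW t0)).
  apply: ar_le => //; [exact: measurable_cutS|by move=> z []].
- move=> eta eta0; have [k [_ Hk]] := dif_small t0 eta0; exists k.
  by rewrite /W ar_iterF.
Qed.

(** The argument of [near_es] run backward. A cut at time 0 is excluded, being the wall itself. For
    a cut at time [i.+1] the pair of walls is read at the point [iter i.+1 G z], where the second
    coordinate of the [i]-th image is [z.1]; hence the index [i.-1]. *)
Lemma near_eu (e : R) : 0 < e -> exists2 d, 0 < d & forall t, 0 < t <= d ->
  ar ((dif U (eu t) `\` cutU 0 t) `&` [set z : T2 | nearZ t z.1]) <= e * t.
Proof.
move=> e0.
have /choice [C HC] : forall i, exists C : R, 0 < C /\
    forall a b : R, 0 <= a -> 0 <= b -> b <= 1 ->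
    let S := [set z : T2 | nearZ a z.1 /\ nearZ b (iter i.-1 F z).2] in
    measurable S /\ ar S <= C * (a * b).
  by move=> i; have [C ? ?] := ar_near_pair lam1 i.-1; exists C.
have C0 i : 0 <= C i by have [/ltW] := HC i.
have [d d0 H] := tail_bound e0 (ler0n R 8) C0.
exists (Num.min d 1); first by rewrite lt_min d0 /=.
move=> t /andP[t0]; rewrite le_min => /andP[td t1].
pose E i := if i is 0%N then set0 else cutU i t `&` [set z : T2 | nearZ t z.1].
pose W k := iter k G @^-1` (dif U (eu (mu ^+ k * t))).
have mE i : measurable (E i).
  by case: i => [|i]; [exact: measurable0|apply: measurableI => //; exact: measurable_cutU].
have mW k : measurable (W k).
  exact: (measurable_pre (measurable_iter k (measurable_Fi lam))).
apply: (H t _ E W) => //.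
- by rewrite t0.
- apply: measurableI => //; apply: measurableD => //; exact: measurable_cutU.
- move=> k z [[Dz nz] Nz].
  case: (pselect (exists2 i, (i < k)%N & cutU i t z)) => [[[|i] ik c]|nc] //.
    by left; exists i.+1.
  right; apply: dif_iterG => // i ik c; apply: nc; by exists i.
- case=> [|i]; first by rewrite /E ar0 mulr_ge0// sqr_ge0.
  have [_ /(_ (mu ^+ i.+1 * t) t)] := HC i.+1.
  have c0 : 0 <= mu ^+ i.+1 * t by rewrite mulr_ge0 ?exprn_ge0// ltW.
  have c1 : mu ^+ i.+1 * t <= t by rewrite ler_piMl ?(ltW t0)// exprn_ile1 ?ltW.
  case=> //; [exact: ltW|move=> mS aS].
  set S := [set z | _] in mS aS.
  have pS : per S.
    apply: perI; first exact: per_near1.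
    by have := @per_iterF R lam i _ (per_near2 t).
  have mP : measurable (iter i.+1 G @^-1` S).
    exact: (measurable_pre (measurable_iter i.+1 (measurable_Fi lam))).
  apply: (@le_trans _ _ (ar (iter i.+1 G @^-1` S))).
    apply: ar_le => // z [cz Nz]; split.
      by apply: cutU_near => //; exact: ltW.
    by have -> : (iter i F (iter i.+1 G z)).2 = z.1 := congr1 fst (iter_FiK lam i.+1 z).
  rewrite ar_iterG//; apply: (le_trans aS).
  by rewrite ler_wpM2l// expr2 ler_pM2r.
- case=> [|i]; first by rewrite /E ar0 !mulr_ge0 ?exprn_ge0// ltW.
  apply: le_trans (ar_cutU i.+1 (ltW t0)).
  apply: ar_le => //; [exact: measurable_cutU|by move=> z []].
- move=> eta eta0; have [k [Hk _]] := dif_small t0 eta0; exists k.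
  by rewrite /W ar_iterG.
Qed.

Lemma eu_es_tr t s z : tr (eu t) (tr (es s) z) = tr (es s) (tr (eu t) z).
Proof. by rewrite /tr /=; congr pair; rewrite addrAC. Qed.

(* A point just left of the wall [x in Z] is joined to the point just right of
   it by going around the wall along the stable direction. *)
Lemma wall_eu (e : R) : 0 < e -> exists2 d, 0 < d & forall t, 0 < t <= d ->
  ar (dif U (eu t) `&` cutU 0 t) <= e * t.
Proof.
move=> e0; have e30 : 0 < e / 3 by rewrite divr_gt0.
have [d1 d10 H1] := near_es e30; have [d2 d20 H2] := near_eu e30.
exists (Num.min (Num.min d1 d2) (1 / 4)); first by rewrite !lt_min d10 d20 /= divr_gt0.
move=> t /andP[t0]; rewrite !le_min => /andP[/andP[td1 td2] t4].
have := H1 t; rewrite t0 td1 => /(_ isT); set S := _ `&` _ => aS.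
have := H2 t; rewrite t0 td2 => /(_ isT); set V := _ `&` _ => aV.
have mS : measurable S by exact: measurableI.
have mV : measurable V.
  by apply: measurableI => //; apply: measurableD => //; exact: measurable_cutU.
have pcut : per (cutU 0 t).
  move=> z; rewrite /cutU /= expr0 mul1r; split => //.
  by rewrite addrAC !(flDz _ 2) /=; split => H E; apply: H; [rewrite E|apply: (addIr 2)].
have pS : per S by apply: perI => //; exact: per_near1.
have pV : per V by apply: perI; [apply: perI => //; exact: perC|exact: per_near1].
have mS' := measurable_pre (measurable_tr (eu t)) mS.
have mV' := measurable_pre (measurable_tr (es t)) mV.
apply: (@le_trans _ _ (ar ((S `|` tr (eu t) @^-1` S) `|` tr (es t) @^-1` V))).
  apply: ar_le; first by apply: measurableI => //; exact: measurable_cutU.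
    by apply: measurableU => //; exact: measurableU.
  move=> z [Dz]; rewrite /cutU /= expr0 mul1r => cz.
  have fI := fl_itv z.1.
  have cz' : fl z.1 + 1 - t <= z.1.
    rewrite leNgt; apply/negP => h; apply: cz.
    by rewrite {1}/fl; apply: fl_eq; rewrite -/(fl z.1); flra.
  have E1 : fl (z.1 + t) = fl z.1 + 1.
    by apply: fl_eqS; flra.
  have E2 : fl (z.1 + t + t) = fl z.1 + 1.
    by apply: fl_eqS; flra.
  apply: contrapT => H; apply: (proj1 (difP U (eu t) z) _ Dz).
  have N1 : nearZ t z.1 by right; flra.
  have N2 : nearZ t (z.1 + t) by left; rewrite E1; flra.
  have U1 : U z <-> U (tr (es t) z).
    by apply/difP => D1; apply: H; left; left.
  have U2 : U (tr (eu t) z) <-> U (tr (es t) (tr (eu t) z)).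
    by apply/difP => D1; apply: H; left; right.
  have U3 : U (tr (es t) z) <-> U (tr (eu t) (tr (es t) z)).
    apply/difP => D1; apply: H; right; split => //; split => //.
    by rewrite /cutU /= expr0 mul1r E2 E1.
  by rewrite U1 U3 eu_es_tr -U2.
apply: (le_trans (arU_le _ mV')); first exact: measurableU.
have := arU_le mS mS'; rewrite !ar_tr//; flra.
Qed.

(** At the first cut [i] the backward iterate is in the situation of [wall_eu] at scale
    [mu ^+ i * t]. These contributions add up to at most e t / 2, and so much is left for the points
    that are not cut before time [k]. *)
Lemma ar_dif_eu_small (e : R) : 0 < e -> exists2 d, 0 < d & forall t, 0 < t <= d ->
  ar (dif U (eu t)) <= e * t.
Proof.
move=> e0; have m1 : 0 < 1 - mu by rewrite subr_gt0.
have e1 : 0 < e * (1 - mu) / 2 by rewrite divr_gt0// mulr_gt0.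
have [d d0 H] := wall_eu e1; exists d => // t /andP[t0 td].
have et : 0 < e * t / 2 by rewrite divr_gt0// mulr_gt0.
have [k [Hk _]] := dif_small t0 et.
pose E i := iter i G @^-1` (dif U (eu (mu ^+ i * t)) `&` cutU 0 (mu ^+ i * t)).
have mE0 s : measurable (dif U (eu s) `&` cutU 0 s).
  by apply: measurableI => //; exact: measurable_cutU.
have pcut s : per (cutU 0 s).
  move=> z; rewrite /cutU /= expr0 mul1r; split => //.
  by rewrite addrAC !(flDz _ 2) /=; split => h E0; apply: h; [rewrite E0|apply: (addIr 2)].
have mG i := measurable_iter i (measurable_Fi lam).
have mE i : measurable (E i) by exact: (measurable_pre (mG i)).
pose W := iter k G @^-1` (dif U (eu (mu ^+ k * t))).
have mW : measurable W by exact: (measurable_pre (mG k)).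
pose a i := e * (1 - mu) / 2 * (mu ^+ i * t).
have Ea i : ar (E i) <= a i.
  rewrite /E ar_iterG//; last exact: perI.
  by apply: H; rewrite mulr_gt0 ?exprn_gt0//= (le_trans _ td)// ler_piMl ?(ltW t0)// exprn_ile1// ltW.
have cov z : dif U (eu t) z -> (exists2 i, (i < k)%N & E i z) \/ W z.
  move=> Dz; case: (pselect (exists i, (i < k)%N && `[< cutU i t z >])) => [ex|nex].
    left; have [i /andP[ik /asboolP ci] mini] := ex_minnP ex; exists i => //.
    split; last by move: ci; rewrite /cutU /= expr0 mul1r.
    apply: dif_iterG => // j ji cj.
    by have := mini j; rewrite (ltn_trans ji ik) (asboolT cj) leqNgt ji => /(_ isT).
  right; apply: dif_iterG => // i ik ci; apply: nex; exists i.
  by rewrite ik; exact/asboolP.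
apply: (le_trans (ar_cover (mdif _) mE mW cov Ea)).
rewrite /W ar_iterG//.
have -> : \sum_(0 <= i < k) a i =
    e * (1 - mu) / 2 * t * \sum_(0 <= i < k) (if (i < 0)%N then 0 else mu ^+ i).
  by rewrite mulr_sumr; apply: eq_bigr => i _; rewrite /a /=; ring.
have h2 := geo_tail_le 0 k; rewrite expr0 in h2.
set s2 := \sum_(0 <= i < k) _ in h2 *.
have : e * (1 - mu) / 2 * t * s2 <= e * (1 - mu) / 2 * t * (1 / (1 - mu)).
  by rewrite ler_wpM2l// ltW// mulr_gt0.
have -> : e * (1 - mu) / 2 * t * (1 / (1 - mu)) = e * t / 2.
  by move: m1; set m := 1 - mu => m1; field; rewrite gt_eqF.
by move: Hk; flra.
Qed.

Lemma dif_trD h h' : dif U (tr h' h) `<=` dif U h `|` tr h @^-1` dif U h'.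
Proof.
move=> z; apply: contraPP => /not_orP[n1 n2]; apply/difP.
move/difP : n1 => ->; move/difP : n2 => ->.
by rewrite /tr /= !addrA.
Qed.

Lemma ar_dif_trD h h' : ar (dif U (tr h' h)) <= ar (dif U h) + ar (dif U h').
Proof.
have mT := measurable_pre (measurable_tr h) (mdif h').
apply: (le_trans (ar_le _ _ (@dif_trD h h'))) => //; first exact: measurableU.
by apply: (le_trans (arU_le _ _)) => //; rewrite ar_tr.
Qed.

Lemma ar_dif_opp h : ar (dif U (- h.1, - h.2)) = ar (dif U h).
Proof.
have mT := measurable_pre (measurable_tr h) (mdif (- h.1, - h.2)).
rewrite -(ar_tr h)//; congr (ar _); apply/seteqP; split => z /=.
  move=> H; apply: contrapT => /(proj2 (difP U h z)) H'.
  apply: (proj1 (difP U _ (tr h z)) _ H).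
  by rewrite {2}/tr /= !addrK -surjective_pairing H'.
move=> H; apply: contrapT => /(proj2 (difP U _ (tr h z))) H'.
apply: (proj1 (difP U h z) _ H).
by rewrite H' {1}/tr /= !addrK -surjective_pairing.
Qed.

(** A quantity that is subadditive in the shift and o(t) at 0 vanishes: split the shift into many
    equal pieces. *)
Lemma ar_dif_eu0 (T : R) : ar (dif U (eu T)) = 0.
Proof.
have pos t : 0 < t -> ar (dif U (eu t)) = 0.
  move=> t0; apply/eqP; rewrite eq_le ar_ge0 andbT; apply/ler_addgt0Pr => e e0.
  rewrite add0r; have [d d0 H] := ar_dif_eu_small (divr_gt0 e0 t0).
  have sub n s : ar (dif U (eu (n.+1%:R * s))) <= n.+1%:R * ar (dif U (eu s)).
    elim: n => [|n IH]; first by rewrite !mul1r.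
    have -> : eu (n.+2%:R * s) = tr (eu s) (eu (n.+1%:R * s)).
      by rewrite /tr /eu /= -[n.+2%:R]natr1; congr pair; ring.
    apply: (le_trans (ar_dif_trD _ _)).
    by rewrite -[n.+2%:R]natr1 mulrDl mul1r lerD2r.
  pose n := Num.trunc (t / d).
  have tn : t / n.+1%:R <= d.
    by rewrite ler_pdivrMr// mulrC -ler_pdivrMr// ltW// truncnS_gt.
  have t1 : 0 < t / n.+1%:R by rewrite divr_gt0.
  have -> : t = n.+1%:R * (t / n.+1%:R) by rewrite mulrC divfK// pnatr_eq0.
  apply: (le_trans (sub _ _)).
  apply: (@le_trans _ _ (n.+1%:R * (e / t * (t / n.+1%:R)))).
    by rewrite ler_pM2l//; apply: H; rewrite t1.
  have N0 : 0 < n.+1%:R :> R by [].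
  set N : R := n.+1%:R in N0 *.
  by rewrite le_eqVlt; apply/orP; left; apply/eqP; field; rewrite !gt_eqF.
have [T0|T0|->] := ltgtP T 0.
- by rewrite -ar_dif_opp /= -mulNr; apply: pos; rewrite oppr_gt0.
- exact: pos.
rewrite (_ : dif _ _ = set0) ?ar0//; apply/seteqP; split => // z; apply/difP.
by rewrite /tr /= mul0r !addr0 -surjective_pairing.
Qed.

End DirectionalInvariance.

(** * The stable direction, and invariance under all translations *)

Section StableDirection.
Context {R : realType}.
Local Notation T1 := (measurableTypeR R).
Local Notation T2 := (T1 * T1)%type.
Implicit Types (A B : set T2) (z h : R * R).
Context (lam : R) (lam1 : 1 < lam).
Local Notation mu := (lam^-1).
Local Notation F := (Fm lam).
Context (U : set T2) (mU : measurable U) (pU : per U)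
  (invU : forall z, U (F z) <-> U z).

Lemma ar_swap A : measurable A -> ar [set z : T2 | A (z.2, z.1)] = ar A.
Proof.
move=> mA; have mS : measurable [set z : T2 | A (z.2, z.1)].
  apply: (@measurable_pre _ (fun z => (z.2, z.1))) => //.
  by apply/measurable_fun_pairP; split; [exact: measurable_snd|exact: measurable_fst].
rewrite !arE; congr fine; by rewrite areaE2// areaE; apply: eq_integral.
Qed.

(** Exchanging the two coordinates is a time-reversing symmetry of [F]: it preserves the class of
    invariant sets and turns the stable direction into the unstable one. *)
Lemma ar_dif_es0 (T : R) : ar (dif U (es lam T)) = 0.
Proof.
pose V : set T2 := [set z | U (z.2, z.1)].
have mV : measurable V.
  apply: (@measurable_pre _ (fun z => (z.2, z.1))) => //.
  by apply/measurable_fun_pairP; split; [exact: measurable_snd|exact: measurable_fst].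
have pV : per V by move=> z; have [p1 p2] := pU (z.2, z.1).
have invV z : V (F z) <-> V z.
  by rewrite /V /= -(invU (_, _)) /Fm /=; rewrite opprB addrC subrK.
have := ar_dif_eu0 lam1 mV pV invV (mu * T).
rewrite -ar_swap//; last exact: measurable_dif.
rewrite (_ : [set z : T2 | _] = dif U (es lam T))//.
have E1 : mu * T * lam = T by rewrite mulrAC mulVf ?mul1r// lam_neq0.
by apply/seteqP; split => -[x y]; rewrite /dif /V /tr /eu /es /= E1 (mulrC mu).
Qed.

(** Every shift is the sum of one along [eu] and one along [es]. This is the form in which
    ergodicity is used below. *)
Theorem invariant_translation h : ar (dif U h) = 0.
Proof.
have l0 := lam_neq0 lam1.
have l2 : lam * lam - 1 != 0 by rewrite gt_eqF// subr_gt0; have := lam1; nra.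
have d0 : lam - mu != 0.
  by rewrite subr_eq0 gt_eqF// (lt_trans (mu_lt1 lam1)).
pose a := (h.2 - mu * h.1) / (lam - mu); pose b := (lam * h.1 - h.2) / (lam - mu).
have -> : h = tr (eu lam a) (es lam b).
  rewrite [LHS]surjective_pairing /tr /eu /es /a /b /=; congr pair; field; by rewrite l0 l2.
apply/eqP; rewrite eq_le ar_ge0 andbT.
by apply: (le_trans (ar_dif_trD mU pU _ _)); rewrite ar_dif_es0 ar_dif_eu0// addr0.
Qed.

End StableDirection.


(** * Transitivity and recurrence *)

Section Transitivity.
Context {R : realType}.
Local Notation T1 := (measurableTypeR R).
Local Notation T2 := (T1 * T1)%type.
Implicit Types (A B : set T2) (z h : R * R).
Context (lam : R) (lam1 : 1 < lam).
Local Notation F := (Fm lam).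
Local Notation G := (Fi lam).

Lemma measurable_iterF n A : measurable A -> measurable (iter n F @^-1` A).
Proof. by move=> mA; apply: (measurable_pre (measurable_iter n (measurable_Fm lam))). Qed.

Lemma measurable_iterG n A : measurable A -> measurable (iter n G @^-1` A).
Proof. by move=> mA; apply: (measurable_pre (measurable_iter n (measurable_Fi lam))). Qed.

(** [U] consists of the points that visit [B] infinitely often. It is invariant, contains almost all
    of [B] because [F] preserves the area, and is invariant under the shift [h] up to a null set; so
    it contains almost every point of [A] that the shift sends into [B]. The shift serves to compare
    boxes with different centres. *)
Theorem sawtooth_transitive A B h (n0 : nat) : measurable A -> measurable B ->
  per A -> per B -> 0 < ar (A `&` (tr h @^-1` B)) ->
  exists2 z, A z & exists2 n, (n0 <= n)%N & B (iter n F z).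
Proof.
move=> mA mB pA pB AB.
pose V (m : nat) : set T2 := \bigcup_n iter (n + m) F @^-1` B.
pose U : set T2 := \bigcap_m V m.
have mV m : measurable (V m) by apply: bigcup_measurable => n _; exact: measurable_iterF.
have pV m : per (V m) by apply: per_bigcup => n; exact: per_iterF.
have mU : measurable U by exact: bigcap_measurable.
have pU : per U by exact: per_bigcap.
have VS m z : V m (F z) <-> V m.+1 z.
  split => -[n _ Bn]; exists n => //; first by rewrite /= addnS iterSr.
  by move: Bn; rewrite /= addnS iterSr.
have VV m z : V m.+1 z -> V m z.
  by move=> [n _ Bn]; exists n.+1 => //; rewrite addSnnS.
have invU z : U (F z) <-> U z.
  split => H m _; first by apply: VV; apply/VS; exact: H.
  by apply/VS; exact: H.
(* [V m.+1] is the preimage of [V m] and is contained in it; both have the same finite area. *)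
have VD m : ar (V m `\` V m.+1) = 0.
  have E : V m.+1 = F @^-1` V m by apply/seteqP; split => z /VS.
  have : ar (V m) = ar (V m.+1) + ar (V m `\` V m.+1).
    rewrite -(arUD (mV m.+1) (mV m)); congr (ar _); apply/seteqP; split => z; first by right.
    by case=> // /VV.
  have -> : ar (V m.+1) = ar (V m) by rewrite E (ar_Fm lam (mV m) (pV m)).
  by flra.
have BU : ar (B `\` U) = 0.
  apply/eqP; rewrite eq_le ar_ge0 andbT.
  have : B `\` U `<=` \bigcup_m (V m `\` V m.+1).
    move=> z [Bz nU]; apply: contrapT => H; apply: nU => m _.
    elim: m => [|m IH]; first by exists 0%N.
    by apply: contrapT => nV; apply: H; exists m.
  move/(ar_le (measurableD mB mU)) => H; apply: (le_trans (H _)).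
    by apply: bigcup_measurable => m _; exact: measurableD.
  apply: (@ar_bigcup _ _ (fun=> 0)) => [m|m|m]; first exact: measurableD.
    by rewrite VD.
  by rewrite big1.
have mT C : measurable C -> measurable (tr h @^-1` C).
  exact: (measurable_pre (measurable_tr h)).
have AU : 0 < ar (A `&` U).
  rewrite ltNge; apply/negP => AU0; move: AB; rewrite ltNge => /negP; apply.
  have Uh := invariant_translation lam1 mU pU invU h.
  apply: (@le_trans _ _ (ar ((A `&` U) `|` (tr h @^-1` (B `\` U) `|` dif U h)))).
    apply: ar_le; first by apply: measurableI => //; exact: mT.
      apply: measurableU; first exact: measurableI.
      apply: measurableU; [by apply: mT; exact: measurableD|exact: measurable_dif].
    move=> z [Az Bz]; case: (pselect (U z)) => Uz; first by left.
    case: (pselect (U (tr h z))) => Uhz; last by right; left.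
    by right; right; right.
  have m1 : measurable (A `&` U) by exact: measurableI.
  have m2 : measurable (tr h @^-1` (B `\` U)) by apply: mT; exact: measurableD.
  have m3 : measurable (dif U h) by exact: measurable_dif.
  have p2 : per (B `\` U) by apply: perI => //; exact: perC.
  apply: (le_trans (arU_le m1 (measurableU _ _ m2 m3))); rewrite -[leRHS]addr0 lerD//.
  apply: (le_trans (arU_le m2 m3)); rewrite Uh addr0 ar_tr ?BU//; exact: measurableD.
have [z [Az Uz]] : (A `&` U) !=set0.
  by apply/set0P/negP => /eqP E; move: AU; rewrite E ar0 ltxx.
exists z => //; have [n _ Bn] := Uz n0 I.
by exists (n + n0)%N => //; rewrite leq_addl.
Qed.

Lemma cover_step (a b c d x y w u : R) : a <= b + c -> c <= x -> 0 <= u -> 0 <= x ->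
  w <= d + y -> w + a <= d + b + (y + 2 * x + u).
Proof. by lra. Qed.

(* Pigeonhole form of Poincare recurrence, uniform in the step [n0]. *)
Theorem sawtooth_recurrent A : measurable A -> per A -> 0 < ar A ->
  exists2 c : R, 0 < c & forall n0, exists2 n, (n0 <= n)%N &
    c <= ar (A `&` iter n F @^-1` A).
Proof.
move=> mA pA A0.
(* The total area is 4, and pairwise overlaps of at most 1/J^2 cost at most 1 altogether; [J * ar A]
   exceeds 4 + 1. *)
pose J := (Num.trunc (5 / ar A)).+1.
have J5 : 5 < J%:R * ar A by rewrite -ltr_pdivrMr// truncnS_gt.
exists ((J ^ 2)%:R^-1); first by rewrite invr_gt0 ltr0n expn_gt0.
move=> n0; apply: contrapT => /forallPNP H.
(* The times are multiples of [n0.+1], so two different ones are at least [n0] apart. *)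
pose C (j : nat) : set T2 := iter (j * n0.+1) F @^-1` A.
have mC j : measurable (C j) by exact: measurable_iterF.
have aC j : ar (C j) = ar A by rewrite ar_iterF.
have small i j : (i < j)%N -> ar (C i `&` C j) <= (J ^ 2)%:R^-1.
  move=> ij; have -> : C i `&` C j = iter (i * n0.+1) F @^-1` (A `&` iter ((j - i) * n0.+1) F @^-1` A).
    rewrite /C; apply/seteqP; split => z /=; rewrite -iterD -mulnDl subnK//; exact: ltnW.
  rewrite ar_iterF; last 2 first.
  - by apply: measurableI => //; exact: measurable_iterF.
  - by apply: perI => //; exact: per_iterF.
  rewrite leNgt; apply/negP => h; apply: (H ((j - i) * n0.+1)%N); last exact: ltW.
  by rewrite (leq_trans (leqnSn n0))// leq_pmull// subn_gt0.
have sum k : (k <= J)%N -> k%:R * ar A <= ar (\big[setU/set0]_(i < k) C i) + (k ^ 2)%:R / (J ^ 2)%:R.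
  elim: k => [|k IH] kJ; first by rewrite mul0r addr_ge0 ?ar_ge0// divr_ge0.
  have mUk : measurable (\big[setU/set0]_(i < k) C i) by exact: bigsetU_measurable.
  rewrite big_ord_recr /=.
  rewrite (arUD mUk (mC k)).
  have h1 := arD (mC k) mUk; rewrite aC in h1.
  have h2 : ar (C k `&` \big[setU/set0]_(i < k) C i) <= k%:R / (J ^ 2)%:R.
    have mI i : measurable (C i `&` C k) by exact: measurableI.
    have mI2 : measurable (C k `&` \big[setU/set0]_(i < k) C i) by exact: measurableI.
    have := @ar_cover R _ (fun i => C i `&` C k) set0 k (fun i => ar (C i `&` C k)) mI2 mI measurable0.
    rewrite ar0 addr0 => /(_ _ (fun=> lexx _)) /le_trans; apply.
      move=> z [Ck]; rewrite -bigcup_mkord => -[i /= ik Ci]; left; by exists i.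
    rewrite big_mkord; apply: (@le_trans _ _ (\sum_(i < k) (J ^ 2)%:R^-1)).
      by apply: ler_sum => i _; exact: small.
    by rewrite sumr_const card_ord -[_ *+ k]mulr_natl.
  have := IH (ltnW kJ).
  have -> : (k.+1 ^ 2)%:R / (J ^ 2)%:R = (k ^ 2)%:R / (J ^ 2)%:R + 2 * (k%:R / (J ^ 2)%:R) + 1 / (J ^ 2)%:R :> R.
    by rewrite !natrX -natr1; field; rewrite pnatr_eq0.
  have : 0 <= k%:R / (J ^ 2)%:R :> R by rewrite divr_ge0.
  have : 0 <= 1 / (J ^ 2)%:R :> R by rewrite divr_ge0.
  rewrite -[k.+1%:R]natr1 mulrDl [1 * ar A]mul1r => p1 p2 p3; exact: (cover_step h1 h2 p1 p2 p3).
have := sum J (leqnn J); rewrite divff ?pnatr_eq0 ?expn_eq0// => h.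
have mUJ : measurable (\big[setU/set0]_(i < J) C i) by exact: bigsetU_measurable.
by have := ar_le mUJ measurableT (@subsetT _ _); rewrite arT; flra.
Qed.

End Transitivity.

(** * Loops of the limit map *)

Section GoodPoints.
Context {R : realType}.
Local Notation T1 := (measurableTypeR R).
Local Notation T2 := (T1 * T1)%type.
Implicit Types (A B : set T2) (z h c : R * R) (g : int * int).
Definition far (d x : R) : Prop := d <= x - fl x /\ d <= fl x + 1 - x.

(** The floor absorbs integers, so [F (z + g) = F z + latF g] for integer vectors although [F] is
    not linear; [latG] plays the same role for the inverse. [latJ g] is the shift of the energy y -
    x. *)
Definition lat g : R * R := (g.1%:~R, g.2%:~R).
Definition latF g : int * int := (g.2, 2 * g.2 - g.1).
Definition latG g : int * int := (2 * g.1 - g.2, g.1).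
Definition latJ g : int := g.2 - g.1.
Definition latD g g' : int * int := (g.1 + g'.1, g.2 + g'.2).

Lemma tr_latD g g' z : tr (lat (latD g g')) z = tr (lat g') (tr (lat g) z).
Proof. by rewrite /tr /lat /latD /= !intrD !addrA. Qed.

Lemma latJF p g : latJ (iter p latF g) = latJ g.
Proof. by elim: p => // p IH; rewrite -[RHS]IH /latJ /latF /=; lia. Qed.

Lemma latJD g g' : latJ (latD g g') = latJ g + latJ g'.
Proof. by rewrite /latJ /latD /=; lia. Qed.

Lemma far_lat d x (m : int) : far d (x + m%:~R) <-> far d x.
Proof. by rewrite /far flDz; split => -[? ?]; split; flra. Qed.

Lemma fl_opp d x : 0 < d -> far d x -> fl (- x) = - fl x - 1.
Proof.
move=> d0 [h1 h2]; have := @fl_eq R (- x) (- Num.floor x - 1).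
by rewrite intrD rmorphN -/(fl x) /=; apply; flra.
Qed.

Lemma far_opp d x : 0 < d -> far d x -> far d (- x).
Proof. by move=> d0 fx; rewrite /far (fl_opp d0 fx); case: fx; split; flra. Qed.

(** [F] commutes with this symmetry except where a floor is taken at an integer; good points avoid
    that. *)
Definition opp z : R * R := (- z.1, - z.2).

Lemma oppK z : opp (opp z) = z.
Proof. by rewrite /opp /= !opprK -surjective_pairing. Qed.

Lemma measurable_far d : measurable (far d : set T1).
Proof.
have -> : (far d : set T1) = ((fun x => x - fl x) @^-1` `[d, +oo[) `&`
    ((fun x => fl x + 1 - x) @^-1` `[d, +oo[).
  by apply/seteqP; split => x /=; rewrite /far /= !in_itv/= !andbT.
have m1 : measurable_fun setT ((fun x => x - fl x) : T1 -> T1).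
  by apply: measurable_funB => //; exact: measurable_fl.
have m2 : measurable_fun setT ((fun x => fl x + 1 - x) : T1 -> T1).
  apply: measurable_funB => //; apply: measurable_funD => //; exact: measurable_fl.
by apply: measurableI; rewrite -[_ @^-1` _]setTI; [apply: m1|apply: m2] => //; exact: measurable_itv.
Qed.

Lemma not_far d x : ~ far d x -> nearZ d x.
Proof.
move=> /not_andP[] /negP; rewrite -ltNge => /ltW; by [left|right].
Qed.

Definition near (w : R) c z : Prop := `|z.1 - c.1| <= w /\ `|z.2 - c.2| <= w.

(** The interval of radius [w] around [a] modulo 2, in a form whose measurability and periodicity
    are visible; [sq1P] gives the meaning. *)
Definition sq1 (w a : R) : set T1 := [set x | mod2 (x - a + w) <= 2 * w].
Definition sq (w : R) c : set T2 := [set z | sq1 w c.1 z.1 /\ sq1 w c.2 z.2].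

Lemma sq1P w a x : 0 <= w < 1 -> sq1 w a x <-> exists i : int, `|x - a - 2 * i%:~R| <= w.
Proof.
move=> w01; rewrite /sq1 /=; split.
  have := mod2_itv (x - a + w); rewrite /mod2 => h1 h2.
  by exists (Num.floor ((x - a + w) / 2)); rewrite ler_norml -/(fl _); flra.
case=> i; rewrite ler_norml => h.
rewrite /mod2 (_ : fl _ = i%:~R); first by flra.
by apply: fl_eq; flra.
Qed.

Lemma measurable_sq1 w a : measurable (sq1 w a).
Proof.
have -> : sq1 w a = (fun x => mod2 (x - a + w)) @^-1` `]-oo, 2 * w].
  by apply/seteqP; split => x /=; rewrite /sq1 /= in_itv.
rewrite -[_ @^-1` _]setTI.
have m1 : measurable_fun setT ((fun x => mod2 (x - a + w)) : T1 -> T1).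
  apply: (measurableT_comp measurable_mod2); apply: measurable_funD => //.
  exact: measurable_funB.
by apply: m1 => //; exact: measurable_itv.
Qed.

Lemma measurable_sq w c : measurable (sq w c).
Proof.
apply: measurableI; first exact: (measurable_fst_set (measurable_sq1 _ _)).
exact: (measurable_snd_set (measurable_sq1 _ _)).
Qed.

Lemma per_sq w c : per (sq w c).
Proof.
have H a x : sq1 w a (x + 2) <-> sq1 w a x.
  rewrite /sq1 /= (_ : x + 2 - a + w = x - a + w + 2); first by rewrite mod2_per.
  by ring.
by move=> z; rewrite /sq /= !H.
Qed.

Lemma mu1_sq1 w a : 0 <= w < 1 -> fine (@mu1 R (sq1 w a)) <= 2 * w.
Proof.
move=> w01; pose B : set T1 := [set x | mod2 x <= 2 * w].
have mB : measurable B.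
  have -> : B = mod2 @^-1` `]-oo, 2 * w].
    by apply/seteqP; split => x /=; rewrite in_itv.
  by rewrite -[_ @^-1` _]setTI; apply: measurable_mod2 => //; exact: measurable_itv.
have pB : per2 B by move=> x; rewrite /B /= mod2_per.
have -> : @mu1 R (sq1 w a) = mu1 B.
  rewrite -(mu1_shift (w - a) mB pB); congr (mu1 _).
  by apply/seteqP; split => x; rewrite /sq1 /B /= addrAC addrA.
apply: (@le_trans _ _ (fine (@mu1 R (`[0, 2 * w]%classic : set T1)))).
  rewrite -lee_fin !fineK ?fin_num_measure// /mu1 /mrestr.
  apply: le_measure; rewrite ?inE; try (by apply: measurableI => //; exact: measurable_itv).
  move=> x [Bx] /=; rewrite !in_itv/= => xI; split => //.
  by move: Bx; rewrite /B /= mod2_id//; flra.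
by apply: le_trans (mu1_itv_le _) _; flra.
Qed.

Lemma ar_sq w c : 0 <= w < 1 -> ar (sq w c) <= (2 * w) ^+ 2.
Proof.
move=> w01; have m1 := measurable_sq1 w c.1; have m2 := measurable_sq1 w c.2.
have -> : sq w c = sq1 w c.1 `*` sq1 w c.2 by [].
rewrite arE (_ : area _ = (@mu1 R (sq1 w c.1) * @mu1 R (sq1 w c.2))%E); last first.
  exact: product_measure1E.
rewrite fineM ?fin_num_measure// expr2; apply: ler_pM; rewrite ?fine_ge0//; exact: mu1_sq1.
Qed.

Lemma ar_opp A : measurable A -> per A -> ar [set z : T2 | A (opp z)] = ar A.
Proof.
move=> mA pA.
have mneg : measurable_fun setT ((fun x => - x) : T1 -> T1) by exact: measurable_funN.
have mo1 : measurable_fun setT ((fun z => (z.1, - z.2)) : T2 -> T2).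
  apply/measurable_fun_pairP; split; first exact: measurable_fst.
  exact: (measurableT_comp mneg measurable_snd).
have mo2 : measurable_fun setT ((fun z => (- z.1, z.2)) : T2 -> T2).
  apply/measurable_fun_pairP; split; last exact: measurable_snd.
  exact: (measurableT_comp mneg measurable_fst).
pose B : set T2 := [set z | A (- z.1, z.2)].
have mB : measurable B by rewrite /B -[X in measurable X]setTI; apply: mo2.
have pB : per B.
  move=> z; rewrite /B /=; have [_ ->] := pA (- z.1, z.2); split => //.
  by have [<- _] := pA (- (z.1 + 2), z.2); rewrite /= opprD subrK.
have mC : measurable ([set z : T2 | B (z.1, - z.2)]).
  by rewrite -[X in measurable X]setTI; apply: mo1.
transitivity (ar [set z : T2 | B (z.1, - z.2)]); first by [].
transitivity (ar B).
  rewrite !arE; congr fine; rewrite !areaE//; apply: eq_integral => y _.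
  have pS : per2 (xsection B y).
    by move=> x; rewrite /xsection /= !inE; have [_] := pB (y, x).
  rewrite -[RHS](mu1_refl 0 (measurable_xsection _ mB) pS).
  by congr (mu1 _); apply/seteqP; split => x; rewrite /xsection /= !inE /= sub0r.
rewrite !arE; congr fine; rewrite !areaE2//; apply: eq_integral => y _.
have pS : per2 (ysection A y).
  by move=> x; rewrite /ysection /= !inE; have [] := pA (x, y).
rewrite -[RHS](mu1_refl 0 (measurable_ysection _ mA) pS).
by congr (mu1 _); apply/seteqP; split => x; rewrite /ysection /= !inE /= sub0r.
Qed.

Context (lam : R) (lam1 : 1 < lam).
Local Notation mu := (lam^-1).
Local Notation F := (Fm lam).
Local Notation G := (Fi lam).

Let mu0 : 0 < mu. Proof. exact: mu_gt0. Qed.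
Let mu1' : mu < 1. Proof. exact: mu_lt1. Qed.

(** The distance to the walls may shrink like [mu ^+ p]. This rate makes the excluded areas
    summable, and it is the one that shadowing needs, since deviations in a tube shrink at the same
    rate away from its two ends. *)
Definition good (r : R) z : Prop := forall p : nat,
  far (r * mu ^+ p) (iter p F z).2 /\ far (r * mu ^+ p) (iter p G z).1.

Lemma iterF_lat p g z : iter p F (tr (lat g) z) = tr (lat (iter p latF g)) (iter p F z).
Proof. by elim: p => // p IH; rewrite iterS IH /tr Fm_lattice. Qed.

Lemma iterG_lat p g z : iter p G (tr (lat g) z) = tr (lat (iter p latG g)) (iter p G z).
Proof. by elim: p => // p IH; rewrite iterS IH /tr Fi_lattice. Qed.

Lemma good_lat r g z : good r (tr (lat g) z) <-> good r z.
Proof.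
by split => H p; have := H p; rewrite iterF_lat iterG_lat /tr /lat /= !far_lat.
Qed.

Lemma iterF_opp r z p : 0 < r -> good r z -> iter p F (opp z) = opp (iter p F z).
Proof.
move=> r0 gz; elim: p => // p IH; rewrite iterS IH iterS {1}/Fm /opp /=.
have d0 : 0 < r * mu ^+ p by rewrite mulr_gt0// exprn_gt0.
by have [/(fl_opp d0) -> _] := gz p; congr pair; field; exact: (lam_neq0 lam1).
Qed.

Lemma iterG_opp r z p : 0 < r -> good r z -> iter p G (opp z) = opp (iter p G z).
Proof.
move=> r0 gz; elim: p => // p IH; rewrite iterS IH iterS {1}/Fi /opp /=.
have d0 : 0 < r * mu ^+ p by rewrite mulr_gt0// exprn_gt0.
by have [_ /(fl_opp d0) ->] := gz p; congr pair; field; exact: (lam_neq0 lam1).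
Qed.

Lemma good_opp r z : 0 < r -> good r z -> good r (opp z).
Proof.
move=> r0 gz p; have d0 : 0 < r * mu ^+ p by rewrite mulr_gt0// exprn_gt0.
rewrite (iterF_opp _ r0 gz) (iterG_opp _ r0 gz) /opp /=.
by have [? ?] := gz p; split; exact: far_opp.
Qed.

Lemma measurable_good r : measurable (good r : set T2).
Proof.
have -> : (good r : set T2) = \bigcap_p
    ((iter p F @^-1` [set z | far (r * mu ^+ p) z.2]) `&`
     (iter p G @^-1` [set z | far (r * mu ^+ p) z.1])).
  by apply/seteqP; split => z H p; [move=> _|]; have := H p; [|move/(_ I)].
apply: bigcap_measurable => // p _; apply: measurableI.
  by apply: measurable_iterF; exact: (measurable_snd_set (measurable_far _)).
by apply: measurable_iterG; exact: (measurable_fst_set (measurable_far _)).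
Qed.

Lemma per_good r : per (good r : set T2).
Proof.
move=> z; split.
  by have := good_lat r (2, 0) z; rewrite /tr /lat /= addr0.
by have := good_lat r (0, 2) z; rewrite /tr /lat /= addr0.
Qed.

Lemma ar_good r : 0 <= r -> ar (~` (good r : set T2)) <= 16 * r / (1 - mu).
Proof.
move=> r0; have m1 : 0 < 1 - mu by rewrite subr_gt0.
pose E p : set T2 := (iter p F @^-1` [set z | nearZ (r * mu ^+ p) z.2]) `|`
     (iter p G @^-1` [set z | nearZ (r * mu ^+ p) z.1]).
have mE1 p : measurable (iter p F @^-1` [set z | nearZ (r * mu ^+ p) z.2] : set T2).
  by apply: measurable_iterF; exact: (measurable_snd_set (measurable_nearZ _)).
have mE2 p : measurable (iter p G @^-1` [set z | nearZ (r * mu ^+ p) z.1] : set T2).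
  by apply: measurable_iterG; exact: (measurable_fst_set (measurable_nearZ _)).
have mE p : measurable (E p) by exact: measurableU.
have mg := measurableC (measurable_good r).
apply: (@le_trans _ _ (ar (\bigcup_p E p))).
  apply: ar_le => //; first exact: bigcup_measurable.
  move=> z /existsNP[p /not_andP H]; exists p => //.
  by case: H => /not_far; [left|right].
have pw p : 0 <= r * mu ^+ p by rewrite mulr_ge0// exprn_ge0// ltW.
apply: (@ar_bigcup _ _ (fun p => 16 * (r * mu ^+ p))) => // [p|n].
  apply: (le_trans (arU_le (mE1 p) (mE2 p))).
  rewrite ar_iterF; [|exact: (measurable_snd_set (measurable_nearZ _))|exact: per_near2].
  rewrite ar_iterG; [|exact: (measurable_fst_set (measurable_nearZ _))|exact: per_near1].
  by have := ar_near1 (pw p); have := ar_near2 (pw p); flra.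
have -> : \sum_(0 <= i < n) 16 * (r * mu ^+ i) =
    16 * r * \sum_(0 <= i < n) (if (i < 0)%N then 0 else mu ^+ i).
  by rewrite mulr_sumr; apply: eq_bigr => i _ /=; ring.
have := geo_tail_le lam1 0 n; rewrite expr0 => h.
have -> : 16 * r / (1 - mu) = 16 * r * (1 / (1 - mu)) by rewrite mul1r.
by rewrite ler_wpM2l// mulr_ge0.
Qed.

End GoodPoints.

(** * Many itineraries returning to a box *)

Section Horseshoe.
Context {R : realType}.
Local Notation T1 := (measurableTypeR R).
Local Notation T2 := (T1 * T1)%type.
Implicit Types (A B : set T2) (z h c : R * R) (g : int * int).
Lemma half_half (a b s u d i e W : R) : u <= s -> u = a + d -> e <= d + i -> e = b ->
  s <= (2 * W) ^+ 2 -> 2 * W ^+ 2 < a -> 2 * W ^+ 2 < b -> 0 < i.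
Proof. by rewrite exprMn; set V := W ^+ 2; rewrite expr2; flra. Qed.

Lemma sq1_mid (w a x : R) : 0 <= w < 1 -> 0 <= x < 2 -> sq1 w a (x + (a - 1)) ->
  `|x + (a - 1) - a| <= w.
Proof.
move=> w01; rewrite /sq1 /= (_ : x + (a - 1) - a + w = x - 1 + w); last by ring.
move=> x2; case: (lerP 0 (x - 1 + w)) => x0; last by rewrite -mod2_per mod2_id ?ler_norml; flra.
by rewrite mod2_id ?ler_norml; flra.
Qed.

Lemma sq1_opp (w a x : R) : 0 <= w < 1 -> sq1 w a x -> sq1 w (- a) (- x).
Proof.
move=> w01 /(sq1P _ _ w01)[i h]; apply/(sq1P _ _ w01); exists (- i).
by rewrite intrN (_ : - x - - a - _ = - (x - a - 2 * i%:~R)) ?normrN//; ring.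
Qed.

Lemma sq_near w c z : 0 <= w < 1 -> sq w c z ->
  exists i j : int, near w (tr (lat (2 * i, 2 * j)) c) z.
Proof.
move=> w01 [/(sq1P _ _ w01)[i h1] /(sq1P _ _ w01)[j h2]]; exists i, j.
by rewrite /near /tr /lat /= !intrM !opprD !addrA.
Qed.

Lemma near_tr w c z h : near w c z -> near w (tr h c) (tr h z).
Proof. have E (x y a : R) : x + a - (y + a) = x - y by ring.
by rewrite /near /tr /= !E. Qed.

Lemma tr_lat0 c : tr (lat (0, 0)) c = c.
Proof. by rewrite /tr /lat /= !addr0 -surjective_pairing. Qed.

Context (lam : R) (lam1 : 1 < lam).
Local Notation mu := (lam^-1).
Local Notation F := (Fm lam).

Let mu0 : 0 < mu. Proof. exact: mu_gt0. Qed.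
Let mu1' : mu < 1. Proof. exact: mu_lt1. Qed.

(** The good points fill more than half of the box, whose area is at most [4 * w ^+ 2]; two sets
    with this property in one box must meet. *)
Definition dense r w c := 2 * w ^+ 2 < ar ((good lam r : set T2) `&` sq w c).

Lemma measurable_gsq r w c : measurable ((good lam r : set T2) `&` sq w c).
Proof. by apply: measurableI; [exact: measurable_good|exact: measurable_sq]. Qed.

Lemma per_gsq r w c : per ((good lam r : set T2) `&` sq w c).
Proof. by apply: perI; [exact: per_good|exact: per_sq]. Qed.

Lemma dense_opp r w c : 0 < r -> 0 <= w < 1 -> dense r w c -> dense r w (opp c).
Proof.
move=> r0 w01; rewrite /dense -(ar_opp (measurable_gsq r w c) (per_gsq r w c)).
rewrite (_ : [set z | _] = (good lam r : set T2) `&` sq w (opp c))//.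
apply/seteqP; split => z [gz [h1 h2]]; split.
- by rewrite -(oppK z); exact: good_opp.
- by split; [have := sq1_opp w01 h1|have := sq1_opp w01 h2]; rewrite opprK.
- exact: good_opp.
- by split; [have := sq1_opp w01 h1|have := sq1_opp w01 h2]; rewrite /= opprK.
Qed.

Lemma dense_lat r w c g : dense r w c -> dense r w (tr (lat g) c).
Proof.
pose m := lat (- g.1, - g.2) : R * R.
rewrite /dense -(ar_tr m (measurable_gsq r w c) (per_gsq r w c)).
rewrite (_ : tr m @^-1` _ = (good lam r : set T2) `&` sq w (tr (lat g) c))//.
have E a (i : int) x : x + (- i)%:~R - a + w = x - (a + i%:~R) + w by rewrite intrN; ring.
apply/seteqP; split => z [/= gz [h1 h2]]; (split; first exact/(good_lat lam r (- g.1, - g.2) z)).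
  by move: h1 h2; rewrite /sq1 /= !E.
by split; move: h1 h2; rewrite /sq1 /= !E.
Qed.

(** The boxes of radius 1/q centred at odd multiples of 1/q tile the torus. Were none of them dense,
    the good points would have area at most 2, half of the total. *)
Lemma dense_exists r (q : nat) : (1 < q)%N -> 0 <= r -> 16 * r / (1 - mu) < 2 ->
  exists c, dense r q%:R^-1 c.
Proof.
move=> q1 r0 hr; apply: contrapT => /forallNP H.
have q0 : 0 < q%:R :> R by rewrite ltr0n; lia.
set w := q%:R^-1 in H; pose a (i : nat) : R := (2 * i%:R + 1) * w.
have w0 : 0 < w by rewrite invr_gt0.
have w1 : w < 1 by rewrite invf_lt1// ltr1n.
have w01 : 0 <= w < 1 by rewrite w1 ltW.
have qw : q%:R * w = 1 by rewrite mulfV// gt_eqF.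
pose s := [seq (i, j) | i <- iota 0 q, j <- iota 0 q].
pose E (ij : nat * nat) : set T2 := (good lam r : set T2) `&` sq w (a ij.1, a ij.2).
have sub : (good lam r : set T2) `<=` \big[setU/set0]_(ij <- s) E ij.
  rewrite -bigcup_seq => z gz.
  have P x : exists2 i, i \in iota 0 q & sq1 w (a i) x.
    have := mod2_itv x => /andP[m0 m2]; pose u := mod2 x / 2 * q%:R.
    have u0 : 0 <= u by rewrite mulr_ge0 ?ler0n// divr_ge0// ler0n.
    have uq : u < q%:R by rewrite -[ltRHS]mul1r ltr_pM2r// ltr_pdivrMr// mul1r.
    have /andP[t1 t2] := truncn_itv u0; exists (Num.truncn u).
      by rewrite mem_iota add0n/= -(ltr_nat R); exact: le_lt_trans t1 uq.
    apply/(sq1P _ _ w01); exists (Num.floor (x / 2)); rewrite -/(fl _).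
    have -> : x - a (Num.truncn u) - 2 * fl (x / 2) = mod2 x - a (Num.truncn u).
      by rewrite /mod2; ring.
    have E1 : mod2 x = 2 * u * w by rewrite /u; move: qw => qw; rewrite -mulrA -[_ * _ * w]mulrA qw; field.
    rewrite E1 /a ler_norml; move: t1 t2; rewrite -natr1 => t1 t2.
    have h1 : 0 <= (u - (Num.truncn u)%:R) * w by rewrite mulr_ge0 ?subr_ge0// ltW.
    have h2 : 0 <= ((Num.truncn u)%:R + 1 - u) * w.
      by rewrite mulr_ge0 ?subr_ge0// ltW.
    by flra.
  have [i si hi] := P z.1; have [j sj hj] := P z.2; exists (i, j) => //=.
  by apply/allpairsP; exists (i, j).
have mg := measurable_good lam r.
have gU : measurable (\big[setU/set0]_(ij <- s) E ij).
  by apply: bigsetU_measurable => i _; exact: measurable_gsq.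
have := ar_le mg gU sub; apply/negP; rewrite -ltNge.
apply: (@le_lt_trans _ _ (\sum_(ij <- s) 2 * w ^+ 2)).
  apply: ar_bigsetU => ij; first exact: measurable_gsq.
  by rewrite leNgt; apply/negP; exact: H.
rewrite big_const_seq count_predT iter_addr_0 size_allpairs !size_iota.
have -> : 2 * w ^+ 2 *+ (q * q) = 2 :> R.
  rewrite -mulr_natr natrM (_ : _ * _ = 2 * (q%:R * w) ^+ 2); last by ring.
  by rewrite qw; ring.
by have := ar_good lam1 r0; rewrite arC//; flra.
Qed.

Definition joins r w c1 c2 n z g : Prop :=
  [/\ good lam r z, good lam r (iter n F z), near w c1 z &
      near w (tr (lat g) c2) (iter n F z)].

Lemma joins_mod r w c1 c2 n z : 0 <= w < 1 -> good lam r z -> good lam r (iter n F z) ->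
  sq w c1 z -> sq w c2 (iter n F z) ->
  exists i j i' j' : int, joins r w c1 c2 n (tr (lat (2 * i, 2 * j)) z)
    (latD (2 * i', 2 * j') (iter n latF (2 * i, 2 * j))).
Proof.
move=> w01 gz gz' /(sq_near w01)[i [j h1]] /(sq_near w01)[i' [j' h2]].
exists (- i), (- j), i', j'; split.
- exact/good_lat.
- by rewrite iterF_lat//; apply/good_lat.
- have := near_tr (lat (2 * - i, 2 * - j)) h1; rewrite -tr_latD.
  by rewrite /latD /= !mulrN !subrr tr_lat0.
- by rewrite iterF_lat// tr_latD; apply: near_tr.
Qed.

(** After the shift [h] both sets of good points fill more than half of the same box, so they
    overlap and transitivity applies. The energy shift is even because the boxes [sq] are taken
    modulo 2Z^2. *)
Lemma joins_exists r w c1 c2 n0 : 0 <= w < 1 -> dense r w c1 -> dense r w c2 ->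
  exists n z g, [/\ (n0 <= n)%N, joins r w c1 c2 n z g & exists k : int, latJ g = 2 * k].
Proof.
move=> w01 d1 d2; pose h : R * R := (c2.1 - c1.1, c2.2 - c1.2).
have mA := measurable_gsq r w c1; have mB := measurable_gsq r w c2.
have pA := per_gsq r w c1; have pB := per_gsq r w c2.
set A := _ `&` sq w c1 in mA pA; set B := _ `&` sq w c2 in mB pB.
have mB' : measurable (tr h @^-1` B) by apply: measurable_pre => //; exact: measurable_tr.
have I0 : 0 < ar (A `&` (tr h @^-1` B)).
  have E : A `|` (tr h @^-1` B) `<=` sq w c1.
    move=> z [[]//|[_]]; rewrite /sq /sq1 /tr /h /=.
    rewrite (_ : z.1 + _ - _ = z.1 - c1.1); last by ring.
    by rewrite (_ : z.2 + _ - _ = z.2 - c1.2); last by ring.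
  have h1 := ar_le (measurableU _ _ mA mB') (measurable_sq w c1) E.
  have h2 := arUD mA mB'; have h3 := arD mB' mA; have h4 := ar_tr h mB pB.
  have h5 := ar_sq c1 w01; move: d1 d2; rewrite /dense -/A -/B setIC.
  exact: half_half h1 h2 h3 h4 h5.
have [z [gz z1] [n n0n [gz' z2]]] := sawtooth_transitive lam1 n0 mA mB pA pB I0.
have [i [j [i' [j' J]]]] := joins_mod w01 gz gz' z1 z2.
exists n; do 2!eexists; split; [exact: n0n|exact: J|].
by rewrite latJD latJF /latJ /=; exists (j' - i' + (j - i)); ring.
Qed.

(** Eigencoordinates: on differences of points in one cell, [F] multiplies [uu] by [lam] and [ss] by
    [mu]. *)
Definition uu z : R := z.2 - mu * z.1.
Definition ss z : R := lam * z.1 - z.2.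

Definition word n z : seq int := [seq Num.floor (iter p F z).2 | p <- iota 0 n].

Lemma wordP n z z' : (forall p, (p < n)%N -> fl (iter p F z).2 = fl (iter p F z').2) <->
  word n z = word n z'.
Proof.
rewrite /word; split => [H|/eq_in_map H p pn].
  apply/eq_in_map => p; rewrite mem_iota add0n /= => /H /eqP.
  by rewrite /fl eqr_int => /eqP.
by rewrite /fl H// mem_iota add0n.
Qed.

Lemma uu_F z z' : fl z.2 = fl z'.2 -> uu (F z) - uu (F z') = lam * (uu z - uu z').
Proof. by rewrite /uu /Fm /= => ->; field; exact: lam_neq0. Qed.

Lemma ss_F z z' : fl z.2 = fl z'.2 -> ss (F z) - ss (F z') = mu * (ss z - ss z').
Proof. by rewrite /ss /Fm /= => ->; field; exact: lam_neq0. Qed.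

(** The difference of [uu] grows by [lam] at each step with a common floor. After [n.+1] steps it is
    still at most 2, because the last two floors agree and these control both coordinates. *)
Lemma word_close n z z' : word n.+2 z = word n.+2 z' ->
  `|uu z - uu z'| <= mu ^+ n.+1 * 2.
Proof.
move=> /wordP H.
have E p : (p < n.+2)%N -> uu (iter p F z) - uu (iter p F z') = lam ^+ p * (uu z - uu z').
  elim: p => [|p IH] pn; first by rewrite mul1r.
  by rewrite !iterS uu_F ?IH 1?ltnW// ?exprS ?mulrA//; apply: H; exact: ltnW.
have h : `|uu (iter n.+1 F z) - uu (iter n.+1 F z')| <= 2.
  have h1 := H n (ltnW (ltnSn _)); have h2 := H n.+1 (ltnSn _).
  have f1 := fl_itv (iter n F z).2; have f2 := fl_itv (iter n F z').2.
  have f3 := fl_itv (iter n.+1 F z).2; have f4 := fl_itv (iter n.+1 F z').2.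
  have e1 : (iter n.+1 F z).1 = (iter n F z).2 by [].
  have e2 : (iter n.+1 F z').1 = (iter n F z').2 by [].
  rewrite /uu e1 e2.
  have k1 : `|(iter n.+1 F z).2 - (iter n.+1 F z').2| <= 1 by rewrite ler_norml; flra.
  have k2 : `|mu * ((iter n F z).2 - (iter n F z').2)| <= 1.
    have k3 : `|(iter n F z).2 - (iter n F z').2| <= 1 by rewrite ler_norml; flra.
    rewrite normrM gtr0_norm// -[leRHS]mulr1; apply: ler_pM => //; exact: ltW.
  rewrite -[2]/(1 + 1 : R); apply: le_trans (lerD k1 k2).
  by apply: le_trans (ler_normB _ _); rewrite le_eqVlt; apply/orP; left; apply/eqP; congr `|_|; ring.
have {}E := E n.+1 (ltnSn _).
have l1 : 0 <= lam ^+ n.+1 by rewrite exprn_ge0// ltW// (lt_trans ltr01).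
rewrite E normrM ger0_norm// in h.
have l0 : 0 < lam ^+ n.+1 by rewrite exprn_gt0// (lt_trans ltr01).
by rewrite exprVn mulrC ler_pdivlMr// mulrC.
Qed.

(** Points with a given word lie in a strip of area of order lam^-n, while the returning good points
    keep an area bounded below for arbitrarily large [n]. A greedy choice outside the strips already
    used yields of the order of lam^n distinct words. *)
Lemma many_words r w c : 0 <= w < 1 -> dense r w c ->
  exists2 c0 : R, 0 < c0 & forall n0, exists2 n, (n0 <= n)%N &
    exists s : seq (R * R), [/\ c0 * lam ^+ n <= (size s)%:R, uniq [seq word n z | z <- s] &
      forall z, z \in s -> exists g, joins r w c c n z g].
Proof.
move=> w01 dc; have mA := measurable_gsq r w c; have pA := per_gsq r w c.
have A0 : 0 < ar ((good lam r : set T2) `&` sq w c).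
  by apply: le_lt_trans dc; rewrite mulr_ge0// sqr_ge0.
have [c1 c10 H] := sawtooth_recurrent lam mA pA A0.
exists (c1 / (16 * lam)); first by rewrite divr_gt0// mulr_gt0// (lt_trans ltr01).
move=> n0; have [[|[|n]] nn0 ar1] := H n0.+2; [by []|by []|]; exists n.+2; first exact: ltnW (ltnW nn0).
set A := _ `&` sq w c in mA pA ar1.
pose V : set T2 := A `&` iter n.+2 F @^-1` A.
have mV : measurable V by apply: measurableI => //; exact: measurable_iterF.
have pV : per V by apply: perI => //; exact: per_iterF.
(* This shift puts [c] in the middle of the fundamental domain, so that the chosen representatives
   are near [c] itself and not near a translate of it. *)
pose h : R * R := (c.1 - 1, c.2 - 1).
pose V' : set T2 := (tr h @^-1` V) `&` Om.
have mO : measurable (Om : set T2) by apply: measurableX; exact: measurable_itv.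
have mV1 : measurable (tr h @^-1` V) by apply: measurable_pre => //; exact: measurable_tr.
have mV' : measurable V' by exact: measurableI.
have arV' : c1 <= ar V'.
  by apply: le_trans ar1 _; rewrite -/V -(ar_tr h mV pV); exact: ar_dom.
have near1 z : V' z -> near w c (tr h z).
  move=> [[[_ [k1 k2]] _] [/=]]; rewrite !in_itv/= => i1 i2.
  by split; apply: (sq1_mid w01).
(* Area of a strip of half-width [mu ^+ n.+1 * 2], as in [word_close], over a period of length 2. *)
pose K : R := 8 * mu ^+ n.+1.
have main k : k%:R * K < c1 + K -> exists s : seq (R * R), [/\ size s = k,
    uniq [seq word n.+2 z | z <- s] & forall z, z \in s -> V z /\ near w c z].
  elim: k => [|k IH] kK; first by exists [::].
  have {}kK : k%:R * K < c1 by move: kK; rewrite -natr1 mulrDl mul1r ltrD2r.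
  have K0 : 0 < K by rewrite mulr_gt0// exprn_gt0.
  have [|s [ss us Hs]] := IH; first by rewrite (lt_trans kK)// ltrDl.
  pose S (z0 : R * R) : set T2 :=
    [set z | setT z.1 /\ `|1 * z.2 - (mu * z.1 + (uu z0 - uu h))| <= mu ^+ n.+1 * 2].
  have SP z0 : measurable (S z0) /\ ar (S z0) <= K.
    have m1 : measurable_fun setT ((fun x => mu * x + (uu z0 - uu h)) : T1 -> T1).
      by apply: measurable_funD => //; exact: measurable_funM.
    have b0 : 0 <= mu ^+ n.+1 * 2 by rewrite mulr_ge0// exprn_ge0// ltW.
    have [? h1] := ar_strip (@measurableT _ T1) m1 (lexx 1) b0; split => //.
    by apply: (le_trans h1); rewrite mu1T /= /K le_eqVlt; apply/orP; left; apply/eqP; ring.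
  have mU : measurable (\big[setU/set0]_(z0 <- s) S z0).
    by apply: bigsetU_measurable => i _; case: (SP i).
  have hU : ar (\big[setU/set0]_(z0 <- s) S z0) <= k%:R * K.
    have := ar_bigsetU s (fun i => (SP i).1) (fun i => (SP i).2).
    by rewrite big_const_seq count_predT iter_addr_0 ss mulr_natl.
  have [z [Vz nz]] : exists z, V' z /\ ~ (\big[setU/set0]_(z0 <- s) S z0) z.
    apply: contrapT => /forallNP N.
    have sub : V' `<=` \big[setU/set0]_(z0 <- s) S z0.
      by move=> z Vz; apply: contrapT => nz; apply: (N z).
    by have := ar_le mV' mU sub; rewrite leNgt => /negP; apply; apply: (le_lt_trans hU); exact: lt_le_trans kK arV'.
  exists (tr h z :: s); split => /=; first by rewrite ss.
    rewrite us andbT; apply/mapP => -[z0 z0s /word_close wc]; apply: nz.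
    rewrite -bigcup_seq; exists z0 => //; split => //.
    by move: wc; rewrite (_ : 1 * z.2 - _ = uu (tr h z) - uu z0)// /uu /tr /=; ring.
  move=> z0; rewrite inE => /orP[/eqP->|/Hs//]; split; last exact: near1.
  by case: Vz.
have K0 : 0 < K by rewrite mulr_gt0// exprn_gt0.
have c1K : 0 <= c1 / (2 * K) by rewrite ltW// divr_gt0// mulr_gt0.
have /andP[t1 t2] := truncn_itv c1K.
have [|s [sN us Hs]] := main (Num.truncn (c1 / (2 * K))).+1.
  rewrite -natr1 mulrDl mul1r ltrD2r; apply: (@le_lt_trans _ _ (c1 / (2 * K) * K)).
    by rewrite ler_pM2r.
  rewrite (_ : c1 / (2 * K) * K = c1 / 2); first by flra.
  by field; exact: lt0r_neq0.
exists s; split => //.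
  rewrite sN; apply: le_trans (ltW t2); rewrite /K exprVn le_eqVlt; apply/orP; left; apply/eqP.
  by rewrite [lam ^+ n.+2]exprS; field; rewrite expf_neq0 (lam_neq0 lam1).
move=> z /Hs [[[gz _] [gz' sz']] nz].
have [i [j Hj]] := sq_near w01 sz'.
by exists (2 * i, 2 * j); split.
Qed.

End Horseshoe.

Lemma int_pad (x y k z : int) : 1 - x - y <= k -> k <= z -> 1 <= x + (z + y).
Proof. by lia. Qed.

(** * Chains of segments and loops with positive drift *)

Section Routes.
Context {R : realType}.
Implicit Types (z h c : R * R) (g : int * int).
Context (lam : R) (lam1 : 1 < lam).
Local Notation mu := (lam^-1).
Local Notation F := (Fm lam).

(** The symmetry that reverses the drift exchanges the two centres, so both have to be carried
    along. *)
Definition ctr c (b : bool) := if b then c else opp c.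

Record seg := Seg {s_b : bool ; s_z : R * R ; s_n : nat ; s_b' : bool ; s_g : int * int}.

(** The bound 4 makes a segment long enough for its tube to be narrower than the crossed box and for
    the stable width to shrink sufficiently; see [seg_lift]. *)
Definition okseg r w c (s : seg) : Prop := 4 <= lam ^+ s_n s /\
  joins lam r w (ctr c (s_b s)) (ctr c (s_b' s)) (s_n s) (s_z s) (s_g s).

Fixpoint route r w c b (L : seq seg) b' : Prop :=
  if L is s :: L' then [/\ s_b s = b, okseg r w c s & route r w c (s_b' s) L' b'] else b = b'.

Definition rlen (L : seq seg) : nat := (\sum_(s <- L) s_n s)%N.
Definition rshift (L : seq seg) : int := \sum_(s <- L) latJ (s_g s).

Lemma route_cat r w c b1 L1 b2 L2 b3 :
  route r w c b1 L1 b2 -> route r w c b2 L2 b3 -> route r w c b1 (L1 ++ L2) b3.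
Proof. by elim: L1 b1 => [|s L1 IH] b1 /=; [move->|move=> [? ? /IH H] /H]. Qed.

Lemma joins_opp r w c1 c2 n z g : 0 < r -> joins lam r w c1 c2 n z g ->
  joins lam r w (opp c1) (opp c2) n (opp z) (- g.1, - g.2).
Proof.
move=> r0 [gz gz' n1 n2].
have P x y : `|- x - - y| = `|x - y| :> R by rewrite -opprD normrN.
split; first exact: good_opp; rewrite ?(iterF_opp lam1 _ r0 gz); first exact: good_opp.
  by rewrite /near /opp /= !P.
have P2 (x y k : R) : `|- x - (- y - k)| = `|x - (y + k)|.
  by rewrite -normrN; congr `|_|; ring.
by move: n2; rewrite /near /opp /tr /lat /= !intrN !P2.
Qed.

Lemma latJN g : latJ (- g.1, - g.2) = - latJ g.
Proof. by rewrite /latJ /=; ring. Qed.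

Lemma okseg_opp r w c b z n b' g : 0 < r -> okseg r w c (Seg b z n b' g) ->
  okseg r w c (Seg (~~ b) (opp z) n (~~ b') (- g.1, - g.2)).
Proof.
move=> r0 [l4 J]; split => //=; have := joins_opp r0 J.
by clear; case: b; case: b' => /=; rewrite ?oppK.
Qed.

Section Dense.
Context (r w : R) (c : R * R) (r0 : 0 < r) (w01 : 0 <= w < 1) (dc : dense lam r w c).

Lemma dense_ctr b : dense lam r w (ctr c b).
Proof. by case: b; [exact: dc|exact: dense_opp]. Qed.

Lemma expr_unbounded (x : R) (a : R) : 1 < x -> exists n0, forall n, (n0 <= n)%N -> a <= x ^+ n.
Proof.
move=> x1; have x0 : 0 < x := lt_trans ltr01 x1.
have a0 : 0 < `|a| + 1 by rewrite ltr_wpDl.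
have [|k hk] := @mu_pow_small _ x x1 (`|a| + 1)^-1; first by rewrite invr_gt0.
exists k => n kn; apply: (le_trans (ler_norm _)); apply: (@le_trans _ _ (`|a| + 1)).
  by rewrite lerDl.
apply: le_trans (ler_weXn2l (ltW x1) kn).
by move: hk; rewrite exprVn lef_pV2 ?posrE ?exprn_gt0.
Qed.

Lemma bridge b b' : exists2 s, okseg r w c s & s_b s = b /\ s_b' s = b'.
Proof.
have [n0 Hn0] := expr_unbounded 4 lam1.
have [n [z [g [nn J _]]]] := joins_exists lam1 n0 w01 (dense_ctr b) (dense_ctr b').
by exists (Seg b z n b' g) => //; split => //=; exact: Hn0.
Qed.

(** The target is the box translated by (0, 1), reached up to an even shift, so the total drift is
    odd and cannot vanish. If it is negative, the opposite segment has positive drift at the other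
    centre. *)
Lemma raise : exists2 s, okseg r w c s & s_b s = s_b' s /\ 1 <= latJ (s_g s).
Proof.
have [n0 Hn0] := expr_unbounded 4 lam1.
have [n [z [g [nn [gz gz' n1 n2] [k Jk]]]]] :=
  joins_exists lam1 n0 w01 dc (dense_lat (0, 1) dc).
have J : joins lam r w c c n z (latD (0, 1) g) by split => //; rewrite tr_latD.
have s1 : okseg r w c (Seg true z n true (latD (0, 1) g)) by split => //=; exact: Hn0.
have E : latJ (latD (0, 1) g) = 2 * k + 1 by rewrite latJD Jk /latJ /=; ring.
case: (lerP 1 (latJ (latD (0, 1) g))) => h; first by exists (Seg true z n true (latD (0, 1) g)).
have s2 := okseg_opp r0 s1; eexists; first exact: s2.
by split => //=; move: h E; rewrite /latJ /=; lia.
Qed.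

(** If the raising segment sits at the other centre, it is reached and left by bridges of unknown
    drift, and repeated often enough to outweigh them. *)
Lemma raising_loop b : exists2 L, route r w c b L b & 1 <= rshift L.
Proof.
have [e oe [eb e1]] := raise.
case: (eqVneq (s_b e) b) => [<-|neb].
  by exists [:: e]; rewrite /= -?eb // /rshift big_seq1.
have [p op [pb pb']] := bridge b (s_b e); have [q oq [qb qb']] := bridge (s_b e) b.
have [k hk] : exists k : nat, 1 - latJ (s_g p) - latJ (s_g q) <= k%:Z.
  by exists (absz (1 - latJ (s_g p) - latJ (s_g q))%R); rewrite abszE ler_norm.
exists (p :: nseq k e ++ [:: q]).
  rewrite /= pb; split => //; rewrite pb'; apply: (@route_cat r w c (s_b e) _ (s_b e)); last by rewrite /= qb qb'.
  by elim: k {hk} => //= k IH; rewrite -eb.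
rewrite /rshift big_cons big_cat big_seq1 /= big_nseq iter_addr_0.
have : k%:Z <= latJ (s_g e) *+ k by rewrite -natz; apply: ler_wMn2r.
by move=> kz; exact: int_pad hk kz.
Qed.

(** Either half of the words have nonnegative drift, or half of them have negative drift and their
    opposites serve at [- c]. The loop [L] that makes the gain strict has a length fixed beforehand,
    so [c0 * lam ^+ n] exceeds [2 * kap ^+ (n + m)] for large [n]. *)
Theorem horseshoe (kap : R) : 1 < kap -> kap < lam ->
  exists b n (gf : R * R -> int * int) (s : seq (R * R)) L,
  [/\ route r w c b L b, 1 <= rshift L, kap ^+ (n + rlen L) <= (size s)%:R,
      uniq [seq word lam n z | z <- s] &
      forall z, z \in s -> okseg r w c (Seg b z n b (gf z)) /\ 0 <= latJ (gf z)].
Proof.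
move=> k1 kl; have k0 : 0 < kap := lt_trans ltr01 k1.
have [L1 rL1 sL1] := raising_loop true; have [L2 rL2 sL2] := raising_loop false.
(* Allows for both raising loops, since the centre is known only after [n] has been chosen. *)
pose m := (rlen L1 + rlen L2)%N.
have [c0 c00 H] := many_words lam1 w01 dc.
have [n1 Hn1] := expr_unbounded 4 lam1.
have kl1 : 1 < lam / kap by rewrite ltr_pdivlMr// mul1r.
have [n2 Hn2] := expr_unbounded (2 * kap ^+ m / c0) kl1.
have [n nn [s [sn us Hs]]] := H (n1 + n2)%N.
have [gf Hgf] : exists gf : R * R -> int * int, forall z, z \in s -> joins lam r w c c n z (gf z).
  have : forall z, exists g, z \in s -> joins lam r w c c n z g.
    move=> z; case: (boolP (z \in s)) => [/Hs[g Jg]|_]; first by exists g.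
    by exists (0, 0).
  by move=> /choice[f Hf]; exists f.
have big : 2 * kap ^+ (n + m) <= (size s)%:R.
  apply: le_trans sn; have := Hn2 n (leq_trans (leq_addl _ _) nn).
  rewrite expr_div_n ler_pdivrMr// exprD => h.
  by rewrite mulrCA -ler_pdivlMl ?exprn_gt0// [c0 * _]mulrC mulrA [_^-1 * _]mulrC.
have l4 : 4 <= lam ^+ n by apply: Hn1; exact: leq_trans (leq_addr _ _) nn.
pose P z := 0 <= latJ (gf z).
have szs : (size s = size [seq z <- s | P z] + size [seq z <- s | predC P z])%N.
  by rewrite !size_filter count_predC.
have half : kap ^+ (n + m) <= (size [seq z <- s | P z])%:R \/
    kap ^+ (n + m) <= (size [seq z <- s | predC P z])%:R.
  move: big; rewrite szs natrD => big.
  by case: (lerP (kap ^+ (n + m)) (size [seq z <- s | P z])%:R) => h; [left|right]; flra.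
case: half => half.
  exists true, n, gf, [seq z <- s | P z], L1; split => //.
  - by apply: le_trans half; rewrite ler_weXn2l ?(ltW k1)// leq_add2l leq_addr.
  - exact: (subseq_uniq (map_subseq _ (filter_subseq _ _)) us).
  - by move=> z; rewrite mem_filter => /andP[Pz /Hgf Jz].
exists false, n, (fun z => (- (gf (opp z)).1, - (gf (opp z)).2)),
  [seq opp z | z <- s & predC P z], L2; split => //.
- rewrite size_map; apply: le_trans half.
  by rewrite ler_weXn2l ?(ltW k1)// leq_add2l leq_addl.
- have := subseq_uniq (map_subseq (word lam n) (filter_subseq (predC P) s)) us.
  rewrite -map_comp.
  (* Off the integers, negation acts on floors by i -> - i - 1, so distinct words stay distinct. *)
  have E : {in [seq z <- s | predC P z], word lam n \o opp =1 (map (fun i : int => - i - 1)) \o word lam n}.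
    move=> z; rewrite mem_filter => /andP[_ /Hgf[gz _ _ _]] /=.
    rewrite /word -map_comp; apply/eq_in_map => p _ /=.
    rewrite (iterF_opp lam1 _ r0 gz) /=; have [fz _] := gz p.
    have d0 : 0 < r * mu ^+ p by rewrite mulr_gt0// exprn_gt0// mu_gt0.
    apply/eqP; rewrite -(eqr_int R) -/(fl _) (fl_opp d0 fz) intrD intrN /fl.
    by rewrite -[X in _ + X]/((-1)%:~R).
  move/eq_in_map: E => ->.
  have I : injective (fun i : int => - i - 1) by move=> i j /addIr/oppr_inj.
  by rewrite map_comp (map_inj_uniq (inj_map I)).
- move=> _ /mapP[z + ->]; rewrite mem_filter => /andP[/= Pz /Hgf Jz]; rewrite oppK.
  split; last by rewrite latJN oppr_ge0 ltW// ltNge.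
  by apply: (@okseg_opp r w c true z n true) => //; split.
Qed.

End Dense.
End Routes.

(** * Lifting loops to a perturbed map *)

Section Crossing.
Context {R : realType}.
Implicit Types (h : R -> R).

(** The intermediate value theorem at the first hitting time, an infimum; the Lipschitz bound shows
    that the value [y] is attained there. *)
Lemma first_hit h (a b K y : R) : 0 <= K -> a <= b ->
  (forall t t', a <= t <= b -> a <= t' <= b -> `|h t - h t'| <= K * `|t - t'|) ->
  h a <= y <= h b -> exists2 t, a <= t <= b /\ h t = y & forall s, a <= s <= t -> h s <= y.
Proof.
move=> K0 ab hK /andP[ya yb].
pose S : set R := [set s | a <= s <= b /\ y <= h s].
have Sb : S b by split; rewrite ?ab ?lexx.
have lS : has_lbound S by exists a => s [/andP[]].
pose t := inf S.
have tb : t <= b by exact: ge_inf.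
have at' : a <= t by apply: lb_le_inf; [exists b|move=> s [/andP[]]].
have ab' : a <= t <= b by rewrite at' tb.
have below s : a <= s < t -> h s < y.
  move=> /andP[as' st]; rewrite ltNge; apply/negP => ys.
  have : S s by split => //; rewrite as' (le_trans (ltW st)).
  by move=> /(ge_inf lS); rewrite leNgt st.
have K1 : 0 < K + 1 by rewrite ltr_wpDl.
have ty : h t = y.
  apply/eqP; rewrite eq_le; apply/andP; split; apply/ler_addgt0Pr => e e0.
  - have [at1|] := ltP a t; last first.
      by move=> ta; rewrite (_ : t = a) ?ler_wpDr// 1?ltW//; apply/eqP; rewrite eq_le ta.
    pose s := Num.max a (t - e / (K + 1)).
    have st : s < t by rewrite gt_max at1/= gtrBl divr_gt0.
    have as' : a <= s by rewrite le_max lexx.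
    have := hK t s ab'; rewrite as' (le_trans (ltW st) tb) => /(_ isT).
    have s2 : t - s <= e / (K + 1) by rewrite lerBlDr -lerBlDl le_max lexx orbT.
    have := below s; rewrite as' st => /(_ isT) hs.
    rewrite [`|t - s|]gtr0_norm ?subr_gt0// => h1.
    have h2 : K * (t - s) <= e.
      apply: (@le_trans _ _ ((K + 1) * (e / (K + 1)))); last by rewrite mulrCA mulfV ?mulr1// gt_eqF.
      by apply: ler_pM => //; rewrite ?subr_ge0 ?(ltW st)// lerDl.
    have := le_trans (ler_norm _) h1; flra.
  - have ee : 0 < e / (K + 1) by rewrite divr_gt0.
    have [s [s1 s2] st] := inf_adherent ee (conj (ex_intro _ b Sb) lS).
    have ts : t <= s by apply: ge_inf.
    have := hK t s ab' s1; rewrite [`|t - s|]distrC [`|s - t|]ger0_norm ?subr_ge0// => h1.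
    have h2 : K * (s - t) <= e.
      apply: (@le_trans _ _ ((K + 1) * (e / (K + 1)))); last by rewrite mulrCA mulfV ?mulr1// gt_eqF.
      by apply: ler_pM; rewrite ?subr_ge0 ?lerDl// lerBlDl ltW.
    move: h1; rewrite ler_norml; flra.
exists t => // s /andP[as']; rewrite le_eqVlt => /orP[/eqP->|st]; first by rewrite ty.
by apply/ltW/below; rewrite as' st.
Qed.

(** Take the first time at which [y] is reached, then the last earlier time at [x]; the latter is a
    first hitting time for t -> - h (- t). *)
Lemma sub_cross h (a b K x y : R) : 0 <= K -> a <= b -> x < y ->
  (forall t t', a <= t <= b -> a <= t' <= b -> `|h t - h t'| <= K * `|t - t'|) ->
  h a <= x -> y <= h b ->
  exists a' b', [/\ a <= a', a' < b', b' <= b, h a' = x /\ h b' = y &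
    forall t, a' <= t <= b' -> x <= h t <= y].
Proof.
move=> K0 ab xy hK ax yb.
have [|b' [/andP[ab' b'b] hb'] H1] := first_hit (y := y) K0 ab hK.
  by rewrite yb (le_trans ax)// ltW.
have [|||a' [/andP[a1 a2] ha'] H2] :=
    @first_hit (fun t => - h (- t)) (- b') (- a) K (- x) K0.
- by rewrite lerN2.
- move=> t t' t1 t2; rewrite -opprD normrN (_ : t - t' = - (- t - - t')); last by ring.
  by rewrite normrN; apply: hK; [move: t1|move: t2] => /andP[? ?]; apply/andP; split; flra.
- by rewrite !opprK hb' !lerN2 ax ltW.
exists (- a'), b'; split => //; first by rewrite lerNr.
- rewrite lt_neqAle lerNl a1 andbT; apply/eqP => e; move: ha'; rewrite e hb' => /oppr_inj.
  by move=> e'; rewrite e' ltxx in xy.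
- by split => //; exact/oppr_inj.
- move=> t /andP[t1 t2]; rewrite H1 ?t2 ?andbT//; last by rewrite (le_trans _ t1)// lerNr.
  by have := H2 (- t); rewrite opprK !lerN2; apply; rewrite t2 lerNl.
Qed.

End Crossing.

(** * Shadowing of segments by the perturbed map *)

Section Lifting.
Context {R : realType}.

Lemma cell_diff (x1 x2 y1 y2 u1 u2 J a b B : R) : a <= x1 < a + 1 -> b <= x2 < b + 1 ->
  a <= y1 < a + 1 -> b <= y2 < b + 1 -> y2 - y1 = u2 - u1 + J -> - B <= u2 - u1 ->
  J - B - 2 <= x2 - x1.
Proof. by flra. Qed.

Implicit Types (z q c : R * R) (g : int * int).
Context (lam : R) (lam1 : 1 < lam).
Local Notation mu := (lam^-1).
Local Notation F := (Fm lam).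
Local Notation uu := (uu lam).
Local Notation ss := (ss lam).

Let mu0 : 0 < mu. Proof. exact: mu_gt0. Qed.
Let mu1' : mu < 1. Proof. exact: mu_lt1. Qed.
Let lm0 : 0 < lam - mu. Proof. by move: mu1' lam1; flra. Qed.
Let lam0 : 0 < lam. Proof. exact: lt_trans ltr01 lam1. Qed.
Let lmu : lam * mu = 1. Proof. exact: lammu. Qed.

(** The sup norm in the eigencoordinates: with it [F] expands by at most [lam] inside a cell, so
    Lipschitz factors multiply along an orbit without an extra constant. *)
Definition ds z z' : R := Num.max `|uu z - uu z'| `|ss z - ss z'|.

Lemma dsP z z' (d : R) : ds z z' <= d <-> `|uu z - uu z'| <= d /\ `|ss z - ss z'| <= d.
Proof. by rewrite /ds ge_max; split => [/andP[]|[-> ->]]. Qed.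

Lemma ds_ge0 z z' : 0 <= ds z z'. Proof. by rewrite le_max normr_ge0. Qed.

Lemma dsxx z : ds z z = 0. Proof. by rewrite /ds !subrr normr0 maxxx. Qed.

Lemma ds_tri z2 z1 z3 : ds z1 z3 <= ds z1 z2 + ds z2 z3.
Proof.
have /dsP[a b] := lexx (ds z1 z2); have /dsP[c d] := lexx (ds z2 z3).
by apply/dsP; split; [apply: le_trans (lerD a c)|apply: le_trans (lerD b d)];
  apply: le_trans (ler_normD _ _); rewrite le_eqVlt; apply/orP; left; apply/eqP; congr `|_|; ring.
Qed.

Lemma uuss1 z z' : (lam - mu) * (z.1 - z'.1) = (uu z - uu z') + (ss z - ss z').
Proof. by rewrite /uu /ss; ring. Qed.

Lemma uuss2 z z' : (lam - mu) * (z.2 - z'.2) = lam * (uu z - uu z') + mu * (ss z - ss z').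
Proof. by rewrite /uu /ss; field; exact: (lam_neq0 lam1). Qed.

Lemma coord_ds z z' (d : R) : ds z z' <= d ->
  `|z.1 - z'.1| <= (lam + 1) / (lam - mu) * d /\ `|z.2 - z'.2| <= (lam + 1) / (lam - mu) * d.
Proof.
move=> /dsP[a b]; have d0 : 0 <= d := le_trans (normr_ge0 _) a.
have P x : `|(lam - mu) * x| <= (lam + 1) * d -> `|x| <= (lam + 1) / (lam - mu) * d.
  by rewrite normrM gtr0_norm// mulrAC ler_pdivlMr// mulrC.
split; apply: P; rewrite ?uuss1 ?uuss2; apply: (le_trans (ler_normD _ _)).
  rewrite mulrDl mul1r lerD//; apply: (le_trans a); rewrite ler_peMl// ltW//.
rewrite !normrM (gtr0_norm lam0) (gtr0_norm mu0) mulrDl lerD//; first by rewrite ler_pM2l.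
by rewrite mul1r; apply: (le_trans _ b); rewrite ler_piMl// ltW.
Qed.

Lemma ds_F z z' : fl z.2 = fl z'.2 -> ds (F z) (F z') <= lam * ds z z'.
Proof.
move=> e; have /dsP[a b] := lexx (ds z z'); apply/dsP; rewrite uu_F// ss_F//.
rewrite !normrM (gtr0_norm lam0) (gtr0_norm mu0); split; first by rewrite ler_pM2l.
by apply: ler_pM => //; [exact: ltW|apply: ltW; exact: lt_trans lam1].
Qed.

Lemma far_close (d x y : R) : 0 < d -> far d x -> `|y - x| <= d / 2 ->
  far (d / 2) y /\ fl y = fl x.
Proof.
move=> d0 [f1 f2]; rewrite ler_norml => h.
have e : fl y = fl x by apply: fl_eq; rewrite -/(fl _); flra.
by split => //; rewrite /far e; split; flra.
Qed.

Lemma far_le (d d' x : R) : d' <= d -> far d x -> far d' x.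
Proof. by move=> dd [a b]; split; apply: le_trans dd _. Qed.

Context (r w : R) (c : R * R) (w0 : 0 < w).
Local Notation beta := ((lam + 1) * w).
Local Notation rho := (4 * beta).
(** [beta] bounds [ds] between points of a box of radius [w] and its centre, [rho] is the radius of
    the region to be crossed, and [r] is twice the displacement [12 * beta / (lam - mu)] that can
    occur in a tube, so that shadowing points stay in the same cells. *)
Context (hr : r = 24 * beta / (lam - mu)).

Let b0 : 0 < beta. Proof. by rewrite mulr_gt0// addr_gt0. Qed.
Let r0 : 0 < r. Proof. by rewrite hr divr_gt0// mulr_gt0. Qed.

Lemma near_ds z z' : near w z z' -> ds z z' <= beta.
Proof.
move=> [h1 h2]; apply/dsP; split; rewrite distrC.
  rewrite (_ : uu z' - uu z = (z'.2 - z.2) - mu * (z'.1 - z.1)); last by rewrite /uu; ring.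
  apply: (le_trans (ler_normB _ _)); rewrite normrM gtr0_norm// mulrDl mul1r addrC lerD//.
  by apply: ler_pM => //; [exact: ltW|apply: ltW; exact: lt_trans lam1].
rewrite (_ : ss z' - ss z = lam * (z'.1 - z.1) - (z'.2 - z.2)); last by rewrite /ss; ring.
by apply: (le_trans (ler_normB _ _)); rewrite normrM gtr0_norm// mulrDl mul1r lerD// ler_pM2l.
Qed.

(* Points which follow the orbit of [z] for [n] steps: they are pinched to a
   width of order [mu ^+ n] in the unstable direction. *)
Definition tube n z q : Prop :=
  lam ^+ n * `|uu q - uu z| <= rho + 2 * beta /\ `|ss q - ss z| <= rho + beta.

(** At time [p] the deviation has an expanding part of order mu^(n-p-1) and a contracting part of
    order mu^p. Goodness of [z] keeps its orbit r mu^p away from the walls, and goodness of the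
    endpoint, read backward, keeps it r mu^(n-p-1) away; the larger of these two margins covers both
    parts. *)
Lemma tube_shadow n z q : good lam r z -> good lam r (iter n F z) -> tube n z q ->
  [/\ uu (iter n F q) - uu (iter n F z) = lam ^+ n * (uu q - uu z),
      ss (iter n F q) - ss (iter n F z) = mu ^+ n * (ss q - ss z) &
   forall p, (p < n)%N -> [/\ fl (iter p F q).1 = fl (iter p F z).1,
     fl (iter p F q).2 = fl (iter p F z).2,
     far (r / 2 * mu ^+ n) (iter p F q).1 & far (r / 2 * mu ^+ n) (iter p F q).2]].
Proof.
move=> gz gz' [tu ts].
have mp p : 0 < mu ^+ p by rewrite exprn_gt0.
have lp p : 0 < lam ^+ p by rewrite exprn_gt0.
have mle p : (p <= n)%N -> mu ^+ n <= mu ^+ p.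
  by move=> pn; rewrite ler_wiXn2l// ltW.
have hb p x : `|(lam - mu) * x| <= 6 * beta * (mu ^+ p) + 6 * beta * mu ^+ p -> `|x| <= r * mu ^+ p / 2.
  rewrite normrM gtr0_norm// -ler_pdivlMl// => h; apply: (le_trans h).
  have gen (e bb m : R) : e * (6 * bb * m + 6 * bb * m) = 24 * bb * e * m / 2 by field.
  by rewrite hr gen.
have main p : (p < n)%N ->
    uu (iter p F q) - uu (iter p F z) = lam ^+ p * (uu q - uu z) ->
    ss (iter p F q) - ss (iter p F z) = mu ^+ p * (ss q - ss z) ->
    fl (iter p F q).2 = fl (iter p F z).2 /\ far (r / 2 * mu ^+ n) (iter p F q).2.
  move=> pn up sp.
  have Dle : `|(lam - mu) * ((iter p F q).2 - (iter p F z).2)| <=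
      6 * beta * mu ^+ (n - p.+1) + 6 * beta * mu ^+ p.
    rewrite uuss2 up sp; apply: (le_trans (ler_normD _ _)); apply: lerD.
      rewrite !normrM (gtr0_norm lam0) (gtr0_norm (lp p)) mulrA -exprS.
      rewrite -(@ler_pM2l _ (lam ^+ (n - p.+1)))// mulrA -exprD subnK// [leRHS]mulrCA -exprMn lmu expr1n mulr1.
      by apply: (le_trans tu); flra.
    rewrite !normrM (gtr0_norm mu0) (gtr0_norm (mp p)); apply: (@le_trans _ _ (mu ^+ p * `|ss q - ss z|)).
      by rewrite ler_piMl ?mulr_ge0// ?ltW.
    by rewrite mulrC ler_pM2r//; apply: (le_trans ts); move: b0; flra.
  have F1 : far (r * mu ^+ p) (iter p F z).2 by case: (gz p).
  have F2 : far (r * mu ^+ (n - p.+1)) (iter p F z).2.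
    have := (gz' (n - p.+1)%N).2.
    by rewrite (_ : iter n F z = iter (n - p.+1) F (iter p.+1 F z)) ?iter_FmK// -iterD subnK.
  have [le|le] := leqP p (n - p.+1).
    have h : mu ^+ (n - p.+1) <= mu ^+ p by rewrite ler_wiXn2l// ltW.
    have [||f e] := far_close (y := (iter p F q).2) _ F1; first by rewrite mulr_gt0.
      by apply: hb; apply: (le_trans Dle); rewrite lerD2r ler_pM2l// mulr_gt0.
    by split => //; apply: far_le f; rewrite mulrAC ler_pM2r// ler_pM2l// mle// ltnW.
  have h : mu ^+ p <= mu ^+ (n - p.+1) by rewrite ler_wiXn2l// ?ltW//; exact: ltnW.
  have [||f e] := far_close (y := (iter p F q).2) _ F2; first by rewrite mulr_gt0.
    by apply: hb; apply: (le_trans Dle); rewrite lerD2l ler_pM2l// mulr_gt0.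
  by split => //; apply: far_le f; rewrite mulrAC ler_pM2r// ler_pM2l// mle// leq_subr.
have lin p : (p <= n)%N ->
    uu (iter p F q) - uu (iter p F z) = lam ^+ p * (uu q - uu z) /\
    ss (iter p F q) - ss (iter p F z) = mu ^+ p * (ss q - ss z).
  elim: p => [|p IH] pn; first by rewrite !mul1r.
  have [e1 e2] := IH (ltnW pn); have [e _] := main p pn e1 e2.
  by rewrite !iterS uu_F// ss_F// e1 e2 !exprS !mulrA.
have [l1 l2] := lin n (leqnn n); split => // p pn.
have [e1 e2] := lin p (ltnW pn); have [f1 f2] := main p pn e1 e2.
(* The first coordinate at time [p.+1] is the second one at time [p]; time 0 is settled by the
   backward half of the goodness of [z]. *)
case: p pn {e1 e2} f1 f2 => [|p] pn f1 f2; last first.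
  have [e1 e2] := lin p (ltnW (ltnW pn)); have [f3 f4] := main p (ltnW pn) e1 e2.
  by split.
have F1 : far r z.1 by have := (gz 0%N).2; rewrite mulr1.
have [//||f e] := far_close (y := q.1) _ F1.
  have := hb 0%N (q.1 - z.1); rewrite !mulr1; apply; rewrite uuss1.
  apply: (le_trans (ler_normD _ _)); apply: lerD; last by apply: (le_trans ts); move: b0; flra.
  apply: (@le_trans _ _ (lam ^+ n * `|uu q - uu z|)); last by apply: (le_trans tu); move: b0; flra.
  by rewrite ler_peMl// exprn_ege1// ltW.
by split => //; apply: far_le f; rewrite ger_pMr ?divr_gt0// exprn_ile1// ltW.
Qed.


Context (FT : R * R -> R * R) (V : R * R -> Prop).

Definition adm (J0 e : R) z : Prop := [/\ J0 <= z.2 - z.1, far e z.1 & far e z.2].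

Hypothesis FT_close : forall e : R, 0 < e -> exists J0 : R, forall z, adm J0 e z ->
  [/\ V z, ds (FT z) (F z) <= e &
    forall z', adm J0 e z' -> fl z'.1 = fl z.1 -> fl z'.2 = fl z.2 ->
      ds (FT z) (FT z') <= (lam + e) * ds z z'].

Definition itin g n z q : Prop := forall p, (p < n)%N ->
  fl (iter p FT q).2 = fl (iter p F z).2 + (iter p latF g).2%:~R.

Definition ready (J : R) n q : Prop := forall p, (p < n)%N ->
  V (iter p FT q) /\ J <= (iter p FT q).2 - (iter p FT q).1.

(** The curve traverses the region of radius [rho] in the unstable direction. Since [uu] varies by
    [2 * rho], the Lipschitz constant [L] bounds the length of the parameter interval from below. *)
Definition crossing b g f (L a a' : R) : Prop :=
  let p0 := tr (lat g) (ctr c b) in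
  [/\ a < a', uu (f a) - uu p0 = - rho /\ uu (f a') - uu p0 = rho,
      forall t, a <= t <= a' -> ds (f t) p0 <= rho &
      forall t t', a <= t <= a' -> a <= t' <= a' -> ds (f t) (f t') <= L * `|t - t'|].

(** One step of [FT] adds an error of at most [e], and earlier errors grow by a factor of at most
    [lam] at each step. As [n] is fixed, [e] can be chosen so small that the total stays below the
    margin [r / 2 * mu ^+ n] given by [tube_shadow]; then [FT] visits the same cells as [F]. *)
Lemma tube_FT n z (eta : R) : 0 < eta -> good lam r z -> good lam r (iter n F z) ->
  exists J1 : R, forall g q, J1 <= (latJ g)%:~R -> tube n (tr (lat g) z) q ->
    [/\ ready ((latJ g)%:~R - J1) n q, itin g n z q, ds (iter n FT q) (iter n F q) <= beta &
    forall q', tube n (tr (lat g) z) q' ->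
      ds (iter n FT q) (iter n FT q') <= (lam + eta) ^+ n * ds q q'].
Proof.
move=> eta0 gz gz'.
have mp p : 0 < mu ^+ p by rewrite exprn_gt0.
have lp p : 0 < (lam + 1) ^+ p by rewrite exprn_gt0// addr_gt0.
have lp1 p : 1 <= (lam + 1) ^+ p by rewrite exprn_ege1// lerDr ltW.
pose m := r / 2 * mu ^+ n; have m0 : 0 < m by rewrite mulr_gt0// divr_gt0.
pose CN := (lam + 1) / (lam - mu); have CN0 : 0 < CN by rewrite divr_gt0// addr_gt0.
pose K := (lam + 1) ^+ n; have K0 : 0 < K by exact: lp.
pose d := Num.min (Num.min (m / 2) (1 / 2)) (CN * beta).
have d0 : 0 < d by rewrite !lt_min divr_gt0//= divr_gt0//= mulr_gt0.
pose e := Num.min (Num.min (m / 2) eta) (d / (CN * K)).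
have e0 : 0 < e by rewrite !lt_min eta0 divr_gt0//= divr_gt0// mulr_gt0.
have eK : CN * (e * K) <= d.
  rewrite mulrCA -ler_pdivlMr; last exact: mulr_gt0.
  by rewrite /e ge_min lexx orbT.
have em : e <= m / 2 by rewrite /e !ge_min lexx.
have ee : e <= eta by rewrite /e !ge_min lexx orbT.
have dm : d <= m / 2 by rewrite /d !ge_min lexx.
have d1 : d <= 1 / 2 by rewrite /d !ge_min lexx orbT.
have db : d <= CN * beta by rewrite /d !ge_min lexx orbT.
have [J0 HJ0] := FT_close e0.
pose B := \sum_(p < n) `|(iter p F z).2 - (iter p F z).1|.
have B0 : 0 <= B by rewrite sumr_ge0.
(* [B] bounds the energies along the orbit of [z], 2 accounts for passing to another point of the
   same cells, the first 1 for the deviation of [FT]; the last 1 is slack. *)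
exists (`|J0| + B + 2 + 1 + 1) => g.
have claim q : `|J0| + B + 2 + 1 + 1 <= (latJ g)%:~R -> tube n (tr (lat g) z) q ->
  forall p, (p <= n)%N -> ds (iter p FT q) (iter p F q) <= e * (lam + 1) ^+ p /\
    ((p < n)%N -> [/\ adm J0 e (iter p FT q),
      (latJ g)%:~R - (`|J0| + B + 2 + 1 + 1) <= (iter p FT q).2 - (iter p FT q).1,
      fl (iter p FT q).1 = fl (iter p F (tr (lat g) z)).1 &
      fl (iter p FT q).2 = fl (iter p F (tr (lat g) z)).2]).
  move=> Jg tq; set zg := tr (lat g) z in tq *.
  have gzg : good lam r zg by exact/good_lat.
  have gzg' : good lam r (iter n F zg) by rewrite iterF_lat//; exact/good_lat.
  have [_ _ T3] := tube_shadow gzg gzg' tq.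
  have cons p : (p < n)%N -> ds (iter p FT q) (iter p F q) <= e * (lam + 1) ^+ p ->
     [/\ adm J0 e (iter p FT q),
      (latJ g)%:~R - (`|J0| + B + 2 + 1 + 1) <= (iter p FT q).2 - (iter p FT q).1,
      fl (iter p FT q).1 = fl (iter p F zg).1,
      fl (iter p FT q).2 = fl (iter p F zg).2 & fl (iter p FT q).2 = fl (iter p F q).2].
    move=> pn dp; have [t1 t2 t3 t4] := T3 p pn.
    have [c1 c2] := coord_ds dp.
    have cd : (lam + 1) / (lam - mu) * (e * (lam + 1) ^+ p) <= d.
      apply: le_trans eK; rewrite ler_pM2l// ler_pM2l// /K.
      by apply: ler_weXn2l; [rewrite lerDr ltW|exact: ltnW].
    have {}c1 := le_trans c1 cd; have {}c2 := le_trans c2 cd.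
    have [h1 h2] := far_close m0 t3 (le_trans c1 dm).
    have [h3 h4] := far_close m0 t4 (le_trans c2 dm).
    have Jp : (latJ g)%:~R - B - 2 <= (iter p F q).2 - (iter p F q).1.
      have f1 := fl_itv (iter p F q).1; have f2 := fl_itv (iter p F q).2.
      have f3 := fl_itv (iter p F zg).1; have f4 := fl_itv (iter p F zg).2.
      rewrite t1 in f1; rewrite t2 in f2.
      have E : (iter p F zg).2 - (iter p F zg).1 = (iter p F z).2 - (iter p F z).1 + (latJ g)%:~R.
        by rewrite iterF_lat -(latJF p g) /latJ /tr /lat /= intrB; ring.
      have Bp : `|(iter p F z).2 - (iter p F z).1| <= B.
        by rewrite /B (bigD1 (Ordinal pn))//= lerDl sumr_ge0.
      by apply: (cell_diff f1 f2 f3 f4 E); rewrite lerNl (le_trans (ler_norm _))// normrN.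
    have Jq : (latJ g)%:~R - B - 2 - 1 <= (iter p FT q).2 - (iter p FT q).1.
      by move: c1 c2; rewrite !ler_norml; flra.
    have J00 := ler_norm J0; have J01 := normr_ge0 J0.
    split; rewrite ?h2 ?h4//; last by flra.
    by split; [flra|exact: far_le em h1|exact: far_le em h3].
  elim=> [|p IH] pn.
    have h : ds q q <= e * (lam + 1) ^+ 0 by rewrite dsxx mulr1 ltW.
    by split => // n0; have [] := cons 0%N n0 h.
  have [h1 h2] := IH (ltnW pn).
  have [a1 a2 a3 a4 a5] := cons p pn h1.
  have [_ b2 _] := HJ0 _ a1.
  have h : ds (iter p.+1 FT q) (iter p.+1 F q) <= e * (lam + 1) ^+ p.+1.
    rewrite !iterS; apply: (le_trans (ds_tri (F (iter p FT q)) _ _)).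
    apply: (le_trans (lerD b2 (ds_F a5))); rewrite exprS mulrCA mulrDl mul1r addrC lerD ?ler_pM2l//.
    by rewrite ler_peMr// ltW.
  by split => // pn'; have [] := cons p.+1 pn' h.
move=> q Jg tq; have cq := claim q Jg tq; split.
- move=> p pn; have [_ /(_ pn)[a1 a2 _ _]] := cq p (ltnW pn).
  by have [Vz _ _] := HJ0 _ a1.
- by move=> p pn; have [_ /(_ pn)[_ _ _ ->]] := cq p (ltnW pn); rewrite iterF_lat// flDz.
- have [h _] := cq n (leqnn n); apply: (le_trans h).
  by rewrite -(ler_pM2l CN0); apply: le_trans db.
move=> q' tq'; have cq' := claim q' Jg tq'.
have H p : (p <= n)%N -> ds (iter p FT q) (iter p FT q') <= (lam + eta) ^+ p * ds q q'.
  elim: p => [|p IH] pn; first by rewrite mul1r.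
  have [_ /(_ pn)[a1 _ a3 a4]] := cq p (ltnW pn).
  have [_ /(_ pn)[a1' _ a3' a4']] := cq' p (ltnW pn).
  have [_ _ H] := HJ0 _ a1.
  rewrite !iterS; apply: (le_trans (H _ a1' _ _)); rewrite ?a3 ?a4//.
  rewrite exprS -mulrA; apply: ler_pM => //; rewrite ?ds_ge0 ?addr_ge0 ?(ltW e0) ?(ltW lam0)//.
    by rewrite lerD2l.
  exact: IH (ltnW pn).
exact: H.
Qed.

(** The part of the curve with unstable coordinate within [6 * beta / lam ^+ n] of that of the
    segment stays in its tube. Its image extends over 6 beta on either side, less 2 beta of errors,
    which is exactly [rho]. In the stable direction the width 5 beta is contracted by at least 4,
    and with 2 beta of errors it remains below [rho]. *)
Lemma seg_lift (s : seg) (eta : R) : 0 < eta -> okseg lam r w c s ->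
  exists J1 : R, forall g f (L a a' : R), J1 <= (latJ g)%:~R -> 0 <= L ->
    crossing (s_b s) g f L a a' -> exists t t', [/\ a <= t, t' <= a',
      crossing (s_b' s) (latD (s_g s) (iter (s_n s) latF g)) (iter (s_n s) FT \o f)
        (L * (lam + eta) ^+ s_n s) t t' &
      forall x, t <= x <= t' ->
        itin g (s_n s) (s_z s) (f x) /\ ready ((latJ g)%:~R - J1) (s_n s) (f x)].
Proof.
case: s => b z n b' gs eta0 [/= l4 [gz gz' nz nz']].
have [J1 HJ] := tube_FT eta0 gz gz'; exists J1 => g f L a a' Jg L0 [aa' [fa fa'] fin fL].
have ln0 : 0 < lam ^+ n by rewrite exprn_gt0.
set p0 := tr (lat g) _ in fa fa' fin; pose zg := tr (lat g) z.
have dz : ds p0 zg <= beta by apply: near_ds; exact: near_tr.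
have [dz1 dz2] := (dsP _ _ _).1 dz.
pose X := 6 * beta / lam ^+ n.
have X0 : 0 < X by rewrite divr_gt0// mulr_gt0.
have lX : lam ^+ n * X = 6 * beta by rewrite mulrC divfK// gt_eqF.
have X3 : X <= 3 * beta.
  rewrite ler_pdivrMr//; apply: (@le_trans _ _ (3 * beta * 4)); first by move: b0; flra.
  by rewrite ler_pM2l// mulr_gt0.
pose x t := uu (f t) - uu zg.
have xL t t' : a <= t <= a' -> a <= t' <= a' -> `|x t - x t'| <= L * `|t - t'|.
  move=> h h'; have [h1 _] := (dsP _ _ _).1 (fL t t' h h').
  by apply: le_trans h1; rewrite le_eqVlt; apply/orP; left; apply/eqP; congr `|_|; rewrite /x; ring.
have XX : - X < X by move: X0; flra.
have [||t1 [t1' [at1 tt1 ta1 [xt1 xt1'] xin]]] := @sub_cross _ x a a' L (- X) X L0 (ltW aa') XX xL.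
- by move: dz1 fa X3 b0; rewrite /x ler_norml; set B := (lam + 1) * w; flra.
- by move: dz1 fa' X3 b0; rewrite /x ler_norml; set B := (lam + 1) * w; flra.
have sub t : t1 <= t <= t1' -> a <= t <= a'.
  by move=> /andP[h1 h2]; rewrite (le_trans at1 h1) (le_trans h2 ta1).
have tub t : t1 <= t <= t1' -> tube n zg (f t).
  move=> ht; split.
    have : `|x t| <= X by rewrite ler_norml xin.
    by rewrite /x -(ler_pM2l ln0) lX; set B := (lam + 1) * w; flra.
  have [_ h] := (dsP _ _ _).1 (fin t (sub t ht)).
  move: h dz2; rewrite !ler_norml; set B := (lam + 1) * w; flra.
have gzg : good lam r zg by exact/good_lat.
have gzg' : good lam r (iter n F zg) by rewrite iterF_lat//; exact/good_lat.
set g' := latD gs _; pose p1 := tr (lat g') (ctr c b').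
have dz' : ds p1 (iter n F zg) <= beta.
  by apply: near_ds; rewrite /p1 /g' tr_latD iterF_lat//; exact: near_tr.
pose h := iter n FT \o f.
have close t : t1 <= t <= t1' -> ds (h t) (iter n F (f t)) <= beta.
  by move=> ht; have [_ _] := HJ g (f t) Jg (tub t ht).
have Lp0 : 0 <= L * (lam + eta) ^+ n by rewrite mulr_ge0// exprn_ge0// addr_ge0 ?(ltW lam0) ?(ltW eta0).
have hL t t' : t1 <= t <= t1' -> t1 <= t' <= t1' -> ds (h t) (h t') <= L * (lam + eta) ^+ n * `|t - t'|.
  move=> ht ht'; have [_ _ _ H] := HJ g (f t) Jg (tub t ht).
  apply: (le_trans (H _ (tub t' ht'))); rewrite mulrAC [leRHS]mulrC ler_wpM2l//.
    by rewrite exprn_ge0// addr_ge0 ?(ltW lam0) ?(ltW eta0).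
  by apply: fL; exact: sub.
pose y t := uu (h t) - uu p1.
have yx t : t1 <= t <= t1' -> `|y t - lam ^+ n * x t| <= 2 * beta /\
    `|ss (h t) - ss p1 - mu ^+ n * (ss (f t) - ss zg)| <= 2 * beta.
  move=> ht; have [e1 e2 _] := tube_shadow gzg gzg' (tub t ht).
  have [h1 h2] := (dsP _ _ _).1 (close t ht); have [h3 h4] := (dsP _ _ _).1 dz'.
  rewrite /y /x -e1 -e2; move: h1 h2 h3 h4; rewrite !ler_norml; set B := (lam + 1) * w; split; flra.
have yL t t' : t1 <= t <= t1' -> t1 <= t' <= t1' -> `|y t - y t'| <= L * (lam + eta) ^+ n * `|t - t'|.
  move=> ht ht'; have [h1 _] := (dsP _ _ _).1 (hL t t' ht ht').
  by apply: le_trans h1; rewrite le_eqVlt; apply/orP; left; apply/eqP; congr `|_|; rewrite /y; ring.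
have rr : - rho < rho by move: b0; flra.
have [||t2 [t2' [at2 tt2 ta2 [yt2 yt2'] yin]]] := @sub_cross _ y t1 t1' _ (- rho) rho Lp0 (ltW tt1) rr yL.
- have := (yx t1 _).1; rewrite lexx (ltW tt1) xt1 mulrN lX ler_norml => /(_ isT).
  by set B := (lam + 1) * w; flra.
- have := (yx t1' _).1; rewrite lexx (ltW tt1) xt1' lX ler_norml => /(_ isT).
  by set B := (lam + 1) * w; flra.
have sub2 t : t2 <= t <= t2' -> t1 <= t <= t1'.
  by move=> /andP[h1 h2]; rewrite (le_trans at2 h1) (le_trans h2 ta2).
exists t2, t2'; split; [exact: le_trans at1 at2|exact: le_trans ta2 ta1| |].
  split => // [t ht|t t' ht ht']; last by apply: hL; exact: sub2.
  apply/dsP; split; first by rewrite -/(y t) ler_norml yin.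
  have [_ h1] := yx t (sub2 t ht).
  have [_ h2] := tub t (sub2 t ht).
  have h3 : `|mu ^+ n * (ss (f t) - ss zg)| <= 2 * beta.
    rewrite normrM gtr0_norm ?exprn_gt0// exprVn ler_pdivrMl//.
    apply: (le_trans h2); apply: (@le_trans _ _ (4 * (2 * beta))); first by move: b0; flra.
    by rewrite ler_pM2r// mulr_gt0.
  by move: h1 h3; rewrite !ler_norml; set B := (lam + 1) * w; flra.
move=> t ht; have [h1 h2 _ _] := HJ g (f t) Jg (tub t (sub2 t ht)).
by split.
Qed.

Definition rend g (L : seq (@seg R)) : int * int :=
  foldl (fun g s => latD (s_g s) (iter (s_n s) latF g)) g L.

Lemma latJ_rend g L : latJ (rend g L) = latJ g + rshift L.
Proof.
elim: L g => [|s L IH] g /=; first by rewrite /rshift big_nil addr0.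
by rewrite IH latJD latJF /rshift big_cons [latJ (s_g s) + _]addrC -addrA.
Qed.

Lemma route_lift (eta : R) b L b' : 0 < eta -> route lam r w c b L b' ->
  exists J1 : R, forall g f (K a a' : R), J1 <= (latJ g)%:~R -> 0 <= K ->
    crossing b g f K a a' -> exists t t', [/\ a <= t, t' <= a',
      crossing b' (rend g L) (iter (rlen L) FT \o f) (K * (lam + eta) ^+ rlen L) t t' &
      forall x, t <= x <= t' -> ready ((latJ g)%:~R - J1) (rlen L) (f x) /\
        (if L is s :: _ then itin g (s_n s) (s_z s) (f x) else True)].
Proof.
move=> eta0; elim: L b => [|s L IH] b /=.
  move=> ->; exists 0 => g f K a a' _ K0 cr; exists a, a'; rewrite /rlen big_nil mulr1.
  by split => // x _; split => // p; rewrite ltn0.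
move=> [<- oks /IH[J2 H2]]; have [J1 H1] := seg_lift eta0 oks.
exists (Num.max J1 (J2 - (latJ (s_g s))%:~R)) => g f K a a'.
rewrite ge_max => /andP[Jg1 Jg2] K0 cr.
have [t [t' [at1 ta1 cr1 rd1]]] := H1 _ _ _ _ _ Jg1 K0 cr.
have le0 n : 0 <= (lam + eta) ^+ n by rewrite exprn_ge0// addr_ge0 ?(ltW lam0) ?(ltW eta0).
have [||u [u' [tu ut cr2 rd2]]] := H2 _ _ _ _ _ _ _ cr1.
- by rewrite latJD latJF intrD addrC -lerBlDr.
- by rewrite mulr_ge0.
have E : rlen (s :: L) = (rlen L + s_n s)%N by rewrite /rlen big_cons addnC.
exists u, u'; rewrite E; split; [exact: le_trans at1 tu|exact: le_trans ut ta1| |].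
  have -> : K * (lam + eta) ^+ (rlen L + s_n s) = K * (lam + eta) ^+ s_n s * (lam + eta) ^+ rlen L.
    by rewrite addnC exprD mulrA.
  suff -> : iter (rlen L + s_n s) FT \o f = iter (rlen L) FT \o (iter (s_n s) FT \o f) by [].
  by apply/funext => x /=; rewrite iterD.
move=> x hx.
have hx' : t <= x <= t' by move: hx => /andP[h1 h2]; rewrite (le_trans tu h1) (le_trans h2 ut).
split; last by have [] := rd1 x hx'.
move=> p pn; have [pn'|pn'] := ltnP p (s_n s).
  have [_ /(_ p pn')[v1 v2]] := rd1 x hx'; split => //; apply: le_trans v2.
  by rewrite lerD2l lerN2 le_max lexx.
have := (rd2 x hx).1 (p - s_n s)%N; rewrite ltn_subLR// addnC => /(_ pn)[].
rewrite /= -iterD subnK// => v1 v2; split => //; apply: le_trans v2.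
have : J2 - (latJ (s_g s))%:~R <= Num.max J1 (J2 - (latJ (s_g s))%:~R) by rewrite le_max lexx orbT.
by rewrite latJD latJF intrD; flra.
Qed.

(** The list is finite, so one threshold serves all words; as a block raises [latJ] by at least 1,
    the threshold stays satisfied when blocks are repeated. *)
Lemma block_lift (eta : R) b n (gf : R * R -> int * int) (s : seq (R * R)) L :
  0 < eta -> route lam r w c b L b -> 1 <= rshift L ->
  (forall z, z \in s -> okseg lam r w c (Seg b z n b (gf z)) /\ 0 <= latJ (gf z)) ->
  exists J1 : R, forall z, z \in s -> forall g f (K a a' : R), J1 <= (latJ g)%:~R -> 0 <= K ->
    crossing b g f K a a' -> exists t t' g', [/\ a <= t, t' <= a', latJ g + 1 <= latJ g',
      crossing b g' (iter (n + rlen L) FT \o f) (K * (lam + eta) ^+ (n + rlen L)) t t' &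
      forall x, t <= x <= t' ->
        itin g n z (f x) /\ ready ((latJ g)%:~R - J1) (n + rlen L) (f x)].
Proof.
move=> eta0 rL sL; elim: s => [|z s IH] Hs; first by exists 0 => z.
have [|J2 H2] := IH; first by move=> z' z's; apply: Hs; rewrite inE z's orbT.
have [oks gz0] := Hs z (mem_head z s).
have rL' : route lam r w c b (Seg b z n b (gf z) :: L) b by [].
have [J1 H1] := route_lift eta0 rL'.
have E : rlen (Seg b z n b (gf z) :: L) = (n + rlen L)%N by rewrite /rlen big_cons.
rewrite E in H1.
have weak J J' m q : J <= J' -> ready J' m q -> ready J m q.
  by move=> JJ rd p /rd[v1 v2]; split => //; exact: le_trans JJ v2.
exists (Num.max J1 J2) => z'; rewrite inE => /predU1P[->|z's] g f K a a'.
  rewrite ge_max => /andP[Jg _] K0 cr.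
  have [t [t' [h1 h2 h3 h4]]] := H1 _ _ _ _ _ Jg K0 cr.
  exists t, t', (rend g (Seg b z n b (gf z) :: L)); split => //.
    rewrite latJ_rend lerD2l /rshift big_cons; apply: (le_trans sL).
    by rewrite lerDr.
  move=> x /h4[rd it]; split => //; apply: weak rd.
  by rewrite lerD2l lerN2 le_max lexx.
rewrite ge_max => /andP[_ Jg] K0 cr.
have [t [t' [g' [h1 h2 h3 h4 h5]]]] := H2 _ z's _ _ _ _ _ Jg K0 cr.
exists t, t', g'; split => // x /h5[it rd]; split => //; apply: weak rd.
by rewrite lerD2l lerN2 le_max lexx orbT.
Qed.

End Lifting.

(** * Dimension of unstable slices *)

Section CantorCover.
Context {R : realType}.

Lemma truncn_scale (N k : nat) (y : R) : (0 < N)%N -> 0 <= y ->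
  (Num.truncn (N%:R ^+ k.+1 * y) %/ N)%N = Num.truncn (N%:R ^+ k * y).
Proof.
move=> N0 y0; have NR : 0 < N%:R :> R by rewrite ltr0n.
have a0 : 0 <= N%:R ^+ k.+1 * y by rewrite mulr_ge0// exprn_ge0// ltW.
have /andP[h1 h2] := truncn_itv a0; set m := Num.truncn _ in h1 h2 *.
apply/esym/truncn_def; apply/andP; split.
  rewrite -(ler_pM2l NR) mulrA -exprS; apply: le_trans h1.
  by rewrite -natrM ler_nat mulnC leq_divM.
rewrite -(ltr_pM2l NR) mulrA -exprS; apply: (lt_le_trans h2).
by rewrite -natrM ler_nat mulnC ltn_ceil.
Qed.

(* A tree with [N] disjoint branches at each node and lengths at least [l0 * q ^+ k]
   at level [k]: an interval shorter than the nodes of level [k] meets at most two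
   of them, namely those containing one of its ends; reading [N]-adic digits along
   the branches turns a cover of the limit set into a cover of [0, 1]. *)
Lemma cantor_cover (X : Type) (lo hi : X -> R) (P : nat -> X -> Prop) (x0 : X)
    (N : nat) (q l0 s : R) (K : set R) :
  (0 < N)%N -> 0 < q < 1 -> 0 < l0 -> 0 <= s -> N%:R^-1 <= q `^ s -> P 0%N x0 ->
  (forall k x, P k x -> lo x + l0 * q ^+ k <= hi x) ->
  (forall k x, P k x -> exists ch : nat -> X,
    (forall i, (i < N)%N -> [/\ P k.+1 (ch i), lo x <= lo (ch i) & hi (ch i) <= hi x]) /\
    (forall i j t, (i < N)%N -> (j < N)%N -> lo (ch i) <= t <= hi (ch i) ->
       lo (ch j) <= t <= hi (ch j) -> i = j)) ->
  (forall t, (forall k, exists2 x, P k x & lo x <= t <= hi x) -> K t) ->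
  forall A B : nat -> R, (forall i, A i < B i) ->
  (forall t, K t -> exists i, A i <= t <= B i) ->
  (1 <= \sum_(0 <= i <oo) (2 * (N%:R * ((B i - A i) / l0) `^ s))%:E)%E.
Proof.
move=> N0 /andP[q0 q1] l00 s0 Nq P0 Plen Pch PK A B AB cov.
have NR : 0 < N%:R :> R by rewrite ltr0n.
have [ch Hch] : exists ch : nat -> X -> nat -> X, forall k x, P k x ->
    (forall i, (i < N)%N -> [/\ P k.+1 (ch k x i), lo x <= lo (ch k x i) & hi (ch k x i) <= hi x]) /\
    (forall i j t, (i < N)%N -> (j < N)%N -> lo (ch k x i) <= t <= hi (ch k x i) ->
       lo (ch k x j) <= t <= hi (ch k x j) -> i = j).
  have : forall kx : nat * X, exists ch : nat -> X, P kx.1 kx.2 ->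
    (forall i, (i < N)%N -> [/\ P kx.1.+1 (ch i), lo kx.2 <= lo (ch i) & hi (ch i) <= hi kx.2]) /\
    (forall i j t, (i < N)%N -> (j < N)%N -> lo (ch i) <= t <= hi (ch i) ->
       lo (ch j) <= t <= hi (ch j) -> i = j).
    move=> [k x] /=; have [/Pch[ch H]|nP] := pselect (P k x); first by exists ch.
    by exists (fun _ => x).
  by move=> /choice[f Hf]; exists (fun k x => f (k, x)) => k x; exact: Hf (k, x).
(* Level [k] is numbered by the [j] below [N ^ k], and the parent of [j] is [j %/ N]: the base [N]
   digits of [j] are the path from the root. *)
pose node := fix node k j := if k is k'.+1 then ch k' (node k' (j %/ N)%N) (j %% N)%N else x0.
have nodeP k j : P k (node k j).
  elim: k j => //= k IH j; have [H _] := Hch k _ (IH (j %/ N)%N).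
  by have [] := H (j %% N)%N (ltn_pmod _ N0).
have nest k j : lo (node k (j %/ N)%N) <= lo (node k.+1 j) /\
    hi (node k.+1 j) <= hi (node k (j %/ N)%N).
  have [H _] := Hch k _ (nodeP k (j %/ N)%N).
  by have [] := H (j %% N)%N (ltn_pmod _ N0).
have inj k j j' t : (j < N ^ k)%N -> (j' < N ^ k)%N ->
    lo (node k j) <= t <= hi (node k j) -> lo (node k j') <= t <= hi (node k j') -> j = j'.
  elim: k j j' => [|k IH] j j'; first by rewrite expn0 !ltnS !leqn0 => /eqP-> /eqP->.
  move=> jN jN' /andP[t1 t2] /andP[t3 t4].
  have [n1 n2] := nest k j; have [n3 n4] := nest k j'.
  have e : (j %/ N = j' %/ N)%N.
    apply: IH; rewrite ?ltn_divLR -?expnSr//; first by rewrite (le_trans n1 t1) (le_trans t2 n2).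
    by rewrite (le_trans n3 t3) (le_trans t4 n4).
  have [_ H] := Hch k _ (nodeP k (j %/ N)%N).
  have m : (j %% N = j' %% N)%N.
    by apply: (H _ _ t); rewrite ?ltn_pmod//; [rewrite t1 t2|rewrite e t3 t4].
  by rewrite (divn_eq j N) (divn_eq j' N) e m.
(* The number [y] follows the branch given by its first [k] digits in base [N]. *)
pose dig k (y : R) := Num.truncn (N%:R ^+ k * y).
have digN k y : 0 <= y < 1 -> (dig k y < N ^ k)%N.
  move=> /andP[y0 y1]; have Nk0 : 0 < N%:R ^+ k :> R by rewrite exprn_gt0.
  rewrite -(ltr_nat R) natrX; apply: (@le_lt_trans _ _ (N%:R ^+ k * y)).
    by rewrite truncn_le// mulr_ge0// ltW.
  by rewrite -[ltRHS]mulr1 ltr_pM2l.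
have pt y : 0 <= y < 1 -> exists t, forall k, lo (node k (dig k y)) <= t <= hi (node k (dig k y)).
  move=> y01; have y0 : 0 <= y by case/andP: y01.
  pose L k := lo (node k (dig k y)); pose H k := hi (node k (dig k y)).
  have dd k : (dig k.+1 y %/ N)%N = dig k y by exact: truncn_scale.
  have LS k : L k <= L k.+1 by have [] := nest k (dig k.+1 y); rewrite dd.
  have HS k : H k.+1 <= H k by have [] := nest k (dig k.+1 y); rewrite dd.
  have Lm k n : L k <= L (k + n)%N by elim: n => [|n IH]; rewrite ?addn0// addnS (le_trans IH).
  have Hm k n : H (k + n)%N <= H k by elim: n => [|n IH]; rewrite ?addn0// addnS (le_trans (HS _)).
  have LHk k : L k <= H k.
    have := Plen k _ (nodeP k (dig k y)); apply: le_trans.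
    by rewrite lerDl mulr_ge0 ?exprn_ge0// ltW.
  have LH k n : L k <= H n.
    by apply: (le_trans (Lm k n)); apply: (le_trans (LHk _)); rewrite addnC.
  exists (sup (range L)) => k; apply/andP; split.
    by apply: ub_le_sup; [exists (H 0%N) => _ [n _ <-]; exact: LH|exists k].
  by apply: ge_sup; [exists (L 0%N), 0%N|move=> _ [n _ <-]; exact: LH].
(* A level whose nodes are longer than the interval, while the interval is at least as long as the
   bound for the next level. Level 0, which has a single node, serves long intervals. *)
have scale i : exists k, l0 * q ^+ k.+1 <= B i - A i /\ (k = 0%N \/ B i - A i < l0 * q ^+ k).
  have r0 : 0 < B i - A i by rewrite subr_gt0.
  have q1' : 1 < q^-1 by rewrite invf_gt1.
  have [k0 hk0] : exists k, l0 * q ^+ k <= B i - A i.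
    have [|k hk] := @mu_pow_small R q^-1 q1' ((B i - A i) / l0); first by rewrite divr_gt0.
    by exists k; rewrite mulrC -ler_pdivlMr//; rewrite invrK in hk.
  have ex : exists k, l0 * q ^+ k <= B i - A i by exists k0.
  have [[|k] hk mk] := ex_minnP ex.
    exists 0%N; split; last by left.
    by apply: le_trans hk; rewrite ler_pM2l// expr0 expr1 ltW.
  exists k; split => //; right; rewrite ltNge; apply/negP => /mk.
  by rewrite ltnn.
have [kf Hkf] := choice scale.
have two i : exists jj : nat * nat, forall j t, (j < N ^ kf i)%N ->
    lo (node (kf i) j) <= t <= hi (node (kf i) j) -> A i <= t <= B i -> j = jj.1 \/ j = jj.2.
  have [k1 [k0|rk]] := Hkf i.
    by exists (0%N, 0%N) => j t; rewrite k0 expn0 ltnS leqn0 => /eqP->; left.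
  have sing (a : R) : exists j0, forall j, (j < N ^ kf i)%N -> lo (node (kf i) j) <= a <= hi (node (kf i) j) -> j = j0.
    have [[j0 [j0N h0]]|no] := pselect (exists j0, (j0 < N ^ kf i)%N /\ lo (node (kf i) j0) <= a <= hi (node (kf i) j0)).
      by exists j0 => j jN h; exact: (inj (kf i) _ _ a).
    by exists 0%N => j jN h; exfalso; apply: no; exists j.
  have [j1 h1] := sing (A i); have [j2 h2] := sing (B i).
  exists (j1, j2) => j t jN /andP[t1 t2] /andP[t3 t4].
  have len := Plen _ _ (nodeP (kf i) j).
  have [lA|Al] := lerP (lo (node (kf i) j)) (A i).
    by left; apply: h1 => //; rewrite lA (le_trans t3 t2).
  right; apply: h2 => //; rewrite (le_trans t1 t4)/=.
  by move: rk len Al; set a := lo _; set b := hi _; set d := l0 * _; flra.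
have [jj Hjj] := choice two.
pose cell k j : set (measurableTypeR R) := `[j%:R / N%:R ^+ k, j.+1%:R / N%:R ^+ k[%classic.
have mcell k j : measurable (cell k j) by exact: measurable_itv.
have leb_cell k j : lebesgue_measure (cell k j) = (N%:R ^- k)%:E :> \bar R.
  have Nk0 : 0 < (N%:R ^+ k)^-1 :> R by rewrite invr_gt0 exprn_gt0.
  rewrite /cell lebesgue_measure_itv/= lte_fin ltr_pM2r// ltr_nat ltnSn -EFinD.
  by congr (_%:E); rewrite -mulrBl -natr1 addrAC subrr add0r mul1r.
(* The numbers [y] whose limit point may lie in the [i]-th interval belong to two cells of length
   N^-k. *)
pose E i := cell (kf i) (jj i).1 `|` cell (kf i) (jj i).2.
have mE i : measurable (E i) by exact: measurableU.
have incell k y : 0 <= y -> cell k (dig k y) y.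
  move=> y0; have Nk0 : 0 < N%:R ^+ k :> R by rewrite exprn_gt0.
  rewrite /cell /= in_itv/= ler_pdivrMr// ltr_pdivlMr// mulrC.
  by apply: truncn_itv; rewrite mulr_ge0// ltW.
have sub : `[0, 1[%classic `<=` \bigcup_i E i.
  move=> y; rewrite /= in_itv/= => y01; have [t ht] := pt y y01.
  have [|i ABt] := cov t; first by apply: PK => k; exists (node k (dig k y)).
  exists i => //; have y0 : 0 <= y by case/andP: y01.
  have := Hjj i _ t (digN (kf i) y y01) (ht (kf i)) ABt.
  by case=> e; [left|right]; rewrite -e; exact: incell.
have m01 : measurable (`[0, 1[%classic : set (measurableTypeR R)) by exact: measurable_itv.
have := measure_sigma_subadditive lebesgue_measure mE m01 sub.
have m1 : lebesgue_measure (`[0, 1[%classic : set R) = 1%E :> \bar R.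
  by rewrite lebesgue_measure_itv/= lte_fin ltr01 oppr0 adde0.
rewrite [X in (X <= _)%E -> _](_ : _ = 1%E); last exact: m1.
move=> /le_trans; apply; apply: lee_nneseries => [i _ _|i _]; first exact: measure_ge0.
apply: (@le_trans _ _ ((N%:R ^- kf i)%:E + (N%:R ^- kf i)%:E)%E).
  rewrite -{1}(leb_cell (kf i) (jj i).1) -(leb_cell (kf i) (jj i).2).
  exact: measureU2.
rewrite -EFinD lee_fin -mulr2n -[leLHS]mulr_natl ler_pM2l//.
have [k1 _] := Hkf i.
have -> : N%:R ^- kf i = N%:R * N%:R ^- (kf i).+1 :> R.
  by rewrite exprS invfM mulrA mulfV ?mul1r// gt_eqF.
rewrite ler_pM2l//; apply: (@le_trans _ _ ((q ^+ (kf i).+1) `^ s)).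
  rewrite -exprVn; elim: (kf i).+1 => [|n IH]; first by rewrite !expr0 powR1.
  rewrite !exprS powRM ?exprn_ge0 ?(ltW q0)//.
  by apply: ler_pM => //; rewrite ?exprn_ge0// invr_ge0 ltW.
apply: ge0_ler_powR => //; rewrite ?nnegrE ?exprn_ge0 ?(ltW q0)//.
  by rewrite divr_ge0// ltW// subr_gt0.
by rewrite ler_pdivlMr// mulrC.
Qed.

End CantorCover.

Section PowR.
Context {R : realType}.
Implicit Types a s : R.

Lemma powR_gt1 a s : 1 < a -> 0 < s -> 1 < a `^ s.
Proof.
by move=> a1 s0; rewrite /powR gt_eqF ?(lt_trans ltr01)// expR_gt1 mulr_gt0// ln_gt0.
Qed.

Lemma powR_exprn a s n : 0 <= a -> (a ^+ n) `^ s = (a `^ s) ^+ n.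
Proof.
by move=> a0; elim: n => [|n IH]; rewrite ?expr0 ?powR1// !exprS powRM ?exprn_ge0// IH.
Qed.

Lemma powR_invr a s : 0 < a -> a^-1 `^ s = (a `^ s)^-1.
Proof.
move=> a0; apply: (mulIf (x := a `^ s)); first by rewrite gt_eqF// powR_gt0.
by rewrite -powRM ?invr_ge0 ?(ltW a0)// !mulVf ?gt_eqF ?powR_gt0// powR1.
Qed.

End PowR.

(** * Escaping points of the perturbed map on a slice *)

Section Slices.
Context {R : realType}.
Implicit Types (z q p c : R * R) (g : int * int).
Context (lam : R) (lam1 : 1 < lam).
Local Notation mu := (lam^-1).
Local Notation F := (Fm lam).

Let mu0 : 0 < mu. Proof. exact: mu_gt0. Qed.
Let mu1' : mu < 1. Proof. exact: mu_lt1. Qed.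
Let lm0 : 0 < lam - mu. Proof. by move: mu1' lam1; flra. Qed.
Let lam0 : 0 < lam. Proof. exact: lt_trans ltr01 lam1. Qed.

Context (FT : R * R -> R * R) (V : R * R -> Prop).

Hypothesis FT_close : forall e : R, 0 < e -> exists J0 : R, forall z, adm J0 e z ->
  [/\ V z, ds lam (FT z) (F z) <= e &
    forall z', adm J0 e z' -> fl z'.1 = fl z.1 -> fl z'.2 = fl z.2 ->
      ds lam (FT z) (FT z') <= (lam + e) * ds lam z z'].

(** The point at offset [t] in [uu] and [x] in [ss] from [p]; a slice is a line with [x] fixed. *)
Definition pt p (x t : R) : R * R :=
  (p.1 + (t + x) / (lam - mu), p.2 + (lam * t + mu * x) / (lam - mu)).

Lemma uu_pt p x t : uu lam (pt p x t) = uu lam p + t.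
Proof.
have e : (lam - mu) / (lam - mu) = 1 by rewrite mulfV// gt_eqF.
by rewrite /uu /pt /= -[t in RHS]mulr1 -e; ring.
Qed.

Lemma ss_pt p x t : ss lam (pt p x t) = ss lam p + x.
Proof.
have e : (lam - mu) / (lam - mu) = 1 by rewrite mulfV// gt_eqF.
by rewrite /ss /pt /= -[x in RHS]mulr1 -e; ring.
Qed.

Lemma ds_pt p x t t' : ds lam (pt p x t) (pt p x t') <= `|t - t'|.
Proof.
have e (a b : R) : a + t - (a + t') = t - t' by ring.
by apply/dsP; rewrite !uu_pt !ss_pt e // subrr normr0.
Qed.

Lemma ds_pt0 p x t (d : R) : `|x| <= d -> `|t| <= d -> ds lam (pt p x t) p <= d.
Proof.
have e (a b : R) : a + b - a = b by ring.
by move=> xd td; apply/dsP; rewrite uu_pt ss_pt !e.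
Qed.

Definition esc q : Prop := (forall n, V (iter n FT q)) /\
  (forall M : R, exists n0, forall n, (n0 <= n)%N -> M <= (iter n FT q).2 - (iter n FT q).1).

(** A node of level [k] is a parameter interval on which [k * m] iterates of [FT] make a crossing.
    The Lipschitz bound makes it at least [2 * rho / La ^+ (k * m)] long, and children are disjoint
    because they follow different words. *)
Theorem esc_slices (s Jmin : R) : 0 < s < 1 -> exists p (rho C : R),
  [/\ 0 < rho, 0 < C,
    forall q, ds lam q p <= rho -> fl q.1 = fl p.1 /\ Jmin <= q.2 - q.1 &
    forall x, `|x| <= rho -> forall A B : nat -> R, (forall i, A i < B i) ->
      (forall t, `|t| <= rho -> esc (pt p x t) -> exists i, A i <= t <= B i) ->
      (1 <= \sum_(0 <= i <oo) (C * (B i - A i) `^ s)%:E)%E].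
Proof.
move=> /andP[s0 s1].
(* Strictly between [lam] and lam^(1/s): the excess [eta] over [lam] pays for the perturbation,
   while [kap = La ^ s] is still below [lam], as the count of words requires. *)
pose La := (lam + lam `^ s^-1) / 2; pose eta := La - lam; pose kap := La `^ s.
have lams : lam < lam `^ s^-1.
  have s1' : 0 < s^-1 - 1 by rewrite subr_gt0 invf_gt1.
  by rewrite -mulr_powRB1 ?invr_gt0 ?(ltW lam0)// ltr_pMr// powR_gt1.
have eta0 : 0 < eta by rewrite /eta /La; move: lams; flra.
have LaE : lam + eta = La by rewrite /eta; ring.
have La1 : 1 < La by rewrite -LaE; move: lam1 eta0; flra.
have kap1 : 1 < kap by exact: powR_gt1.
have kapl : kap < lam.
  have -> : lam = (lam `^ s^-1) `^ s.
    by rewrite -powRrM mulVf ?gt_eqF// powRr1// ltW.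
  apply: gt0_ltr_powR => //; rewrite ?nnegrE ?powR_ge0 ?(ltW (lt_trans ltr01 La1))//.
  by rewrite /La; move: lams; flra.
pose D := 24 * (lam + 1) / (lam - mu).
have D0 : 0 < D by rewrite divr_gt0// mulr_gt0// addr_gt0.
(* A fine grid makes [r = D / qn] so small that the points that are not good have area less than 2,
   as [dense_exists] asks. *)
have [qn [qn1 hq]] : exists qn : nat, (1 < qn)%N /\ 16 * (D * qn%:R^-1) / (1 - mu) < 2.
  have m1 : 0 < 1 - mu by rewrite subr_gt0.
  pose a := 8 * D / (1 - mu); exists (Num.truncn a).+2; split => //.
  have h : a < (Num.truncn a).+2%:R by apply: lt_trans (truncnS_gt _) _; rewrite ltr_nat.
  have q0 : 0 < (Num.truncn a).+2%:R :> R by rewrite ltr0n.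
  rewrite ltr_pdivrMr// mulrA ltr_pdivrMr//.
  by move: h; rewrite /a ltr_pdivrMr//; flra.
pose w : R := qn%:R^-1; pose r : R := D * w.
have w0 : 0 < w by rewrite invr_gt0 ltr0n; exact: ltnW.
have w01 : 0 <= w < 1 by rewrite (ltW w0)/= invf_lt1 ?ltr1n// ltr0n ltnW.
have r0 : 0 < r by rewrite mulr_gt0.
have [c dc] := dense_exists lam1 qn1 (ltW r0) hq.
have hr : r = 24 * ((lam + 1) * w) / (lam - mu) by rewrite /r /D; ring.
have [b [n [gf [sq [L [rL sL Nsz uw Hs]]]]]] := horseshoe lam1 r0 w01 dc kap1 kapl.
have [J1 HJ] := block_lift lam1 w0 hr FT_close eta0 rL sL Hs.
set m := (n + rlen L)%N in Nsz HJ; set rho := 4 * ((lam + 1) * w).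
have rho0 : 0 < rho by rewrite !mulr_gt0// addr_gt0.
have N0 : (0 < size sq)%N.
  by rewrite -(ltr_nat R); apply: lt_le_trans Nsz; rewrite exprn_gt0// (lt_trans ltr01).
have [z0 sq0] : exists z0, z0 \in sq by case: (sq) N0 => // z0 ? _; exists z0; rewrite mem_head.
have [[/= l4 [gz0 _ nz0 _]] _] := Hs z0 sq0.
have m0 : (0 < m)%N.
  rewrite /m addn_gt0; apply/orP; left; rewrite lt0n; apply/eqP => n0.
  by move: l4; rewrite n0 expr0; flra.
pose CN := (lam + 1) / (lam - mu).
(* A starting level high enough for lifting the loops and for keeping the energy above [Jmin] on the
   whole box. *)
have [g0 Hg0] : exists g0, Num.max J1 (Jmin + `|(ctr c b).2 - (ctr c b).1| + 2 * (CN * rho)) <= (latJ g0)%:~R.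
  pose a := Num.max J1 (Jmin + `|(ctr c b).2 - (ctr c b).1| + 2 * (CN * rho)).
  exists (0, Num.ceil a); rewrite /latJ /= subr0; exact: ceil_ge.
move: Hg0; rewrite ge_max => /andP[Jg0 Jg1].
pose p := tr (lat g0) (ctr c b).
pose q := La ^- m; pose l0 := 2 * rho.
have q01 : 0 < q < 1.
  by rewrite invr_gt0 exprn_gt0 ?(lt_trans ltr01)//= invf_lt1 ?exprn_egt1 ?exprn_gt0 ?(lt_trans ltr01)// -lt0n.
have l00 : 0 < l0 by rewrite mulr_gt0.
pose C := 2 * ((size sq)%:R * l0^-1 `^ s).
exists p, rho, C; split => //.
- by rewrite !mulr_gt0 ?ltr0n// powR_gt0// invr_gt0.
- move=> y yp; have [c1 c2] := coord_ds lam1 yp.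
  split.
    (* The box meets no vertical wall: it lies around a point near the good point [z0], which is at
       distance [r] from the walls, and its extent is a fraction of [r]. *)
    have F1 : far r (tr (lat g0) z0).1 by rewrite far_lat; have := (gz0 0%N).2; rewrite mulr1.
    have wr : w <= r / 24.
      have gen (X Y : R) : 24 * X * Y / 24 = X * Y by field.
      by rewrite hr gen ler_pdivlMr// mulrC ler_pM2r//; move: mu0; flra.
    have n1 : `|p.1 - (tr (lat g0) z0).1| <= r / 24.
      apply: le_trans wr; have [h _] := near_tr (lat g0) nz0; by rewrite distrC.
    have n2 : `|y.1 - p.1| <= r / 3.
      have [h1 h2] := (dsP lam y p rho).1 yp.
      rewrite -(ler_pM2l lm0) -{1}(gtr0_norm lm0) -normrM (uuss1 lam).
      apply: (le_trans (ler_normD _ _)); apply: (le_trans (lerD h1 h2)).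
      have E : (lam - mu) * r = 24 * ((lam + 1) * w) by rewrite hr mulrC divfK// gt_eqF.
      by rewrite mulrA E /rho; set B := (lam + 1) * w; flra.
    have [|_ ->] := far_close (y := p.1) r0 F1; first by move: n1 r0; flra.
    have [|_ ->//] := far_close (y := y.1) r0 F1.
    by move: n1 n2 r0; rewrite !ler_norml; flra.
  have E : p.2 - p.1 = (ctr c b).2 - (ctr c b).1 + (latJ g0)%:~R.
    by rewrite /p /tr /lat /latJ /= intrB; ring.
  have h := ler_norm (- ((ctr c b).2 - (ctr c b).1)); rewrite normrN in h.
  by move: c1 c2 Jg1 E h; rewrite -/CN !ler_norml; set K := CN * rho; flra.
move=> x xr A B AB cov.
(* A node carries its lattice position and its parameter interval. The lower bound [j%:R] for the
   energy during block [j] is what makes limit points escape. *)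
pose P k (X : (int * int) * (R * R)) :=
  [/\ crossing lam w c b X.1 (iter (k * m) FT \o pt p x) (La ^+ (k * m)) X.2.1 X.2.2,
      J1 + k%:R <= (latJ X.1)%:~R, - rho <= X.2.1 /\ X.2.2 <= rho &
      forall j, (j < k)%N -> forall t, X.2.1 <= t <= X.2.2 ->
        ready FT V j%:R m (iter (j * m) FT (pt p x t))].
pose K := [set t | `|t| <= rho /\ esc (pt p x t)].
have ler_scale : forall i, C * (B i - A i) `^ s = 2 * ((size sq)%:R * ((B i - A i) / l0) `^ s).
  move=> i; have AB0 : 0 <= B i - A i by rewrite subr_ge0 ltW.
  by rewrite powRM ?invr_ge0 ?(ltW l00)// /C; ring.
rewrite (eq_eseriesr (g := fun i => (2 * ((size sq)%:R * ((B i - A i) / l0) `^ s))%:E)); last first.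
  by move=> i _; rewrite ler_scale.
apply: (@cantor_cover _ _ (fun X => X.2.1) (fun X => X.2.2) P (g0, (- rho, rho)) _ q l0 s K) => //.
- exact: ltW.
- rewrite /q -exprVn; apply: (@le_trans _ _ (kap ^- m)).
    rewrite lef_pV2 ?posrE ?ltr0n ?exprn_gt0 ?(lt_trans ltr01)//.
  have La0 : 0 < La := lt_trans ltr01 La1.
  by rewrite powR_exprn ?invr_ge0 ?(ltW La0)// powR_invr// exprVn.
- split => //=.
  + split => //=.
    * by move: rho0; flra.
    * by rewrite -/p -/rho !uu_pt; split; rewrite addrAC subrr add0r.
    * by move=> t t0; apply: ds_pt0; rewrite // ler_norml.
    * by move=> t t' _ _; rewrite mul0n expr0 mul1r; exact: ds_pt.
  + by rewrite addr0.
- move=> k X [[aa [u1 u2] _ H] _ _ _].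
  have Lk : 0 < La ^+ (k * m) by rewrite exprn_gt0// (lt_trans ltr01).
  have i1 : X.2.1 <= X.2.1 <= X.2.2 by rewrite lexx ltW.
  have i2 : X.2.1 <= X.2.2 <= X.2.2 by rewrite lexx ltW.
  have [h _] := (dsP _ _ _ _).1 (H _ _ i2 i1).
  have {}h := le_trans (ler_norm _) h.
  rewrite [`|_ - _|]gtr0_norm ?subr_gt0// in h.
  have -> : l0 * q ^+ k = l0 / La ^+ (k * m) by rewrite /q mulnC exprM exprVn.
  rewrite -lerBrDl ler_pdivrMr// mulrC; apply: le_trans h.
  by rewrite /l0; move: u1 u2; rewrite -/rho; flra.
- move=> k X [cr Jk [b1 b2] rd].
  have La0 : 0 <= La ^+ (k * m) by rewrite exprn_ge0// ltW// (lt_trans ltr01).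
  have J1k : J1 <= (latJ X.1)%:~R by apply: le_trans Jk; rewrite lerDl.
  pose z i := nth z0 sq i.
  have : forall i, exists X', (i < size sq)%N -> [/\ P k.+1 X', X.2.1 <= X'.2.1, X'.2.2 <= X.2.2 &
     forall t, X'.2.1 <= t <= X'.2.2 -> itin lam FT X.1 n (z i) (iter (k * m) FT (pt p x t))].
    move=> i; have [isz|] := ltnP i (size sq); last by exists X.
    have zi : z i \in sq by rewrite mem_nth.
    have [t [t' [g' [t1 t2 Jg' cr' H]]]] := HJ _ zi _ _ _ _ _ J1k La0 cr.
    exists (g', (t, t')) => _; split => //=; last by move=> u /H[].
    split => /=.
    + have fE : iter (k.+1 * m) FT \o pt p x = iter m FT \o (iter (k * m) FT \o pt p x).
        by apply/funext => u /=; rewrite mulSn iterD.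
      have KE : La ^+ (k.+1 * m) = La ^+ (k * m) * (lam + eta) ^+ m.
        by rewrite LaE mulSn addnC exprD.
      by rewrite fE KE.
    + rewrite -natr1; move: Jk Jg'; rewrite -(ler_int R) intrD; flra.
    + by rewrite (le_trans b1 t1) (le_trans t2 b2).
    + move=> j; rewrite ltnS leq_eqVlt => /orP[/eqP->|jk] u hu.
        have [_ rdu] := H u hu; move=> i' /rdu[v1 v2]; split => //.
        by apply: le_trans v2; move: Jk; flra.
      by apply: rd => //; move: hu => /andP[h1 h2]; rewrite (le_trans t1 h1) (le_trans h2 t2).
  move=> /choice[ch Hch]; exists ch; split.
    by move=> i /Hch[].
  move=> i j t iN jN ti tj.
  have [_ _ _ /(_ t ti) it1] := Hch i iN; have [_ _ _ /(_ t tj) it2] := Hch j jN.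
  apply/eqP; rewrite -(nth_uniq [::] _ _ uw) ?size_map//; apply/eqP.
  rewrite !(nth_map z0)//; apply/wordP => i' i'n.
  by have := it1 i' i'n; rewrite it2// => /addIr.
- move=> t ht; have [X [_ _ [b1 b2] _] /andP[t1 t2]] := ht 0%N.
  split; first by rewrite ler_norml (le_trans b1 t1) (le_trans t2 b2).
  have rdk k : ready FT V k%:R m (iter (k * m) FT (pt p x t)).
    by have [X' [_ _ _ rd] t'] := ht k.+1; apply: rd.
  split => [i|M].
    have := rdk (i %/ m)%N (i %% m)%N; rewrite ltn_mod m0 -iterD addnC -divn_eq.
    by move=> /(_ isT)[].
  exists ((Num.truncn M).+1 * m)%N => i iM.
  have := rdk (i %/ m)%N (i %% m)%N; rewrite ltn_mod m0 -iterD addnC -divn_eq.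
  move=> /(_ isT)[_ h]; apply: le_trans h; apply: (@le_trans _ _ (Num.truncn M).+1%:R).
    exact: ltW (truncnS_gt _).
  by rewrite ler_nat leq_divRL.
- by move=> t [tr' et]; apply: cov.
Qed.

End Slices.

(** * One flight of the particle *)

Section Remainders.
Context {R : realType}.
Implicit Types (f g : R * R -> R) (q : R * R) (D : set (R * R)).

Definition d1 q q' : R := `|q.1 - q'.1| + `|q.2 - q'.2|.

Lemma d1_ge0 q q' : 0 <= d1 q q'. Proof. by rewrite addr_ge0. Qed.

(* Bounded functions on [D] whose local Lipschitz constant at [q] is of order
   [1 / wt q]. *)
Definition Cl (wt : R * R -> R) D f : Prop := exists2 C : R, 0 <= C &
  forall q q', D q -> D q' -> `|f q| <= C /\ wt q * `|f q - f q'| <= C * d1 q q'.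

Section Closure.
Context (wt : R * R -> R) (D : set (R * R)) (wt0 : forall q, D q -> 0 <= wt q).

Lemma Cl_cst (a : R) : Cl wt D (fun=> a).
Proof.
exists `|a| => // q q' _ _; split => //.
by rewrite subrr normr0 mulr0 mulr_ge0// d1_ge0.
Qed.

Lemma Cl_add f g : Cl wt D f -> Cl wt D g -> Cl wt D (fun q => f q + g q).
Proof.
move=> [C C0 Cf] [C' C'0 Cg]; exists (C + C'); first exact: addr_ge0.
move=> q q' Dq Dq'; have [a b] := Cf q q' Dq Dq'; have [c d] := Cg q q' Dq Dq'; split.
  exact: le_trans (ler_normD _ _) (lerD a c).
apply: (@le_trans _ _ (wt q * `|f q - f q'| + wt q * `|g q - g q'|)).
  by rewrite -mulrDr ler_wpM2l ?wt0// opprD addrACA ler_normD.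
by rewrite mulrDl lerD.
Qed.

Lemma Cl_mul f g : Cl wt D f -> Cl wt D g -> Cl wt D (fun q => f q * g q).
Proof.
move=> [C C0 Cf] [C' C'0 Cg]; exists (2 * (C * C')); first by rewrite !mulr_ge0.
move=> q q' Dq Dq'; have [a b] := Cf q q' Dq Dq'; have [c d] := Cg q q' Dq Dq'; split.
  rewrite normrM; apply: (@le_trans _ _ (C * C')); first exact: ler_pM.
  by rewrite ler_peMl ?mulr_ge0// ler1n.
have [a' _] := Cf q' q Dq' Dq.
apply: (@le_trans _ _ ((wt q * `|f q - f q'|) * `|g q| + `|f q'| * (wt q * `|g q - g q'|))).
  rewrite mulrAC [`|f q'| * _]mulrCA -!mulrA -mulrDr ler_wpM2l ?wt0// -!normrM.
  rewrite (_ : f q * g q - _ = g q * (f q - f q') + f q' * (g q - g q')); last by ring.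
  exact: ler_normD.
apply: (@le_trans _ _ (C * d1 q q' * C' + C * (C' * d1 q q'))).
  by apply: lerD; apply: ler_pM => //; rewrite mulr_ge0// wt0.
by rewrite le_eqVlt; apply/orP; left; apply/eqP; ring.
Qed.

Lemma Cl_opp f : Cl wt D f -> Cl wt D (fun q => - f q).
Proof.
move=> [C C0 Cf]; exists C => // q q' Dq Dq'; have [a b] := Cf q q' Dq Dq'.
by rewrite normrN -opprD normrN.
Qed.

Lemma Cl_sub f g : Cl wt D f -> Cl wt D g -> Cl wt D (fun q => f q - g q).
Proof. by move=> Cf Cg; apply: Cl_add => //; exact: Cl_opp. Qed.

Lemma Cl_ext f g : (forall q, D q -> f q = g q) -> Cl wt D f -> Cl wt D g.
Proof. by move=> fg [C C0 H]; exists C => // q q' Dq Dq'; rewrite -!fg//; exact: H. Qed.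

End Closure.

Lemma Cl_weaken (wt : R * R -> R) D f (M : R) : (forall q, D q -> wt q <= M) -> 0 <= M ->
  Cl (fun=> 1) D f -> Cl wt D f.
Proof.
move=> wM M0 [C C0 H]; exists (C * (M + 1)); first by rewrite mulr_ge0// addr_ge0.
move=> q q' Dq Dq'; have [a b] := H q q' Dq Dq'; rewrite mul1r in b; split.
  by apply: (le_trans a); rewrite ler_peMr// lerDr.
apply: (@le_trans _ _ ((M + 1) * (C * d1 q q'))); last by rewrite mulrCA mulrA.
apply: (@le_trans _ _ ((M + 1) * `|f q - f q'|)).
  by rewrite ler_wpM2r// (le_trans (wM q Dq))// lerDl.
by rewrite ler_wpM2l// addr_ge0.
Qed.

Lemma Cl_pre D D' f (phi : R * R -> R * R) :
  (forall q, D' q -> D (phi q)) ->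
  (forall q q', D' q -> D' q' -> d1 (phi q) (phi q') <= d1 q q') ->
  Cl (fun=> 1) D f -> Cl (fun=> 1) D' (fun q => f (phi q)).
Proof.
move=> H1 H2 [C C0 H]; exists C => // q q' Dq Dq'.
have [a b] := H _ _ (H1 q Dq) (H1 q' Dq'); split => //.
by apply: (le_trans b); rewrite ler_wpM2l// H2.
Qed.

Lemma MVT_bound (f df : R -> R) (a b C : R) : a <= b ->
  (forall x, a <= x <= b -> is_derive x 1 f (df x)) ->
  (forall x, a <= x <= b -> `|df x| <= C) -> `|f b - f a| <= C * (b - a).
Proof.
move=> ab dfx bd.
have [||c cab ->] := @MVT_segment R f df a b ab.
- by move=> x; rewrite in_itv/= => /andP[x1 x2]; apply: dfx; rewrite !ltW.
- apply: derivable_within_continuous => x; rewrite in_itv/= => xab.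
  exact: (@ex_derive _ _ _ _ _ _ _ (dfx x xab)).
rewrite normrM [`|b - a|]ger0_norm ?subr_ge0// ler_wpM2r ?subr_ge0//.
by apply: bd; move: cab; rewrite in_itv.
Qed.

Lemma is_derive_scale (f : R -> R) (a c x df : R) :
  is_derive (x * a) 1 f df -> is_derive x 1 (fun r => f (r * a) * c) (a * df * c).
Proof.
move=> H.
have H1 : is_derive x 1 (fun r : R => r * a) a.
  have := @is_deriveM R R id (cst a) x 1 1 0 (is_derive_id _ _) (is_derive_cst _ _ _).
  by rewrite scaler0 add0r -[a *: 1]/(a * 1) mulr1.
have H2 : is_derive x 1 (f \o (fun r : R => r * a)) (df * a) by exact: (@is_derive1_comp R f (fun r : R => r * a) x df a H H1).
have H3 := @is_deriveM R R (f \o (fun r : R => r * a)) (cst c) x 1 _ 0 H2 (is_derive_cst _ _ _).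
apply: (is_derive_eq H3); rewrite scaler0 add0r -[c *: _]/(c * _).
by rewrite mulrC [df * a]mulrC.
Qed.

(* A function with derivative [h ^ k * W], [W] bounded Lipschitz, which vanishes at
   [h = 0] is [h ^ (k + 1) * W1] with [W1] bounded Lipschitz. *)
Lemma remainder_int D (k : nat) (N N' : R -> R -> R) (W : R * R -> R) :
  (forall q, D q -> 0 < q.2) ->
  (forall q (r : R), D q -> 0 < r <= 1 -> D (q.1, r * q.2)) ->
  (forall q, D q -> is_derive q.2 1 (N q.1) (N' q.1 q.2)) ->
  (forall q, D q -> N q.1 (r * q.2) @[r --> 0^'+] --> (0 : R)) ->
  (forall q, D q -> N' q.1 q.2 = q.2 ^+ k * W q) -> Cl (fun=> 1) D W ->
  exists2 W1, Cl (fun=> 1) D W1 & forall q, D q -> N q.1 q.2 = q.2 ^+ k.+1 * W1 q.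
Proof.
move=> D0 Ds dN N0 N'W [C C0 CW].
(* The rescaled primitive. Its derivative in [r] is r^k times [W], so the mean value inequality on
   (0, 1] bounds both [W1] and its differences. *)
pose G q r := N q.1 (r * q.2) * q.2 ^- k.+1.
have dG q (r : R) : D q -> 0 < r <= 1 -> is_derive r 1 (G q) (r ^+ k * W (q.1, r * q.2)).
  move=> Dq r01; have Dr := Ds q r Dq r01; have q0 := D0 q Dq.
  have H := @is_derive_scale (N q.1) q.2 (q.2 ^- k.+1) r _ (dN _ Dr).
  apply: (is_derive_eq H); have /= -> := N'W _ Dr.
  by rewrite exprMn exprS; field; rewrite lt0r_neq0 ?exprn_gt0//=; exact: lt0r_neq0.
have G0 q : D q -> G q r @[r --> 0^'+] --> (0 : R).
  move=> Dq; rewrite -[X in _ --> X](mul0r (q.2 ^- k.+1)).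
  by apply: cvgMl; exact: N0.
have rk (r : R) : 0 < r <= 1 -> 0 <= r ^+ k <= 1.
  by move=> /andP[r0 r1]; rewrite exprn_ge0 ?(ltW r0)// exprn_ile1// ltW.
have key (f df : R -> R) (K : R) : (forall r : R, 0 < r <= 1 -> is_derive r 1 f (df r)) ->
    (forall r : R, 0 < r <= 1 -> `|df r| <= K) -> f r @[r --> 0^'+] --> (0 : R) -> `|f 1| <= K.
  move=> dfr bd f0; have K0 : 0 <= K by apply: le_trans (bd 1 _); rewrite ?ltr01 ?lexx.
  apply/ler_addgt0Pr => e e0.
  have : \forall r \near 0^'+, `|f r| <= e.
    by move/cvgrPdist_le: f0 => /(_ e e0); apply: filterS => r; rewrite sub0r normrN.
  move=> fe.
  have [r [r0 r1 fr]] : exists r, [/\ 0 < r, r < 1 & `|f r| <= e].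
    near (0 : R)^'+ => r; exists r; split; [by []|by []|near: r; exact: fe].
  have h : `|f 1 - f r| <= K * (1 - r).
    apply: (@MVT_bound f df) => [|x /andP[x1 x2]|x /andP[x1 x2]]; first exact: ltW.
      by apply: dfr; rewrite x2 (lt_le_trans r0).
    by apply: bd; rewrite x2 (lt_le_trans r0).
  apply: (@le_trans _ _ (`|f 1 - f r| + `|f r|)).
    by rewrite -{1}(subrK (f r) (f 1)) ler_normD.
  by apply: lerD => //; apply: (le_trans h); rewrite ler_piMr// gerBl ltW.
exists (fun q => G q (1 : R)); last first.
  move=> q Dq; rewrite /G mul1r mulrCA mulfV ?mulr1//.
  by rewrite expf_neq0// gt_eqF// D0.
exists C => // q q' Dq Dq'; split.
  apply: (key _ _ _ (fun r => dG q r Dq) _ (G0 q Dq)) => r r01.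
  have [h _] := CW _ _ (Ds q r Dq r01) Dq; have /andP[k0 k1] := rk r r01.
  by rewrite normrM (ger0_norm k0) -[C]mul1r; apply: ler_pM.
rewrite mul1r.
apply: (key (fun r => G q r - G q' r) (fun r => r ^+ k * W (q.1, r * q.2) - r ^+ k * W (q'.1, r * q'.2))).
- by move=> r r01; apply: is_deriveB; exact: dG.
- move=> r r01; have [_ h] := CW _ _ (Ds q r Dq r01) (Ds q' r Dq' r01).
  have /andP[k0 k1] := rk r r01; rewrite mul1r in h.
  rewrite -mulrBr normrM (ger0_norm k0); apply: (@le_trans _ _ (1 * (C * d1 (q.1, r * q.2) (q'.1, r * q'.2)))).
    by apply: ler_pM.
  rewrite mul1r ler_wpM2l// /d1 /= lerD2l -mulrBr normrM; move: r01 => /andP[r0 r1].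
  by rewrite (gtr0_norm r0) ler_piMl.
- rewrite -[X in _ --> X](subr0 (0 : R)); apply: cvgB; exact: G0.
Unshelve. all: by end_near.
Qed.

End Remainders.

(** * Taylor expansions with bounded Lipschitz remainders *)

Section UnitInterval.
Context {R : realType}.
Implicit Types (f df : R -> R) (q : R * R).
Local Notation one := (fun=> 1 : R).

(** Functions of one variable are treated as functions of the second coordinate, so that the
    calculus of [Cl] applies to them. [D1] is the set of pairs (departure time, duration) of flights
    inside one period. *)
Definition DU : set (R * R) := [set q | 0 < q.2 < 1].
Definition D1 : set (R * R) := [set q | [/\ 0 < q.1, 0 < q.2 & q.1 + q.2 < 1]].

Definition BL f : Prop := Cl one DU (fun q => f q.2).

Let one0 D : forall q, D q -> 0 <= (1 : R). Proof. by []. Qed.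

Lemma BLP f (C : R) : 0 <= C -> (forall x : R, 0 < x < 1 -> `|f x| <= C) ->
  (forall x y : R, 0 < x < 1 -> 0 < y < 1 -> `|f x - f y| <= C * `|x - y|) -> BL f.
Proof.
move=> C0 H1 H2; exists C => // q q' Dq Dq'; split; first exact: H1.
by rewrite mul1r (le_trans (H2 _ _ Dq Dq'))// ler_wpM2l// lerDr.
Qed.

Lemma BL_pre f (D : set (R * R)) (phi : R * R -> R) : BL f ->
  (forall q, D q -> 0 < phi q < 1) ->
  (forall q q', D q -> D q' -> `|phi q - phi q'| <= d1 q q') ->
  Cl one D (fun q => f (phi q)).
Proof.
move=> Bf H1 H2; apply: (@Cl_pre _ DU D (fun q => f q.2) (fun q => (0, phi q)) H1 _ Bf).
by move=> q q' Dq Dq'; rewrite /d1 /= subrr normr0 add0r; exact: H2.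
Qed.

Lemma BL_mul f g : BL f -> BL g -> BL (fun x => f x * g x).
Proof. by move=> Bf Bg; apply: (Cl_mul _ Bf Bg). Qed.

Lemma BL_add f g : BL f -> BL g -> BL (fun x => f x + g x).
Proof. by move=> Bf Bg; apply: (Cl_add _ Bf Bg). Qed.

Lemma BL_cst (a : R) : BL (fun=> a).
Proof. exact: Cl_cst. Qed.

Lemma BL_mirror f : BL f -> BL (fun x => f (1 - x)).
Proof.
move=> Bf; apply: (@BL_pre f DU (fun q => 1 - q.2)) => // [q|q q' _ _].
  by move=> /andP[a b]; apply/andP; split; flra.
rewrite (_ : 1 - q.2 - _ = - (q.2 - q'.2)); last by ring.
by rewrite normrN lerDr.
Qed.

Lemma BL_ext f g : (forall x : R, 0 < x < 1 -> f x = g x) -> BL f -> BL g.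
Proof. by move=> fg; apply: Cl_ext => q; exact: fg. Qed.

Lemma BL_inv f (c : R) : 0 < c -> (forall x : R, 0 < x < 1 -> c <= f x) -> BL f ->
  BL (fun x => (f x)^-1).
Proof.
move=> c0 cf [C C0 H].
have Hxy (x y : R) : 0 < x < 1 -> 0 < y < 1 -> `|f x - f y| <= C * `|x - y|.
  move=> hx hy; have [_] := H (0, x) (0, y) hx hy.
  by rewrite mul1r /d1 /= subrr normr0 add0r.
apply: (@BLP _ (c^-1 + C * c^-1 * c^-1)).
- by rewrite addr_ge0 ?mulr_ge0// ?invr_ge0 ltW.
- move=> x hx; have fx := cf x hx; have f0 := lt_le_trans c0 fx.
  rewrite gtr0_norm ?invr_gt0//; apply: (@le_trans _ _ c^-1); first by rewrite lef_pV2.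
  by rewrite lerDl !mulr_ge0// ?invr_ge0 ltW.
- move=> x y hx hy; have fx := cf x hx; have f0 := lt_le_trans c0 fx.
  have fy := cf y hy; have f0' := lt_le_trans c0 fy.
  rewrite (_ : (f x)^-1 - (f y)^-1 = (f y - f x) * ((f x)^-1 * (f y)^-1)); last first.
    by field; rewrite !gt_eqF.
  rewrite normrM distrC; apply: (@le_trans _ _ (C * `|x - y| * (c^-1 * c^-1))).
    apply: ler_pM => //; first exact: Hxy.
    by rewrite gtr0_norm ?mulr_gt0 ?invr_gt0//; apply: ler_pM; rewrite ?lef_pV2 ?invr_ge0 ?(ltW f0) ?(ltW f0').
  rewrite mulrAC; apply: ler_wpM2r => //; rewrite mulrA lerDr invr_ge0; exact: ltW.
Qed.

Lemma BL_derive f df : (forall x : R, 0 < x < 1 -> is_derive x 1 f (df x)) ->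
  (exists C : R, forall x : R, 0 < x < 1 -> `|f x| <= C) ->
  (exists C : R, forall x : R, 0 < x < 1 -> `|df x| <= C) -> BL f.
Proof.
move=> dfx [C0 H0] [C1 H1].
have h2 : (0 < (2^-1 : R)) && ((2^-1 : R) < 1) by flra.
have C00 := le_trans (normr_ge0 _) (H0 _ h2); have C10 := le_trans (normr_ge0 _) (H1 _ h2).
have main (x y : R) : 0 < x < 1 -> 0 < y < 1 -> x <= y -> `|f y - f x| <= (C0 + C1) * (y - x).
  move=> hx hy xy; apply: (@le_trans _ _ (C1 * (y - x))).
    apply: (@MVT_bound _ f df) => // z /andP[z1 z2]; [apply: dfx|apply: H1];
    by move: hx hy => /andP[? _] /andP[_ ?]; apply/andP; split; flra.
  by rewrite ler_wpM2r ?subr_ge0// lerDr.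
apply: (@BLP _ (C0 + C1)); first exact: addr_ge0.
  by move=> x /H0 h; apply: (le_trans h); rewrite lerDl.
move=> x y hx hy; have [xy|yx] := lerP x y.
  by rewrite distrC main.
by rewrite main// ltW.
Qed.

Lemma is_derive_shift f (df a x c0 c1 c2 : R) : is_derive (a + x) 1 f df ->
  is_derive x 1 (fun h => f (a + h) + (c0 + c1 * h + c2 * h ^+ 2)) (df + (c1 + 2 * c2 * x)).
Proof.
move=> H.
have H1 : is_derive x 1 (fun h : R => a + h) 1.
  by apply: (is_derive_eq (is_deriveD (is_derive_cst a x 1) (is_derive_id x 1))); rewrite add0r.
have H2 := @is_derive1_comp R f (fun h : R => a + h) x df 1 H H1.
have H3 : is_derive x 1 (fun h : R => c0 + c1 * h + c2 * h ^+ 2) (c1 + 2 * c2 * x).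
  have e1 := is_deriveM (is_derive_cst c1 x 1) (is_derive_id x 1).
  have e2 := is_deriveM (is_derive_cst c2 x 1) (is_deriveX 2 (is_derive_id x 1)).
  have e3 := is_deriveD (is_deriveD (is_derive_cst c0 x 1) e1) e2.
  apply: (is_derive_eq e3); rewrite /= !scaler0 !addr0 add0r.
  by rewrite /GRing.scale /= /cst; ring.
by apply: (is_derive_eq (is_deriveD H2 H3)); rewrite mulr1.
Qed.

Lemma is_derive_cont f (x df : R) : is_derive x 1 f df -> f y @[y --> x] --> f x.
Proof.
by move=> [H _]; apply: differentiable_continuous; apply/derivable1_diffP.
Qed.

Lemma remainder_D1 (k : nat) (N N' : R -> R -> R) (W : R * R -> R) :
  (forall a h : R, 0 < a -> 0 <= h -> a + h < 1 -> is_derive h 1 (N a) (N' a h)) ->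
  (forall a, N a 0 = 0) -> (forall q, D1 q -> N' q.1 q.2 = q.2 ^+ k * W q) -> Cl one D1 W ->
  exists2 W1, Cl one D1 W1 & forall q, D1 q -> N q.1 q.2 = q.2 ^+ k.+1 * W1 q.
Proof.
move=> dN N0 N'W CW; apply: (@remainder_int _ D1 k N N' W) => //.
- by move=> q [].
- move=> q r [q1 q2 q3] /andP[r0 r1]; split => //=; first exact: mulr_gt0.
  by apply: le_lt_trans q3; rewrite lerD2l ler_piMl// ltW.
- by move=> q [q1 q2 q3]; apply: dN => //; exact: ltW.
- move=> q [q1 q2 q3].
  have c0 : N q.1 y @[y --> (0 : R)] --> N q.1 0.
    by apply: (@is_derive_cont _ 0 (N' q.1 0)); apply: dN => //; rewrite addr0; flra.
  rewrite N0 in c0; apply: cvg_at_right_filter.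
  have lin : r * q.2 @[r --> (0 : R)] --> (0 : R).
    by rewrite -[X in _ --> X](mul0r q.2); apply: cvgMl; exact: cvg_id.
  exact: (cvg_comp _ _ lin c0).
Qed.

Lemma Cl_D1_end f : BL f -> Cl one D1 (fun q => f (q.1 + q.2)).
Proof.
move=> Bf; apply: (BL_pre (phi := fun q => q.1 + q.2)) => // [q [q1 q2 q3]|q q' _ _].
  by rewrite q3 addr_gt0.
by rewrite opprD addrACA ler_normD.
Qed.

Lemma Cl_D1_start f : BL f -> Cl one D1 (fun q => f q.1).
Proof.
move=> Bf; apply: (BL_pre (phi := fun q => q.1)) => // [q [q1 q2 q3]|q q' _ _].
  by apply/andP; split; flra.
by rewrite lerDl.
Qed.

Lemma Cl_D1_step : Cl one D1 (fun q => q.2).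
Proof.
exists 1 => // q q' [a b c] [a' b' c']; rewrite !mul1r lerDr normr_ge0 gtr0_norm//; split => //.
by flra.
Qed.

Lemma taylor1 f df : (forall x : R, 0 < x < 1 -> is_derive x 1 f (df x)) -> BL df -> exists2 W, Cl one D1 W &
  forall q, D1 q -> f (q.1 + q.2) = f q.1 + q.2 * W q.
Proof.
move=> df_f Bd.
pose N a h : R := f (a + h) + (- f a + 0 * h + 0 * h ^+ 2).
have [||||W1 CW1 H1] := @remainder_D1 0 N (fun a h => df (a + h)) (fun q => df (q.1 + q.2)).
- move=> a h a0 h0 ah; have ah' : 0 < a + h < 1 by rewrite ah ltr_wpDr.
  have := is_derive_shift (- f a) 0 0 (df_f _ ah').
  by move/is_derive_eq; apply; ring.
- by move=> a; rewrite /N addr0; ring.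
- by move=> q Dq; rewrite mul1r.
- exact: Cl_D1_end.
exists W1 => // q Dq; have := H1 q Dq; rewrite /N expr1 => <-; ring.
Qed.

Lemma taylor2 f df ddf : (forall x : R, 0 < x < 1 -> is_derive x 1 f (df x)) ->
  (forall x : R, 0 < x < 1 -> is_derive x 1 df (ddf x)) -> BL ddf ->
  exists2 W, Cl one D1 W &
  forall q, D1 q -> f (q.1 + q.2) = f q.1 + q.2 * df q.1 + q.2 ^+ 2 * W q.
Proof.
move=> d1f d2f Bd; have [W CW HW] := taylor1 d2f Bd.
pose N a h : R := f (a + h) + (- f a + (- df a) * h + 0 * h ^+ 2).
have [|||W1 CW1 H1] := @remainder_D1 1 N (fun a h => df (a + h) - df a) W _ _ _ CW.
- move=> a h a0 h0 ah; have ah' : 0 < a + h < 1 by rewrite ah ltr_wpDr.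
  have := is_derive_shift (- f a) (- df a) 0 (d1f _ ah').
  by move/is_derive_eq; apply; ring.
- by move=> a; rewrite /N addr0; ring.
- by move=> q Dq; rewrite HW// expr1; ring.
exists W1 => // q Dq; have := H1 q Dq; rewrite /N => <-; ring.
Qed.

Lemma taylor3 f df ddf dddf : (forall x : R, 0 < x < 1 -> is_derive x 1 f (df x)) ->
  (forall x : R, 0 < x < 1 -> is_derive x 1 df (ddf x)) ->
  (forall x : R, 0 < x < 1 -> is_derive x 1 ddf (dddf x)) -> BL dddf ->
  exists2 W, Cl one D1 W &
  forall q, D1 q -> f (q.1 + q.2) = f q.1 + q.2 * df q.1 + q.2 ^+ 2 / 2 * ddf q.1 + q.2 ^+ 3 * W q.
Proof.
move=> d1f d2f d3f Bd; have [W CW HW] := taylor2 d2f d3f Bd.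
pose N a h : R := f (a + h) + (- f a + (- df a) * h + (- (ddf a / 2)) * h ^+ 2).
have [|||W1 CW1 H1] := @remainder_D1 2 N (fun a h => df (a + h) - df a - h * ddf a) W _ _ _ CW.
- move=> a h a0 h0 ah; have ah' : 0 < a + h < 1 by rewrite ah ltr_wpDr.
  have := is_derive_shift (- f a) (- df a) (- (ddf a / 2)) (d1f _ ah').
  by move/is_derive_eq; apply; field.
- by move=> a; rewrite /N addr0; ring.
- by move=> q Dq; rewrite HW//; ring.
by exists W1 => // q Dq; have := H1 q Dq; rewrite /N => <-; field.
Qed.

(** An expansion from the end 0, where the value [c0] is known only as a one-sided limit; this is
    why [remainder_int] asks for a limit and not for a value. *)
Lemma edge_rem (k : nat) f df (c0 c1 : R) (W : R -> R) :
  (forall x : R, 0 < x < 1 -> is_derive x 1 f (df x)) -> f x @[x --> 0^'+] --> c0 ->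
  (forall x : R, 0 < x < 1 -> df x = c1 + x ^+ k * W x) -> BL W ->
  exists2 W1, BL W1 & forall x : R, 0 < x < 1 -> f x = c0 + c1 * x + x ^+ k.+1 * W1 x.
Proof.
move=> dff fc dfW BW.
pose N (_ h : R) := f (0 + h) + (- c0 + (- c1) * h + 0 * h ^+ 2).
have [|||||W1 CW1 H1] := @remainder_int _ DU k N (fun _ h => df h - c1) (fun q => W q.2) _ _ _ _ _ BW.
- by move=> q /andP[].
- move=> q r /andP[q0 q1] /andP[r0 r1]; rewrite /DU /= mulr_gt0//=.
  by apply: le_lt_trans q1; rewrite ler_piMl// ltW.
- move=> q Dq; have H : is_derive (0 + q.2) 1 f (df q.2) by rewrite add0r; exact: dff.
  by have := is_derive_shift (- c0) (- c1) 0 H; move/is_derive_eq; apply; ring.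
- move=> q /andP[q0 q1].
  have lin : r * q.2 @[r --> (0 : R)^'+] --> (0 : R)^'+.
    move=> A [d /= d0 HA]; exists (d / q.2); rewrite /= ?divr_gt0// => r /= rd r0.
    apply: HA => /=; last exact: mulr_gt0.
    move: rd; rewrite !sub0r !normrN normrM (gtr0_norm q0) => rd.
    by rewrite -ltr_pdivlMr.
  have lin0 : r * q.2 @[r --> (0 : R)^'+] --> (0 : R).
    by apply: (cvg_trans lin); exact: cvg_within.
  have fc' := cvg_comp _ _ lin fc.
  rewrite [X in _ --> X](_ : 0 = c0 + (- c0 + (- c1) * 0 + 0 * 0 ^+ 2)); last by ring.
  apply: cvgD; first by move: fc'; rewrite /comp; under eq_fun do rewrite -[_ * _]add0r.
  apply: cvgD; first by apply: cvgD; [exact: cvg_cst|exact: cvgMr].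
  by rewrite mul0r; under eq_fun do rewrite mul0r; exact: cvg_cst.
- by move=> q Dq; rewrite dfW//; ring.
exists (fun x => W1 (0, x)).
  apply: (@Cl_pre _ DU DU W1 (fun q => (0, q.2))) => // q q' _ _.
  by rewrite /d1 /= subrr normr0 add0r lerDr.
by move=> x hx; have := H1 (0, x) hx; rewrite /N /= add0r => <-; ring.
Qed.

End UnitInterval.

(** * The wall near and between its discontinuities *)

Section Wall.
Context {R : realType} (l : R -> R) (hl : fermi_ulam_wall l).
Local Notation one := (fun=> 1 : R).
Local Notation frac := Defs.frac.

Lemma wall_lip : exists2 k : R, 0 <= k & forall x y, `|l x - l y| <= k * `|x - y|.
Proof.
have [k lk] := wall_lipschitz hl; exists `|k| => // x y.
have /= h := lk (x, y) (conj I I); apply: (le_trans h).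
by rewrite ler_wpM2r// ler_norm.
Qed.

Lemma wall_cont : continuous l.
Proof.
have [k k0 lk] := wall_lip; move=> x; apply/cvgrPdist_le => e e0.
exists (e / (k + 1)); first by rewrite /= divr_gt0// ltr_wpDl.
move=> y /= xy; apply: (le_trans (lk x y)).
apply: (@le_trans _ _ ((k + 1) * `|x - y|)); first by rewrite ler_wpM2r// lerDl.
by rewrite mulrC -ler_pdivlMr ?ltr_wpDl// ltW.
Qed.

Lemma wall_int (n : int) t : l (t + n%:~R) = l t.
Proof.
have H (m : nat) u : l (u + m%:R) = l u.
  elim: m => [|m IH]; first by rewrite addr0.
  by rewrite -natr1 addrA (wall_periodic hl).
case: n => m; first exact: H.
by rewrite -[LHS](H m.+1) NegzE intrN subrK.
Qed.

Lemma wall_frac t : l (frac t) = l t.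
Proof. by rewrite /frac -rmorphN wall_int. Qed.

Lemma frac_itv (t : R) : 0 <= frac t < 1.
Proof. by have := fl_itv t; rewrite /frac -/(fl t); flra. Qed.

Lemma wall_bounds : exists c M : R, 0 < c /\ forall t, c <= l t <= M.
Proof.
have cl : {within `[0, 1], continuous l} by apply: continuous_subspaceT; exact: wall_cont.
have [a _ Ha] := EVT_min ler01 cl; have [b _ Hb] := EVT_max ler01 cl.
exists (l a), (l b); split; first exact: wall_gt0.
move=> t; have /andP[f0 f1] := frac_itv t; rewrite -(wall_frac t).
by rewrite Ha ?Hb// in_itv/= f0 ltW.
Qed.

Lemma bounded_unit (f : R -> R) (a b : R) :
  (forall x : R, 0 < x < 1 -> f y @[y --> x] --> f x) ->
  f x @[x --> 0^'+] --> a -> f x @[x --> 1^'-] --> b ->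
  exists C : R, forall x : R, 0 < x < 1 -> `|f x| <= C.
Proof.
move=> cf fa fb.
have tri (u v : R) : `|u| <= `|v - u| + `|v|.
  by rewrite addrC -{1}(subKr v u); exact: ler_normB.
move/cvgrPdist_le: fa => /(_ 1 ltr01)[d /= d0 Hd].
move/cvgrPdist_le: fb => /(_ 1 ltr01)[e /= e0 He].
pose m := Num.min (Num.min d e) 1 / 3.
have m0 : 0 < m by rewrite divr_gt0// !lt_min d0 e0 ltr01.
have [md [me m1]] : m < d /\ m < e /\ m <= 1 / 3.
  have h1 : Num.min (Num.min d e) 1 <= d by rewrite !ge_min lexx.
  have h2 : Num.min (Num.min d e) 1 <= e by rewrite !ge_min lexx orbT.
  have h3 : Num.min (Num.min d e) 1 <= 1 by rewrite ge_min lexx orbT.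
  by rewrite /m; split; [flra|split; flra].
have mm : m <= 1 - m by flra.
have cw : {within `[m, 1 - m], continuous (fun x => `|f x|)}.
  apply/continuous_in_subspaceT => x; rewrite inE /= in_itv/= => /andP[x1 x2].
  by apply: cvg_norm; apply: cf; apply/andP; split; flra.
have [c _ Hc] := EVT_max mm cw.
have c0 := normr_ge0 (f c).
exists (`|f c| + `|a| + `|b| + 1) => x /andP[x0 x1].
have a0 := normr_ge0 a; have b0 := normr_ge0 b.
have [xm|mx] := ltP x m.
  have := Hd x; rewrite /= sub0r normrN gtr0_norm// => /(_ (lt_trans xm md) x0) h.
  have : `|f x| <= `|a - f x| + `|a|.
    exact: tri.
  by flra.
have [mx'|xm'] := ltP (1 - m) x.
  have := He x; rewrite /= gtr0_norm ?subr_gt0// => h'.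
  have h : `|b - f x| <= 1 by apply: h' => //; flra.
  have : `|f x| <= `|b - f x| + `|b|.
    exact: tri.
  by flra.
have := Hc x; rewrite in_itv/= mx xm' => /(_ isT); flra.
Qed.

Lemma wall_derive n (x : R) : 0 < x < 1 ->
  is_derive x 1 (derive1n n l) (derive1n n.+1 l x).
Proof.
move=> hx; have [H _] := wall_smooth hl; rewrite derive1nS derive1E.
by apply: DeriveDef => //; exact: H.
Qed.

Lemma wall_deriv_bounded n : exists C : R, forall x : R, 0 < x < 1 -> `|derive1n n l x| <= C.
Proof.
have [_ /(_ n)[c0 c1]] := wall_smooth hl.
apply: (@bounded_unit _ _ _ _ c0 c1) => x hx.
exact: is_derive_cont (wall_derive n hx).
Qed.

Lemma wall_BL n : BL (derive1n n l).
Proof.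
apply: (@BL_derive _ _ (derive1n n.+1 l)); [exact: wall_derive|exact: wall_deriv_bounded|].
exact: wall_deriv_bounded.
Qed.

Local Notation lp := (dl_right l).
Local Notation lm := (dl_left l).

Lemma dl_right_cvg : derive1 l x @[x --> 0^'+] --> lp.
Proof. by have [_ /(_ 1%N)[c0 _]] := wall_smooth hl. Qed.

Lemma derive1_per x : derive1 l (x + 1) = derive1 l x.
Proof.
rewrite /derive1.
have -> // : (fun h => h^-1 *: (l (h + (x + 1)) - l (x + 1))) = (fun h => h^-1 *: (l (h + x) - l x)).
by apply/funext => h; rewrite addrA !(wall_periodic hl).
Qed.

(** [dl_left] is a limit at 0 from the left; periodicity moves it to the end 1 of the interval where
    the wall is smooth. *)
Lemma dl_left_cvg : derive1 l x @[x --> 1^'-] --> lm.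
Proof.
have [_ /(_ 1%N)[_ c1]] := wall_smooth hl.
suff -> : lm = lim (derive1 l x @[x --> 1^'-]) by [].
apply/cvg_lim => //; apply/cvgrPdist_le => e e0.
move/cvgrPdist_le : c1 => /(_ e e0)[d /= d0 H]; exists d => //= x.
rewrite /= sub0r normrN => xd x0; rewrite -derive1_per; apply: H.
  by rewrite /= opprD addrCA subrr addr0 normrN.
by rewrite -[ltRHS]add0r ltrD2r.
Qed.

Definition rate (t : R) : R := (l t)^-1 * (l t)^-1.

Lemma rate_cont : continuous rate.
Proof.
move=> x; apply: cvgM; apply: cvgV; rewrite ?gt_eqF ?wall_gt0//; exact: wall_cont.
Qed.

(** The primitive of [rate] that vanishes at 0. Integrating from -1 places 0 and 1 inside the range
    of the fundamental theorem of calculus, which applies there because [l] is continuous. *)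
Definition clock (t : R) : R :=
  \int[lebesgue_measure]_(s in `[-1, t]) rate s - \int[lebesgue_measure]_(s in `[-1, 0]) rate s.

Lemma rate_integrable (a b : R) : (@lebesgue_measure R).-integrable `[a, b] (EFin \o rate).
Proof.
apply: continuous_compact_integrable; first exact: segment_compact.
by apply: continuous_subspaceT; exact: rate_cont.
Qed.

Lemma clock_derive (t : R) : -1 < t -> t < 3 -> is_derive t 1 clock (rate t).
Proof.
move=> t1 t3.
have [d1 d2] := @continuous_FTC1 R rate (BLeft (-1)) t 3 t3 (rate_integrable _ _) t1 (rate_cont (x := t)).
have H : is_derive t 1 (fun x => \int[lebesgue_measure]_(s in `[-1, x]) rate s)%R (rate t).
  by apply: DeriveDef; [exact: d1|rewrite -derive1E; exact: d2].
have := is_deriveD H (is_derive_cst (- \int[lebesgue_measure]_(s in `[-1, 0]) rate s)%R t 1).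
by rewrite addr0.
Qed.

Lemma clock0 : clock 0 = 0. Proof. by rewrite /clock subrr. Qed.

Lemma clock1 : clock 1 = alpha l.
Proof.
rewrite /clock Rintegral_itvB; [|exact: rate_integrable|by rewrite bnd_simp; flra|by rewrite bnd_simp; flra].
rewrite Rintegral_itv_obnd_cbnd; last first.
  by apply: (integrableS _ _ _ (rate_integrable 0 1)) => //; exact: subset_itv_oc_cc.
rewrite /alpha; apply: eq_Rintegral => x _.
by rewrite /rate -invfM expr2.
Qed.


Lemma BL_wall : BL l. Proof. exact: (wall_BL 0). Qed.

Lemma BL_wall1 : BL (derive1 l). Proof. exact: (wall_BL 1). Qed.

Lemma BL_winv : BL (fun x => (l x)^-1).
Proof.
have [c [M [c0 cl]]] := wall_bounds.
apply: (BL_inv c0) BL_wall => x _; by have /andP[] := cl x.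
Qed.

Definition drate (t : R) : R := - 2 * derive1 l t * ((l t)^-1 * (l t)^-1 * (l t)^-1).

Lemma BL_rate : BL rate. Proof. exact: BL_mul BL_winv BL_winv. Qed.

Lemma BL_drate : BL drate.
Proof.
apply: BL_mul; last exact: BL_mul BL_rate BL_winv.
exact: BL_mul (BL_cst _) BL_wall1.
Qed.

Lemma winv_derive (x : R) : 0 < x < 1 ->
  is_derive x 1 (fun t => (l t)^-1) (- (derive1 l x * rate x)).
Proof.
move=> hx; have l0 : l x != 0 by rewrite gt_eqF// wall_gt0.
apply: (is_derive_eq (is_deriveV l0 (wall_derive 0 hx))).
by rewrite /rate /= /GRing.scale /=; field.
Qed.

Lemma rate_derive (x : R) : 0 < x < 1 -> is_derive x 1 rate (drate x).
Proof.
move=> hx; have l0 : l x != 0 by rewrite gt_eqF// wall_gt0.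
have := is_deriveM (winv_derive hx) (winv_derive hx); move/is_derive_eq; apply.
by rewrite /GRing.scale /= /drate /rate; field.
Qed.

Lemma BL_clock : BL clock.
Proof.
have [c [M [c0 cl]]] := wall_bounds.
apply: (@BL_derive _ clock rate).
- by move=> x /andP[x0 x1]; apply: clock_derive; flra.
- apply: (@bounded_unit _ (clock 0) (clock 1)) => [x /andP[x0 x1]||].
  + by apply: is_derive_cont; apply: clock_derive; flra.
  + by apply: cvg_at_right_filter; apply: is_derive_cont; apply: clock_derive; flra.
  + by apply: cvg_at_left_filter; apply: is_derive_cont; apply: clock_derive; flra.
- exists (c^-1 * c^-1) => x _; have /andP[cx _] := cl x; have l0 := lt_le_trans c0 cx.
  by rewrite gtr0_norm ?mulr_gt0 ?invr_gt0//; apply: ler_pM; rewrite ?invr_ge0 ?lef_pV2 ?(ltW l0).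
Qed.

Lemma wall_jet : exists r3 s2 t2, [/\ Cl one D1 r3, Cl one D1 s2, Cl one D1 t2 &
  forall q, D1 q -> let: (a, h) := q in
  [/\ l (a + h) = l a + h * derive1 l a + h ^+ 2 / 2 * derive1n 2 l a + h ^+ 3 * r3 q,
      derive1 l (a + h) = derive1 l a + h * derive1n 2 l a + h ^+ 2 * s2 q &
      clock (a + h) = clock a + h * rate a + h ^+ 2 / 2 * drate a + h ^+ 3 * t2 q]].
Proof.
have [r3 C3 H3] := taylor3 (wall_derive 0) (wall_derive 1) (wall_derive 2) (wall_BL 3).
have [s2 C2 H2] := taylor2 (wall_derive 1) (wall_derive 2) (wall_BL 3).
have BW : BL (fun x => - 2 * derive1n 2 l x * ((l x)^-1 * (l x)^-1 * (l x)^-1) +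
    6 * (derive1 l x * derive1 l x) * (rate x * rate x)).
  apply: BL_add.
    apply: BL_mul; last exact: BL_mul BL_rate BL_winv.
    exact: BL_mul (BL_cst _) (wall_BL 2).
  apply: BL_mul; last exact: BL_mul BL_rate BL_rate.
  exact: BL_mul (BL_cst _) (BL_mul BL_wall1 BL_wall1).
have d2 (x : R) : 0 < x < 1 -> is_derive x 1 drate (- 2 * derive1n 2 l x * ((l x)^-1 * (l x)^-1 * (l x)^-1) +
    6 * (derive1 l x * derive1 l x) * (rate x * rate x)).
  move=> hx; have l0 : l x != 0 by rewrite gt_eqF// wall_gt0.
  have e1 : is_derive x 1 (fun t => - 2 * derive1 l t) (- 2 * derive1n 2 l x).
    apply: (is_derive_eq (is_deriveM (is_derive_cst (- 2 : R) x 1) (wall_derive 1 hx))).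
    by rewrite scaler0 addr0.
  have e2 : is_derive x 1 (fun t => (l t)^-1 * (l t)^-1 * (l t)^-1)
      (- 3 * derive1 l x * (rate x * rate x)).
    apply: (is_derive_eq (is_deriveM (rate_derive hx) (winv_derive hx))).
    by rewrite /GRing.scale /= /drate /rate; field.
  apply: (is_derive_eq (is_deriveM e1 e2)).
  by rewrite /GRing.scale /= /rate; field.
have d1 (x : R) : 0 < x < 1 -> is_derive x 1 clock (rate x).
  by move=> /andP[x0 x1]; apply: clock_derive; flra.
have [t2 Ct Ht] := taylor3 d1 rate_derive d2 BW.
exists r3, s2, t2; split => // -[a h] Dq.
by split; [exact: H3 Dq|exact: H2 Dq|exact: Ht Dq].
Qed.

Lemma edge_right : exists kap s tau : R -> R,
  [/\ BL kap, BL s, BL tau & forall x : R, 0 < x < 1 ->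
  [/\ l x = l 0 + x * (lp + x * kap x), derive1 l x = lp + x * s x &
      clock x = x * (rate 0 + x * tau x)]].
Proof.
have z (W : R -> R) (x : R) : W x = 0 + x ^+ 0 * W x :> R by rewrite mul1r add0r.
have [s Bs Hs] := @edge_rem R 0 _ _ _ 0 _ (wall_derive 1) dl_right_cvg (fun x _ => z _ x) (wall_BL 2).
have Hs' (x : R) : 0 < x < 1 -> derive1 l x = lp + x ^+ 1 * s x.
  by move=> hx; rewrite [LHS](Hs x hx) mul0r addr0.
have lc : l x @[x --> 0^'+] --> l 0 by apply: cvg_at_right_filter; exact: wall_cont.
have [kap Bk Hk] := @edge_rem R 1 _ _ _ lp _ (wall_derive 0) lc Hs' Bs.
have rc : rate x @[x --> 0^'+] --> rate 0 by apply: cvg_at_right_filter; exact: rate_cont.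
have [u Bu Hu] := @edge_rem R 0 _ _ _ 0 _ rate_derive rc (fun x _ => z _ x) BL_drate.
have Hu' (x : R) : 0 < x < 1 -> rate x = rate 0 + x ^+ 1 * u x.
  by move=> hx; rewrite [LHS](Hu x hx) mul0r addr0.
have d1 (x : R) : 0 < x < 1 -> is_derive x 1 clock (rate x).
  by move=> /andP[x0 x1]; apply: clock_derive; flra.
have cc : clock x @[x --> 0^'+] --> clock 0.
  by apply: cvg_at_right_filter; apply: is_derive_cont; apply: clock_derive; flra.
rewrite clock0 in cc.
have [tau Bt Ht] := @edge_rem R 1 _ _ _ (rate 0) _ d1 cc Hu' Bu.
exists kap, s, tau; split => // x hx; split; [rewrite [LHS](Hk x hx)|rewrite [LHS](Hs x hx)|rewrite [LHS](Ht x hx)]; ring.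
Qed.

Lemma is_derive_mirror (f df : R -> R) (x : R) : 0 < x < 1 ->
  (forall x : R, 0 < x < 1 -> is_derive x 1 f (df x)) ->
  is_derive x 1 (fun u => f (1 - u)) (- df (1 - x)).
Proof.
move=> hx dff.
have H1 : is_derive x 1 (fun u : R => 1 - u) (- 1).
  by have := is_deriveB (is_derive_cst (1 : R) x 1) (is_derive_id x 1); rewrite sub0r.
have h' : 0 < 1 - x < 1 by move: hx => /andP[? ?]; apply/andP; split; flra.
have := @is_derive1_comp R f (fun u : R => 1 - u) x _ _ (dff _ h') H1.
by rewrite mulrN1.
Qed.

Lemma cvg_mirror (f : R -> R) (a : R) : f x @[x --> 1^'-] --> a -> f (1 - x) @[x --> 0^'+] --> a.
Proof.
move=> /cvgrPdist_le H; apply/cvgrPdist_le => e /H[d /= d0 Hd]; exists d => //= x.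
rewrite /= sub0r normrN => xd x0; apply: Hd; last by rewrite gtrBl.
by rewrite /= opprB addrC subrK.
Qed.

(** The expansions of [edge_right] applied to the functions reflected by x -> 1 - x, with the signs
    restored at the end. *)
Lemma edge_left : exists xi s tau : R -> R,
  [/\ BL xi, BL s, BL tau & forall x : R, 0 < x < 1 ->
  [/\ l (1 - x) = l 0 - x * (lm + x * xi x), derive1 l (1 - x) = lm + x * s x &
      alpha l - clock (1 - x) = x * (rate 0 + x * tau x)]].
Proof.
have l1 : l 1 = l 0 by rewrite -[1 in LHS]add0r (wall_periodic hl).
have z (W : R -> R) (x : R) : W x = 0 + x ^+ 0 * W x :> R by rewrite mul1r add0r.
have BN (f : R -> R) : BL f -> BL (fun x => - f x).
  by move=> Bf; apply: BL_ext (BL_mul (BL_cst (-1)) Bf) => x _; rewrite mulN1r.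
have [s Bs Hs] := @edge_rem R 0 _ _ _ 0 _ (fun x hx => is_derive_mirror hx (wall_derive 1))
  (cvg_mirror dl_left_cvg) (fun x _ => z _ x) (BN _ (BL_mirror (wall_BL 2))).
have Hs' (x : R) : 0 < x < 1 -> derive1 l (1 - x) = lm + x ^+ 1 * s x.
  by move=> hx; rewrite [LHS](Hs x hx) mul0r addr0.
have lc : l (1 - x) @[x --> 0^'+] --> l 0.
  by apply: cvg_mirror; rewrite -l1; apply: cvg_at_left_filter; exact: wall_cont.
have Hd (x : R) : 0 < x < 1 -> - derive1n 1 l (1 - x) = - lm + x ^+ 1 * (- s x).
  by move=> hx; rewrite mulrN -opprD -Hs'.
have [xi Bk Hk] := @edge_rem R 1 _ _ _ (- lm) _ (fun x hx => is_derive_mirror hx (wall_derive 0)) lc Hd (BN _ Bs).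
have r1 : rate 1 = rate 0 by rewrite /rate l1.
have rc : rate (1 - x) @[x --> 0^'+] --> rate 0.
  by apply: cvg_mirror; rewrite -r1; apply: cvg_at_left_filter; exact: rate_cont.
have [u Bu Hu] := @edge_rem R 0 _ _ _ 0 _ (fun x hx => is_derive_mirror hx rate_derive)
  rc (fun x _ => z _ x) (BN _ (BL_mirror BL_drate)).
have Hu' (x : R) : 0 < x < 1 -> - rate (1 - x) = - rate 0 + x ^+ 1 * (- u x).
  by move=> hx; rewrite (Hu x hx) mul0r addr0 opprD mulrN.
have d1 (x : R) : 0 < x < 1 -> is_derive x 1 clock (rate x).
  by move=> /andP[x0 x1]; apply: clock_derive; flra.
have cc : clock (1 - x) @[x --> 0^'+] --> alpha l.
  rewrite -clock1; apply: cvg_mirror; apply: cvg_at_left_filter.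
  by apply: is_derive_cont; apply: clock_derive; flra.
have [tau Bt Ht] := @edge_rem R 1 _ _ _ (- rate 0) _ (fun x hx => is_derive_mirror hx d1) cc Hu' (BN _ Bu).
exists (fun x => - xi x), s, (fun x => - tau x); split; [exact: BN|exact: Bs|exact: BN|].
move=> x hx; split; [rewrite [LHS](Hk x hx)|rewrite [LHS](Hs x hx)|rewrite (Ht x hx)]; ring.
Qed.

End Wall.

(** * Momentum and phase across one collision *)

Section Flight.
Context {R : realType} (l : R -> R) (hl : fermi_ulam_wall l).
Local Notation one := (fun=> 1 : R).
Local Notation l1 := (derive1 l).
Local Notation l2 := (derive1n 2 l).
Local Notation clock := (clock l).

Ltac Cl_tac w0 := repeat first
  [ assumption | exact: Cl_cst | apply: (Cl_sub w0) | apply: (Cl_add w0)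
  | apply: (Cl_mul w0) | apply: (Cl_opp (wt := _)) ].

(** The momentum l (v + l') after the departure at [a] and after the arrival at [a + h], in terms of
    the flight time: v = (l a + l (a + h)) / h, and the collision replaces v by v - 2 l'. *)
Definition pdep (a h : R) : R := l a * ((l a + l (a + h)) / h + l1 a).
Definition parr (a h : R) : R := l (a + h) * ((l a + l (a + h)) / h - l1 (a + h)).

(** The change of momentum is the difference quotient of l^2 minus the mean of its derivatives at
    the two ends. This is the error of the trapezoidal rule divided by [h], hence of order h^2. In
    the phase the terms of orders 0 and 1 reduce to the constant 2. *)
Lemma flight_inside : exists WP WZ, [/\ Cl one D1 WP, Cl one D1 WZ &
  forall q, D1 q -> let: (a, h) := q in
  parr a h - pdep a h = h ^+ 2 * WP q /\
  parr a h * clock (a + h) - pdep a h * clock a = 2 + h ^+ 2 * WZ q].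
Proof.
have [r3 [s2 [t2 [C3 C2 Ct H]]]] := wall_jet hl.
have w0 : forall q : R * R, D1 q -> 0 <= (1 : R) by [].
have cl := Cl_D1_start (BL_wall hl); have cl1 := Cl_D1_start (BL_wall1 hl).
have cl2 := Cl_D1_start (wall_BL hl 2); have ci := Cl_D1_start (BL_winv hl).
have cs := Cl_D1_end (BL_clock hl); have ch := @Cl_D1_step R.
pose X (q : R * R) := l1 q.1 + q.2 * (l2 q.1 * 2^-1 + q.2 * r3 q).
pose Y (q : R * R) := l2 q.1 + q.2 * s2 q.
have cX : Cl one D1 X by rewrite /X; Cl_tac w0.
have cY : Cl one D1 Y by rewrite /Y; Cl_tac w0.
pose WP (q : R * R) := 2 * (l q.1 * r3 q) - l q.1 * s2 q +
   X q * (l2 q.1 * 2^-1 + q.2 * r3 q) - X q * Y q.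
have cWP : Cl one D1 WP by rewrite /WP; Cl_tac w0.
pose Gq (q : R * R) := l2 q.1 * 2^-1 + q.2 * r3 q.
have cG : Cl one D1 Gq by rewrite /Gq; Cl_tac w0.
pose WZ (q : R * R) := WP q * clock (q.1 + q.2) + 2 * (l q.1 * l q.1 * t2 q)
  - 2 * (l1 q.1 * l1 q.1 * ((l q.1)^-1 * (l q.1)^-1)) + Gq q * (l q.1)^-1
  + q.2 * (2 * (l q.1 * l1 q.1 * t2 q) - Gq q * l1 q.1 * ((l q.1)^-1 * (l q.1)^-1))
  + q.2 * q.2 * (l q.1 * Gq q * t2 q).
have cWZ : Cl one D1 WZ by rewrite /WZ; Cl_tac w0.
exists WP, WZ; split => // -[a h] Dq; have [e1 e2 e3] := H _ Dq.
have [a0 h0 ah] := Dq; rewrite /= in a0 h0 ah.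
have hn : h != 0 by rewrite gt_eqF.
have ln : l a != 0 by rewrite gt_eqF// wall_gt0.
have EP : parr a h - pdep a h = h ^+ 2 * WP (a, h).
  rewrite /parr /pdep e1 e2 /WP /X /Y /=; field; exact: hn.
split => //.
have -> : parr a h * clock (a + h) - pdep a h * clock a =
  (parr a h - pdep a h) * clock (a + h) + pdep a h * (clock (a + h) - clock a) by ring.
have e4 : clock (a + h) - clock a = h * rate l a + h ^+ 2 / 2 * drate l a + h ^+ 3 * t2 (a, h).
  by rewrite e3; ring.
rewrite EP e4 /WZ /pdep e1 /rate /drate /Gq /=.
by field; rewrite hn ln.
Qed.

(** A flight across the discontinuity leaves at [1 - u] and arrives at [b] in the next period;
    [u + b] is its duration. *)
Definition D2 : set (R * R) := [set q | 0 < q.1 < 1 /\ 0 < q.2 < 1].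

(** Times [alpha l] this is - Delta, the constant [D] of the sawtooth map. *)
Definition jump : R := l 0 * (dl_left l - dl_right l).

(** Let th = u / (u + b) be the fraction of the flight before the discontinuity, and L, M the slopes
    of [l] on its right and left. To leading order [E] is 2 th and the kick is l(0) (2 (1 - th) L +
    2 th M - L - M). As th has derivatives of order 1/h in (u, b), the remainders are Lipschitz only
    with the weight [q.1 + q.2]. *)
Lemma flight_across :
  exists W1 W2, [/\ Cl (fun q => q.1 + q.2) D2 W1, Cl (fun q => q.1 + q.2) D2 W2 &
  forall q, D2 q -> let: (u, b) := q in
  let la := l (1 - u) in let h := u + b in
  let pa := la * ((la + l b) / h + l1 (1 - u)) in
  let pb := l b * ((la + l b) / h - l1 b) in
  let E := pa * (alpha l - clock (1 - u)) in
  pb - pa = jump * (E - 1) + h * W2 q /\ pb * clock b = 2 - E + h * W1 q].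
Proof.
have [kap [s [tau [Bk Bs Bt Hr]]]] := edge_right hl.
have [xi [s' [tau' [Bx Bs' Bt' Hl]]]] := edge_left hl.
set L := dl_right l in Hr; set M := dl_left l in Hl.
pose wt (q : R * R) := q.1 + q.2.
have w0 q : D2 q -> 0 <= wt q by move=> [/andP[? _] /andP[? _]]; rewrite addr_ge0// ltW.
have wle q : D2 q -> wt q <= 2 by move=> [/andP[_ ?] /andP[_ ?]]; rewrite /wt; flra.
have pull (f : R -> R) : BL f -> Cl wt D2 (fun q => f q.2) /\ Cl wt D2 (fun q => f q.1).
  move=> Bf; split; apply: (Cl_weaken wle) => //.
    apply: (BL_pre (phi := fun q => q.2)) => // [q []//|q q' _ _].
    by rewrite lerDr.
  apply: (BL_pre (phi := fun q => q.1)) => // [q []//|q q' _ _].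
  by rewrite lerDl.
have [ck _] := pull _ Bk; have [cs _] := pull _ Bs; have [ct _] := pull _ Bt.
have [_ cx] := pull _ Bx; have [_ cs'] := pull _ Bs'; have [_ ct'] := pull _ Bt'.
have Bid : BL (fun x : R => x).
  by apply: (@BLP _ _ 1) => // [x /andP[x0 x1]|x y _ _]; rewrite ?mul1r// gtr0_norm// ltW.
have [cb cu] := pull _ Bid.
pose th (q : R * R) := q.1 / (q.1 + q.2).
have cth : Cl wt D2 th.
  exists 2 => // q q' Dq Dq'.
  have P z : D2 z -> [/\ 0 < z.1, 0 < wt z & z.1 <= wt z].
    by move=> [/andP[a _] /andP[b _]]; rewrite /wt lerDl ltW// addr_gt0.
  have [a1 a2 a3] := P q Dq; have [b1 b2 b3] := P q' Dq'.
  have t1 z : D2 z -> `|th z| <= 1.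
    by move=> /P[z1 z2 z3]; rewrite ger0_norm ?divr_ge0 ?(ltW z1) ?(ltW z2)// ler_pdivrMr// mul1r.
  split; first by apply: (le_trans (t1 q Dq)); rewrite ler1n.
  rewrite -{1}(gtr0_norm a2) -normrM.
  have -> : wt q * (th q - th q') = (q.1 - q'.1) - th q' * (wt q - wt q').
    rewrite /th /wt; field; rewrite -!/(wt _) !gt_eqF//.
  apply: (le_trans (ler_normB _ _)); rewrite normrM.
  have h1 : `|th q'| * `|wt q - wt q'| <= d1 q q'.
    rewrite -[leRHS]mul1r; apply: ler_pM => //; first exact: t1.
    by rewrite /wt opprD addrACA ler_normD.
  have h2 : `|q.1 - q'.1| <= d1 q q' by rewrite lerDl.
  by move: h1 h2; flra.
have [c [Mx [c0 cl]]] := wall_bounds hl.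
pose i0 := rate l 0.
pose lamb (q : R * R) := L + q.2 * kap q.2; pose nu (q : R * R) := M + q.1 * xi q.1.
pose lb' (q : R * R) := L + q.2 * s q.2; pose la' (q : R * R) := M + q.1 * s' q.1.
pose hh (q : R * R) := q.1 + q.2.
have clam : Cl wt D2 lamb by rewrite /lamb; Cl_tac w0.
have cnu : Cl wt D2 nu by rewrite /nu; Cl_tac w0.
have clb' : Cl wt D2 lb' by rewrite /lb'; Cl_tac w0.
have cla' : Cl wt D2 la' by rewrite /la'; Cl_tac w0.
have chh : Cl wt D2 hh by rewrite /hh; Cl_tac w0.
pose a1 q := - (th q * nu q); pose b1 q := (1 - th q) * lamb q.
have ca1 : Cl wt D2 a1 by rewrite /a1; apply: Cl_opp; Cl_tac w0.
have cb1 : Cl wt D2 b1 by rewrite /b1; Cl_tac w0.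
pose c1 q := a1 q + b1 q + la' q; pose d1' q := a1 q + b1 q - lb' q.
have cc1 : Cl wt D2 c1 by rewrite /c1; Cl_tac w0.
have cd1 : Cl wt D2 d1' by rewrite /d1'; Cl_tac w0.
pose E1 q := th q * ((2 * l 0 * a1 q + l 0 * c1 q + hh q * (a1 q * c1 q)) *
  (i0 + hh q * (th q * tau' q.1)) + 2 * l 0 * l 0 * (th q * tau' q.1)).
have cE1 : Cl wt D2 E1 by rewrite /E1; Cl_tac w0.
pose Z1 q := (1 - th q) * ((2 * l 0 * b1 q + l 0 * d1' q + hh q * (b1 q * d1' q)) *
  (i0 + hh q * ((1 - th q) * tau q.2)) + 2 * l 0 * l 0 * ((1 - th q) * tau q.2)).
have cZ1 : Cl wt D2 Z1 by rewrite /Z1; Cl_tac w0.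
pose m0 q := (1 - th q) * L + th q * M.
pose m1 q := (1 - th q) * (1 - th q) * kap q.2 + th q * th q * xi q.1.
have cm0 : Cl wt D2 m0 by rewrite /m0; Cl_tac w0.
have cm1 : Cl wt D2 m1 by rewrite /m1; Cl_tac w0.
pose P1 q := m1 q * (2 * l 0 + hh q * (a1 q + b1 q)) + m0 q * (a1 q + b1 q)
  - b1 q * lb' q - l 0 * ((1 - th q) * s q.2) - a1 q * la' q - l 0 * (th q * s' q.1).
have cP1 : Cl wt D2 P1 by rewrite /P1; Cl_tac w0.
pose W1 q := Z1 q + E1 q; pose W2 q := P1 q - jump * E1 q.
have cW1 : Cl wt D2 W1 by rewrite /W1; Cl_tac w0.
have cW2 : Cl wt D2 W2 by rewrite /W2; Cl_tac w0.
exists W1, W2; split => // -[u b] Dq; have [hu hb] := Dq; rewrite /= in hu hb.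
have [r1 r2 r3] := Hr b hb; have [e1 e2 e3] := Hl u hu.
have h0 : u + b != 0 by rewrite gt_eqF// addr_gt0//; [case/andP: hu|case/andP: hb].
have ln : l 0 != 0 by rewrite gt_eqF// wall_gt0.
pose t := th (u, b); pose h := u + b.
have uE : u = t * h by rewrite /t /th /h /= divfK.
have bE : b = (1 - t) * h by rewrite mulrBl mul1r -uE /h addrAC subrr add0r.
have hn : h != 0 by [].
have i0E : i0 = (l 0)^-1 * (l 0)^-1 by [].
cbv zeta.
pose la := l 0 + h * a1 (u, b); pose lb := l 0 + h * b1 (u, b).
have laE : l (1 - u) = la.
  by rewrite e1 {1}uE /la /a1 /nu /= -/t; ring.
have lbE : l b = lb.
  by rewrite r1 {1}bE /lb /b1 /lamb /= -/t; ring.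
have qa : (la + lb) / h + la' (u, b) = (2 * l 0 + h * c1 (u, b)) / h.
  by rewrite /la /lb /c1; field.
have qb : (la + lb) / h - lb' (u, b) = (2 * l 0 + h * d1' (u, b)) / h.
  by rewrite /la /lb /d1'; field.
have EE : la * ((la + lb) / h + la' (u, b)) * (u * (rate l 0 + u * tau' u)) = 2 * t + h * E1 (u, b).
  rewrite qa {2 3}uE -/i0 /la /E1 /= -/t /hh /= -/h; set A := a1 _; set C := c1 _; set T := tau' u.
  by rewrite i0E; field; rewrite hn ln.
have ZE : lb * ((la + lb) / h - lb' (u, b)) * (b * (rate l 0 + b * tau b)) = 2 * (1 - t) + h * Z1 (u, b).
  rewrite qb {2 3}bE -/i0 /lb /Z1 /= -/t /hh /= -/h; set A := b1 _; set C := d1' _; set T := tau b.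
  by rewrite i0E; field; rewrite hn ln.
rewrite e3 r3 laE lbE e2 r2 -/h -[M + _]/(la' (u, b)) -[L + _]/(lb' (u, b)).
rewrite EE ZE; split; last by rewrite /W1; ring.
have -> : lb * ((la + lb) / h - lb' (u, b)) - la * ((la + lb) / h + la' (u, b)) =
   (lb - la) / h * (lb + la) - (lb * lb' (u, b) + la * la' (u, b)) by field.
have -> : (lb - la) / h = m0 (u, b) + h * m1 (u, b).
  have b1E : b1 (u, b) = (1 - t) * (L + (1 - t) * h * kap b) by rewrite -bE.
  have a1E : a1 (u, b) = - (t * (M + t * h * xi u)) by rewrite -uE.
  by rewrite /lb /la a1E b1E /m0 /m1 /= -/t; field.
rewrite /W2 /P1 /lb /la /jump -/L -/M /hh /= -/h -/t.
set A := a1 _; set B := b1 _.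
have lbx : lb' (u, b) = L + h * ((1 - t) * s b) by rewrite /lb' /= {1}bE; ring.
have lax : la' (u, b) = M + h * (t * s' u) by rewrite /la' /= {1}uE; ring.
rewrite lbx lax /m0 /= -/t; set E := E1 _; set K := m1 _.
ring.
Qed.

End Flight.

(** * Flights at high momentum and their dependence on the data *)

Section Steps.
Context {R : realType} (l : R -> R) (hl : fermi_ulam_wall l).
Local Notation frac := Defs.frac.
Local Notation l1 := (derive1 l).
Local Notation clock := (clock l).

Lemma mul_diff (a b a' b' A B x y : R) : `|a| <= A -> `|b'| <= B -> `|a - a'| <= x ->
  `|b - b'| <= y -> `|a * b - a' * b'| <= A * y + B * x.
Proof.
move=> aA bB ax bY; rewrite (_ : a * b - a' * b' = a * (b - b') + b' * (a - a')); last by ring.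
by apply: (le_trans (ler_normD _ _)); rewrite !normrM lerD//; apply: ler_pM.
Qed.

Lemma wall_const : exists2 K : R, 1 <= K & [/\
  forall t, K^-1 <= l t <= K, forall x y, `|l x - l y| <= K * `|x - y|,
  forall t, 0 < t < 1 -> `|l1 t| <= K &
  forall x y, 0 < x < 1 -> 0 < y < 1 -> `|l1 x - l1 y| <= K * `|x - y|].
Proof.
have [k k0 lk] := wall_lip hl; have [c [M [c0 cl]]] := wall_bounds hl.
have [C C0 H] := BL_wall1 hl.
have M0 : 0 < M by have /andP[h1 h2] := cl 0; exact: lt_le_trans c0 (le_trans h1 h2).
exists (1 + k + c^-1 + M + C).
  by rewrite -!addrA lerDl !addr_ge0 ?invr_ge0// ltW.
have ci : 0 < c^-1 by rewrite invr_gt0.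
split.
- move=> t; have /andP[h1 h2] := cl t; apply/andP; split; last by flra.
  by apply: (le_trans _ h1); rewrite invf_ple ?posrE//; flra.
- by move=> x y; apply: (le_trans (lk x y)); rewrite ler_wpM2r//; flra.
- move=> t ht; have [h _] := H (0, t) (0, t) ht ht; apply: (le_trans h); flra.
- move=> x y hx hy; have [_ h] := H (0, x) (0, y) hx hy.
  rewrite mul1r /d1 /= subrr normr0 add0r in h; apply: (le_trans h).
  by rewrite ler_wpM2r//; flra.
Qed.

Definition flies (t v s : R) : Prop := 0 < s /\ v * s = l t + l (t + s).

Lemma flies_exists t v : 0 < v -> exists s, flies t v s.
Proof.
move=> v0; have [K K1 [lK _ _ _]] := wall_const.
have K0 : 0 < K := lt_le_trans ltr01 K1.
pose S := 2 * K / v; have S0 : 0 < S by rewrite divr_gt0// mulr_gt0.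
pose g s := v * s - l t - l (t + s).
have cg : {within `[0, S], continuous g}.
  apply: continuous_subspaceT => s; apply: cvgB.
    by apply: cvgB; [apply: cvgMr; exact: cvg_id|exact: cvg_cst].
  apply: (continuous_comp (f := fun s => t + s) (g := l)); last exact: wall_cont.
  by apply: cvgD; [exact: cvg_cst|exact: cvg_id].
have l0 u : 0 < l u by exact: wall_gt0.
have [s sS gs] : exists2 s, s \in `[0, S]%R & g s = 0.
  apply: (IVT (ltW S0) cg).
  have g0 : g 0 < 0 by rewrite /g mulr0 addr0 sub0r; have := l0 t; flra.
  have gS : 0 <= g S.
    rewrite /g /S mulrCA mulfV ?gt_eqF// mulr1.
    by have /andP[_ h1] := lK t; have /andP[_ h2] := lK (t + 2 * K / v); flra.
  by rewrite ge_min le_max (ltW g0) gS orbT.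
exists s; have e : v * s = l t + l (t + s) by move: gs; rewrite /g; flra.
split => //; rewrite -(pmulr_rgt0 _ v0) e addr_gt0//.
Qed.

(** The default 0 is not met when [v] is positive, by [flightP]. *)
Definition flight (t v : R) : R := xget 0 [set s | flies t v s].

Lemma flightP t v : 0 < v -> flies t v (flight t v).
Proof. by move=> v0; rewrite /flight; case: xgetP => //= h; have [s /h] := flies_exists t v0. Qed.

Definition momentum (t v : R) : R := l t * (v + l1 t).
Definition phase (t v : R) : R := momentum t v * clock t.
Definition next_hit (z : R * R) : R * R :=
  let t := frac (z.1 + flight z.1 z.2) in (t, z.2 - 2 * l1 t).

Definition fast (P t v : R) : Prop := 0 < t < 1 /\ P <= momentum t v.

Lemma fast_speed : exists C P0 : R, [/\ 0 < C, 1 <= P0 & forall P t v, P0 <= P -> fast P t v ->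
  P / C <= v /\ forall s, flies t v s -> s <= C / P].
Proof.
have [K K1 [lK _ l1K _]] := wall_const.
have K0 : 0 < K := lt_le_trans ltr01 K1.
have KK : 1 <= K * K by rewrite -[1]mulr1; apply: ler_pM.
have KK0 : 0 < K * K by rewrite mulr_gt0.
exists (8 * (K * (K * K))), (4 * (K * K)); split; [by rewrite !mulr_gt0|by flra|].
move=> P t v PP [t01 pP].
have P0 : 0 < P by apply: lt_le_trans PP; rewrite !mulr_gt0.
have /andP[lt1 lt2] := lK t; have lt0 : 0 < l t by exact: wall_gt0.
have h1 : P / (4 * (K * K)) <= v.
  have a1 : `|l1 t| <= K by exact: l1K.
  have a2 : P <= K * (v + K).
    apply: (le_trans pP); rewrite /momentum; have a3 : 0 <= v + l1 t.
      by rewrite -(pmulr_rge0 _ lt0) -/(momentum t v) (le_trans _ pP)// ltW.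
    apply: ler_pM => //; [exact: ltW|rewrite lerD2l; exact: le_trans (ler_norm _) a1].
  rewrite ler_pdivrMr ?mulr_gt0//.
  have a4 : 0 <= v by rewrite -(pmulr_rge0 _ K0); move: a2 PP; flra.
  have a5 : 0 <= K * v by rewrite mulr_ge0// ltW.
  have a6 : K * v <= v * (K * K) by rewrite mulrC ler_wpM2l// ler_peMl// ltW.
  by move: a2 PP a5 a6; flra.
split.
  apply: le_trans h1; rewrite ler_pM2l// lef_pV2 ?posrE ?mulr_gt0//.
  by have := ler_wpM2r (ltW KK0) K1; rewrite mul1r; flra.
move=> s [s0 e].
have s2 : v * s <= 2 * K.
  by rewrite e; have /andP[_ b1] := lK t; have /andP[_ b2] := lK (t + s); flra.
rewrite ler_pdivlMr//.
have s3 : P / (4 * (K * K)) * s <= 2 * K by apply: le_trans s2; rewrite ler_pM2r.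
rewrite mulrAC ler_pdivrMr ?mulr_gt0// in s3; rewrite mulrC; apply: (le_trans s3).
by rewrite le_eqVlt; apply/orP; left; apply/eqP; ring.
Qed.

Lemma clock_mvt (x y : R) : -1 < x -> x <= y -> y < 3 ->
  exists2 c, x <= c <= y & clock y - clock x = rate l c * (y - x).
Proof.
move=> x1 xy y3.
have d c : x <= c <= y -> is_derive c 1 clock (rate l c).
  by move=> /andP[h1 h2]; apply: (clock_derive hl); flra.
have [||c cxy e] := @MVT_segment R clock (rate l) x y xy.
- by move=> c; rewrite in_itv/= => /andP[h1 h2]; apply: d; rewrite !ltW.
- apply: derivable_within_continuous => c; rewrite in_itv/= => h.
  exact: (@ex_derive _ _ _ _ _ _ _ (d c h)).
by exists c => //; move: cxy; rewrite in_itv.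
Qed.

Lemma rate_bounds (K : R) : 1 <= K -> (forall t, K^-1 <= l t <= K) ->
  forall t, (K * K)^-1 <= rate l t <= K * K.
Proof.
move=> K1 lK t; have K0 : 0 < K := lt_le_trans ltr01 K1.
have /andP[h1 h2] := lK t; have l0 : 0 < l t by exact: wall_gt0.
have i1 : K^-1 <= (l t)^-1 by rewrite lef_pV2.
have i2 : (l t)^-1 <= K by rewrite -[leRHS]invrK lef_pV2 ?posrE ?invr_gt0.
have [k0 k1 k2] : [/\ 0 <= K, 0 <= K^-1 & 0 <= (l t)^-1].
  by split; rewrite ?invr_ge0 ltW.
by rewrite /rate invfM; apply/andP; split; apply: ler_pM.
Qed.

Lemma clock_bound (K : R) : 1 <= K -> (forall t, K^-1 <= l t <= K) ->
  forall t, 0 < t < 1 -> `|clock t| <= K * K.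
Proof.
move=> K1 lK t /andP[t0 t1]; have K0 : 0 < K := lt_le_trans ltr01 K1.
have [||| c _] := @clock_mvt 0 t; [by flra|by exact: ltW|by flra|].
rewrite clock0 !subr0 => ->; have /andP[r1 r2] := rate_bounds K1 lK c.
have r0 : 0 < rate l c by apply: lt_le_trans r1; rewrite invr_gt0 mulr_gt0.
have h : 0 <= rate l c * t by rewrite mulr_ge0// ltW.
by rewrite ger0_norm//; apply: (le_trans _ r2); rewrite ger_pMr// ltW.
Qed.

Definition phase_gap (t v t' v' : R) : R := `|phase t v - phase t' v'| + `|momentum t v - momentum t' v'|.

Lemma gap_ge0 t v t' v' : 0 <= phase_gap t v t' v'. Proof. exact: addr_ge0. Qed.

(** The phase is the momentum times [clock], so at momentum [P] a gap in phase is a gap of order 1/P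
    in time. The duration, itself of order 1/P, then changes by order 1/P per unit of time and 1/P^2
    per unit of momentum. *)
Lemma flight_diff : exists C P0 : R, [/\ 0 < C, 1 <= P0 & forall P t v s t' v' s', P0 <= P ->
  fast P t v -> fast P t' v' -> flies t v s -> flies t' v' s' ->
  `|t - t'| <= C / P * phase_gap t v t' v' /\ `|s - s'| <= C / P / P * phase_gap t v t' v'].
Proof.
have [K K1 [lK lipK l1K lip1]] := wall_const.
have K0 : 0 < K := lt_le_trans ltr01 K1.
have [C1 [P1 [C10 P11 HC]]] := fast_speed.
pose K2 := K * K; have K20 : 0 < K2 by rewrite mulr_gt0.
have K21 : 1 <= K2 by rewrite -[1]mulr1; apply: ler_pM.
pose C := K2 * K2 + 12 * (K2 * (K2 * K2)) + 2 * C1.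
have KKK0 : 0 < K2 * K2 by rewrite mulr_gt0.
have KKKK0 : 0 < K2 * (K2 * K2) by rewrite mulr_gt0.
exists C, (P1 + C1 + 4 * K2); split; [by rewrite /C; flra|by flra|].
move=> P t v s t' v' s' PP F F' fl fl'.
have PP1 : P1 <= P by flra.
have P0 : 0 < P by flra.
have [_ Hs] := HC P t v PP1 F; have [_ Hs'] := HC P t' v' PP1 F'.
have {}Hs := Hs s fl; have {}Hs' := Hs' s' fl'.
have C1P : C1 / P <= 1 by rewrite ler_pdivrMr// mul1r; flra.
have [t01 Pp] := F; have [t01' Pp'] := F'; have [s0 e] := fl; have [s0' e'] := fl'.
set D := phase_gap t v t' v'; have D0 : 0 <= D by exact: gap_ge0.
have ht : P * `|t - t'| <= K2 * K2 * D.
  have h1 : P * `|clock t - clock t'| <= K2 * D.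
    have h2 : momentum t v * (clock t - clock t') = (phase t v - phase t' v') - clock t' * (momentum t v - momentum t' v').
      by rewrite /phase; ring.
    apply: (@le_trans _ _ `|momentum t v * (clock t - clock t')|).
      by rewrite normrM ler_wpM2r// (le_trans Pp)// ler_norm.
    rewrite h2; apply: (le_trans (ler_normB _ _)); rewrite normrM.
    have h3 : `|clock t'| * `|momentum t v - momentum t' v'| <= K2 * `|momentum t v - momentum t' v'|.
      by rewrite ler_wpM2r//; exact: clock_bound.
    have h4 : `|phase t v - phase t' v'| <= K2 * `|phase t v - phase t' v'| by rewrite ler_peMl.
    by rewrite /D /phase_gap mulrDr lerD.
  have h5 : `|t - t'| <= K2 * `|clock t - clock t'|.
    wlog tt : t t' {v v' s s' F F' fl fl' Hs Hs' Pp Pp' e e' s0 s0' D D0 h1} t01 t01' / t' <= t.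
      move=> H; have [h|h] := leP t' t; first exact: H.
      by rewrite distrC [`|clock t - _|]distrC; apply: H => //; exact: ltW.
    move: t01 t01' => /andP[a1 a2] /andP[b1 b2].
    have [||| c _ ->] := @clock_mvt t' t; [by flra|by []|by flra|].
    have /andP[r1 r2] := rate_bounds K1 lK c.
    have r0 : 0 < rate l c by apply: lt_le_trans r1; rewrite invr_gt0.
    rewrite normrM (gtr0_norm r0) mulrA ler_peMl//.
    by rewrite mulrC -ler_pdivrMr// div1r.
  apply: (@le_trans _ _ (P * (K2 * `|clock t - clock t'|))); first by rewrite ler_pM2l.
  by rewrite mulrCA -mulrA ler_pM2l.
have hs : P * `|s - s'| <= 12 * K2 * `|t - t'| + 2 * (C1 / P) * D.
  have H1 t1 v1 s1 : flies t1 v1 s1 -> momentum t1 v1 * s1 = l t1 * (l t1 + l (t1 + s1) + s1 * l1 t1).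
    by move=> [_ f]; rewrite /momentum -f; ring.
  have h2 : momentum t v * (s - s') = (l t * (l t + l (t + s) + s * l1 t) -
      l t' * (l t' + l (t' + s') + s' * l1 t')) - s' * (momentum t v - momentum t' v').
    by rewrite -(H1 t v s fl) -(H1 t' v' s' fl'); ring.
  have lKn x : `|l x| <= K.
    by rewrite gtr0_norm ?wall_gt0//; have /andP[] := lK x.
  have s1 : s <= 1 by exact: le_trans C1P.
  have s1' : s' <= 1 by exact: le_trans C1P.
  have dsum : `|l t + l (t + s) + s * l1 t - (l t' + l (t' + s') + s' * l1 t')| <=
      3 * (K * `|t - t'|) + 2 * (K * `|s - s'|).
    have d1' := lipK t t'; have d2' := lipK (t + s) (t' + s').
    have d3 : `|t + s - (t' + s')| <= `|t - t'| + `|s - s'| by rewrite opprD addrACA ler_normD.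
    have d4 : `|s * l1 t - s' * l1 t'| <= 1 * (K * `|t - t'|) + K * `|s - s'|.
      apply: mul_diff => //; [by rewrite gtr0_norm|exact: l1K|exact: lip1].
    have d5 : K * `|t + s - (t' + s')| <= K * (`|t - t'| + `|s - s'|) by rewrite ler_pM2l.
    rewrite (_ : _ - _ = (l t - l t') + (l (t + s) - l (t' + s')) + (s * l1 t - s' * l1 t')); last by ring.
    apply: (le_trans (ler_normD _ _)); apply: (le_trans (lerD (ler_normD _ _) (lexx _))).
    by rewrite mulrDr in d5; clear -hl d1' d2' d4 d5; lra.
  have bsum : `|l t' + l (t' + s') + s' * l1 t'| <= 3 * K.
    apply: (le_trans (ler_normD _ _)); apply: (le_trans (lerD (ler_normD _ _) (lexx _))).
    have d1' := lKn t'; have d2' := lKn (t' + s').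
    have d3 : `|s' * l1 t'| <= 1 * K by rewrite normrM; apply: ler_pM => //; [rewrite gtr0_norm|exact: l1K].
    by clear -hl d1' d2' d3; lra.
  have dH := mul_diff (lKn t) bsum (lipK t t') dsum.
  have h3 : P * `|s - s'| <= `|momentum t v * (s - s')|.
    by rewrite normrM ler_wpM2r// (le_trans Pp)// ler_norm.
  rewrite h2 in h3; have h4 := le_trans h3 (ler_normB _ _).
  have h5 : `|s' * (momentum t v - momentum t' v')| <= C1 / P * D.
    rewrite normrM (gtr0_norm s0'); apply: ler_pM => //; first exact: ltW.
    by rewrite /D /phase_gap lerDr.
  (* For [P] large, the term in [|s - s'|] that comes from [l (t + s)] is absorbed by the left
     side. *)
  have h6 : 4 * K2 * `|s - s'| <= P * `|s - s'| by rewrite ler_wpM2r//; clear -hl PP P11 C10; lra.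
  have h7 : K * (3 * (K * `|t - t'|) + 2 * (K * `|s - s'|)) + 3 * K * (K * `|t - t'|) =
     6 * K2 * `|t - t'| + 2 * K2 * `|s - s'| by rewrite /K2; ring.
  rewrite h7 in dH.
  by have h8 := le_trans h4 (lerD dH h5); clear -hl h6 h8; lra.
split.
  rewrite mulrAC ler_pdivlMr// mulrC; apply: (le_trans ht); rewrite ler_wpM2r// /C; clear -hl KKK0 KKKK0 C10; lra.
have i0 : 0 < P^-1 by rewrite invr_gt0.
rewrite -(ler_pM2l P0); apply: (le_trans hs).
have ht' : `|t - t'| <= K2 * K2 * D / P by rewrite ler_pdivlMr// mulrC.
have h9 : 12 * K2 * `|t - t'| <= 12 * K2 * (K2 * K2 * D / P) by rewrite ler_pM2l// mulr_gt0.
apply: (@le_trans _ _ ((12 * (K2 * (K2 * K2)) + 2 * C1) * (D / P))).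
  apply: (le_trans (lerD h9 (lexx _))); rewrite le_eqVlt; apply/orP; left; apply/eqP; ring.
have -> : P * (C / P / P * D) = C * (D / P) by field; rewrite gt_eqF.
by rewrite ler_wpM2r ?divr_ge0 ?(ltW P0)// /C; clear -hl KKK0; lra.
Qed.

End Steps.

(** * One collision in the coordinates (phase, momentum) *)

Section Returns.
Context {R : realType} (l : R -> R) (hl : fermi_ulam_wall l).
Local Notation l1 := (derive1 l).
Local Notation clock := (clock l).
Local Notation pp := (momentum l).
Local Notation zz := (phase l).
Local Notation flies := (flies l).
Local Notation fast := (fast l).
Local Notation gap := (phase_gap l).

Lemma flight_size : exists C P0 : R, [/\ 0 < C, 1 <= P0 & forall P t v s, P0 <= P ->
  fast P t v -> flies t v s -> [/\ 0 < P, P^-1 <= 1, 0 < s, s <= C * P^-1 & s < 2^-1 /\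
  forall t' v' s', fast P t' v' -> flies t' v' s' ->
  `|t - t'| <= C * P^-1 * gap t v t' v' /\ `|s - s'| <= C * P^-1 * P^-1 * gap t v t' v']].
Proof.
have [C1 [P1 [C10 P11 H1]]] := fast_speed hl.
have [C2 [P2 [C20 P21 H2]]] := flight_diff hl.
exists (C1 + C2), (P1 + P2 + 4 * C1); split; [by flra|by flra|].
move=> P t v s PP F fl.
have P0 : 0 < P by flra.
have i0 : 0 < P^-1 by rewrite invr_gt0.
have i1 : P^-1 <= 1 by rewrite invf_le1//; flra.
have PP1 : P1 <= P by flra.
have PP2 : P2 <= P by flra.
have [_ /(_ s fl) h1] := H1 P t v PP1 F.
have h2 : C1 / P <= 4^-1 by rewrite ler_pdivrMr//; flra.
have [s0 _] := fl; split => //.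
  by apply: (le_trans h1); rewrite ler_pM2r//; flra.
split; first by flra.
move=> t' v' s' F' fl'; have [a b] := H2 P t v s t' v' s' PP2 F F' fl fl'.
have g0 := gap_ge0 l t v t' v'.
split; [apply: (le_trans a)|apply: (le_trans b)]; rewrite ler_wpM2r//.
  by rewrite ler_pM2r//; flra.
by rewrite ler_pM2r// ler_pM2r//; flra.
Qed.

Lemma sq_rem W : Cl (fun=> 1) D1 W -> exists C P0 : R, [/\ 0 < C, 1 <= P0 &
  forall P t v s, P0 <= P -> fast P t v -> flies t v s -> t + s < 1 ->
  `|s ^+ 2 * W (t, s)| <= C * P^-1 * P^-1 /\
  forall t' v' s', fast P t' v' -> flies t' v' s' -> t' + s' < 1 ->
  `|s ^+ 2 * W (t, s) - s' ^+ 2 * W (t', s')| <= C * P^-1 * P^-1 * gap t v t' v'].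
Proof.
move=> [M M0 HW]; have [C1 [P1 [C10 P11 H1]]] := flight_size.
have CC : 0 < C1 * C1 by rewrite mulr_gt0.
exists (C1 * C1 * M + 2 * (C1 * C1 * C1 * M) + 2 * (C1 * C1 * M) + 1), P1; split => //.
  have h1 : 0 <= C1 * C1 * M by rewrite mulr_ge0// ltW.
  have h2 : 0 <= C1 * C1 * C1 * M by rewrite !mulr_ge0// ltW.
  by flra.
move=> P t v s PP F fl ts.
have [P0 i1 s0 sC [_ Hd]] := H1 P t v s PP F fl.
have i0 : 0 < P^-1 by rewrite invr_gt0.
set i := P^-1 in i0 i1 sC Hd *.
have [/andP[t0 _] _] := F.
have D1q : D1 (t, s) by split.
have ii : 0 < i * i by rewrite mulr_gt0.
have M2 : 0 <= C1 * C1 * M by rewrite mulr_ge0// ltW.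
have M3 : 0 <= C1 * C1 * C1 * M by rewrite !mulr_ge0// ltW.
have ss2 : `|s * s| <= C1 * C1 * (i * i).
  rewrite gtr0_norm ?mulr_gt0// (_ : _ * (i * i) = C1 * i * (C1 * i)); last by ring.
  by apply: ler_pM => //; exact: ltW.
have C1i : 0 < C1 * i by rewrite mulr_gt0.
split.
  have [w1 _] := HW _ _ D1q D1q.
  rewrite expr2 normrM; apply: (@le_trans _ _ (C1 * C1 * (i * i) * M)); first exact: ler_pM.
  rewrite (_ : C1 * C1 * (i * i) * M = C1 * C1 * M * (i * i)); last by ring.
  by rewrite -[leRHS]mulrA ler_pM2r//; flra.
move=> t' v' s' F' fl' ts'.
have [_ _ s0' sC' _] := H1 P t' v' s' PP F' fl'.
have [/andP[t0' _] _] := F'.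
have D1q' : D1 (t', s') by split.
have [_ w2] := HW _ _ D1q D1q'; have [w3 _] := HW _ _ D1q' D1q; rewrite mul1r in w2.
have [dt dsx] := Hd t' v' s' F' fl'; set g := gap _ _ _ _ in dt dsx *.
have g0 : 0 <= g by exact: gap_ge0.
have ig : i * g <= g by rewrite ler_piMl.
have dss : `|s * s - s' * s'| <= C1 * i * (C1 * i * i * g) + C1 * i * (C1 * i * i * g).
  by apply: mul_diff => //; rewrite gtr0_norm.
have dW : `|W (t, s) - W (t', s')| <= M * (C1 * g + C1 * g).
  apply: (le_trans w2); rewrite ler_wpM2l// /d1 /=.
  have e1 : C1 * i * g <= C1 * g by rewrite -mulrA ler_pM2l.
  have e2 : C1 * i * i * g <= C1 * g.
    rewrite -!mulrA ler_pM2l//; apply: (le_trans _ ig); rewrite ler_piMl//.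
    by rewrite mulr_ge0// ltW.
  by flra.
rewrite !expr2; apply: (le_trans (mul_diff ss2 w3 dss dW)).
have e3 : C1 * i * (C1 * i * i * g) + C1 * i * (C1 * i * i * g) <= 2 * (C1 * C1 * (i * i * g)).
  have : C1 * C1 * (i * i * (i * g)) <= C1 * C1 * (i * i * g) by rewrite ler_pM2l// ler_pM2l.
  by flra.
apply: (le_trans (lerD (lexx _) (ler_wpM2l M0 e3))).
have z : 0 <= i * i * g by rewrite mulr_ge0// ltW.
rewrite (_ : _ * i * i * g = (C1 * C1 * M + 2 * (C1 * C1 * C1 * M) + 2 * (C1 * C1 * M) + 1) * (i * i * g)); last by ring.
apply: (@le_trans _ _ ((2 * (C1 * C1 * C1 * M) + 2 * (C1 * C1 * M)) * (i * i * g))).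
  by rewrite le_eqVlt; apply/orP; left; apply/eqP; ring.
by rewrite ler_wpM2r//; flra.
Qed.

(** The Lipschitz constant of [W] is of order 1/s, which the factor [s] cancels; the factor 1/P in
    the second bound comes from [flight_diff], since the times differ by order gap/P. *)
Lemma lin_rem W : Cl (fun q => q.1 + q.2) D2 W -> exists C P0 : R, [/\ 0 < C, 1 <= P0 &
  forall P t v s, P0 <= P -> fast P t v -> flies t v s -> 1 < t + s ->
  `|s * W (1 - t, t + s - 1)| <= C * P^-1 /\
  forall t' v' s', fast P t' v' -> flies t' v' s' -> 1 < t' + s' ->
  `|s * W (1 - t, t + s - 1) - s' * W (1 - t', t' + s' - 1)| <= C * P^-1 * gap t v t' v'].
Proof.
move=> [M M0 HW]; have [C1 [P1 [C10 P11 H1]]] := flight_size.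
have CM : 0 <= C1 * M by rewrite mulr_ge0// ltW.
exists (4 * (C1 * M) + 1), P1; split => //; first by flra.
move=> P t v s PP F fl ts.
have [P0 i1 s0 sC [s2 Hd]] := H1 P t v s PP F fl.
have i0 : 0 < P^-1 by rewrite invr_gt0.
set i := P^-1 in i0 i1 sC Hd *.
have inD t1 v1 s1 : fast P t1 v1 -> flies t1 v1 s1 -> 1 < t1 + s1 -> D2 (1 - t1, t1 + s1 - 1).
  move=> F1 f1 h1; have [_ _ _ _ [s3 _]] := H1 P t1 v1 s1 PP F1 f1.
  have [/andP[? ?] _] := F1; split => /=; apply/andP; split; flra.
have Dq := inD t v s F fl ts.
have [w1 _] := HW _ _ Dq Dq.
split.
  rewrite normrM gtr0_norm//; apply: (@le_trans _ _ (C1 * i * M)); first by apply: ler_pM => //; exact: ltW.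
  by rewrite mulrAC ler_pM2r//; flra.
move=> t' v' s' F' fl' ts'.
have Dq' := inD t' v' s' F' fl' ts'.
have [_ w2] := HW _ _ Dq Dq'; have [w3 _] := HW _ _ Dq' Dq.
have [dt dsx] := Hd t' v' s' F' fl'; set g := gap _ _ _ _ in dt dsx *.
have g0 : 0 <= g by exact: gap_ge0.
set w := W (1 - t, _) in w1 w2 *; set w' := W (1 - t', _) in w2 w3 *.
have es : (1 - t) + (t + s - 1) = s by ring.
rewrite /= es in w2.
have dss : `|s - s'| <= C1 * i * g.
  apply: (le_trans dsx); rewrite ler_wpM2r// -[leRHS]mulr1 ler_wpM2l//.
  by rewrite mulr_ge0// ltW.
have d1le : d1 (1 - t, t + s - 1) (1 - t', t' + s' - 1) <= 2 * `|t - t'| + `|s - s'|.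
  rewrite /d1 /= (_ : 1 - t - (1 - t') = - (t - t')); last by ring.
  rewrite (_ : t + s - 1 - _ = (t - t') + (s - s')); last by ring.
  by rewrite normrN; have := ler_normD (t - t') (s - s'); flra.
rewrite (_ : s * w - s' * w' = s * (w - w') + (s - s') * w'); last by ring.
apply: (le_trans (ler_normD _ _)); rewrite !normrM (gtr0_norm s0).
have e1 : s * `|w - w'| <= M * (3 * (C1 * i * g)).
  apply: (le_trans w2); rewrite ler_wpM2l//; apply: (le_trans d1le).
  by move: dt dss; flra.
have e2 : `|s - s'| * `|w'| <= C1 * i * g * M by apply: ler_pM.
apply: (le_trans (lerD e1 e2)).
have ig : 0 <= i * g by rewrite mulr_ge0// ltW.
rewrite (_ : (4 * (C1 * M) + 1) * i * g = (4 * (C1 * M)) * (i * g) + i * g); last by ring.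
apply: (@le_trans _ _ ((4 * (C1 * M)) * (i * g))); last by rewrite lerDl.
by rewrite le_eqVlt; apply/orP; left; apply/eqP; ring.
Qed.

Lemma pp_parr t v s : flies t v s -> pp (t + s) (v - 2 * l1 (t + s)) = parr l t s /\ pp t v = pdep l t s.
Proof.
move=> [s0 e]; have vE : v = (l t + l (t + s)) / s by rewrite -e mulfK// gt_eqF.
by rewrite /momentum /parr /pdep -vE; split => //; ring.
Qed.

Lemma step_in : exists C P0 : R, [/\ 0 < C, 1 <= P0 &
  forall P t v s, P0 <= P -> fast P t v -> flies t v s -> t + s < 1 ->
  let v1 := v - 2 * l1 (t + s) in
  [/\ `|pp (t + s) v1 - pp t v| <= C * P^-1 * P^-1,
      `|zz (t + s) v1 - zz t v - 2| <= C * P^-1 * P^-1 &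
  forall t' v' s', fast P t' v' -> flies t' v' s' -> t' + s' < 1 ->
  let v1' := v' - 2 * l1 (t' + s') in
  `|(pp (t + s) v1 - pp t v) - (pp (t' + s') v1' - pp t' v')| <= C * P^-1 * P^-1 * gap t v t' v' /\
  `|(zz (t + s) v1 - zz t v) - (zz (t' + s') v1' - zz t' v')| <= C * P^-1 * P^-1 * gap t v t' v']].
Proof.
have [WP [WZ [cP cZ H]]] := flight_inside hl.
have [C1 [P1 [C10 P11 H1]]] := sq_rem cP; have [C2 [P2 [C20 P21 H2]]] := sq_rem cZ.
exists (C1 + C2), (P1 + P2); split; [by flra|by flra|] => P t v s PP F fl ts v1.
have PP1 : P1 <= P by flra.
have PP2 : P2 <= P by flra.
have P0 : 0 < P by flra.
have i0 : 0 < P^-1 by rewrite invr_gt0.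
have ii : 0 < P^-1 * P^-1 by rewrite mulr_gt0.
have le1 : C1 * P^-1 * P^-1 <= (C1 + C2) * P^-1 * P^-1.
  by rewrite -!mulrA ler_pM2r//; flra.
have le2 : C2 * P^-1 * P^-1 <= (C1 + C2) * P^-1 * P^-1.
  by rewrite -!mulrA ler_pM2r//; flra.
have key t1 v0 s1 : fast P t1 v0 -> flies t1 v0 s1 -> t1 + s1 < 1 ->
   pp (t1 + s1) (v0 - 2 * l1 (t1 + s1)) - pp t1 v0 = s1 ^+ 2 * WP (t1, s1) /\
   zz (t1 + s1) (v0 - 2 * l1 (t1 + s1)) - zz t1 v0 = 2 + s1 ^+ 2 * WZ (t1, s1).
  move=> [/andP[a1 _] _] f1 h1; have [e1 e2] := pp_parr f1.
  have Dq : D1 (t1, s1) by split => //; case: f1.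
  by have := H _ Dq; rewrite /phase e1 e2.
have [k1 k2] := key t v s F fl ts.
have [b1 d1] := H1 P t v s PP1 F fl ts; have [b2 d2] := H2 P t v s PP2 F fl ts.
rewrite /v1 k1 k2; split.
- exact: le_trans b1 le1.
- by rewrite addrAC subrr add0r; exact: le_trans b2 le2.
move=> t' v' s' F' fl' ts'; have [k1' k2'] := key t' v' s' F' fl' ts'.
have g0 := gap_ge0 l t v t' v'.
rewrite k1' k2'; split; first by apply: (le_trans (d1 _ _ _ F' fl' ts')); rewrite ler_wpM2r.
have e (a b : R) : 2 + a - (2 + b) = a - b by ring.
rewrite e.
by apply: (le_trans (d2 _ _ _ F' fl' ts')); rewrite ler_wpM2r.
Qed.

(** The phase still to be covered before the end of the period; a collision consumes about 2 of
    it. *)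
Definition time_left t v : R := alpha l * pp t v - zz t v.

Lemma step_cross : exists C P0 : R, [/\ 0 < C, 1 <= P0 &
  forall P t v s, P0 <= P -> fast P t v -> flies t v s -> 1 < t + s ->
  let t1 := t + s - 1 in let v1 := v - 2 * l1 t1 in
  let ep := pp t1 v1 - pp t v - jump l * (time_left t v - 1) in
  let ez := zz t1 v1 - (2 - time_left t v) in
  [/\ 0 < t1 < 2^-1, `|ep| <= C * P^-1, `|ez| <= C * P^-1 &
  forall t' v' s', fast P t' v' -> flies t' v' s' -> 1 < t' + s' ->
  let t1' := t' + s' - 1 in let v1' := v' - 2 * l1 t1' in
  let ep' := pp t1' v1' - pp t' v' - jump l * (time_left t' v' - 1) in
  let ez' := zz t1' v1' - (2 - time_left t' v') in
  `|ep - ep'| <= C * P^-1 * gap t v t' v' /\ `|ez - ez'| <= C * P^-1 * gap t v t' v']].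
Proof.
have [W1 [W2 [c1 c2 H]]] := flight_across hl.
have [C1 [P1 [C10 P11 H1]]] := lin_rem c1; have [C2 [P2 [C20 P21 H2]]] := lin_rem c2.
have [C3 [P3 [C30 P31 H3]]] := flight_size.
exists (C1 + C2), (P1 + P2 + P3); split; [by flra|by flra|] => P t v s PP F fl ts t1 v1 ep ez.
have PP1 : P1 <= P by flra.
have PP2 : P2 <= P by flra.
have PP3 : P3 <= P by flra.
have P0 : 0 < P by flra.
have i0 : 0 < P^-1 by rewrite invr_gt0.
have le1 : C1 * P^-1 <= (C1 + C2) * P^-1 by rewrite ler_pM2r//; flra.
have le2 : C2 * P^-1 <= (C1 + C2) * P^-1 by rewrite ler_pM2r//; flra.
have in1 t0 v0 s0 : fast P t0 v0 -> flies t0 v0 s0 -> 1 < t0 + s0 ->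
    0 < t0 + s0 - 1 < 2^-1 /\ D2 (1 - t0, t0 + s0 - 1).
  move=> F1 f1 h1; have [_ _ _ _ [s3 _]] := H3 P t0 v0 s0 PP3 F1 f1.
  have [/andP[? ?] _] := F1.
  by split; [apply/andP; split; flra|split => /=; apply/andP; split; flra].
have key t0 v0 s0 : fast P t0 v0 -> flies t0 v0 s0 -> 1 < t0 + s0 ->
   let t1 := t0 + s0 - 1 in let v1 := v0 - 2 * l1 t1 in
   pp t1 v1 - pp t0 v0 - jump l * (time_left t0 v0 - 1) = s0 * W2 (1 - t0, t0 + s0 - 1) /\
   zz t1 v1 - (2 - time_left t0 v0) = s0 * W1 (1 - t0, t0 + s0 - 1).
  move=> F1 f1 h1 t2 v2; have [_ Dq] := in1 _ _ _ F1 f1 h1.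
  have [a0 e] := f1; have [/andP[h2 h3] _] := F1.
  have vE : v0 = (l t0 + l t2) / s0.
    have lt2 : l t2 = l (t0 + s0) by rewrite -[in RHS](subrK 1 (t0 + s0)) (wall_periodic hl).
    by rewrite lt2 -e mulfK// gt_eqF.
  have es : (1 - t0) + (t0 + s0 - 1) = s0 by ring.
  have := H _ Dq; cbv beta iota zeta; rewrite es subKr -/t2 -vE /time_left /v2 => -[q1 q2].
  have e1 : pp t2 (v0 - 2 * l1 t2) = l t2 * (v0 - l1 t2) by rewrite /momentum; ring.
  have e2 : alpha l * pp t0 v0 - zz t0 v0 = l t0 * (v0 + l1 t0) * (alpha l - clock t0).
    by rewrite /phase /momentum; ring.
  rewrite /phase e1 -/(zz t0 v0) e2 /momentum; split; first by rewrite q1; ring.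
  by rewrite q2; ring.
have [k1 k2] := key t v s F fl ts; have [tt _] := in1 t v s F fl ts.
have [b1 d1] := H1 P t v s PP1 F fl ts; have [b2 d2] := H2 P t v s PP2 F fl ts.
rewrite /ep /ez /v1 /t1 k1 k2; split => //.
- exact: le_trans b2 le2.
- exact: le_trans b1 le1.
move=> t' v' s' F' fl' ts'; have [k1' k2'] := key t' v' s' F' fl' ts'.
have g0 := gap_ge0 l t v t' v'.
cbv zeta; rewrite k1' k2'; split.
  by apply: (le_trans (d2 _ _ _ F' fl' ts')); rewrite ler_wpM2r.
by apply: (le_trans (d1 _ _ _ F' fl' ts')); rewrite ler_wpM2r.
Qed.

(** A flight takes phase 2 up to O(1/P), and [clock] is increasing. So comparing [time_left] with 2
    tells on which side of the discontinuity the next collision falls, outside a window of width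
    O(1/P). *)
Lemma step_side : exists C P0 : R, [/\ 0 < C, 1 <= P0 &
  forall P t v s, P0 <= P -> fast P t v -> flies t v s ->
  (t + s <= 1 -> 2 - C * P^-1 <= time_left t v) /\ (1 <= t + s -> time_left t v <= 2 + C * P^-1)].
Proof.
have [K K1 [lK lipK l1K lip1]] := wall_const hl.
have K0 : 0 < K := lt_le_trans ltr01 K1.
have [C1 [P1 [C10 P11 H1]]] := flight_size.
pose K2 := K * K; have K20 : 0 < K2 by rewrite mulr_gt0.
(* The left factor is [pp t v * s]. *)
have main t s c : 0 < t < 1 -> 0 < s < 2^-1 -> t <= c <= t + s ->
   `|l t * (l t + l (t + s) + s * l1 t) * rate l c - 2| <= 8 * (K2 * K2) * s.
  move=> t01 /andP[s0 _] /andP[c1 c2].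
  have nl x : `|l x| <= K by rewrite gtr0_norm ?wall_gt0//; have /andP[] := lK x.
  have lc0 : l c != 0 by rewrite gt_eqF// wall_gt0.
  have -> : l t * (l t + l (t + s) + s * l1 t) * rate l c - 2 =
      ((l t * l t - l c * l c) + (l t * l (t + s) - l c * l c) + s * (l t * l1 t)) * rate l c.
    by rewrite /rate; field.
  have d1 : `|l t - l c| <= K * s.
    apply: (le_trans (lipK _ _)); rewrite ler_pM2l// distrC ger0_norm ?subr_ge0//; flra.
  have d2 : `|l (t + s) - l c| <= K * s.
    apply: (le_trans (lipK _ _)); rewrite ler_pM2l// ger0_norm ?subr_ge0//; flra.
  have q1 := mul_diff (nl t) (nl c) d1 d1.
  have q2 := mul_diff (nl t) (nl c) d1 d2.
  have q3 : `|s * (l t * l1 t)| <= s * (K * K).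
    by rewrite normrM (gtr0_norm s0) ler_pM2l// normrM; apply: ler_pM => //; exact: l1K.
  have /andP[r1 r2] := rate_bounds hl K1 lK c.
  have r0 : 0 < rate l c by apply: lt_le_trans r1; rewrite invr_gt0.
  rewrite normrM (gtr0_norm r0) (_ : 8 * (K2 * K2) * s = 8 * K2 * s * K2); last by ring.
  apply: ler_pM => //; first exact: ltW.
  apply: (le_trans (ler_normD _ _)); apply: (le_trans (lerD (ler_normD _ _) (lexx _))).
  apply: (le_trans (lerD (lerD q1 q2) q3)).
  have : 0 <= K2 * s by rewrite mulr_ge0// ltW.
  by rewrite /K2; flra.
exists (8 * (K2 * K2) * C1), P1; split => //; first by rewrite !mulr_gt0.
move=> P t v s PP F fl; have [P0 i1 s0 sC [s2 _]] := H1 P t v s PP F fl.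
have i0 : 0 < P^-1 by rewrite invr_gt0.
have [/andP[t0 t1] pP] := F; have [_ e] := fl.
have p0 : 0 < pp t v by exact: lt_le_trans pP.
have E : pp t v * s = l t * (l t + l (t + s) + s * l1 t) by rewrite /momentum -e; ring.
have [||| c cts ec] := @clock_mvt _ _ hl t (t + s); [by flra|by flra|by flra|].
have t01 : 0 < t < 1 by rewrite t0.
have s01 : 0 < s < 2^-1 by rewrite s0.
have m := main t s c t01 s01 cts.
have mC : 8 * (K2 * K2) * s <= 8 * (K2 * K2) * C1 * P^-1.
  by rewrite -[leRHS]mulrA ler_pM2l// !mulr_gt0.
have RE : pp t v * (clock (t + s) - clock t) = l t * (l t + l (t + s) + s * l1 t) * rate l c.
  by rewrite ec addrAC subrr add0r -E; ring.
have mono x y : 0 <= x -> x <= y -> y < 3 -> clock x <= clock y.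
  move=> x0 xy y3; have [||| c' _ h] := @clock_mvt _ _ hl x y; [by flra|by []|by []|].
  rewrite -subr_ge0 h mulr_ge0 ?subr_ge0//.
  have l0 : 0 < l c' by exact: wall_gt0.
  by rewrite mulr_ge0// invr_ge0 ltW.
have rE : time_left t v = pp t v * (clock 1 - clock t) by rewrite /time_left /phase clock1//; ring.
move: m; rewrite -RE ler_norml => /andP[m1 m2].
split => h.
  have h1 : pp t v * (clock (t + s) - clock t) <= time_left t v.
    by rewrite rE ler_pM2l// lerD2r; apply: mono => //; [exact: addr_ge0 (ltW t0) (ltW s0)|rewrite ltr1n].
  by flra.
have h1 : time_left t v <= pp t v * (clock (t + s) - clock t).
  rewrite rE ler_pM2l// lerD2r; apply: mono => //.
  by apply: (lt_trans (ltrD t1 s2)); flra.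
by flra.
Qed.

End Returns.

(** * One period of the wall *)

Section Laps.
Context {R : realType} (l : R -> R) (hl : fermi_ulam_wall l).
Local Notation frac := Defs.frac.
Local Notation l1 := (derive1 l).
Local Notation fast P w := (fast l P w.1 w.2).
Local Notation pw w := (momentum l w.1 w.2).
Local Notation zw w := (phase l w.1 w.2).
Local Notation gap w w' := (phase_gap l w.1 w.2 w'.1 w'.2).
Local Notation rest w := (time_left l w.1 w.2).
Local Notation step := (next_hit l).

Lemma frac_eq (x : R) (m : int) : m%:~R <= x < m%:~R + 1 -> frac x = x - m%:~R.
Proof. by move=> h; rewrite /frac -/(fl x) (fl_eq h). Qed.

Lemma step_collision : exists2 V0 : R, 0 < V0 & forall w : R * R, V0 <= w.2 -> 0 < w.1 < 1 ->
  0 < (step w).1 < 1 -> collision_map l w (step w).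
Proof.
have [K K1 [lK lipK l1K _]] := wall_const hl.
exists (2 * K); first by flra.
move=> [t v] /= Vv t01 s01; set t1 := frac _ in s01 *.
have b1 := l1K t t01; have b2 := l1K t1 s01.
have := ler_norm (- l1 t); have := ler_norm (l1 t1); rewrite normrN => n1 n2.
split; [by split => //=; flra|by split => //=; flra|].
have v0 : 0 < v by flra.
apply/(@next_collision_fast _ l K) => //.
- exact: wall_gt0.
- by move=> [x y] _ /=; exact: lipK.
- by flra.
have [_ e] := flightP hl t v0.
by exists (flight l t v); split; rewrite // -e mulrAC mulfV ?mul1r// gt_eqF.
Qed.

(** The errors of a crossing collision with respect to the limit, in which the kick is
    [jump l * (rest w - 1)] and the phase afterwards is [2 - rest w]. *)
Definition ep (w : R * R) := pw (step w) - pw w - jump l * (rest w - 1).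
Definition ez (w : R * R) := zw (step w) - (2 - rest w).

Lemma step_cases : exists C P0 : R, [/\ 0 < C, 1 <= P0 & forall P w, P0 <= P -> fast P w ->
  [/\ P / C <= w.2,
   2 + C * P^-1 < rest w -> [/\ 0 < (step w).1 < 1, collision_map l w (step w),
      `|pw (step w) - pw w| <= C * P^-1 * P^-1,
      `|zw (step w) - zw w - 2| <= C * P^-1 * P^-1 &
      forall w', fast P w' -> 2 + C * P^-1 < rest w' ->
      `|(pw (step w) - pw w) - (pw (step w') - pw w')| <= C * P^-1 * P^-1 * gap w w' /\
      `|(zw (step w) - zw w) - (zw (step w') - zw w')| <= C * P^-1 * P^-1 * gap w w'] &
   rest w < 2 - C * P^-1 -> [/\ 0 < (step w).1 < 1, collision_map l w (step w),
      `|ep w| <= C * P^-1, `|ez w| <= C * P^-1 &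
      forall w', fast P w' -> rest w' < 2 - C * P^-1 ->
      `|ep w - ep w'| <= C * P^-1 * gap w w' /\ `|ez w - ez w'| <= C * P^-1 * gap w w']]].
Proof.
have [C1 [P1 [C10 P11 H1]]] := fast_speed hl.
have [C2 [P2 [C20 P21 H2]]] := step_in hl.
have [C3 [P3 [C30 P31 H3]]] := step_cross hl.
have [C4 [P4 [C40 P41 H4]]] := step_side hl.
have [C5 [P5 [C50 P51 H5]]] := flight_size hl.
have [V0 V00 HV] := step_collision.
pose C := C1 + C2 + C3 + C4.
have C0 : 0 < C by rewrite /C; flra.
exists C, (P1 + P2 + P3 + P4 + P5 + V0 * C1); split => //.
  by have := mulr_gt0 V00 C10; flra.
move=> P w PP F.
have VC := mulr_gt0 V00 C10.
have P0 : 0 < P by flra.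
have i0 : 0 < P^-1 by rewrite invr_gt0.
have ii : 0 < P^-1 * P^-1 by rewrite mulr_gt0.
have leC c : c <= C -> c * P^-1 <= C * P^-1 by move=> h; rewrite ler_pM2r.
have leC2 c : c <= C -> c * P^-1 * P^-1 <= C * P^-1 * P^-1.
  by move=> h; rewrite -!mulrA ler_pM2r.
have [c1 c2 c3 c4] : [/\ C1 <= C, C2 <= C, C3 <= C & C4 <= C] by rewrite /C; clear -hl C10 C20 C30 C40; split; lra.
have [Q1 Q2 Q3 Q4 Q5] : [/\ P1 <= P, P2 <= P, P3 <= P, P4 <= P & P5 <= P].
  by clear -hl PP P11 P21 P31 P41 P51 VC; split; lra.
have vP w1 : fast P w1 -> V0 <= w1.2.
  move=> F1; have [h _] := H1 P _ _ Q1 F1; apply: le_trans h.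
  by rewrite ler_pdivlMr//; flra.
have Fl w1 : fast P w1 -> flies l w1.1 w1.2 (flight l w1.1 w1.2).
  by move=> F1; apply: flightP => //; exact: lt_le_trans V00 (vP _ F1).
have inE w1 : fast P w1 -> 2 + C * P^-1 < rest w1 ->
    w1.1 + flight l w1.1 w1.2 < 1 /\
    step w1 = (w1.1 + flight l w1.1 w1.2, w1.2 - 2 * l1 (w1.1 + flight l w1.1 w1.2)).
  move=> F1 h1; have [_ h2] := H4 P _ _ _ Q4 F1 (Fl _ F1).
  have h3 : w1.1 + flight l w1.1 w1.2 < 1.
    rewrite ltNge; apply/negP => /h2 h3; have := leC _ c4; flra.
  split => //; rewrite /next_hit (@frac_eq _ 0) ?subr0//.
  have [/andP[t0 _] _] := F1; have [s0 _] := Fl _ F1.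
  by rewrite add0r h3 andbT addr_ge0// ltW.
have outE w1 : fast P w1 -> rest w1 < 2 - C * P^-1 ->
    1 < w1.1 + flight l w1.1 w1.2 /\
    step w1 = (w1.1 + flight l w1.1 w1.2 - 1, w1.2 - 2 * l1 (w1.1 + flight l w1.1 w1.2 - 1)).
  move=> F1 h1; have [h2 _] := H4 P _ _ _ Q4 F1 (Fl _ F1).
  have h3 : 1 < w1.1 + flight l w1.1 w1.2.
    rewrite ltNge; apply/negP => /h2 h3; have := leC _ c4; flra.
  split => //; rewrite /next_hit (@frac_eq _ 1)//.
  have [_ _ _ _ [s2 _]] := H5 P _ _ _ Q5 F1 (Fl _ F1); have [/andP[_ t1] _] := F1.
  by rewrite ltW//=; apply: (lt_trans (ltrD t1 s2)); flra.
have w01 : 0 < w.1 < 1 by case: F.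
split.
- have [h _] := H1 P _ _ Q1 F; apply: le_trans h; rewrite ler_pM2l// lef_pV2//.
- move=> rw; have [h1 e1] := inE w F rw.
  have [b1 b2 b3] := H2 P _ _ _ Q2 F (Fl _ F) h1.
  have s01 : 0 < (step w).1 < 1.
    by rewrite e1 /= h1 andbT; have [s0 _] := Fl _ F; have /andP[? _] := w01; exact: addr_gt0.
  split => //; [exact: HV (vP _ F) w01 s01|rewrite e1 /=|rewrite e1 /=|].
  + exact: le_trans b1 (leC2 _ c2).
  + exact: le_trans b2 (leC2 _ c2).
  move=> w' F' rw'; have [h1' e1'] := inE w' F' rw'.
  have [d1 d2] := b3 _ _ _ F' (Fl _ F') h1'; have g0 := gap_ge0 l w.1 w.2 w'.1 w'.2.
  rewrite e1 e1' /=; split; [apply: (le_trans d1)|apply: (le_trans d2)];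
    by rewrite ler_wpM2r// leC2.
move=> rw; have [h1 e1] := outE w F rw.
have [b0 b1 b2 b3] := H3 P _ _ _ Q3 F (Fl _ F) h1.
have s01 : 0 < (step w).1 < 1.
  by rewrite e1 /=; have /andP[-> /lt_trans->//] := b0; flra.
split => //; [exact: HV (vP _ F) w01 s01|rewrite /ep e1 /=|rewrite /ez e1 /=|].
- exact: le_trans b1 (leC _ c3).
- exact: le_trans b2 (leC _ c3).
move=> w' F' rw'; have [h1' e1'] := outE w' F' rw'.
have [d1 d2] := b3 _ _ _ F' (Fl _ F') h1'; have g0 := gap_ge0 l w.1 w.2 w'.1 w'.2.
rewrite /ep /ez e1 e1' /=; split; [apply: (le_trans d1)|apply: (le_trans d2)];
  by rewrite ler_wpM2r// leC.
Qed.

Lemma rest_drift (w w' : R * R) (n E : R) : rest w = 2 * n + E ->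
  rest w' = 2 * n + E + alpha l * (pw w' - pw w) - (zw w' - zw w).
Proof. by rewrite /time_left => h; rewrite -h; ring. Qed.

Lemma norm_alpha (x y : R) : `|x| <= y -> `|alpha l * x| <= `|alpha l| * y.
Proof. by move=> h; rewrite normrM ler_wpM2l. Qed.

(** The data force [N] collisions inside the period and then one across the discontinuity. [E] is
    about the phase left before the last one; its distance [e] from 0 and 2 prevents errors of order
    1/P from changing the count. The margin in [P + 1] absorbs the drift of the momentum during the
    lap. *)
Definition lap (P e : R) (N : nat) (E : R) (w : R * R) : Prop :=
  [/\ fast (P + 1) w, rest w = 2 * N%:R + E & e <= E <= 2 - e].

Definition lap_p (N : nat) (E : R) (w : R * R) := pw (iter N.+1 step w) - pw w - jump l * (E - 1).
Definition lap_z (N : nat) (E : R) (w : R * R) := zw (iter N.+1 step w) - (2 - E).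

Lemma diff2 (x y x' y' : R) : x - y - (x' - y') = (x - x') - (y - y').
Proof. by ring. Qed.

Lemma diff3 (j x y z x' y' z' : R) :
  x + y + j * z - (x' + y' + j * z') = (x - x') + (y - y') + j * (z - z').
Proof. by ring. Qed.

Lemma diff4 (c m x y E x' y' E' : R) :
  (m + E + c * x - y - E) - (m + E' + c * x' - y' - E') = c * (x - x') - (y - y').
Proof. by ring. Qed.

(** A lap has O(P) collisions inside the period, each with errors of order P^-2 in value and in
    Lipschitz constant, so their sum is of order 1/P, like the single crossing error. Before the
    crossing the gap between two particles at most doubles. *)
Lemma laps : exists2 C : R, 0 < C & forall B e : R, 0 < B -> 0 < e -> exists2 P1 : R, 1 <= P1 &
  forall P N, P1 <= P -> N.+1%:R <= B * P -> forall w E, lap P e N E w ->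
  [/\ forall j, (j < N.+1)%N -> collision_map l (iter j step w) (iter j.+1 step w) /\
        P / C <= (iter j step w).2,
      0 < (iter N.+1 step w).1 < 1, `|lap_p N E w| <= e, `|lap_z N E w| <= e &
      forall w' E', lap P e N E' w' ->
        `|lap_p N E w - lap_p N E' w'| <= e * gap w w' /\
        `|lap_z N E w - lap_z N E' w'| <= e * gap w w'].
Proof.
have [C [P0 [C0 P01 H]]] := step_cases; exists C => // B e B0 e0.
pose a : R := `|alpha l|; pose J : R := `|jump l|.
have a0 : 0 <= a by exact: normr_ge0.
have J0 : 0 <= J by exact: normr_ge0.
(* Collects the constants so that the errors below are controlled by [X / P], with [X / P] at most 1
   and less than [e]. *)
pose X := 4 * (1 + a) * (1 + J) * (C + B * C).
have BC0 : 0 < B * C by rewrite mulr_gt0.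
have X0 : 0 < X by rewrite mulr_gt0 ?addr_gt0// mulr_gt0 ?mulr_gt0//; flra.
have Xe0 : 0 < X / e by rewrite divr_gt0.
exists (P0 + X + X / e + 1); first by flra.
move=> P N PP NB.
have P_gt0 : 0 < P by flra.
pose i := P^-1; have i0 : 0 < i by rewrite invr_gt0.
have PP0 : P0 <= P by flra.
have Xi1 : X * i <= 1 by rewrite ler_pdivrMr// mul1r; flra.
have Xie : X * i < e by rewrite ltr_pdivrMr// mulrC -ltr_pdivrMr//; flra.
pose q := (C + B * C) * i; have q0 : 0 < q by rewrite mulr_gt0// addr_gt0.
have XE : X * i = 4 * q + 4 * (a * q) + 4 * (J * q) + 4 * (J * (a * q)) by rewrite /X /q; ring.
have q0' := ltW q0.
have [aq Jq Jaq] : [/\ 0 <= a * q, 0 <= J * q & 0 <= J * (a * q)] by split; do ?[apply: mulr_ge0 => //].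
have qE : q = C * i + B * C * i by rewrite /q mulrDl.
have Ci0 : 0 < C * i by rewrite mulr_gt0.
have BCi0 : 0 < B * C * i by rewrite mulr_gt0.
have small j : (j <= N)%N -> j%:R * (C * i * i) <= B * C * i.
  move=> jN; have h : j%:R * i <= B.
    by rewrite ler_pdivrMr//; apply: le_trans NB; rewrite ler_nat ltnW.
  rewrite (_ : j%:R * _ = (j%:R * i) * (C * i)); last by ring.
  by rewrite -[leRHS]mulrA ler_pM2r.
have s1 : 4 * (B * C * i) <= 1 by flra.
have qB : B * C * i <= q by rewrite qE lerDr ltW.
have qC : C * i <= q by rewrite qE lerDl ltW.
have Xq : a * q + q + C * i < e by clear -hl Xie XE aq Jq Jaq qE BCi0 Ci0 q0; lra.
have inner w E : lap P e N E w -> forall j, (j <= N)%N ->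
  [/\ fast P (iter j step w), forall k, (k < j)%N -> collision_map l (iter k step w) (iter k.+1 step w) /\
        P / C <= (iter k step w).2,
      `|pw (iter j step w) - pw w| <= j%:R * (C * i * i),
      `|zw (iter j step w) - zw w - 2 * j%:R| <= j%:R * (C * i * i) &
      `|rest (iter j step w) - 2 * (N%:R - j%:R) - E| <= a * q + q].
  move=> [[w01 wP] rw /andP[E1 E2]]; elim=> [|j IH] jN.
    rewrite mulr0 subr0 !subrr normr0 mul0r rw subr0 [_ - _ - E]addrAC addrK.
    split => //; last by rewrite subrr normr0 addr_ge0.
    by split => //; clear -hl wP; lra.
  have [F coll bp bz br] := IH (ltnW jN).
  have jN1 : j%:R + 1 <= N%:R :> R by rewrite natr1 ler_nat.
  have [h1 h2 _] := H P _ PP0 F.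
  have rj : 2 + C * P^-1 < rest (iter j step w).
    rewrite -/i; move: br; rewrite ler_norml => /andP[br _]; clear -hl E1 br Xq jN1; lra.
  have {h2}[t01 cm dp dz _] := h2 rj.
  have sj := small _ jN.
  have bp' : `|pw (iter j.+1 step w) - pw w| <= j.+1%:R * (C * i * i).
    rewrite -natr1 mulrDl mul1r (_ : _ - _ = (pw (iter j step w) - pw w) + (pw (iter j.+1 step w) - pw (iter j step w))); last by ring.
    exact: le_trans (ler_normD _ _) (lerD bp dp).
  have bz' : `|zw (iter j.+1 step w) - zw w - 2 * j.+1%:R| <= j.+1%:R * (C * i * i).
    rewrite -[j.+1%:R]natr1 [leRHS]mulrDl mul1r (_ : _ - _ - _ = (zw (iter j step w) - zw w - 2 * j%:R) + (zw (iter j.+1 step w) - zw (iter j step w) - 2)); last by ring.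
    exact: le_trans (ler_normD _ _) (lerD bz dz).
  split => //.
  - split => //; have h := le_trans bp' sj.
    by move: h; rewrite ler_norml => /andP[h _]; clear -hl wP h s1 BCi0; lra.
  - by move=> k; rewrite ltnS leq_eqVlt => /orP[/eqP->//|/coll].
  rewrite (rest_drift (iter j.+1 step w) rw).
  rewrite (_ : _ - E = alpha l * (pw (iter j.+1 step w) - pw w) - (zw (iter j.+1 step w) - zw w - 2 * j.+1%:R)); last by ring.
  apply: (le_trans (ler_normB _ _)); apply: lerD; last exact: le_trans bz' (le_trans sj qB).
  exact: norm_alpha (le_trans bp' (le_trans sj qB)).
have gapb w w' j : (j <= N)%N ->
    `|(pw (iter j step w) - pw w) - (pw (iter j step w') - pw w')| <= j%:R * (C * i * i) * (2 * gap w w') ->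
    `|(zw (iter j step w) - zw w) - (zw (iter j step w') - zw w')| <= j%:R * (C * i * i) * (2 * gap w w') ->
    gap (iter j step w) (iter j step w') <= 2 * gap w w'.
  move=> /small sj dp dz; have g0 := gap_ge0 l w.1 w.2 w'.1 w'.2.
  have tri (x y x' y' : R) : `|x - x'| <= `|(x - y) - (x' - y')| + `|y - y'|.
    by rewrite (_ : x - x' = (x - y) - (x' - y') + (y - y')) ?ler_normD//; ring.
  have t1 := tri (zw (iter j step w)) (zw w) (zw (iter j step w')) (zw w').
  have t2 := tri (pw (iter j step w)) (pw w) (pw (iter j step w')) (pw w').
  have u1 := le_trans dp (ler_wpM2r (mulr_ge0 (ler0n R 2) g0) sj).
  have u2 := le_trans dz (ler_wpM2r (mulr_ge0 (ler0n R 2) g0) sj).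
  have u3 := ler_wpM2r g0 s1; rewrite mul1r in u3.
  have gE : gap w w' = `|zw w - zw w'| + `|pw w - pw w'| by [].
  by rewrite {1}/phase_gap; clear -hl t1 t2 u1 u2 u3 gE; lra.
have drift w E w' E' : lap P e N E w -> lap P e N E' w' -> forall j, (j <= N)%N ->
  `|(pw (iter j step w) - pw w) - (pw (iter j step w') - pw w')| <= j%:R * (C * i * i) * (2 * gap w w') /\
  `|(zw (iter j step w) - zw w) - (zw (iter j step w') - zw w')| <= j%:R * (C * i * i) * (2 * gap w w').
  move=> L L'; have g0 := gap_ge0 l w.1 w.2 w'.1 w'.2.
  elim=> [|j IH] jN; first by rewrite !subrr normr0 !mul0r.
  have [dp dz] := IH (ltnW jN).
  have [F _ _ _ br] := inner _ _ L _ (ltnW jN); have [F' _ _ _ br'] := inner _ _ L' _ (ltnW jN).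
  have jN1 : j%:R + 1 <= N%:R :> R by rewrite natr1 ler_nat.
  have [_ h2 _] := H P _ PP0 F.
  have big w1 E1 : lap P e N E1 w1 -> `|rest (iter j step w1) - 2 * (N%:R - j%:R) - E1| <= a * q + q ->
      2 + C * P^-1 < rest (iter j step w1).
    move=> [_ _ /andP[e1 e2]]; rewrite -/i ler_norml => /andP[b _]; clear -hl e1 b Xq jN1; lra.
  have [_ _ _ _ /(_ _ F' (big _ _ L' br'))[]] := h2 (big _ _ L br).
  have gj := gapb _ _ _ (ltnW jN) dp dz.
  have Cii : 0 <= C * i * i by rewrite mulr_ge0// ltW.
  have gj' := ler_wpM2l Cii gj.
  move=> /le_trans/(_ gj') d1 /le_trans/(_ gj') d2.
  have add (x y z x' y' z' c : R) : `|(y - x) - (y' - x')| <= j%:R * (C * i * i) * c ->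
     `|(z - y) - (z' - y')| <= C * i * i * c ->
     `|(z - x) - (z' - x')| <= j.+1%:R * (C * i * i) * c.
    move=> k1 k2; rewrite -natr1 mulrDl mul1r mulrDl (_ : z - x - _ = ((y - x) - (y' - x')) + ((z - y) - (z' - y'))); last by ring.
    exact: le_trans (ler_normD _ _) (lerD k1 k2).
  by split; [exact: add dp d1|exact: add dz d2].
have last1 w E : lap P e N E w -> rest (iter N step w) < 2 - C * P^-1.
  move=> L; have [_ _ _ _] := inner _ _ L _ (leqnn N); rewrite subrr mulr0 subr0 -/i.
  by have [_ _ /andP[e1 e2]] := L; rewrite ler_norml => /andP[_ b]; clear -hl e2 b Xq; lra.
have pE w E : lap_p N E w = ep (iter N step w) + (pw (iter N step w) - pw w) + jump l * (rest (iter N step w) - E).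
  by rewrite /lap_p /ep iterS; ring.
have zE w E : lap_z N E w = ez (iter N step w) - (rest (iter N step w) - E).
  by rewrite /lap_z /ez iterS; ring.
move=> w E L; have [F coll bp bz br] := inner _ _ L _ (leqnn N).
rewrite subrr mulr0 subr0 in br.
have [h1 _ /(_ (last1 _ _ L))[t01 cm bep bez dd]] := H P _ PP0 F.
have sN := small _ (leqnn N).
split => //.
- by move=> k; rewrite ltnS leq_eqVlt => /orP[/eqP->//|/coll].
- rewrite pE; apply: (le_trans (ler_normD _ _)); apply: (le_trans (lerD (ler_normD _ _) (lexx _))).
  have h : `|jump l * (rest (iter N step w) - E)| <= J * (a * q + q) by rewrite normrM ler_wpM2l.
  by rewrite -/i in bep; rewrite [leRHS]mulrDr in h; have {}bp := le_trans bp sN; clear -hl bep bp h XE Xie qE q0 Ci0 BCi0 aq Jq Jaq; lra.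
- rewrite zE; apply: (le_trans (ler_normB _ _)).
  by rewrite -/i in bez; clear -hl bez br XE Xie qE q0 Ci0 BCi0 aq Jq Jaq; lra.
move=> w' E' L'; have [F' _ _ _ _] := inner _ _ L' _ (leqnn N).
have [dp dz] := drift _ _ _ _ L L' _ (leqnn N).
have g0 := gap_ge0 l w.1 w.2 w'.1 w'.2.
have [d1 d2] := dd _ F' (last1 _ _ L').
have gN := gapb _ _ _ (leqnn N) dp dz.
set g := gap w w' in g0 dp dz gN *.
have u1 := le_trans dp (ler_wpM2r (mulr_ge0 (ler0n R 2) g0) sN).
have u2 := le_trans dz (ler_wpM2r (mulr_ge0 (ler0n R 2) g0) sN).
have bq : B * C * i * (2 * g) <= q * (2 * g) by rewrite ler_wpM2r ?mulr_ge0.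
move: (le_trans u1 bq) (le_trans u2 bq) => {u1 u2 bq} u1 u2.
have [{}d1 {}d2] : `|ep (iter N step w) - ep (iter N step w')| <= C * i * (2 * g) /\
   `|ez (iter N step w) - ez (iter N step w')| <= C * i * (2 * g).
  have h := ler_wpM2l (ltW Ci0) gN.
  by split; [exact: le_trans d1 h|exact: le_trans d2 h].
have bq : C * i * (2 * g) <= q * (2 * g) by rewrite ler_wpM2r ?mulr_ge0.
move: (le_trans d1 bq) (le_trans d2 bq) => {d1 d2 bq} d1 d2.
have dr : `|(rest (iter N step w) - E) - (rest (iter N step w') - E')| <= a * (q * (2 * g)) + q * (2 * g).
  have [_ r1 _] := L; have [_ r2 _] := L'.
  rewrite (rest_drift _ r1) (rest_drift _ r2).
  rewrite diff4.
  by apply: (le_trans (ler_normB _ _)); apply: lerD => //; exact: norm_alpha.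
have fin : (4 * q + 4 * (a * q) + 4 * (J * q) + 4 * (J * (a * q))) * g <= e * g.
  by rewrite -XE ler_wpM2r// ltW.
have [g1 g2 g3 g4] : [/\ 0 <= q * g, 0 <= a * q * g, 0 <= J * q * g & 0 <= J * (a * q) * g].
  by split; do ?[apply: mulr_ge0 => //].
split.
  rewrite !pE diff3.
  apply: (le_trans (ler_normD _ _)); apply: (le_trans (lerD (ler_normD _ _) (lexx _))).
  have h : `|jump l * ((rest (iter N step w) - E) - (rest (iter N step w') - E'))| <= J * (a * (q * (2 * g)) + q * (2 * g)).
    by rewrite normrM ler_wpM2l.
  by apply: (le_trans _ fin); apply: (le_trans (lerD (lerD d1 u1) h)); clear -hl g1 g2 g3 g4; lra.
rewrite !zE diff2.
apply: (le_trans (ler_normB _ _)).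
by apply: (le_trans _ fin); apply: (le_trans (lerD d2 dr)); clear -hl g1 g2 g3 g4; lra.
Qed.

End Laps.

(** * Coding the particle by two successive phases *)

Section Decoding.
Context {R : realType} (l : R -> R) (hl : fermi_ulam_wall l).
Local Notation frac := Defs.frac.
Local Notation l1 := (derive1 l).
Local Notation clock := (clock l).
Local Notation pw w := (momentum l w.1 w.2).
Local Notation zw w := (phase l w.1 w.2).
Local Notation gap w w' := (phase_gap l w.1 w.2 w'.1 w'.2).
Local Notation step := (next_hit l).
Local Notation a := (alpha l).

Lemma clock_lt (x y : R) : 0 <= x -> x < y -> y <= 1 -> clock x < clock y.
Proof.
move=> x0 xy y1; have [||| c _ h] := @clock_mvt _ _ hl x y; [by flra|exact: ltW|by flra|].
rewrite -subr_gt0 h mulr_gt0 ?subr_gt0//.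
by have l0 : 0 < l c by [exact: wall_gt0]; rewrite mulr_gt0// invr_gt0.
Qed.

Lemma alpha_gt0 : 0 < a.
Proof. by rewrite -(clock1 hl) -(clock0 l); exact: clock_lt. Qed.

Lemma momentum_phase_inj w w' : 0 < w.1 < 1 -> 0 < w'.1 < 1 -> 0 < pw w -> pw w = pw w' ->
  zw w = zw w' -> w = w'.
Proof.
case: w w' => [t v] [t' v'] /= /andP[t0 t1] /andP[t0' t1'] p0 pE.
rewrite /phase -pE => /(mulfI (lt0r_neq0 p0)) cE.
have tE : t = t'.
  case: (ltgtP t t') => // h.
    by have := clock_lt (ltW t0) h (ltW t1'); rewrite cE ltxx.
  by have := clock_lt (ltW t0') h (ltW t1); rewrite cE ltxx.
subst t'; congr pair; move: pE; rewrite /momentum => /(mulfI (lt0r_neq0 (wall_gt0 hl t))).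
exact: addIr.
Qed.

(* A point [(t, v)] of the collision space is encoded by [z] when the position of [t]
   in the period is that of [z.1] and the energy is [z.2 - z.1]; only the integer part
   of [z.1], which counts collisions, is arbitrary. *)
Definition is_dec (z w : R * R) : Prop :=
  [/\ 0 < w.1 < 1, pw w = 2 * (z.2 - z.1) / a & zw w = 2 * (1 - frac z.1)].

Definition dec (z : R * R) : R * R := xget (0, 0) [set w | is_dec z w].

(** The energy fixes the momentum [p], and the time then solves [clock t = Z / p]; an energy of at
    least 1 keeps [Z / p] below [alpha l]. *)
Lemma is_dec_exists z : 1 <= z.2 - z.1 -> 0 < frac z.1 -> exists w, is_dec z w.
Proof.
move=> J1 f0; have a0 := alpha_gt0.
have /andP[_ f1] := frac_itv z.1.
pose p := 2 * (z.2 - z.1) / a; pose Z := 2 * (1 - frac z.1).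
have p0 : 0 < p by rewrite divr_gt0// mulr_gt0//; flra.
have Z0 : 0 < Z by rewrite /Z; flra.
have ZP : Z / p < a.
  rewrite ltr_pdivrMr// /p mulrCA mulfV ?gt_eqF// mulr1 /Z; flra.
have Zp0 : 0 < Z / p by rewrite divr_gt0.
have cc : {within `[0, 1], continuous clock}.
  apply: derivable_within_continuous => t; rewrite in_itv/= => /andP[t0 t1].
  by apply: (@ex_derive _ _ _ _ _ _ _ (clock_derive hl _ _)); flra.
have [||t] := @IVT R clock 0 1 (Z / p) _ cc; first exact: ler01.
  by rewrite (clock0 l) (clock1 hl) min_l ?max_r ?(ltW a0)// !ltW.
rewrite in_itv/= => /andP[t0 t1] tE.
have t01 : 0 < t < 1.
  rewrite !lt_neqAle t0 t1 !andbT; apply/andP; split; apply/negP => /eqP h.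
    by move: tE Zp0; rewrite -h clock0 => <-; rewrite ltxx.
  by move: tE ZP; rewrite h (clock1 hl) => <-; rewrite ltxx.
have l0 : l t != 0 by rewrite gt_eqF// wall_gt0.
have E : momentum l t (p / l t - l1 t) = p by rewrite /momentum subrK mulrCA mulfV ?mulr1.
by exists (t, p / l t - l1 t); split => //=; rewrite /phase E tE mulrCA mulfV ?mulr1 ?gt_eqF.
Qed.

Lemma decP z : 1 <= z.2 - z.1 -> 0 < frac z.1 -> is_dec z (dec z).
Proof. by move=> h1 h2; rewrite /dec; case: xgetP => //= h; have [w /h] := is_dec_exists h1 h2. Qed.

Lemma dec_eq z w : 0 < z.2 - z.1 -> is_dec z w -> dec z = w.
Proof.
move=> J0 d; rewrite /dec; case: xgetP => [w' _ [h1 h2 h3]|/(_ w)//].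
have [g1 g2 g3] := d; apply: momentum_phase_inj => //; rewrite ?h2 ?h3//.
by rewrite divr_gt0 ?alpha_gt0// mulr_gt0.
Qed.

Definition laps_nb (z : R * R) : nat := `|Num.floor z.2 - Num.floor z.1|%N.

(** The passage map in coded form. At the start of a lap the phase left is 2 (y - fl x - 1), that
    is, [laps_nb z - 1] collisions inside the period and [E = 2 * frac y] before the crossing one.
    The new first coordinate is y up to the error of the lap, which is how the second order
    recurrence arises. *)
Definition FT (z : R * R) : R * R :=
  let w := iter (laps_nb z) step (dec z) in
  let x := fl z.2 + 1 - zw w / 2 in (x, x + a * pw w / 2).

(** What one step of [FT] must certify so that its orbits are orbits of the particle: the code
    agrees with the dynamics, every collision of the lap is genuine, and the speed is bounded below
    by the energy. *)
Definition tracks (c : R) (z : R * R) : Prop :=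
  [/\ (0 < laps_nb z)%N, is_dec z (dec z), dec (FT z) = iter (laps_nb z) step (dec z) &
  forall j, (j < laps_nb z)%N ->
    collision_map l (iter j step (dec z)) (iter j.+1 step (dec z)) /\
    c * (z.2 - z.1) <= (iter j step (dec z)).2].

Lemma laps_nbE z : 1 <= z.2 - z.1 -> (laps_nb z)%:R = fl z.2 - fl z.1.
Proof.
move=> h; rewrite natr_absz ger0_norm ?intrB// subr_ge0; apply: le_floor; flra.
Qed.

Context (lam : R) (lam1 : 1 < lam) (lamE : lam + lam^-1 - 2 = a * jump l).
Local Notation F := (Fm lam).

Lemma ds_shift (f f' : R * R) (d1 d2 d1' d2' : R) :
  ds lam (f.1 + d1, f.2 + d2) (f'.1 + d1', f'.2 + d2') <=
  ds lam f f' + lam * (`|d1 - d1'| + `|d2 - d2'|).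
Proof.
have /(dsP lam)[h1 h2] := lexx (ds lam f f').
have lam0 : 0 < lam by apply: lt_trans lam1.
have mu0 : 0 < lam^-1 by rewrite invr_gt0.
have mu1 : lam^-1 <= 1 by rewrite invf_le1// ltW.
have [n1 n2] : 0 <= `|d1 - d1'| /\ 0 <= `|d2 - d2'| by split; exact: normr_ge0.
have m1 : lam^-1 * `|d1 - d1'| <= lam * `|d1 - d1'|.
  by rewrite ler_wpM2r// (le_trans mu1)// ltW.
have m2 : `|d2 - d2'| <= lam * `|d2 - d2'| by rewrite ler_peMl// ltW.
apply/(dsP lam); rewrite mulrDr; split.
  rewrite (_ : uu lam _ - _ = (uu lam f - uu lam f') + ((d2 - d2') - lam^-1 * (d1 - d1'))); last by rewrite /uu /=; ring.
  apply: (le_trans (ler_normD _ _)); rewrite lerD//.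
  by apply: (le_trans (ler_normB _ _)); rewrite normrM (gtr0_norm mu0); flra.
rewrite (_ : ss lam _ - _ = (ss lam f - ss lam f') + (lam * (d1 - d1') - (d2 - d2'))); last by rewrite /ss /=; ring.
apply: (le_trans (ler_normD _ _)); rewrite lerD//.
by apply: (le_trans (ler_normB _ _)); rewrite normrM (gtr0_norm lam0); flra.
Qed.

Lemma FT_lap z N : laps_nb z = N.+1 -> is_dec z (dec z) -> let E := 2 * frac z.2 in
  let dp := lap_p l N E (dec z) in let dz := lap_z l N E (dec z) in
  FT z = ((F z).1 - dz / 2, (F z).2 + (a * dp / 2 - dz / 2)).
Proof.
move=> NE [_ pE _] E dp dz; rewrite /FT NE.
have a0 := alpha_gt0.
set w := iter _ _ _.
have e1 : zw w = 2 - E + dz by rewrite /dz /lap_z -/w; ring.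
have e2 : pw w = 2 * (z.2 - z.1) / a + jump l * (E - 1) + dp by rewrite /dp /lap_p -/w -pE; ring.
have e3 : fl z.2 + 1 - zw w / 2 = z.2 - dz / 2 by rewrite e1 /E /frac -/(fl z.2); field.
rewrite e3 e2 /Fm /=; congr pair.
rewrite (_ : (lam + lam^-1) * z.2 = (lam + lam^-1 - 2) * z.2 + 2 * z.2); last by ring.
by rewrite lamE /E /frac -/(fl z.2); field; rewrite gt_eqF.
Qed.

(** This supplies the hypothesis [FT_close] of the lifting, with [tracks c] as the validity
    predicate. Admissible points with the same floors make the same number of collisions, so [laps]
    can compare them. *)
Lemma FT_tracks : exists2 c : R, 0 < c & forall e : R, 0 < e -> exists J0 : R, forall z, adm J0 e z ->
  [/\ tracks c z, ds lam (FT z) (F z) <= e &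
    forall z', adm J0 e z' -> fl z'.1 = fl z.1 -> fl z'.2 = fl z.2 ->
      ds lam (FT z) (FT z') <= (lam + e) * ds lam z z'].
Proof.
have a0 := alpha_gt0; have lam0 : 0 < lam by apply: lt_trans lam1.
have mu1 : lam^-1 < 1 by rewrite invf_lt1.
have lm0 : 0 < lam - lam^-1 by rewrite subr_gt0; exact: lt_trans lam1.
have [C C0 HC] := laps hl.
exists (a * C)^-1; first by rewrite invr_gt0 mulr_gt0.
move=> e e0; pose kap := (lam + 1) / (lam - lam^-1).
have kap0 : 0 < kap by rewrite divr_gt0//; flra.
pose Q := lam * (1 + a) * (1 + (4 + 4 / a) * kap).
have ai0 : 0 < 4 / a by rewrite divr_gt0.
have X0 : 0 < (4 + 4 / a) * kap by rewrite mulr_gt0//; flra.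
have Q1 : 1 < Q.
  apply: (lt_le_trans lam1); rewrite /Q -mulrA ler_peMr ?(ltW lam0)//.
  by rewrite -[leLHS]mulr1; apply: ler_pM; flra.
have Q0 : 0 < Q by flra.
pose e1 := Num.min 1 (e / Q).
have e10 : 0 < e1 by rewrite lt_min ltr01 divr_gt0.
have e11 : e1 <= 1 by rewrite ge_min lexx.
have e1Q : e1 * Q <= e by rewrite -ler_pdivlMr// ge_min lexx orbT.
have e1e : e1 <= e by apply: le_trans e1Q; rewrite ler_peMr// ltW.
(* [laps] is applied at P = (y - x) / a, and the number of collisions is at most 2 (y - x) = 2 a
   P. *)
have [P1 P11 HP] := HC (2 * a) e1 (mulr_gt0 (ltr0n R 2) a0) e10.
pose J0 := 4 + a * (2 + P1 + `|jump l|).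
have nj : 0 <= `|jump l| := normr_ge0 _.
have aP : 0 <= a * P1 by rewrite mulr_ge0 ?(ltW a0)//; flra.
have aj : 0 <= a * `|jump l| by rewrite mulr_ge0 ?(ltW a0).
exists (J0 + 2).
have pre z z' : adm (J0 + 2) e z -> adm (J0 + 2) e z' -> fl z'.1 = fl z.1 -> fl z'.2 = fl z.2 ->
    [/\ is_dec z' (dec z'), lap l ((z.2 - z.1) / a) e1 (laps_nb z).-1 (2 * frac z'.2) (dec z')
      & laps_nb z' = laps_nb z].
  move=> [zJ [zx1 zx2] [zy1 zy2]] [zJ' [zx1' zx2'] [zy1' zy2']] f1 f2.
  have iJ : 6 + 2 * a <= z.2 - z.1 by apply: (le_trans _ zJ); rewrite /J0 !mulrDr; clear -hl lam1 lamE aP aj; flra.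
  have flz := fl_itv z.1; have fly := fl_itv z.2; have flz' := fl_itv z'.1; have fly' := fl_itv z'.2.
  have J' : z.2 - z.1 - 2 <= z'.2 - z'.1 by rewrite f1 f2 in flz' fly'; clear -hl lam1 lamE flz fly flz' fly'; flra.
  have fx : frac z'.1 = z'.1 - fl z'.1 by [].
  have fy : frac z'.2 = z'.2 - fl z'.2 by [].
  have J1' : 1 <= z'.2 - z'.1 by clear -hl lam1 lamE J' iJ a0; flra.
  have D : is_dec z' (dec z') by apply: decP; clear -hl lam1 lamE J1' fx zx1' e0; flra.
  have N' : laps_nb z' = laps_nb z.
    have i1 : Num.floor z'.1 = Num.floor z.1 by apply: (@intr_inj R).
    have i2 : Num.floor z'.2 = Num.floor z.2 by apply: (@intr_inj R).
    by rewrite /laps_nb i1 i2.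
  split => //; have [d1 d2 d3] := D; have NE := laps_nbE J1'; rewrite -N'.
  have N0 : (0 < laps_nb z')%N by rewrite -(ltr0n R) NE; clear -hl lam1 lamE flz' fly' J' iJ a0; flra.
  split.
  - split => //; rewrite d2 ler_pdivlMr// mulrDl mulfVK ?gt_eqF//; clear -hl lam1 lamE J' iJ a0; flra.
  - rewrite /time_left d2 d3 -subn1 natrB// NE fx fy.
    by field; rewrite gt_eqF.
  by rewrite fy; apply/andP; split; clear -hl lam1 lamE zy1' zy2' e1e e0; flra.
have small m x y : `|x| <= m -> `|y| <= m -> lam * (`|x / 2| + `|a * y / 2 - x / 2|) <= lam * (1 + a) * m.
  move=> xm ym; rewrite -[leRHS]mulrA ler_pM2l//.
  have h2 : `|2^-1 : R| = 2^-1 by rewrite ger0_norm// invr_ge0.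
  have t := ler_normB (a * y / 2) (x / 2).
  have h3 : a * `|y| <= a * m by rewrite ler_pM2l.
  have h4 : 0 <= a * `|y| by rewrite mulr_ge0// ltW.
  rewrite !normrM (gtr0_norm a0) h2 in t *; clear -hl lam1 lamE t h3 h4 xm; flra.
move=> z A; have [D L _] := pre z z A A erefl erefl.
have [JJ [fx1 fx2] [fy1 fy2]] := A.
have iJ : 4 + a * (2 + P1 + `|jump l|) <= z.2 - z.1 by apply: (le_trans _ JJ); rewrite /J0; clear -hl lam1 lamE; flra.
rewrite !mulrDr in iJ.
have J1 : 1 <= z.2 - z.1 by clear -hl lam1 lamE iJ aP aj a0; flra.
have NE := laps_nbE J1.
have [Ng0 NB P1P] : [/\ (0 < laps_nb z)%N, (laps_nb z)%:R <= 2 * a * ((z.2 - z.1) / a) & P1 <= (z.2 - z.1) / a].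
  have flz := fl_itv z.1; have fly := fl_itv z.2.
  split; first by rewrite -(ltr0n R) NE; clear -hl lam1 lamE flz fly iJ aP aj a0; flra.
    rewrite (_ : 2 * a * _ = 2 * (z.2 - z.1)); last by field; rewrite gt_eqF.
    by rewrite NE; clear -hl lam1 lamE flz fly J1; flra.
  by rewrite ler_pdivlMr// mulrC; clear -hl lam1 lamE iJ aP aj a0; flra.
have NP : laps_nb z = (laps_nb z).-1.+1 by rewrite prednK.
move: (HP _ (laps_nb z).-1 P1P); rewrite -NP => /(_ NB _ _ L)[col w01 bp bz bd].
have lap_small := FT_lap NP D.
split.
- split => //; last first.
    move=> j /col[c1 c2]; split => //; apply: (le_trans _ c2).
    by rewrite le_eqVlt; apply/orP; left; apply/eqP; field; rewrite !gt_eqF.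
  have [d1 d2 d3] := D; have [_ _ /andP[E1 E2]] := L.
  have fy : frac z.2 = z.2 - fl z.2 by [].
  apply: dec_eq.
    rewrite /FT /= addrC addKr divr_gt0// mulr_gt0//.
    rewrite NP; move: bp; rewrite /lap_p; set p := pw (iter _ _ _).
    have j1 : `|jump l * (2 * frac z.2 - 1)| <= `|jump l|.
      by rewrite normrM ler_piMr// ler_norml; clear -hl lam1 lamE fy fy1 fy2 e0; apply/andP; split; flra.
    have p1 : `|jump l| + 1 < pw (dec z) by rewrite d2 ltr_pdivlMr// mulrDl; clear -hl lam1 lamE iJ aP aj a0; flra.
    by move: j1; rewrite !ler_norml => /andP[j1 j2] /andP[b1 b2]; clear -hl lam1 lamE j1 j2 b1 b2 p1 e11; flra.
  split.
  + exact: w01.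
  + rewrite /FT /= addrC addKr; field; rewrite gt_eqF//.
  rewrite /FT /=; set w := iter _ _ _.
  have -> : frac (fl z.2 + 1 - zw w / 2) = 1 - zw w / 2.
    rewrite (@frac_eq _ _ (Num.floor z.2)) -/(fl z.2); first by ring.
    move: bz; rewrite /lap_z -NP -/w fy ler_norml => /andP[b1 b2]; clear -hl lam1 lamE b1 b2 fy1 fy2 e1e e0; apply/andP; split; flra.
  by field.
- rewrite lap_small.
  have := @ds_shift (F z) (F z) (- (lap_z l (laps_nb z).-1 (2 * frac z.2) (dec z) / 2))
     (a * lap_p l (laps_nb z).-1 (2 * frac z.2) (dec z) / 2 - lap_z l (laps_nb z).-1 (2 * frac z.2) (dec z) / 2) 0 0.
  rewrite !addr0 !subr0 normrN (dsxx lam) add0r => /le_trans; apply.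
  apply: (le_trans (small _ _ _ bz bp)); apply: le_trans e1Q; rewrite mulrC ler_pM2l//.
  by rewrite /Q ler_peMr ?mulr_ge0 ?(ltW lam0)//; clear -hl lam1 lamE X0 a0; flra.
move=> z' A' f1 f2; have [D' L' N'] := pre z z' A A' f1 f2.
have NP' : laps_nb z' = (laps_nb z).-1.+1 by rewrite N'.
rewrite lap_small (FT_lap NP' D').
have [d1 d2] := bd _ _ L'.
apply: (le_trans (@ds_shift (F z) (F z') _ _ _ _)).
set p := lap_p _ _ _ _ in d1 *; set p' := lap_p _ _ _ _ in d1 *.
set q := lap_z _ _ _ _ in d2 *; set q' := lap_z _ _ _ _ in d2 *.
have g0 : 0 <= gap (dec z) (dec z') by exact: gap_ge0.
rewrite (_ : - (q / 2) - - (q' / 2) = - ((q - q') / 2)); last by ring.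
rewrite (_ : a * p / 2 - q / 2 - (a * p' / 2 - q' / 2) = a * (p - p') / 2 - (q - q') / 2); last by ring.
rewrite normrN; apply: (le_trans (lerD (ds_F lam1 _) (small _ _ _ d2 d1))) => //.
set d := ds lam z z'.
have gd : gap (dec z) (dec z') <= (4 + 4 / a) * kap * d.
  have [c1 c2] := coord_ds lam1 (lexx d); rewrite -/kap in c1 c2.
  have [_ r2 r3] := D; have [_ r2' r3'] := D'.
  rewrite /phase_gap r2 r3 r2' r3'.
  rewrite (_ : 2 * (1 - frac z.1) - 2 * (1 - frac z'.1) = - (2 * (z.1 - z'.1))); last first.
    by rewrite /frac -/(fl z.1) -/(fl z'.1) f1; ring.
  rewrite (_ : _ / a - _ / a = 2 / a * ((z.2 - z'.2) - (z.1 - z'.1))); last by field; rewrite gt_eqF.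
  have i2 : 0 < 2 / a by rewrite divr_gt0.
  rewrite normrN (normrM 2) (normrM (2 / a)) (gtr0_norm i2) (ger0_norm (ler0n R 2)).
  have h1 := ler_normB (z.2 - z'.2) (z.1 - z'.1).
  have h2 : 2 / a * `|z.2 - z'.2 - (z.1 - z'.1)| <= 2 / a * (2 * (kap * d)) by rewrite ler_pM2l//; clear -hl lam1 lamE h1 c1 c2; flra.
  have h3 : 0 <= kap * d by rewrite mulr_ge0 ?(ltW kap0)// ds_ge0.
  by rewrite mulrDl mulrDl; clear -hl lam1 lamE h2 c1 c2 h3; flra.
have d0 : 0 <= d by exact: ds_ge0.
have L0 : 0 <= lam * (1 + a) by rewrite mulr_ge0 ?(ltW lam0)//; clear -hl lam1 lamE a0; flra.
rewrite mulrDl lerD2l; apply: (le_trans (ler_wpM2l L0 (ler_wpM2l (ltW e10) gd))).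
apply: (le_trans _ (ler_wpM2r d0 e1Q)); rewrite /Q.
have h : 0 <= e1 * (lam * (1 + a)) * d := mulr_ge0 (mulr_ge0 (ltW e10) L0) d0.
rewrite -subr_ge0; apply: (le_trans h); rewrite le_eqVlt; apply/orP; left; apply/eqP; ring.
Qed.

End Decoding.

(** * From codes to escaping orbits *)

Section Escaping.
Context {R : realType} (l : R -> R) (hl : fermi_ulam_wall l).
Local Notation frac := Defs.frac.
Local Notation l1 := (derive1 l).
Local Notation clock := (clock l).
Local Notation step := (next_hit l).
Local Notation dec := (dec l).
Local Notation FT := (FT l).
Local Notation a := (alpha l).

(** Laps are concatenated: [S k] is the number of collisions before lap [k], during which the speed
    is at least [c] times an energy that tends to infinity. *)
Lemma esc_escaping (c : R) q : 0 < c -> esc FT (tracks l c) q -> escaping l (dec q).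
Proof.
move=> c0 [Vn Jn]; pose S k := (\sum_(i < k) laps_nb (iter i FT q))%N.
have SS k : S k.+1 = (laps_nb (iter k FT q) + S k)%N by rewrite /S big_ord_recr /= addnC.
have Sk k : iter (S k) step (dec q) = dec (iter k FT q).
  elim: k => [|k IH]; first by rewrite /S big_ord0.
  by rewrite SS iterD IH iterS; have [_ _ ->] := Vn k.
have loc k0 n : (S k0 <= n)%N -> exists k j, [/\ (k0 <= k)%N, (j < laps_nb (iter k FT q))%N &
    n = (j + S k)%N].
  elim: n => [|n IH].
    rewrite leqn0 => /eqP e; exists k0, 0%N; split => //.
    by have [] := Vn k0.
  rewrite leq_eqVlt => /orP[/eqP e|/IH[k [j [k0k jk ->]]]].
    by exists k0, 0%N; split => //; have [] := Vn k0.
  have [h|h] := ltnP j.+1 (laps_nb (iter k FT q)); first by exists k, j.+1.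
  exists k.+1, 0%N; split => //; [exact: ltnW|by have [] := Vn k.+1|].
  have e : j.+1 = laps_nb (iter k FT q) by apply/eqP; rewrite eqn_leq jk h.
  by rewrite SS -e -addSn.
exists (fun n => iter n step (dec q)); split => //.
  move=> n; have [|k [j [_ jk ->]]] := loc 0%N n; first by rewrite /S big_ord0.
  rewrite -addSn !iterD Sk; have [_ _ _ H] := Vn k.
  by have [] := H _ jk.
apply/cvgryPge => M; have [k0 H0] := Jn (M / c).
exists (S k0) => // n /= /loc[k [j [k0k jk ->]]].
rewrite iterD Sk; have [_ _ _ /(_ _ jk)[_ h]] := Vn k; apply: le_trans h.
by rewrite mulrC -ler_pdivrMr//; exact: H0.
Qed.

Lemma circle_dist_le (t t' : R) : `|t - t'| <= 2^-1 -> `|t - t'| <= circle_dist t t'.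
Proof.
move=> h; rewrite /circle_dist; have [d|d] := leP 0 (t - t').
  rewrite (@frac_eq _ _ 0); last by rewrite add0r d; move: h; rewrite ger0_norm//; flra.
  by move: h; rewrite ger0_norm// subr0 le_min lexx /=; flra.
rewrite (@frac_eq _ _ (-1)); last first.
  by rewrite mulrN1z; move: h; rewrite ltr0_norm//; flra.
by move: h; rewrite mulrN1z ltr0_norm// le_min; flra.
Qed.

Lemma cylinder_dist_le (w w' : R * R) : `|w.1 - w'.1| <= 2^-1 ->
  `|w.1 - w'.1| <= cylinder_dist w w' /\ `|w.2 - w'.2| <= cylinder_dist w w'.
Proof.
move=> /circle_dist_le h; rewrite /cylinder_dist; split.
  apply: (le_trans h); apply: (le_trans (ler_norm _)); rewrite -sqrtr_sqr ler_wsqrtr//.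
  by rewrite lerDl sqr_ge0.
by rewrite -sqrtr_sqr ler_wsqrtr// lerDr sqr_ge0.
Qed.

Context (lam : R) (lam1 : 1 < lam).

(** The phase varies with time at a rate proportional to the momentum, so [C] depends on the upper
    bound [Jmax]. Above [Jmin] the decoded times are below 1/4, so that the circle distance bounds
    the ordinary difference of times. *)
Lemma dec_lipschitz : exists Jmin : R, forall Jmax : R, exists2 C : R, 0 < C & forall q q' w w',
  is_dec l q w -> is_dec l q' w' -> fl q.1 = fl q'.1 ->
  Jmin <= q.2 - q.1 -> Jmin <= q'.2 - q'.1 -> q.2 - q.1 <= Jmax -> q'.2 - q'.1 <= Jmax ->
  ds lam q q' <= C * cylinder_dist w w'.
Proof.
have [K K1 [lK lipK l1K lip1]] := wall_const hl.
have K0 : 0 < K := lt_le_trans ltr01 K1; have a0 := alpha_gt0 hl.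
pose K2 := K * K; have K20 : 0 < K2 by rewrite mulr_gt0.
have aK : 0 < a * K2 by rewrite mulr_gt0.
exists (1 + 4 * (a * K2)) => Jmax.
pose P := 2 * `|Jmax| / a; have P0 : 0 <= P by rewrite divr_ge0 ?(ltW a0)// mulr_ge0.
pose C1 := K * (1 + K) + K * P * K; pose C2 := P * K2 + K2 * C1.
have [K0' K2' a0'] : [/\ 0 <= K, 0 <= K2 & 0 <= a] by split; exact: ltW.
have C10 : 0 <= C1 := addr_ge0 (mulr_ge0 K0' (addr_ge0 ler01 K0')) (mulr_ge0 (mulr_ge0 K0' P0) K0').
have C20 : 0 <= C2 := addr_ge0 (mulr_ge0 P0 K2') (mulr_ge0 K2' C10).
have lam0 : 0 < lam by apply: lt_trans lam1.
exists (lam * (C2 + a * C1) + 1).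
  exact: ltr_wpDl (mulr_ge0 (ltW lam0) (addr_ge0 C20 (mulr_ge0 a0' C10))) ltr01.
move=> q q' [t v] [t' v'] [t01 pE zE] [t01' pE' zE'] fE J J' JM JM'; rewrite /= in t01 t01' pE zE pE' zE'.
have dclock (x y : R) : 0 <= x -> x <= y -> y < 1 ->
    y - x <= K2 * (clock y - clock x) /\ clock y - clock x <= K2 * (y - x).
  move=> x0 xy y1; have [||| c _ ->] := @clock_mvt _ _ hl x y.
  - exact: lt_le_trans x0.
  - by [].
  - by apply: lt_trans y1 _; rewrite ltr1n.
  have /andP[r1 r2] := rate_bounds hl K1 lK c.
  rewrite mulrA; split; last by rewrite ler_wpM2r// subr_ge0.
  by rewrite ler_peMl ?subr_ge0// mulrC -ler_pdivrMr// div1r.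
have size (p : R * R) (u w : R) : 0 < u < 1 -> 1 + 4 * (a * K2) <= p.2 - p.1 ->
    momentum l u w = 2 * (p.2 - p.1) / a -> phase l u w = 2 * (1 - frac p.1) -> u < 4^-1.
  move=> /andP[u0 u1] Jp; rewrite /phase => -> h.
  have [c1 _] := dclock 0 u (lexx 0) (ltW u0) u1; rewrite clock0 !subr0 in c1.
  have /andP[f0 _] := frac_itv p.1.
  set x := p.2 - p.1 in h Jp.
  have h1 : x * clock u <= a.
    rewrite (_ : x * clock u = a / 2 * (2 * x / a * clock u)); last by field; rewrite gt_eqF.
    rewrite h (_ : a / 2 * _ = a * (1 - frac p.1)); last by field.
    by rewrite ler_piMr//; clear -hl lam1 f0; flra.
  have x0 : 0 <= x by clear -hl lam1 Jp aK; flra.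
  have h2 : x * u <= K2 * (x * clock u) by rewrite mulrCA ler_wpM2l.
  have h3 : K2 * (x * clock u) <= K2 * a by rewrite ler_pM2l.
  rewrite ltNge; apply/negP => u4.
  have h4 : x * 4^-1 <= x * u by rewrite ler_wpM2l.
  by clear -hl lam1 h2 h3 h4 Jp; flra.
have t4 := size _ _ _ t01 J pE zE; have t4' := size _ _ _ t01' J' pE' zE'.
have [[t0 t1] [t0' t1']] : (0 < t /\ t < 1) /\ (0 < t' /\ t' < 1).
  by move: t01 t01' => /andP[] ? ? /andP[].
have tt : `|t - t'| <= 2^-1.
  by rewrite ler_norml; clear -hl lam1 t4 t4' t0 t0'; apply/andP; split; flra.
have [d1 d2] := @cylinder_dist_le (t, v) (t', v') tt; rewrite /= in d1 d2.
set r := cylinder_dist _ _ in d1 d2 *.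
have r0 : 0 <= r := le_trans (normr_ge0 _) d1.
have nl x : `|l x| <= K by rewrite gtr0_norm ?wall_gt0//; have /andP[] := lK x.
have pP (p : R * R) (u w : R) : 1 + 4 * (a * K2) <= p.2 - p.1 -> p.2 - p.1 <= Jmax ->
    momentum l u w = 2 * (p.2 - p.1) / a -> `|momentum l u w| <= P /\ `|w + l1 u| <= K * P.
  move=> Jp JMp e; have x0 : 0 <= p.2 - p.1 by clear -hl lam1 Jp aK; flra.
  have h : `|momentum l u w| <= P.
    rewrite e ger0_norm; last by rewrite divr_ge0// mulr_ge0.
    rewrite ler_pM2r ?invr_gt0// ler_pM2l//; apply: (le_trans JMp); exact: ler_norm.
  split => //; have l0 : l u != 0 by rewrite gt_eqF// wall_gt0.
  rewrite (_ : w + l1 u = (l u)^-1 * momentum l u w); last by rewrite /momentum mulKf.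
  rewrite normrM; apply: ler_pM => //.
  rewrite ger0_norm ?invr_ge0 ?(ltW (wall_gt0 hl u))// -[leRHS]invrK lef_pV2 ?posrE ?invr_gt0 ?(wall_gt0 hl)//.
  by have /andP[] := lK u.
have [p1 _] := pP _ _ _ J JM pE; have [p1' v1'] := pP _ _ _ J' JM' pE'.
have dl : `|l t - l t'| <= K * r by apply: (le_trans (lipK t t')); rewrite ler_pM2l.
have dv : `|v + l1 t - (v' + l1 t')| <= (1 + K) * r.
  rewrite (_ : _ - _ = (v - v') + (l1 t - l1 t')); last by ring.
  apply: (le_trans (ler_normD _ _)); rewrite mulrDl mul1r lerD//.
  by apply: (le_trans (lip1 _ _ t01 t01')); rewrite ler_pM2l.
have dp : `|momentum l t v - momentum l t' v'| <= C1 * r.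
  apply: (le_trans (mul_diff (nl t) v1' dl dv)).
  by rewrite /C1; clear; rewrite le_eqVlt; apply/orP; left; apply/eqP; ring.
have dc : `|clock t - clock t'| <= K2 * r.
  have h : `|clock t - clock t'| <= K2 * `|t - t'|.
    have [h|h] := leP t t'.
      have [_ c] := dclock t t' (ltW t0) h t1'; rewrite distrC [`|t - t'|]distrC.
      rewrite [leRHS](_ : _ = K2 * (t' - t)); last by rewrite ger0_norm ?subr_ge0.
      by rewrite ger0_norm// -(pmulr_rge0 _ K20); apply: le_trans (proj1 (dclock t t' (ltW t0) h t1')); rewrite subr_ge0.
    have [c0 c] := dclock t' t (ltW t0') (ltW h) t1.
    rewrite [leRHS](_ : _ = K2 * (t - t')); last by rewrite gtr0_norm ?subr_gt0.
    by rewrite ger0_norm// -(pmulr_rge0 _ K20); apply: le_trans c0; rewrite subr_ge0 ltW.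
  by apply: (le_trans h); rewrite ler_pM2l.
have dz : `|phase l t v - phase l t' v'| <= C2 * r.
  apply: (le_trans (mul_diff p1 (clock_bound hl K1 lK t01') dp dc)).
  by rewrite /C2 /K2; clear; rewrite le_eqVlt; apply/orP; left; apply/eqP; ring.
have e1 : q.1 - q'.1 = - ((phase l t v - phase l t' v') / 2).
  by rewrite zE zE' /Defs.frac -/(fl q.1) -/(fl q'.1) fE; field.
have e2 : q.2 - q'.2 = (q.1 - q'.1) + a * ((momentum l t v - momentum l t' v') / 2).
  by rewrite pE pE'; field; rewrite gt_eqF.
have half x y : `|x| <= y -> `|x / 2| <= y / 2.
  by move=> h; rewrite normrM (ger0_norm (_ : 0 <= 2^-1)) ?invr_ge0// ler_pM2r// invr_gt0.
have n1 : `|q.1 - q'.1| <= C2 * r / 2 by rewrite e1 normrN half.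
have n2 : `|q.2 - q'.2| <= C2 * r / 2 + a * (C1 * r / 2).
  rewrite e2; apply: (le_trans (ler_normD _ _)); rewrite lerD//.
  by rewrite normrM (gtr0_norm a0) ler_pM2l// half.
have := ds_shift lam1 (0, 0) (0, 0) q.1 q.2 q'.1 q'.2.
rewrite /= !add0r (dsxx lam) add0r -!surjective_pairing => /le_trans; apply.
apply: (@le_trans _ _ (lam * (C2 * r / 2 + (C2 * r / 2 + a * (C1 * r / 2))))).
  by rewrite ler_pM2l// lerD.
rewrite (_ : lam * _ = lam * (C2 + a * (C1 / 2)) * r); last by field.
rewrite ler_wpM2r// ler_wpDr// ler_pM2l// lerD2l ler_pM2l// ler_pdivrMr// ler_peMr//.
by rewrite ler1n.
Qed.

End Escaping.

(** * Hausdorff dimension *)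

Section SliceBound.
Context {R : realType} {T : Type} (d : T -> T -> R) (E : set T) (d0 : forall x y, 0 <= d x y).
Local Notation leb := (@lebesgue_measure R).

Lemma content_cover (s delta e : R) : 0 < delta -> 0 < e -> hausdorff_measure d s E = 0%E ->
  exists U : (set T)^nat, [/\ E `<=` \bigcup_i U i, forall i, (diam d (U i) <= delta%:E)%E &
    (\sum_(0 <= i <oo) diam_pow d s (U i) < e%:E)%E].
Proof.
move=> delta0 e0 H.
have h : (hausdorff_content d s delta E < e%:E)%E.
  by apply: (@le_lt_trans _ _ 0%E); [rewrite -H; apply: ereal_sup_ubound; exists delta|rewrite lte_fin].
by have [_ [U [U1 U2] <-] U3] := ereal_inf_lt h; exists U.
Qed.

Lemma diam_fin U : (diam d U <= 1)%E -> [/\ 0 <= fine (diam d U) <= 1,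
  forall x y, U x -> U y -> d x y <= fine (diam d U) &
  forall s s', 0 <= s <= s' -> 0 < s' -> ((fine (diam d U) `^ s')%:E <= diam_pow d s U)%E].
Proof.
move=> U1; have [->|/set0P[x0 Ux0]] := eqVneq U set0; rewrite /diam_pow; last first.
  have Ud x y : U x -> U y -> ((d x y)%:E <= diam d U)%E.
    by move=> Ux Uy; apply: ereal_sup_ubound; exists (x, y).
  have D0 : (0 <= diam d U)%E by apply: le_trans (Ud _ _ Ux0 Ux0); rewrite lee_fin.
  have fin : diam d U \is a fin_num.
    by rewrite ge0_fin_numE//; apply: (le_lt_trans U1); rewrite ltry.
  rewrite -(fineK fin) in D0 U1 Ud *; rewrite !lee_fin in D0 U1 *.
  set r := fine _ in D0 U1 Ud *.
  split; [by rewrite D0|by move=> x y Ux Uy; have := Ud _ _ Ux Uy; rewrite lee_fin|].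
  move=> s s' /andP[s0 ss] s'0; case: asboolP => [U0|_]; first by move: Ux0; rewrite U0.
  rewrite poweR_EFin lee_fin.
  have [->|r0] := eqVneq r 0; first by rewrite powR0 ?powR_ge0// gt_eqF.
  by apply: ger_powR => //; rewrite U1 lt_neqAle eq_sym r0 D0.
(* The empty set has diameter -oo, whose real part is 0; since it contributes 0, the bounds hold for
   it too. *)
have -> : diam d set0 = -oo%E by rewrite /diam set0X image_set0 ereal_sup0.
split => //=; first by rewrite lexx ler01.
by move=> s s' _ s'0; case: asboolP => // _; rewrite powR0// gt_eqF.
Qed.

(** A set of diameter r in a cover meets only slices with [x] in an interval of length of order r,
    and on each of them parameters in an interval of length of order r. Integrating the slice bounds
    over [x] bounds [rho] by a constant times the sum of the r^(1+s), and r^(1+s) <= r^sig because r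
    <= 1. The Lipschitz condition is on the inverse of [f]. *)
Lemma slice_measure_neq0 (s rho C L sig : R) (f : R -> R -> T) (K : R -> R -> Prop) :
  0 < s -> 0 < rho -> 0 < C -> 0 < L -> 0 <= sig <= 1 + s ->
  (forall x t, `|x| <= rho -> `|t| <= rho -> K x t -> E (f x t)) ->
  (forall x t x' t', `|x| <= rho -> `|t| <= rho -> `|x'| <= rho -> `|t'| <= rho -> K x t -> K x' t' ->
    `|x - x'| <= L * d (f x t) (f x' t') /\ `|t - t'| <= L * d (f x t) (f x' t')) ->
  (forall x, `|x| <= rho -> forall A B : nat -> R, (forall i, A i < B i) ->
    (forall t, `|t| <= rho -> K x t -> exists i, A i <= t <= B i) ->
    (1 <= \sum_(0 <= i <oo) (C * (B i - A i) `^ s)%:E)%E) ->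
  hausdorff_measure d sig E <> 0%E.
Proof.
move=> s0 rho0 C0 L0 /andP[sig0 sigs] KE Kd slices H.
pose C4 := C * (2 * L) * (2 * L) `^ s.
have C40 : 0 < C4 by rewrite /C4 !mulr_gt0// powR_gt0// mulr_gt0.
have C44 : 0 < 4 * C4 := mulr_gt0 (ltr0n R 4) C40.
pose e := Num.min 1 (rho / (4 * C4)).
have e0 : 0 < e by rewrite lt_min ltr01 divr_gt0.
have e1 : e <= 1 by rewrite ge_min lexx.
have eC : C4 * (2 * e) <= rho / 2.
  have : e <= rho / (4 * C4) by rewrite ge_min lexx orbT.
  rewrite ler_pdivlMr// => h.
  rewrite ler_pdivlMr// (_ : _ * 2 = e * (4 * C4))//; ring.
have [U [EU U1 US]] := content_cover ltr01 e0 H.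
pose r i := fine (diam d (U i)); pose ei (i : nat) := e / (2 ^ i.+1)%:R.
have ei0 i : 0 < ei i by rewrite divr_gt0// ltr0n expn_gt0.
have ei1 i : ei i <= 1.
  by apply: le_trans e1; rewrite ler_pdivrMr ?ltr0n ?expn_gt0// ler_peMr ?(ltW e0)// ler1n expn_gt0.
have r01 i : 0 <= r i <= 1 by have [] := diam_fin (U1 i).
(* Sets of diameter 0 are thickened by [ei i], of total at most [e], to give nondegenerate
   intervals. *)
pose R' i := Num.max (r i) (ei i).
have R'0 i : 0 < R' i by rewrite lt_max ei0 orbT.
have LR i : 0 < L * R' i by rewrite mulr_gt0.
have : forall i, exists p : R * R, forall x t : R, `|x| <= rho -> `|t| <= rho -> K x t ->
    U i (f x t) -> `|x - p.1| <= L * R' i /\ `|t - p.2| <= L * R' i.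
  move=> i.
  have [[[x t] /= [xr [tr [Kxt Uxt]]]]|no] :=
    pselect (exists p : R * R, `|p.1| <= rho /\ `|p.2| <= rho /\ K p.1 p.2 /\ U i (f p.1 p.2)); last first.
    by exists (0, 0) => x t h1 h2 h3 h4; case: no; exists (x, t).
  exists (x, t) => x' t' xr' tr' Kxt' Uxt' /=.
  have [k1 k2] := Kd _ _ _ _ xr' tr' xr tr Kxt' Kxt.
  have [_ /(_ _ _ Uxt' Uxt) dr _] := diam_fin (U1 i).
  have h : L * d (f x' t') (f x t) <= L * R' i.
    by rewrite ler_pM2l//; apply: (le_trans dr); rewrite le_max lexx.
  by split; [exact: le_trans k1 h|exact: le_trans k2 h].
move=> /choice[c Hc].
pose J i : set R := [set x | (c i).1 - L * R' i <= x <= (c i).1 + L * R' i].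
pose wt i := C * (2 * (L * R' i)) `^ s.
have wt0 i : 0 <= wt i by rewrite mulr_ge0 ?powR_ge0// ltW.
have JE i : J i = `[(c i).1 - L * R' i, (c i).1 + L * R' i]%classic.
  by rewrite set_itvE.
have mJ i : measurable (J i) by rewrite JE; exact: measurable_itv.
have half x : `|x| <= rho -> ((2^-1)%:E <= \sum_(0 <= i <oo) ((wt i)%:E * (\1_(J i) x)%:E))%E.
  move=> xr.
  (* The slice bound wants an interval for each index. Where the [i]-th set misses the slice a dummy
     interval is used, and the dummies weigh at most 1/2 together. *)
  pose ti (i : nat) := 2^-1 / (2 ^ i.+1)%:R / C : R.
  have ti0 i : 0 < ti i by rewrite !divr_gt0// ltr0n expn_gt0.
  pose A i := if x \in J i then (c i).2 - L * R' i else 0.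
  pose B i := if x \in J i then (c i).2 + L * R' i else ti i `^ s^-1.
  have AB i : A i < B i.
    by rewrite /A /B; case: ifP => _; [have := LR i; flra|exact: powR_gt0].
  have cov t : `|t| <= rho -> K x t -> exists i, A i <= t <= B i.
    move=> tr Kxt; have [i _ Ui] := EU _ (KE _ _ xr tr Kxt); exists i.
    have [h1 h2] := Hc i _ _ xr tr Kxt Ui.
    have xJ : x \in J i by apply/mem_set; rewrite /J /=; move: h1; rewrite ler_norml; flra.
    by rewrite /A /B xJ; move: h2; rewrite ler_norml; flra.
  have := slices x xr A B AB cov.
  have le i : ((C * (B i - A i) `^ s)%:E <= (wt i)%:E * (\1_(J i) x)%:E + (2^-1 / (2 ^ i.+1)%:R)%:E)%E.
    rewrite -EFinM -EFinD lee_fin /A /B indicE; case: (x \in J i); rewrite /= ?mulr1 ?mulr0.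
      rewrite (_ : _ - _ = 2 * (L * R' i)); last by ring.
      by rewrite lerDl divr_ge0.
    rewrite subr0 -powRrM mulVf ?gt_eqF// powRr1 ?(ltW (ti0 i))// add0r.
    by rewrite /ti mulrC divfK// gt_eqF.
  move=> /le_trans/(_ (lee_nneseries _ (fun i _ => le i))) h.
  have {h} := h _; have g0 (i : nat) : (0 <= (wt i)%:E * (\1_(J i) x)%:E)%E.
    by rewrite -EFinM lee_fin mulr_ge0// indicE.
  have tr := @epsilon_trick R (fun i => ((wt i)%:E * (\1_(J i) x)%:E)%E) 2^-1 xpredT g0 _.
  move=> h; have {h tr} := le_trans (h _) (tr _); rewrite -leeBlDr//.
  rewrite -EFinB (_ : 1 - 2^-1 = 2^-1 :> R); last by flra.
  apply => [i _ _|]; last by rewrite invr_ge0.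
  by rewrite lee_fin mulr_ge0 ?powR_ge0// ltW.
pose D : set R := `[- rho, rho]%classic.
have mD : measurable D by exact: measurable_itv.
have lD : leb D = (2 * rho)%:E.
  rewrite lebesgue_measure_itv /= lte_fin (_ : - rho < rho); last by flra.
  by rewrite -EFinB; congr EFin; ring.
have g0 i x : (0 <= (wt i)%:E * (\1_(J i) x)%:E)%E by rewrite -EFinM lee_fin mulr_ge0// indicE.
have mI i : measurable_fun D (fun x => (\1_(J i) x : R)%:E).
  by apply/measurable_EFinP; exact: measurable_indic.
have mg i : measurable_fun D (fun x => ((wt i)%:E * (\1_(J i) x)%:E)%E).
  by apply: measurable_funeM; exact: mI.
have int1 : (rho%:E <= \int[leb]_(x in D) (\sum_(0 <= i <oo) ((wt i)%:E * (\1_(J i) x)%:E)))%E.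
  apply: (@le_trans _ _ (\int[leb]_(x in D) (cst (2^-1)%:E x))%E).
    by rewrite integral_cst// [_ D]lD -EFinM lee_fin mulrA mulVf// mul1r.
  apply: ge0_le_integral => //.
  - by move=> x _; rewrite lee_fin invr_ge0.
  - have m := @ge0_emeasurable_sum _ _ R D (fun i x => ((wt i)%:E * (\1_(J i) x)%:E)%E) xpredT
      (fun i x _ _ => g0 i x) (fun i _ => mg i).
    by apply: (eq_measurable_fun _ _ m) => x _; apply: eq_eseriesl => i.
  by move=> x; rewrite /D /= in_itv/= => /andP[x1 x2]; apply: half; rewrite ler_norml x1.
rewrite integral_nneseries// in int1.
have term i : (\int[leb]_(x in D) ((wt i)%:E * (\1_(J i) x)%:E) <=
    C4%:E * (diam_pow d sig (U i) + (ei i)%:E))%E.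
  rewrite ge0_integralZl_EFin//; last exact: mI.
  rewrite integral_indic//; last exact: mJ.
  apply: (@le_trans _ _ ((wt i)%:E * leb (J i))%E).
    apply: lee_wpmul2l; first by rewrite lee_fin.
    have mJD : measurable (J i `&` D) by exact: measurableI.
    by apply: le_measure; rewrite ?inE//; exact: mJ.
  rewrite JE lebesgue_measure_itv /= lte_fin ifT; last by have := LR i; flra.
  rewrite -EFinB -EFinM.
  apply: (@le_trans _ _ (C4%:E * (r i `^ (1 + s) + ei i)%:E)%E); last first.
    rewrite lee_pmul2l// ?lte_fin// EFinD leeD2r//.
    by have [_ _ h] := diam_fin (U1 i); apply: h; [rewrite sig0|exact: addr_gt0].
  rewrite -EFinM lee_fin /wt.
  rewrite (_ : _ + _ - _ = 2 * (L * R' i)); last by ring.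
  rewrite (_ : C * _ * _ = C4 * R' i `^ (1 + s)).
    rewrite ler_pM2l// /R'; case: (leP (r i) (ei i)) => h.
      apply: (@le_trans _ _ (ei i)); last by rewrite lerDr powR_ge0.
      rewrite -[leRHS]powRr1 ?(ltW (ei0 i))//; apply: ger_powR; first by rewrite ei0 ei1.
      by rewrite lerDl ltW.
    by rewrite lerDl ltW.
  rewrite powRD; last by rewrite (gt_eqF (R'0 i)) implybT.
  rewrite powRr1 ?(ltW (R'0 i))// !(mulrA 2) powRM ?(ltW (R'0 i))//; last by rewrite mulr_ge0// ltW.
  by rewrite /C4; ring.
have fin : (rho%:E <= C4%:E * (\sum_(0 <= i <oo) diam_pow d sig (U i) + e%:E))%E.
  have dp0 i : (0 <= diam_pow d sig (U i))%E.
    by rewrite /diam_pow; case: asboolP => // _; exact: poweR_ge0.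
  apply: (le_trans int1).
  apply: (@le_trans _ _ (\sum_(0 <= i <oo) (C4%:E * (diam_pow d sig (U i) + (ei i)%:E)))%E).
    by apply: lee_nneseries => i _ *; [exact: integral_ge0|exact: term].
  rewrite nneseriesZl; last by move=> i _; rewrite adde_ge0// lee_fin ltW.
  by rewrite lee_pmul2l ?lte_fin//; exact: epsilon_trick (ltW e0).
have : (rho%:E < (rho / 2)%:E + (rho / 2)%:E)%E.
  apply: (le_lt_trans fin); apply: (@lt_le_trans _ _ (C4%:E * (e%:E + e%:E))%E).
    by rewrite lte_pmul2l ?lte_fin// lteD2rE.
  by rewrite -!EFinD -EFinM lee_fin; move: eC; flra.
by rewrite -EFinD lte_fin; flra.
Qed.

End SliceBound.

(** * Covers of arbitrarily small total size *)

Section UpperBound.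
Context {R : realType} {T : Type} (d : T -> T -> R).

Lemma diam_pow_ge0 s U : (0 <= diam_pow d s U)%E.
Proof. by rewrite /diam_pow; case: asboolP => // _; exact: poweR_ge0. Qed.

Lemma diam_pow_le s U (c : R) : (forall x, 0 <= d x x) -> 0 <= s -> 0 <= c ->
  (diam d U <= c%:E)%E -> (diam_pow d s U <= (c `^ s)%:E)%E.
Proof.
move=> d0 s0 c0 Uc; rewrite /diam_pow; case: asboolP => [_|/eqP/set0P[x Ux]].
  by rewrite lee_fin powR_ge0.
rewrite -poweR_EFin; apply: gt0_ler_poweR => //; rewrite in_itv/= ?leey ?andbT//.
apply: (@le_trans _ _ (d x x)%:E); first by rewrite lee_fin.
by apply: ereal_sup_ubound; exists (x, x).
Qed.

Definition small_cover (s : R) (E : set T) : Prop := forall delta e : R, 0 < delta -> 0 < e ->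
  exists U : (set T)^nat, [/\ E `<=` \bigcup_i U i, forall i, (diam d (U i) <= delta%:E)%E &
    (\sum_(0 <= i <oo) diam_pow d s (U i) <= e%:E)%E].

Lemma small_cover_measure s E : small_cover s E -> hausdorff_measure d s E = 0%E.
Proof.
have ge0 delta : (0 <= hausdorff_content d s delta E)%E.
  by apply: le_ereal_inf_tmp => _ [U _ <-]; apply: nneseries_ge0 => i _ _; exact: diam_pow_ge0.
move=> H; apply/eqP; rewrite eq_le; apply/andP; split.
  apply: ge_ereal_sup => _ [delta delta0 <-]; apply/lee_addgt0Pr => e e0; rewrite add0e.
  have [U [U1 U2 U3]] := H delta e delta0 e0; apply: le_trans U3.
  by apply: ereal_inf_lbound; exists U.
apply: (le_trans (ge0 1)); apply: ereal_sup_ubound; exists 1 => //=; exact: ltr01.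
Qed.

Lemma nneseries_pairs (a : nat -> nat -> \bar R) : (forall i j, (0 <= a i j)%E) ->
  exists f : nat -> nat * nat, (forall i j, exists n, f n = (i, j)) /\
    (\sum_(0 <= n <oo) a (f n).1 (f n).2 = \sum_(0 <= i <oo) \sum_(0 <= j <oo) a i j)%E.
Proof.
move=> a0; have /card_esym/ppcard_eqP[f] := card_nat2; exists f; split.
  by move=> i j; exists (f^-1%FUN (i, j)); rewrite invK ?inE.
rewrite (nneseries_esum (P := xpredT))// [RHS](nneseries_esum (P := xpredT))//; last first.
  by move=> i _; apply: nneseries_ge0.
rewrite [RHS](eq_esum (b := fun i => \esum_(j in setT) a i j)); last first.
  by move=> i _; rewrite nneseries_esum//; congr esum; apply/seteqP; split.
rewrite esum_esum//.
have -> : [set x : nat | xpredT x] = setT by apply/seteqP; split.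
have -> : ((setT : set nat) `*`` (fun=> setT : set nat)) = setT by apply/seteqP; split.
exact: (esym (@reindex_esum R _ _ setT setT f (fun k => a k.1 k.2) bij)).
Qed.

Lemma small_cover_bigcup s (A : (set T)^nat) : (forall k, small_cover s (A k)) ->
  small_cover s (\bigcup_k A k).
Proof.
move=> H delta e delta0 e0.
have ek (k : nat) : 0 < e / (2 ^ k.+1)%:R by rewrite divr_gt0// ltr0n expn_gt0.
have /choice[U HU] := fun k => H k delta _ delta0 (ek k).
have [f [fs fsum]] := nneseries_pairs (fun i j => diam_pow_ge0 s (U i j)).
exists (fun n => U (f n).1 (f n).2); split.
- move=> x [k _ Akx]; have [/(_ _ Akx)[j _ Ux] _ _] := HU k.
  by have [n fn] := fs k j; exists n => //; rewrite fn.
- by move=> n; have [_ h _] := HU (f n).1.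
rewrite fsum; apply: le_trans (epsilon_trick0 xpredT (ltW e0)).
apply: lee_nneseries => k _; first by move=> _; apply: nneseries_ge0 => j _ _; exact: diam_pow_ge0.
by have [] := HU k.
Qed.

Lemma small_cover_sub s A B : A `<=` B -> small_cover s B -> small_cover s A.
Proof.
move=> AB H delta e delta0 e0; have [U [U1 U2 U3]] := H delta e delta0 e0; exists U; split => //.
exact: subset_trans U1.
Qed.

End UpperBound.

(** * The upper bound on the cylinder *)

Section Cylinder.
Context {R : realType}.
Local Notation cd := (@cylinder_dist R).

Lemma cylinder_dist_ge0 w w' : 0 <= cd w w'. Proof. exact: sqrtr_ge0. Qed.

Lemma cylinder_dist_le_add (w w' : R * R) : cd w w' <= `|w.1 - w'.1| + `|w.2 - w'.2|.
Proof.
have [c0 c1] : 0 <= circle_dist w.1 w'.1 /\ circle_dist w.1 w'.1 <= `|w.1 - w'.1|.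
  rewrite /circle_dist; set x := w.1 - w'.1; have /andP[f0 f1] := frac_itv x.
  split; first by rewrite le_min f0 subr_ge0 ltW.
  have xE : Defs.frac x = x - fl x by [].
  have [x0|x0] := leP 0 x; rewrite ge_min.
    by rewrite ger0_norm// xE gerBl /fl ler0z floor_ge0 x0.
  apply/orP; right; rewrite ltr0_norm// xE opprB addrA lerBlDr addrC.
  by rewrite addNr /fl -[X in _ + X]/(1%:~R) -intrD lerz0 lezD1 floor_lt0.
set b := w.2 - w'.2; have bb : 0 <= `|b| := normr_ge0 _.
rewrite /cylinder_dist -/b.
have h : circle_dist w.1 w'.1 ^+ 2 + b ^+ 2 <= (`|w.1 - w'.1| + `|b|) ^+ 2.
  have -> : b ^+ 2 = `|b| ^+ 2 by rewrite -normrX ger0_norm// sqr_ge0.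
  set x := `|w.1 - w'.1| in c1 *; set y := `|b| in bb *.
  have x0 : 0 <= x := le_trans c0 c1.
  apply: (@le_trans _ _ (x ^+ 2 + y ^+ 2)); first by rewrite lerD2r lerXn2r.
  by rewrite sqrrD lerD2r lerDl mulrn_wge0// mulr_ge0.
apply: (le_trans (ler_wsqrtr h)); rewrite sqrtr_sqr ger0_norm//.
Qed.

(** A grid of n^2 cells of diameter at most c = B / n has total size at most B^2 c^(s-2), which
    tends to 0 because s > 2. *)
Lemma box_small_cover (s K : R) : 2 < s -> 0 < K ->
  small_cover cd s [set w | 0 < w.1 < 1 /\ `|w.2| < K].
Proof.
move=> s2 K0 delta e delta0 e0.
pose B := 1 + 2 * K; have B0 : 0 < B by rewrite addr_gt0// mulr_gt0.
(* The value of c at which B^2 c^(s-2) equals [e]. *)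
pose rr := (e / B ^+ 2) `^ (s - 2)^-1.
have rr0 : 0 < rr by rewrite powR_gt0// divr_gt0// exprn_gt0.
pose n := (Num.truncn (B / Num.min delta rr)).+1.
have m0 : 0 < Num.min delta rr by rewrite lt_min delta0.
have nR : 0 < n%:R :> R by rewrite ltr0n.
have cle : B / n%:R <= Num.min delta rr.
  rewrite ler_pdivrMr// mulrC -ler_pdivrMr//; exact: ltW (truncnS_gt _).
have c0 : 0 < B / n%:R by rewrite divr_gt0.
set c := B / n%:R in cle c0.
have [cd' cr] : c <= delta /\ c <= rr by move: cle; rewrite le_min => /andP[].
pose cell (a b : nat) : set (R * R) := [set w | a%:R <= n%:R * w.1 <= a%:R + 1 /\
   b%:R <= n%:R * ((w.2 + K) / (2 * K)) <= b%:R + 1].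
pose U i := if (i < n * n)%N then cell (i %/ n)%N (i %% n)%N else set0.
have Udiam i : (diam cd (U i) <= c%:E)%E.
  apply: ge_ereal_sup => _ [[w w'] /= [Uw Uw'] <-]; rewrite lee_fin.
  move: Uw Uw'; rewrite /U; case: ifP => // _ [w1 w2] [w1' w2'].
  apply: (le_trans (cylinder_dist_le_add w w')).
  have dn (x y z : R) : z <= n%:R * x <= z + 1 -> z <= n%:R * y <= z + 1 -> `|x - y| <= n%:R^-1.
    move=> hx hy; rewrite -div1r ler_pdivlMr// mulrC -[X in X * _](gtr0_norm nR) -normrM mulrBr ler_norml.
    by move: hx hy; flra.
  have d1 := dn _ _ _ w1 w1'; have d2 := dn _ _ _ w2 w2'.
  rewrite -mulrBl opprD addrACA subrr addr0 normrM in d2.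
  rewrite (gtr0_norm (_ : 0 < (2 * K)^-1)) ?invr_gt0 ?mulr_gt0// in d2.
  rewrite ler_pdivrMr ?mulr_gt0// in d2.
  by rewrite /c /B mulrDl mul1r; apply: lerD => //; rewrite [leRHS]mulrC.
exists U; split.
- move=> w [/andP[t0 t1] vK]; move: vK; rewrite ltr_norml => /andP[v1 v2].
  have K20 : 0 < 2 * K by rewrite mulr_gt0.
  pose y := (w.2 + K) / (2 * K).
  have y0 : 0 <= y by rewrite divr_ge0 ?(ltW K20)//; clear -v1; flra.
  have y1 : y < 1 by rewrite ltr_pdivrMr//; clear -v2; flra.
  have tr (x : R) : 0 <= x < 1 -> (Num.truncn (n%:R * x) < n)%N /\
      (Num.truncn (n%:R * x))%:R <= n%:R * x <= (Num.truncn (n%:R * x))%:R + 1.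
    move=> /andP[x0 x1]; have nx0 : 0 <= n%:R * x by rewrite mulr_ge0// ltW.
    have /andP[h1 h2] := truncn_itv nx0.
    split; last by rewrite h1 natr1 ltW.
    rewrite -(ltr_nat R); apply: (le_lt_trans h1); rewrite -[ltRHS]mulr1 ltr_pM2l//.
  have [|a1 a2] := tr w.1; first by rewrite (ltW t0).
  have [|b1 b2] := tr y; first by rewrite y0.
  set a := Num.truncn (n%:R * w.1) in a1 a2; set b := Num.truncn (n%:R * y) in b1 b2.
  exists (a * n + b)%N => //; rewrite /U ifT; last first.
    by apply: (@leq_trans (a.+1 * n)%N); [rewrite mulSn addnC ltn_add2r|rewrite leq_pmul2r].
  by rewrite divnMDl// modnMDl divn_small// modn_small// addn0.
- by move=> i; apply: (le_trans (Udiam i)); rewrite lee_fin.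
have s0 : 0 <= s by apply: ltW; exact: lt_trans s2.
have part m : (\sum_(0 <= i < m) diam_pow cd s (U i) <= ((minn m (n * n))%:R * c `^ s)%:E)%E.
  elim: m => [|m IH]; first by rewrite big_geq// min0n mul0r.
  rewrite big_nat_recr//=; have [mn|mn] := ltnP m (n * n)%N.
    have -> : minn m.+1 (n * n) = (minn m (n * n)).+1 by rewrite (minn_idPl mn) (minn_idPl (ltnW mn)).
    rewrite -natr1 mulrDl mul1r EFinD leeD//.
    apply: diam_pow_le => //; [by move=> x; exact: cylinder_dist_ge0|exact: ltW].
  have -> : minn m.+1 (n * n) = minn m (n * n) by rewrite (minn_idPr mn) (minn_idPr (leqW mn)).
  by rewrite /U ltnNge mn /diam_pow asboolT// adde0.
have tot : n%:R * n%:R * c `^ s <= e.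
  have cE (t : R) : c `^ (2 + t) = c * c * c `^ t.
    by rewrite powRD ?(gt_eqF c0) ?implybT// powR_mulrn ?(ltW c0)// expr2.
  have -> : c `^ s = c * c * c `^ (s - 2) by rewrite -cE; congr (_ `^ _); ring.
  have -> : n%:R * n%:R * (c * c * c `^ (s - 2)) = B ^+ 2 * c `^ (s - 2).
    by rewrite expr2 -[B](divfK (lt0r_neq0 nR)) -/c; ring.
  rewrite -ler_pdivlMl ?exprn_gt0// mulrC.
  have E : rr `^ (s - 2) = e / B ^+ 2.
    rewrite /rr -powRrM mulVf; last by rewrite subr_eq0 gt_eqF.
    by rewrite powRr1// divr_ge0 ?(ltW e0)// exprn_ge0// ltW.
  rewrite -E; apply: ge0_ler_powR; rewrite ?nnegrE ?(ltW c0) ?(ltW rr0)//.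
  by rewrite subr_ge0 ltW.
apply: lime_le; first by apply: is_cvg_nneseries => i _ _; exact: diam_pow_ge0.
near=> m; apply: (le_trans (part m)); rewrite lee_fin; apply: le_trans tot.
by rewrite ler_wpM2r ?powR_ge0// -natrM ler_nat geq_minr.
Unshelve. all: by end_near. Qed.

Lemma escaping_dim_le (l : R -> R) : (hausdorff_dim cd (escaping l) <= 2%:E)%E.
Proof.
apply/lee_addgt0Pr => e e0; rewrite -EFinD; apply: ereal_inf_lbound.
exists (2 + e) => //; split; first by rewrite addr_ge0// ltW.
apply: small_cover_measure.
have : small_cover cd (2 + e) (\bigcup_k [set w : R * R | 0 < w.1 < 1 /\ `|w.2| < k%:R + 1]).
  by apply: small_cover_bigcup => k; apply: box_small_cover; [rewrite ltrDl|rewrite ltr_wpDl].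
apply: small_cover_sub => w [z [<- cm _]]; have [[w01 _] _ _] := cm 0%N.
exists (Num.truncn `|(z 0%N).2|) => //; split => //.
by rewrite natr1; exact: truncnS_gt.
Qed.

End Cylinder.

(** * The lower bound and the conclusion *)

Section LowerBound.
Context {R : realType} (l : R -> R) (hl : fermi_ulam_wall l).
Local Notation cd := (@cylinder_dist R).

(** [lam] is the larger root of X^2 - (2 + D) X + 1, and the other root is its inverse. *)
Lemma hyperbolic_root (D : R) : 0 < D -> exists2 lam : R, 1 < lam & lam + lam^-1 - 2 = D.
Proof.
move=> D0; pose r := Num.sqrt (D * (D + 4)).
have DD : 0 <= D * (D + 4) by rewrite mulr_ge0//; flra.
have rr : r * r = D * (D + 4) by rewrite -expr2 sqr_sqrtr.
have r0 : 0 <= r by exact: sqrtr_ge0.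
pose lam := 1 + D / 2 + r / 2.
have lam1 : 1 < lam by rewrite /lam; flra.
exists lam => //; have lam0 : lam != 0 by rewrite gt_eqF//; flra.
apply: (mulIf lam0); rewrite mulrBl mulrDl mulVf//.
have q : lam * lam = lam * (2 + D) - 1.
  rewrite /lam; have -> : (1 + D / 2 + r / 2) * (1 + D / 2 + r / 2) =
    (1 + D / 2) * (1 + D / 2) + (1 + D / 2) * r + r * r / 4 by field.
  by rewrite rr; field.
by rewrite q; ring.
Qed.

(** Carries [esc_slices] to the cylinder by [dec]. The box obtained there has bounded energy, and
    this bound fixes the Lipschitz constant of the code. *)
Lemma escaping_slices (s : R) : 0 < s < 1 -> 0 < alpha l * jump l ->
  exists (rho C L : R) (f : R -> R -> R * R) (K : R -> R -> Prop),
  [/\ 0 < rho, 0 < C, 0 < L, forall x t, K x t -> escaping l (f x t) &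
    (forall x t x' t', `|x| <= rho -> `|t| <= rho -> `|x'| <= rho -> `|t'| <= rho -> K x t -> K x' t' ->
      `|x - x'| <= L * cd (f x t) (f x' t') /\ `|t - t'| <= L * cd (f x t) (f x' t')) /\
    (forall x, `|x| <= rho -> forall A B : nat -> R, (forall i, A i < B i) ->
      (forall t, `|t| <= rho -> K x t -> exists i, A i <= t <= B i) ->
      (1 <= \sum_(0 <= i <oo) (C * (B i - A i) `^ s)%:E)%E)].
Proof.
move=> s01 aj0; have [lam lam1 lamE] := hyperbolic_root aj0.
have [c c0 close] := FT_tracks hl lam1 lamE.
have [Jmin HJ] := dec_lipschitz hl lam1.
have [p [rho [C [rho0 C0 box slices]]]] := esc_slices lam1 close Jmin s01.
pose kap := (lam + 1) / (lam - lam^-1).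
have [L L0 Lip] := HJ (p.2 - p.1 + 2 * (kap * rho)).
pose K x t := esc (FT l) (tracks l c) (pt lam p x t).
exists rho, C, L, (fun x t => dec l (pt lam p x t)), K; split => //.
  by move=> x t; exact: esc_escaping.
split => // x t x' t' xr tr xr' tr' Kxt Kxt'.
have good y u : `|y| <= rho -> `|u| <= rho -> K y u -> [/\ is_dec l (pt lam p y u) (dec l (pt lam p y u)),
    fl (pt lam p y u).1 = fl p.1, Jmin <= (pt lam p y u).2 - (pt lam p y u).1 &
    (pt lam p y u).2 - (pt lam p y u).1 <= p.2 - p.1 + 2 * (kap * rho)].
  move=> yr ur [V _]; have [_ dq _ _] := V 0%N.
  have dr : ds lam (pt lam p y u) p <= rho by exact: ds_pt0.
  have [b1 b2] := box _ dr; split => //.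
  have [] := coord_ds lam1 dr; rewrite -/kap !ler_norml.
  by set q := pt _ _ _ _; move=> /andP[? ?] /andP[? ?]; flra.
have [d1 f1 j1 J1] := good _ _ xr tr Kxt; have [d2 f2 j2 J2] := good _ _ xr' tr' Kxt'.
have := Lip _ _ _ _ d1 d2 (etrans f1 (esym f2)) j1 j2 J1 J2.
have e (a b b' : R) : a + b - (a + b') = b - b' by ring.
by move=> /(dsP lam)[]; rewrite !(uu_pt lam1) !(ss_pt lam1) !e.
Qed.

Lemma escaping_dim_ge : 0 < alpha l * jump l -> (2%:E <= hausdorff_dim cd (escaping l))%E.
Proof.
move=> aj0; apply: le_ereal_inf_tmp => _ [sig [sig0 H] <-]; rewrite lee_fin leNgt; apply/negP => sig2.
(* [s] has to satisfy [sig <= 1 + s] and stay below 1; the value 1/2 keeps it positive when [sig] is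
   small. *)
pose s := Num.max 2^-1 (sig - 1).
have s01 : 0 < s < 1.
  by rewrite lt_max gt_max; apply/andP; split; [apply/orP; left|apply/andP; split]; flra.
have sigs : sig <= 1 + s by rewrite -lerBlDl le_max lexx orbT.
have [rho [C [L [f [K [rho0 C0 L0 KE [Kd sl]]]]]]] := escaping_slices s01 aj0.
have [s0 _] := andP s01.
apply: (@slice_measure_neq0 _ _ cd (escaping l) (@cylinder_dist_ge0 R) s rho C L sig f K) => //.
  by rewrite sig0.
by move=> x t _ _; exact: KE.
Qed.

End LowerBound.

Unset Implicit Arguments.
Theorem theorem6 (R : realType) (l : R -> R) (hl : fermi_ulam_wall l)
  (htr : 2 < \tr (limit_matrix (Delta l))) :
  hausdorff_dim cylinder_dist (escaping l) = 2%:E.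
Proof.
apply/eqP; rewrite eq_le escaping_dim_le /=; apply: escaping_dim_ge => //.
rewrite limit_matrix_tr /Delta in htr.
have e : alpha l * jump l = - (alpha l * l 0 * (dl_right l - dl_left l)) by rewrite /jump; ring.
by rewrite e; lra.
Qed.
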